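(* Let $\Omega\subset\mathbb{R}^3$ be a bounded domain, $\nu>0$ and $\mathbf{f}\in V'$. Let $B$ be a weakly compact subset of $H$ for which $\mathcal{P}_{\mathrm{fpsss}}(B)$ is non-empty. Then $$\sup_{\mu\in\mathcal{P}_{\mathrm{fpsss}}(B)}\int_H\|\nabla\mathbf{u}\|_{L^2}^2\,d\mu(\mathbf{u})=\lim_{k\to\infty}\ \inf_{\Psi\in\mathcal{T}^{\mathrm{cyl}}}\ \max_{(\theta_1,\theta_2,\mathbf{u}_1,\mathbf{u}_2)\in\mathcal{B}_f}\ \sum_{i=1}^2\theta_i\left\{\|\nabla P_k\mathbf{u}_i\|_{L^2}^2+\langle\mathbf{F}(\mathbf{u}_i),\mathbf{D}\Psi(\mathbf{u}_i)\rangle_{V',V}\right\}.$$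
   Context: Spaces: $H$ (resp. $V$) is the closure of $\{\mathbf{u}\in C_c^\infty(\Omega)^3:\nabla\cdot\mathbf{u}=0\}$ in $L^2(\Omega)^3$ (resp. in $H_0^1(\Omega)^3$), with norm $\|\mathbf{u}\|_{L^2}$ (resp. $\|\nabla\mathbf{u}\|_{L^2}$). $H$ is identified with its dual, so $V\subset H=H'\subset V'$; $\langle\cdot,\cdot\rangle_{V',V}$ is the duality pairing (extending the $L^2$ inner product) and $\|\cdot\|_{V'}$ the dual norm. The Stokes operator $A:D(A)\subset H\to H$ is the positive self-adjoint operator with compact inverse associated with the form $(\mathbf{u},\mathbf{v})\mapsto\int_\Omega\nabla\mathbf{u}:\nabla\mathbf{v}\,d\mathbf{x}$ on $V$; its eigenvalues are listed in nondecreasing order with multiplicity, and $P_k:H\to H$ is the orthogonal projector onto the span of the first $k$ eigenvectors (of an orthonormal eigenbasis). $\mathbf{F}:V\to V'$ is given by $\langle\mathbf{F}(\mathbf{u}),\mathbf{w}\rangle_{V',V}=\langle\mathbf{f},\mathbf{w}\rangle_{V',V}-\nu\int_\Omega\nabla\mathbf{u}:\nabla\mathbf{w}\,d\mathbf{x}-\int_\Omega(\mathbf{u}\cdot\nabla)\mathbf{u}\cdot\mathbf{w}\,d\mathbf{x}$ for $\mathbf{w}\in V$. Test functionals: $\mathcal{T}^{\mathrm{cyl}}$ is the set of $\Psi:V'\to\mathbb{R}$ of the form $\Psi(\mathbf{u})=\psi(\langle\mathbf{u},\mathbf{w}_1\rangle_{V',V},\dots,\langle\mathbf{u},\mathbf{w}_m\rangle_{V',V})$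 with $m\in\mathbb{N}$, $\mathbf{w}_1,\dots,\mathbf{w}_m\in V$, $\psi\in C_c^1(\mathbb{R}^m)$; its differential is $\mathbf{D}\Psi(\mathbf{u})=\sum_{j=1}^m\partial_j\psi(\langle\mathbf{u},\mathbf{w}_1\rangle_{V',V},\dots,\langle\mathbf{u},\mathbf{w}_m\rangle_{V',V})\,\mathbf{w}_j\in V$. Stationary statistical solutions: $\mathcal{P}_{\mathrm{fpsss}}(H)$ is the set of Borel probability measures $\mu$ on $H$ such that (i) $\int_H\|\nabla\mathbf{u}\|_{L^2}^2\,d\mu(\mathbf{u})<\infty$ (with $\|\nabla\mathbf{u}\|_{L^2}=+\infty$ if $\mathbf{u}\notin V$, so $\mu(H\setminus V)=0$); (ii) $\int_H\psi'(\|\mathbf{u}\|_{L^2}^2)(\nu\|\nabla\mathbf{u}\|_{L^2}^2-\langle\mathbf{f},\mathbf{u}\rangle_{V',V})\,d\mu(\mathbf{u})\le 0$ for every nonnegative, non-decreasing, continuously differentiable $\psi:[0,\infty)\to\mathbb{R}$ with bounded derivative; (iii) $\int_H\langle\mathbf{F}(\mathbf{u}),\mathbf{D}\Psi(\mathbf{u})\rangle_{V',V}\,d\mu(\mathbf{u})=0$ for all $\Psi\in\mathcal{T}^{\mathrm{cyl}}$. For a Borel set $B\subset H$, $\mathcal{P}_{\mathrm{fpsss}}(B)=\{\mu\in\mathcal{P}_{\mathrm{fpsss}}(H):\mu(H\setminus B)=0\}$. The set $\mathcal{B}_f$: let $\ell(\mathbf{u})=\nu\|\nabla\mathbf{u}\|_{L^2}^2-\langle\mathbf{f},\mathbf{u}\rangle_{V',V}$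 for $\mathbf{u}\in V$. Then $\mathcal{B}_f=\mathcal{B}_{f,1}\cup\mathcal{B}_{f,2}$, where $\mathcal{B}_{f,1}=\{(1,0,\mathbf{u},\mathbf{u}):\mathbf{u}\in B\cap V,\ \ell(\mathbf{u})\le 0\}$ and $\mathcal{B}_{f,2}$ is the set of $(\theta_1,\theta_2,\mathbf{u}_1,\mathbf{u}_2)$ with $0<\theta_1<1$, $\theta_2=1-\theta_1$, $\mathbf{u}_1,\mathbf{u}_2\in B\cap V$, $\|\mathbf{u}_1\|_{L^2}=\|\mathbf{u}_2\|_{L^2}$, $\ell(\mathbf{u}_1)<0<\ell(\mathbf{u}_2)$ and $\theta_1\ell(\mathbf{u}_1)+\theta_2\ell(\mathbf{u}_2)=0$. *)

(* Defs.v *)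
From HB Require Import structures.
From mathcomp Require Import all_boot all_order all_algebra.
From mathcomp Require Import all_classical all_reals all_analysis.
From mathcomp Require Import measurable_realfun.
From mathcomp Require Import ring lra.
Set Implicit Arguments.
Unset Strict Implicit.
Unset Printing Implicit Defensive.
Import Order.TTheory GRing.Theory Num.Theory numFieldNormedType.Exports.
Local Open Scope classical_set_scope.
Local Open Scope ring_scope.

Notation R3 R := (measurableTypeR R * measurableTypeR R * measurableTypeR R)%type.
(* Vector fields, given by components.  Fields on the domain are represented by
   functions on the whole space; every integral below is over the domain. *)
Notation vfield R := ('I_3 -> R3 R -> R).

Definition lebesgue3 (R : realType) : {measure set (R3 R) -> \bar R} :=
  ((@lebesgue_measure R \x @lebesgue_measure R) \x @lebesgue_measure R)%E.

Record bounded_domain (R : realType) := BoundedDomain {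
  dom :> set (R3 R) ;
  dom_open : open dom ;
  dom_connected : connected dom ;
  dom_bounded : bounded_set dom ;
  dom_nonempty : dom !=set0 }.

Section OpenMeasurable.
Variable R : realType.

Lemma open_measurable3 (A : set (R3 R)) : open A -> measurable A.
Proof.
move=> oA.
pose c (q : rat * rat * rat * rat) : R3 R :=
  (ratr q.1.1.1, ratr q.1.1.2, ratr q.1.2).
pose box q := ball (c q) (ratr q.2 : R).
have -> : A = \bigcup_(q in [set q | box q `<=` A]) box q.
  apply/seteqP; split=> [p Ap|p [q qA qp]]; last exact: qA.
  have /nbhs_ballP[e /= e0 pe] : nbhs p A by exact: open_nbhs_nbhs.
  have e20 : 0 < e / 2 by rewrite divr_gt0.
  have [r /andP[r0 re]] : exists r : rat, (0 < ratr r :> R) && (ratr r < e / 2).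
    have [r] := rat_in_itvoo e20; rewrite in_itv/= => /andP[r0 re].
    by exists r; rewrite r0 re.
  have near1 (x : R) : exists q : rat, `|ratr q - x| < ratr r.
    have xlt : x < x + ratr r by rewrite ltrDl.
    have [q] := rat_in_itvoo xlt; rewrite in_itv/= => /andP[q1 q2].
    by exists q; rewrite ger0_norm ?subr_ge0 ?ltW// ltrBlDl.
  have [a Ha] := near1 p.1.1; have [b Hb] := near1 p.1.2.
  have [d Hd] := near1 p.2.
  have bp : ball (c (a, b, d, r)) (ratr r : R) p by split; [split|].
  exists (a, b, d, r) => //= z bz; apply: pe.
  have : ball p (ratr r + ratr r : R) z.
    by apply: ball_triangle bz; exact: ball_sym.
  by apply: le_ball; rewrite [leRHS]splitr lerD// ltW.
rewrite bigcup_mkcond; apply: countable_bigcupT_measurable => // q.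
case: ifPn => // _.
rewrite /box (_ : ball _ _ = ball (c q).1.1 (ratr q.2) `*` ball (c q).1.2 (ratr q.2)
   `*` ball (c q).2 (ratr q.2)).
  by apply: measurableX; [apply: measurableX|]; rewrite ball_itv; exact: measurable_itv.
by apply/seteqP; split=> [[[x y] z] [[]]|[[x y] z] [[]]].
Qed.

End OpenMeasurable.

Section Spaces.
Variables (R : realType) (O : bounded_domain R).

Definition leb_dom : {measure set (R3 R) -> \bar R} :=
  mrestr (lebesgue3 R) (open_measurable3 (@dom_open R O)).

Definition basis3 (j : 'I_3) : R3 R :=
  ((j == 0%N :> nat)%:R, (j == 1%N :> nat)%:R, (j == 2%N :> nat)%:R).

Definition partial (j : 'I_3) (g : R3 R -> R) : R3 R -> R :=
  fun x => 'D_(basis3 j) g x.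

(* All iterated partial derivatives exist and are continuous. *)
Definition smooth (g : R3 R -> R) :=
  forall s : seq 'I_3, let h := foldr partial g s in
  continuous h /\ forall j x, derivable h x (basis3 j).

Definition test_fun (g : R3 R -> R) :=
  [/\ smooth g, compact (closure [set x | g x != 0])
    & closure [set x | g x != 0] `<=` dom O].

Definition test_field (phi : vfield R) := forall i, test_fun (phi i).

Definition solenoidal_test (phi : vfield R) :=
  test_field phi /\ forall x, \sum_i partial i (phi i) x = 0.

Definition L2field (u : vfield R) := forall i, u i \in Lfun leb_dom 2%:E.

Definition dotL2 (u v : vfield R) : R :=
  \sum_i \int[leb_dom]_x (u i x * v i x).

Definition normL2 (u : vfield R) : R := Num.sqrt (dotL2 u u).

Definition inH (u : vfield R) := L2field u /\
  forall eps : R, 0 < eps -> exists2 phi, solenoidal_test phi & normL2 (u - phi) < eps.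

Lemma L2field_int u v i : L2field u -> L2field v ->
  leb_dom.-integrable setT (EFin \o (fun x => u i x * v i x)).
Proof. by move=> Lu Lv; apply/Lfun1_integrable; exact: Lfun2_mul_Lfun1. Qed.

Lemma L2field_lin a u v : L2field u -> L2field v -> L2field (a *: u + v).
Proof.
have p1 : (1 <= 2%:E :> \bar R)%E by rewrite lee_fin ler1n.
by have [_ h] := Lfun_submod_closed leb_dom p1 => Lu Lv i; exact: h.
Qed.

Lemma L2fieldD u v : L2field u -> L2field v -> L2field (u + v).
Proof. by move=> Lu Lv; rewrite -[u]scale1r; exact: L2field_lin. Qed.

Lemma L2fieldB u v : L2field u -> L2field v -> L2field (u - v).
Proof. by move=> Lu Lv; rewrite addrC -scaleN1r; exact: L2field_lin. Qed.

Lemma L2fieldZ a u : L2field u -> L2field (a *: u).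
Proof.
have p1 : (1 <= 2%:E :> \bar R)%E by rewrite lee_fin ler1n.
have [h0 _] := Lfun_submod_closed leb_dom p1.
by move=> Lu; rewrite -[_ *: _]addr0; apply: L2field_lin => // i; exact: h0.
Qed.

Lemma dotL2C u v : dotL2 u v = dotL2 v u.
Proof. by apply: eq_bigr => i _; apply: eq_Rintegral => x _; rewrite mulrC. Qed.

Lemma dotL2Dl u v w : L2field u -> L2field v -> L2field w ->
  dotL2 (u + v) w = dotL2 u w + dotL2 v w.
Proof.
move=> Lu Lv Lw; rewrite -big_split; apply: eq_bigr => i _ /=.
rewrite -RintegralD//; [|exact: L2field_int..].
by apply: eq_Rintegral => x _; rewrite -mulrDl.
Qed.

Lemma dotL2Zl a u w : L2field u -> L2field w -> dotL2 (a *: u) w = a * dotL2 u w.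
Proof.
move=> Lu Lw; rewrite mulr_sumr; apply: eq_bigr => i _ /=.
rewrite -RintegralZl//; last exact: L2field_int.
by apply: eq_Rintegral => x _; rewrite mulrA.
Qed.

Lemma dotL2_ge0 u : 0 <= dotL2 u u.
Proof. by apply: sumr_ge0 => i _; apply: Rintegral_ge0 => x _; rewrite -expr2 sqr_ge0. Qed.

Lemma normL2_triangle u v : L2field u -> L2field v ->
  normL2 (u + v) <= normL2 u + normL2 v.
Proof.
move=> Lu Lv; have Luv := L2fieldD Lu Lv.
have cs : dotL2 u v <= normL2 u * normL2 v.
  set a := normL2 u; set b := normL2 v.
  have aa : a ^+ 2 = dotL2 u u by rewrite sqr_sqrtr// dotL2_ge0.
  have bb : b ^+ 2 = dotL2 v v by rewrite sqr_sqrtr// dotL2_ge0.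
  have a0 : 0 <= a by exact: sqrtr_ge0.
  have b0 : 0 <= b by exact: sqrtr_ge0.
  have q s t : 0 <= s ^+ 2 * a ^+ 2 + 2 * s * t * dotL2 u v + t ^+ 2 * b ^+ 2.
    have := dotL2_ge0 (s *: u + t *: v).
    have Ls := L2fieldZ s Lu; have Lt := L2fieldZ t Lv; have Lst := L2fieldD Ls Lt.
    rewrite dotL2Dl// !dotL2Zl// ![dotL2 _ (_ + _)]dotL2C !dotL2Dl// !dotL2Zl//.
    rewrite [dotL2 v u]dotL2C -aa -bb => h; apply: le_trans h _.
    by rewrite le_eqVlt; apply/orP; left; apply/eqP; ring.
  have [d0|d0] := leP (dotL2 u v) 0; first by rewrite (le_trans d0)// mulr_ge0.
  move: a0; rewrite le_eqVlt => /orP[/eqP a0|a0].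
    have := q (- (b ^+ 2 + 1) / dotL2 u v) 1; rewrite -!a0.
    rewrite (_ : _ + _ = - b ^+ 2 - 2); last by field; rewrite gt_eqF.
    by have := sqr_ge0 b; lra.
  move: b0; rewrite le_eqVlt => /orP[/eqP b0|b0].
    have := q 1 (- (a ^+ 2 + 1) / dotL2 u v); rewrite -!b0.
    rewrite (_ : _ + _ = - a ^+ 2 - 2); last by field; rewrite gt_eqF.
    by have := sqr_ge0 a; lra.
  have := q b (- a).
  have ab : 0 < a * b by exact: mulr_gt0.
  rewrite (_ : _ + _ = (2 * (a * b)) * (a * b - dotL2 u v)); last by ring.
  by rewrite pmulr_rge0 ?subr_ge0// mulr_gt0.
rewrite -[leRHS]ger0_norm ?addr_ge0 ?sqrtr_ge0// -sqrtr_sqr.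
rewrite ler_sqrt ?sqr_ge0// sqrrD !sqr_sqrtr ?dotL2_ge0//.
rewrite dotL2Dl// ![dotL2 _ (_ + _)]dotL2C !dotL2Dl// [dotL2 v u]dotL2C.
by move: cs; lra.
Qed.


Lemma L2field_meas u i : L2field u -> measurable_fun setT (u i).
Proof. by move=> /(_ i); rewrite inE => /andP[]; rewrite inE. Qed.

Lemma normL2_eq0 u : L2field u -> normL2 u = 0 ->
  forall i, u i = cst 0 %[ae leb_dom].
Proof.
move=> Lu /eqP; rewrite sqrtr_eq0 => u0 i.
have {}u0 : dotL2 u u = 0 by apply/eqP; rewrite eq_le u0 dotL2_ge0.
have ge0 k : 0 <= \int[leb_dom]_x (u k x * u k x).
  by apply: Rintegral_ge0 => x _; rewrite -expr2 sqr_ge0.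
move: u0 => /eqP; rewrite psumr_eq0 // => /allP/(_ i (mem_index_enum i))/eqP ui0.
have iu := L2field_int i Lu Lu.
have : (\int[leb_dom]_x `|(u i x * u i x)%:E| = 0)%E.
  under eq_integral do rewrite abse_EFin ger0_norm -?expr2 ?sqr_ge0// expr2.
  by rewrite -[LHS]fineK ?(integrable_fin_num measurableT iu)// [fine _]ui0.
move/ae_eq_integral_abs => /(_ measurableT (measurable_int _ iu)).
apply: filterS => x /(_ I) [] /eqP; rewrite mulf_eq0 orbb => /eqP -> _.
by [].
Qed.

Lemma ae0_L2field (u : vfield R) : (forall i, measurable_fun setT (u i)) ->
  (forall i, u i = cst 0 %[ae leb_dom]) -> L2field u /\ normL2 u = 0.
Proof.
move=> mu0 u0; have Lu : L2field u.
  move=> i; rewrite inE; apply/andP; split; rewrite inE//= /finite_norm unlock.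
  rewrite (ae_eq_integral (cst 0%E)) ?integral0 ?poweR0r ?ltry//.
  - have mabs : measurable_fun setT (fun x => `|(u i x)%:E|%E).
      by apply: measurableT_comp => //; exact/measurable_EFinP.
    have := measurableT_comp (measurable_poweR (2 : R)) mabs.
    exact.
  - apply: filterS (u0 i) => x /= h _; by rewrite h// normr0 powR0.
split=> //; rewrite /normL2 /dotL2 big1 ?sqrtr0// => i _.
rewrite /Rintegral (ae_eq_integral (cst 0%E)) ?integral0//.
- by have := L2field_int i Lu Lu => /measurable_int.
- by apply: filterS (u0 i) => x /= h _; rewrite h// mul0r.
Qed.

Lemma test_fun0 : test_fun (cst 0).
Proof.
have p0 s : foldr partial (cst 0) s = cst 0.
  elim: s => //= j s ->; apply/funext => x; rewrite /partial.
  exact: derive_cst.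
have c0 : closure [set x : R3 R | @cst (R3 R) R 0 x != 0] = set0.
  rewrite (_ : [set _ | _] = set0) ?closure0//.
  by apply/seteqP; split=> x //=; rewrite eqxx.
split.
- by move=> s; rewrite /= p0; split=> [|j x]; [exact: cst_continuous|exact: derivable_cst].
- by have := @compact0 (R3 R); rewrite -c0.
- by have := @sub0set _ (dom O); rewrite -c0.
Qed.

Lemma solenoidal_test0 : solenoidal_test 0.
Proof.
split=> [i|x]; first exact: test_fun0.
rewrite big1// => i _; exact: derive_cst.
Qed.

(* Elements are classes modulo equality a.e. on the domain, so that equality
   in [Hspace] is equality of elements of L^2. *)
Record Hspace := MkH {
  hclass : 'I_3 -> {mfun_ leb_dom, R3 R >-> R} ;
  hclass_inH : inH (fun i => hclass i : R3 R -> R) }.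

Definition hfun (u : Hspace) : vfield R := fun i => hclass u i.
Coercion hfun : Hspace >-> Funclass.

Lemma hfun_L2 (u : Hspace) : L2field u.
Proof. by case: u => u []. Qed.

Lemma hfun_inj (u v : Hspace) : (forall i, u i = v i %[ae leb_dom]) -> u = v.
Proof.
case: u v => [u uH] [v vH] /= uv.
have E : u = v.
  apply/funext => i.
  rewrite -[u i]reprK -[v i]reprK; apply/eqquotP/asboolP; exact: uv.
by subst v; congr MkH; exact: Prop_irrelevance.
Qed.

Definition hclass0 : {mfun_ leb_dom, R3 R >-> R} :=
  (\pi_({mfun_ leb_dom, R3 R >-> R}) (cst 0))%qT.

Lemma hclass0_inH : inH (fun=> hclass0 : R3 R -> R).
Proof.
set u := (X in inH X).
have [||Lu u0] := @ae0_L2field u.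
- by move=> i; exact: (@measurable_funPT _ _ _ _ (repr hclass0)).
- by move=> i; have /eqquotP/asboolP := reprK hclass0.
split=> // eps eps0; exists 0; first exact: solenoidal_test0.
by rewrite subr0 u0.
Qed.

HB.instance Definition _ := gen_eqMixin Hspace.
HB.instance Definition _ := gen_choiceMixin Hspace.
HB.instance Definition _ := isPointed.Build Hspace (MkH hclass0_inH).

Definition distH (u v : Hspace) : R := normL2 (hfun u - hfun v).

Lemma distHxx u : distH u u = 0.
Proof.
rewrite /distH subrr; have [||_ //] := @ae0_L2field 0.
  by move=> i; exact: measurable_cst.
by move=> i; exact: nearW.
Qed.

Lemma distH_eq0 u v : distH u v = 0 -> u = v.
Proof.
move=> uv; apply: hfun_inj => i.
have := normL2_eq0 (L2fieldB (hfun_L2 u) (hfun_L2 v)) uv i.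
by apply: filterS => x; rewrite !fctE => h t; apply/eqP; rewrite -subr_eq0; apply/eqP/h.
Qed.

Lemma distHC u v : distH u v = distH v u.
Proof.
rewrite /distH /normL2 /dotL2; congr Num.sqrt; apply: eq_bigr => i _.
by apply: eq_Rintegral => x _; rewrite !fctE; ring.
Qed.

Lemma distH_triangle v u w : distH u w <= distH u v + distH v w.
Proof.
rewrite /distH -[hfun u - hfun w](subrKA (hfun v)) .
by apply: normL2_triangle; apply: L2fieldB; exact: hfun_L2.
Qed.

HB.instance Definition _ :=
  @isMetric.Build R Hspace distH distHxx distH_eq0 distHC distH_triangle.

(* The metric of [Hspace] is the L^2 distance, so this is the Borel
   sigma-algebra of the norm topology. *)
Definition Hborel := g_sigma_algebraType (@open Hspace).

(* Initial topology of the functionals (., v), v in H, which are all the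
   continuous linear functionals since H is identified with its dual. *)
Definition Hweak := initial_topology
  (fun u : Hspace => (fun v => dotL2 u v) : prod_topology (fun _ : Hspace => R)).

Definition weakly_compact (B : set Hspace) := compact (B : set Hweak).

Definition is_weak_partial (j : 'I_3) (g h : R3 R -> R) :=
  h \in Lfun leb_dom 2%:E /\ forall phi, test_fun phi ->
    \int[leb_dom]_x (g x * partial j phi x) = - \int[leb_dom]_x (h x * phi x).

(* Weak partial derivatives are unique only up to equality a.e.; [get] picks
   a representative, and returns a junk value when there is none. *)
Definition weak_partial (j : 'I_3) (g : R3 R -> R) : R3 R -> R :=
  get [set h | is_weak_partial j g h].

Definition dot_grad (u v : vfield R) : R :=
  \sum_i \sum_j \int[leb_dom]_x (weak_partial j (u i) x * weak_partial j (v i) x).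

Definition norm_grad (u : vfield R) : R := Num.sqrt (dot_grad u u).

(* H^1(Omega)^3, then H^1_0 as the H^1-closure of the test fields, then V as
   the closure of the solenoidal test fields in H^1_0 for the gradient norm. *)
Definition inH1 (u : vfield R) := L2field u /\
  forall i j, exists h, is_weak_partial j (u i) h.

Definition normH1 (u : vfield R) : R := Num.sqrt (dotL2 u u + dot_grad u u).

Definition inH10 (u : vfield R) := inH1 u /\
  forall eps : R, 0 < eps -> exists2 phi, test_field phi & normH1 (u - phi) < eps.

Definition inV (u : vfield R) := inH10 u /\
  forall eps : R, 0 < eps -> exists2 phi, solenoidal_test phi & norm_grad (u - phi) < eps.

(* A functional on vector fields belongs to V' through its restriction to V;
   its values outside V are never used. *)
Definition inVdual (L : vfield R -> R) :=
  (forall a u v, inV u -> inV v -> L (a *: u + v) = a * L u + L v) /\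
  exists C : R, forall u, inV u -> `|L u| <= C * norm_grad u.

Definition convection (u v w : vfield R) : R :=
  \int[leb_dom]_x (\sum_i \sum_j u j x * weak_partial j (v i) x * w i x).

(* Fns nu f u w = <F(u), w>; convection u v w = \int (u . grad) v . w. *)
Definition Fns (nu : R) (f : vfield R -> R) (u w : vfield R) : R :=
  f w - nu * dot_grad u w - convection u u w.

Definition enstrophy (u : vfield R) : \bar R :=
  if `[< inV u >] then (norm_grad u ^+ 2)%:E else +oo%E.

(* u \in D(A) and A u = g *)
Definition stokes (u g : vfield R) :=
  [/\ inV u, inH g & forall v, inV v -> dot_grad u v = dotL2 g v].

Definition Pk (e : nat -> Hspace) (k : nat) (u : vfield R) : vfield R :=
  \sum_(n < k) dotL2 u (e n) *: (e n : vfield R).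

(* An orthonormal basis of H made of eigenvectors of the Stokes operator;
   since the basis is complete, [lam] lists all the eigenvalues with
   multiplicity.  Indices start at 0. *)
Definition stokes_eigenbasis (lam : nat -> R) (e : nat -> Hspace) :=
  [/\ forall n, stokes (e n) (lam n *: (e n : vfield R)),
      forall m n, dotL2 (e m) (e n) = (m == n)%:R,
      forall u : Hspace, normL2 (hfun u - Pk e k u) @[k --> \oo] --> (0 : R)
    & nondecreasing_seq lam].

Definition C1_compact m (psi : 'rV[R]_m -> R) :=
  [/\ forall x j, derivable psi x (delta_mx 0 j),
      forall j, continuous (fun x => 'D_(delta_mx 0 j) psi x)
    & compact (closure [set x | psi x != 0])].

(* A cylindrical functional is given by its data (w_1, .., w_m, psi).  H embeds
   in V' by u |-> dotL2 u. *)
Record cyl := Cyl {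
  cyl_dim : nat ;
  cyl_w : 'I_cyl_dim -> vfield R ;
  cyl_wV : forall j, inV (cyl_w j) ;
  cyl_psi : 'rV[R]_cyl_dim -> R ;
  cyl_psiC1 : C1_compact cyl_psi }.
Arguments cyl_w : clear implicits.
Arguments cyl_psi : clear implicits.

(* The functional Psi : V' -> R itself, and its differential. *)
Definition cyl_fun (Psi : cyl) (L : vfield R -> R) : R :=
  cyl_psi Psi (\row_j L (cyl_w Psi j)).

Definition cyl_diff (Psi : cyl) (L : vfield R -> R) : vfield R :=
  \sum_j 'D_(delta_mx 0 j) (cyl_psi Psi) (\row_i L (cyl_w Psi i)) *: cyl_w Psi j.

Definition ell (nu : R) (f : vfield R -> R) (u : vfield R) : R :=
  nu * norm_grad u ^+ 2 - f u.

(* [dpsi] is the derivative of [psi] on [0, +oo[, one-sided at 0. *)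
Definition energy_weight (psi dpsi : R -> R) :=
  [/\ forall x, 0 <= x -> 0 <= psi x,
      forall x y, 0 <= x -> x <= y -> psi x <= psi y,
      forall x, 0 <= x ->
        h^-1 * (psi (x + h) - psi x) @[h --> within [set h | 0 <= x + h] (0 : R)^'] --> dpsi x,
      {within `[0, +oo[, continuous dpsi}
    & exists C : R, forall x, 0 <= x -> `|dpsi x| <= C].

(* The last two integrands are meaningful only on V, which has full measure by
   the first condition, where the integrand is +oo outside V. *)
Definition fpsss (nu : R) (f : vfield R -> R) : set (probability Hborel R) :=
  [set mu : probability Hborel R |
    [/\ (\int[mu]_u enstrophy (hfun u) < +oo)%E,
        forall psi dpsi, energy_weight psi dpsi ->
          (\int[mu]_(u in [set u | inV (hfun u)])
             (dpsi (normL2 (hfun u) ^+ 2) * ell nu f (hfun u))%:E <= 0)%E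
      & forall Psi : cyl,
          (\int[mu]_(u in [set u | inV (hfun u)])
             (Fns nu f (hfun u) (cyl_diff Psi (dotL2 (hfun u))))%:E = 0)%E]].

Definition fpsss_on (nu : R) (f : vfield R -> R) (B : set Hspace) :
    set (probability Hborel R) :=
  [set mu : probability Hborel R | fpsss nu f mu /\ mu (~` B) = 0%E].

Definition Bf1 (nu : R) (f : vfield R -> R) (B : set Hspace) :
    set (R * R * Hspace * Hspace) :=
  [set b | exists u, [/\ B u, inV u, ell nu f u <= 0 & b = (1, 0, u, u)]].

Definition Bf2 (nu : R) (f : vfield R -> R) (B : set Hspace) :
    set (R * R * Hspace * Hspace) :=
  [set b | let: (t1, t2, u1, u2) := b in
    [/\ 0 < t1 < 1 /\ t2 = 1 - t1, (B u1 /\ inV u1) /\ (B u2 /\ inV u2),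
        normL2 u1 = normL2 u2, ell nu f u1 < 0 < ell nu f u2
      & t1 * ell nu f u1 + t2 * ell nu f u2 = 0]].

Definition Bf nu f B := Bf1 nu f B `|` Bf2 nu f B.

(* ||grad P_k u||^2 + <F(u), D Psi(u)> *)
Definition bracket (nu : R) (f : vfield R -> R) (e : nat -> Hspace) (k : nat)
    (Psi : cyl) (u : vfield R) : R :=
  norm_grad (Pk e k u) ^+ 2 + Fns nu f u (cyl_diff Psi (dotL2 u)).

Definition objective (nu : R) (f : vfield R -> R) (e : nat -> Hspace) (k : nat)
    (Psi : cyl) (b : R * R * Hspace * Hspace) : R :=
  let: (t1, t2, u1, u2) := b in
  t1 * bracket nu f e k Psi u1 + t2 * bracket nu f e k Psi u2.

End Spaces.

Definition is_max (R : realType) (S : set R) (m : R) := S m /\ ubound S m.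

(* Main.v *)
(** Weak duality.  If the objective of a cylindrical functional Psi is at most M on B_f, a
    compactness argument over the spheres |u|_{L^2} = r produces a bounded continuous a >= 0 with
    |grad P_k u|^2 + <F(u), D Psi(u)> - a(|u|^2) ell(u) <= M + eps on B /\ V.  Integrating against a
    stationary statistical solution removes the transport term and gives
    \int |grad P_k u|^2 dmu <= M + eps.

    Attainment.  Since V is compactly embedded in H, every functional in play is "tame": up to an
    error eta (1 + |grad u|^2) it is weakly continuous on B.  This makes the limits along minimising
    sequences and along ultrafilters legitimate despite the convection term.

    Strong duality.  Let m be a lower bound of the maxima for P_k.  For finitely many Psi_j and
    eta > 0, some mixture of admissible pairs has mean |grad P_k u|^2 above m - eta and means of
    <F(u), D Psi_j(u)> below eta: otherwise the squared distance to these constraints could be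
    decreased by mixing in a maximiser of the objective for a linear combination of the Psi_j.
    An ultrafilter limit of these mixtures is a positive normalised functional.  It is represented
    by a measure on B, the image of Lebesgue measure under the map that reads a point of B off the
    coordinate comparisons, and this measure is a stationary statistical solution.  Monotone
    convergence in k concludes. *)

Require Import Defs.
From HB Require Import structures.
From mathcomp Require Import all_boot all_order all_algebra.
From mathcomp Require Import all_classical all_reals all_analysis.
From mathcomp Require Import measurable_realfun.
From mathcomp Require Import ring lra.
Set Implicit Arguments.
Unset Strict Implicit.
Unset Printing Implicit Defensive.
Import Order.TTheory GRing.Theory Num.Theory numFieldNormedType.Exports.
Local Open Scope classical_set_scope.
Local Open Scope ring_scope.

(** * Calculus on lines and in space *)

(** The energy inequalities for all [psi] say that the mean of [ell] on almost every sphere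
    |u|_{L^2} = r is at most 0. The extreme laws under this constraint sit on one point with [ell]
    <= 0, or on two points of one sphere with mean [ell] equal to 0. Hence the shape of [Bf], and
    hence a multiplier that is a function of |u|^2. Two quantities are not weakly continuous. The
    enstrophy is only lower semicontinuous: the objective contains |grad P_k u|^2 instead, of finite
    rank and nondecreasing in k, and [ell] is approximated from below in the same way, which
    suffices because it occurs only in inequalities that survive a decrease of [ell]. The convection
    term is quadratic in u: against a smooth w an integration by parts makes it continuous for the
    L^2 norm, and for w in V the error is a small multiple of |grad u|^2 by the L^4 bound.
    Compactness of V in H enters only through the divergence of the eigenvalues, which is proved by
    testing with solenoidal fields of small support. *)

Section LineDerivative.
Variable R : realType.

Lemma line_quotient (V : normedModType R) (k : V -> R) (p v : V) (t : R) :
  (fun h : R => h^-1 *: (((fun s : R => k (p + s *: v)) \o shift t) (h *: (1 : R)) - k (p + t *: v))) =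
  (fun h : R => h^-1 *: ((k \o shift (p + t *: v)) (h *: v) - k (p + t *: v))).
Proof.
apply/funext => h /=; congr (_ *: (k _ - _)).
by rewrite /shift/= scalerDl -[h *: (1 : R)]/(h * 1) mulr1 addrCA.
Qed.

Lemma derivable_line (V : normedModType R) (k : V -> R) (p v : V) (t : R) :
  derivable k (p + t *: v) v -> derivable (fun s : R => k (p + s *: v)) t 1.
Proof. by rewrite /derivable line_quotient. Qed.

Lemma derive_line (V : normedModType R) (k : V -> R) (p v : V) (t : R) :
  'D_1 (fun s : R => k (p + s *: v)) t = 'D_v k (p + t *: v).
Proof. by rewrite /derive line_quotient. Qed.

(** Partial derivatives below are computed by restriction to a line, where the one-variable rules
    apply. *)
Lemma is_derive_of_line (V : normedModType R) (g : V -> R) (x v : V) (d : R) :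
  is_derive (0 : R) (1 : R) (fun s : R => g (x + s *: v)) d -> is_derive x v g d.
Proof.
have x0 : x + (0 : R) *: v = x by rewrite scale0r addr0.
case=> dl <-; have dg : derivable g (x + 0 *: v) v by move: dl; rewrite /derivable -line_quotient.
by apply: DeriveDef; [move: dg; rewrite x0|rewrite derive_line x0].
Qed.

End LineDerivative.

(** * The fundamental theorem of calculus for functions with bounded support *)

Section Calculus1.
Variable R : realType.
Implicit Types g : R -> R.

Lemma FTC2_all g a b : a <= b -> (forall x, derivable g x 1) ->
  continuous (fun x => 'D_1 g x) ->
  (\int[lebesgue_measure]_(x in `[a, b]) ('D_1 g x)%:E = (g b - g a)%:E)%E.
Proof.
rewrite le_eqVlt => /predU1P[->|ab] dg cg.
  by rewrite set_itv1 integral_set1 subrr.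
rewrite (@continuous_FTC2 _ _ g) ?EFinB//.
- exact: continuous_subspaceT.
- have cont x : {for x, continuous g}.
    by apply: differentiable_continuous; apply/derivable1_diffP; exact: dg.
  split; [by move=> x _; exact: dg|..].
  - by apply: cvg_at_right_filter; exact: cont.
  - by apply: cvg_at_left_filter; exact: cont.
- by move=> x _; rewrite derive1E.
Qed.

Lemma integral_supp_itv g a b : (forall x, (x < a) || (b < x) -> g x = 0) ->
  (\int[lebesgue_measure]_x (g x)%:E = \int[lebesgue_measure]_(x in `[a, b]) (g x)%:E)%E.
Proof.
move=> g0; rewrite [RHS]integral_mkcond; apply: eq_integral => x _.
rewrite patchE; case: ifPn => // /negP xab; rewrite g0//.
apply: contra_notT xab; rewrite negb_or -!leNgt => /andP[? ?].
by rewrite inE/= in_itv/=; apply/andP.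
Qed.

Lemma derive_supp0 g a b : (forall x, (x <= a) || (b <= x) -> g x = 0) ->
  forall x, (x < a) || (b < x) -> 'D_1 g x = 0.
Proof.
move=> g0 x xab; rewrite -(@derive_cst _ R R 0 x 1).
apply: near_eq_derive.
case/orP: xab => xab.
  near=> y; rewrite g0//; apply/orP; left; apply: ltW.
  by near: y; exact: lt_nbhsl.
near=> y; rewrite g0//; apply/orP; right; apply: ltW.
by near: y; exact: lt_nbhsr.
Unshelve. all: by end_near. Qed.

Lemma integral_derive0 g a b : a <= b ->
  (forall x, derivable g x 1) -> continuous (fun x => 'D_1 g x) ->
  (forall x, (x <= a) || (b <= x) -> g x = 0) ->
  (\int[lebesgue_measure]_x ('D_1 g x)%:E = 0)%E.
Proof.
move=> ab dg cg g0.
rewrite (@integral_supp_itv _ a b); last exact: derive_supp0.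
by rewrite FTC2_all// !g0 ?lexx ?orbT// subrr.
Qed.

(** Since [g] is zero far to the left, the fundamental theorem bounds |g| by the L^1 norm of its
    derivative; this is the pointwise input of the Ladyzhenskaya inequality. *)
Lemma norm_le_integral_derive g a :
  (forall x, derivable g x 1) -> continuous (fun x => 'D_1 g x) ->
  (forall x, x <= a -> g x = 0) -> forall t,
  (`|g t|%:E <= \int[lebesgue_measure]_x `|'D_1 g x|%:E)%E.
Proof.
move=> dg cg g0 t.
have mcg : measurable_fun setT (fun x => 'D_1 g x) by exact: continuous_measurable_fun.
have [ta|/ltW at_] := leP t a; first by rewrite g0// normr0 integral_ge0.
have -> : `|g t|%:E = `|\int[lebesgue_measure]_(x in `[a, t]) ('D_1 g x)%:E|%E.
  by rewrite FTC2_all// (g0 a)// subr0.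
apply: le_trans.
  apply: le_abse_integral => //.
  by apply/measurable_EFinP; exact: measurable_funTS.
apply: ge0_subset_integral => //.
by apply/measurable_EFinP; exact: measurableT_comp.
Qed.

End Calculus1.

(** * Fubini and Tonelli for the threefold product of Lebesgue measure *)

Section Lebesgue3.
Variable R : realType.
Local Open Scope ereal_scope.
Local Notation leb := (@lebesgue_measure R).
Implicit Type f : R3 R -> \bar R.
Implicit Type h : measurableTypeR R * measurableTypeR R -> \bar R.

(** A separate name for the planar measure, so that it carries its own sigma-finite structure and
    [lebesgue3] can be cut into slices z = const. *)
Definition lam2 : set (measurableTypeR R * measurableTypeR R)%type -> \bar R :=
  (leb \x leb)%E.

HB.instance Definition _ := Measure.copy lam2 (leb \x leb)%E.

Definition itv2 (L : R) : set (measurableTypeR R) := [set x | (- L <= x <= L)%R].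

Lemma measurable_itv2 L : measurable (itv2 L).
Proof.
rewrite (_ : itv2 L = `[(- L)%R, L]%classic); first exact: measurable_itv.
by apply/seteqP; split=> x /=; rewrite in_itv.
Qed.

Lemma lebesgue_itv2_fin L : leb (itv2 L) < +oo.
Proof.
rewrite (_ : itv2 L = `[(- L)%R, L]%classic).
  by rewrite lebesgue_measure_itv/=; case: ifP; rewrite ?ltry// -EFinD ltry.
by apply/seteqP; split=> x /=; rewrite in_itv.
Qed.

Lemma lam2_box L : lam2 (itv2 L `*` itv2 L) < +oo.
Proof.
have -> : lam2 (itv2 L `*` itv2 L) = leb (itv2 L) * leb (itv2 L).
  by apply: product_measure1E; exact: measurable_itv2.
rewrite -ge0_fin_numE ?mule_ge0// fin_numM// ge0_fin_numE//; exact: lebesgue_itv2_fin.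
Qed.

Lemma lam2_sigma_finite : sigma_finite setT lam2.
Proof.
exists (fun n => itv2 n%:R `*` itv2 n%:R).
  apply/esym/seteqP; split=> // -[x y] _.
  pose n := (Num.truncn (Num.max `|x : R| `|y : R|)%R).+1.
  have hn : (Num.max `|x : R| `|y : R| < n%:R)%R by exact: truncnS_gt.
  exists n => //; rewrite /itv2/= -!ler_norml; move: hn.
  by rewrite gt_max => /andP[/ltW ? /ltW ?].
by move=> n; split; [apply: measurableX; exact: measurable_itv2|exact: lam2_box].
Qed.

HB.instance Definition _ := Measure_isSigmaFinite.Build _ _ _ lam2 lam2_sigma_finite.

Lemma integrable_lebesgue3E f : (lebesgue3 R).-integrable setT f = (lam2 \x leb).-integrable setT f.
Proof. by []. Qed.

Lemma integral_lebesgue3E f : \int[lebesgue3 R]_x f x = \int[lam2 \x leb]_x f x.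
Proof. by []. Qed.

Lemma integral_lebesgue3_z f : (lebesgue3 R).-integrable setT f ->
  \int[lebesgue3 R]_x f x = \int[leb]_z \int[lam2]_xy f (xy, z).
Proof. by rewrite integrable_lebesgue3E integral_lebesgue3E => fi; rewrite -(integral21_prod_meas1 fi). Qed.

Lemma integral_lebesgue3_xy f : (lebesgue3 R).-integrable setT f ->
  \int[lebesgue3 R]_x f x = \int[lam2]_xy \int[leb]_z f (xy, z).
Proof. by rewrite integrable_lebesgue3E integral_lebesgue3E => fi; rewrite -(integral12_prod_meas1 fi). Qed.

Lemma tonelli_lebesgue3_z f : measurable_fun setT f -> (forall x, 0 <= f x) ->
  \int[lebesgue3 R]_x f x = \int[leb]_z \int[lam2]_xy f (xy, z).
Proof. by move=> mf f0; rewrite integral_lebesgue3E; exact: fubini_tonelli2. Qed.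

Lemma tonelli_lam2_yx h : measurable_fun setT h -> (forall x, 0 <= h x) ->
  \int[lam2]_x h x = \int[leb]_y \int[leb]_x h (x, y).
Proof. by move=> mh h0; exact: (@fubini_tonelli2 _ _ _ _ R leb leb h). Qed.

Lemma tonelli_lam2_xy h : measurable_fun setT h -> (forall x, 0 <= h x) ->
  \int[lam2]_x h x = \int[leb]_x \int[leb]_y h (x, y).
Proof. by move=> mh h0; exact: (@fubini_tonelli1 _ _ _ _ R leb leb h). Qed.

Lemma tonelli_lebesgue3_xy f : measurable_fun setT f -> (forall x, 0 <= f x) ->
  \int[lebesgue3 R]_x f x = \int[lam2]_xy \int[leb]_z f (xy, z).
Proof. by move=> mf f0; rewrite integral_lebesgue3E; exact: fubini_tonelli1. Qed.

Lemma integral_lam2_yx h : lam2.-integrable setT h ->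
  \int[lam2]_x h x = \int[leb]_y \int[leb]_x h (x, y).
Proof. by move=> hi; symmetry; exact: (@integral21_prod_meas1 _ _ _ _ R leb leb h). Qed.

Lemma integral_lam2_xy h : lam2.-integrable setT h ->
  \int[lam2]_x h x = \int[leb]_x \int[leb]_y h (x, y).
Proof. by move=> hi; symmetry; exact: (@integral12_prod_meas1 _ _ _ _ R leb leb h). Qed.

End Lebesgue3.

(** * Integrals of derivatives of functions supported in the domain *)

Section Calculus3.
Variables (R : realType) (O : bounded_domain R).
Local Notation mu := (leb_dom O).
Implicit Types k g : R3 R -> R.

Lemma continuous_measurable3 k : continuous k -> measurable_fun setT k.
Proof.
move=> ck; apply: (measurability _ (RGenOInfty.measurableE R)).
move=> /= _ [_ [a ->]] <-; apply: measurableI => //; apply: open_measurable3.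
by apply: open_comp; [move=> x _; exact: ck|exact: interval_open].
Qed.

Definition box3 (L : R) : set (R3 R) := itv2 L `*` itv2 L `*` itv2 L.

Lemma measurable_box3 L : measurable (box3 L).
Proof. by apply: measurableX; [apply: measurableX|]; exact: measurable_itv2. Qed.

Lemma dom_box3 : exists2 L : R, 0 < L & dom O `<=` box3 L.
Proof.
have [M [_ HM]] := @dom_bounded R O.
exists (`|M| + 1); first by rewrite ltr_wpDl.
move=> x Ox; have := HM (`|M| + 1) _ x Ox.
rewrite (le_lt_trans (ler_norm M)) ?ltrDl// => /(_ isT).
by rewrite /box3/itv2/= 2!prod_normE !ge_max -!ler_norml => /andP[/andP[-> ->] ->].
Qed.

Lemma lebesgue3_box (L : R) : (lebesgue3 R (box3 L) < +oo)%E.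
Proof.
have -> : (lebesgue3 R (box3 L) = lam2 (itv2 L `*` itv2 L) * lebesgue_measure (itv2 L))%E.
  by apply: product_measure1E; [apply: measurableX|]; exact: measurable_itv2.
rewrite -ge0_fin_numE ?mule_ge0// fin_numM// ge0_fin_numE//.
  exact: lam2_box.
exact: lebesgue_itv2_fin.
Qed.

Lemma leb_dom_fin : (mu setT < +oo)%E.
Proof.
have [L _ OL] := dom_box3.
rewrite -[mu setT]/(lebesgue3 R (setT `&` dom O)) setTI; apply: le_lt_trans (lebesgue3_box L).
apply: le_measure => //; rewrite inE; [apply: open_measurable3; exact: dom_open|].
exact: measurable_box3.
Qed.

Lemma integral_leb_dom (f : R3 R -> \bar R) : (forall x, ~ dom O x -> f x = 0%E) ->
  (\int[mu]_x f x = \int[lebesgue3 R]_x f x)%E.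
Proof.
move=> f0; have fO : f = f \_ (dom O).
  by apply/funext => x; rewrite patchE; case: ifPn => // /negP; rewrite inE => /f0.
rewrite fO -!integral_mkcond; apply: eq_measure_integral => A mA AO.
by rewrite -[mu A]/(lebesgue3 R (A `&` dom O)) setIidl.
Qed.

Definition supp_in k := closure [set x | k x != 0] `<=` dom O.

Lemma supp_in0 k x : supp_in k -> ~ dom O x -> k x = 0.
Proof. by move=> sk; apply: contra_notP => /eqP kx; apply: sk; exact: subset_closure. Qed.

Lemma partial_near0 k j x : (\near x, k x = 0) -> partial j k x = 0.
Proof.
move=> k0; rewrite /partial -(@derive_cst _ (R3 R) R 0 x (basis3 R j)).
exact: near_eq_derive.
Qed.

Lemma near_closureC k x : ~ closure [set y | k y != 0] x -> \near x, k x = 0.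
Proof.
move=> kx; have : nbhs x (~` closure [set y | k y != 0]) by apply: open_nbhs_nbhs; split=> //; apply: closed_openC; exact: closed_closure.
apply: filterS => y ky; apply: contra_notP ky => /eqP ?; exact: subset_closure.
Qed.

Lemma supp_in_partial k j : supp_in k -> supp_in (partial j k).
Proof.
move=> sk; apply: subset_trans sk.
rewrite [X in _ `<=` X](@closure_id _ (closure [set x | k x != 0])).1; last exact: closed_closure.
apply: closure_subset => x /=; apply: contraNP => kx.
by apply/eqP; apply: partial_near0; exact: near_closureC.
Qed.

Lemma bounded_supp k : continuous k -> supp_in k ->
  exists M : R, forall x, `|k x| <= M.
Proof.
move=> ck sk; have [L L0 OL] := dom_box3.
have cB : compact (closure (dom O)).
  have cI : compact (itv2 L).
    rewrite (_ : itv2 L = `[(- L)%R, L]%classic); first exact: segment_compact.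
    by apply/seteqP; split=> x /=; rewrite in_itv.
  have cbox : compact (box3 L) by apply: compact_setX => //; exact: compact_setX.
  have hR : hausdorff_space (R3 R) by exact: norm_hausdorff.
  apply: (subclosed_compact _ cbox); first exact: closed_closure.
  rewrite [X in _ `<=` X](closure_id _).1; first exact: closure_subset.
  exact: compact_closed.
have cK : compact (k @` closure (dom O)).
  apply: continuous_compact => //; exact: continuous_subspaceT.
have [M [_ HM]] := compact_bounded cK.
exists (`|M| + 1) => x; have [Ox|nOx] := pselect (dom O x).
  apply: (HM (`|M| + 1)); first by rewrite (le_lt_trans (ler_norm M))// ltrDl.
  by exists x => //; exact: subset_closure.
by rewrite (supp_in0 sk nOx) normr0 addr_ge0.
Qed.

Lemma bounded_integrable_dom k (M : R) : measurable_fun setT k -> (forall x, `|k x| <= M) ->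
  mu.-integrable setT (EFin \o k).
Proof.
move=> mk kM; apply: measurable_bounded_integrable => //; first exact: leb_dom_fin.
exists M; split; first exact: num_real.
by move=> N MN x _; apply: le_trans (kM x) _; exact: ltW.
Qed.

Lemma integrable_lebesgue3 k : continuous k -> supp_in k ->
  (lebesgue3 R).-integrable setT (EFin \o k).
Proof.
move=> ck sk; have [M HM] := bounded_supp ck sk.
have mk := continuous_measurable3 ck.
have /integrableP[_ fk] := bounded_integrable_dom mk HM.
apply/integrableP; split; first exact/measurable_EFinP.
rewrite -integral_leb_dom// => x Ox /=; by rewrite (supp_in0 sk Ox) normr0.
Qed.

(** Only the direction [j] is differentiated, since integrals are taken along lines parallel to
    [basis3 j]. *)
Record C1_supp (j : 'I_3) k : Prop := C1Supp {
  C1_cont : continuous k ;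
  C1_deriv : forall x, derivable k x (basis3 R j) ;
  C1_pcont : continuous (partial j k) ;
  C1_supp_in : supp_in k }.

Lemma partial_line k j p t :
  partial j k (p + t *: basis3 R j) = 'D_1 (fun s : R => k (p + s *: basis3 R j)) t.
Proof. by rewrite derive_line. Qed.

Lemma cont_line k (p v : R3 R) : continuous k -> continuous (fun s : R => k (p + s *: v)).
Proof.
move=> ck s; apply: (@continuous_comp _ _ _ (fun s : R => p + s *: v) k); last exact: ck.
by apply: cvgD; [exact: cvg_cst|apply: cvgZr_tmp; exact: cvg_id].
Qed.

Definition coord3 (j : 'I_3) (p : R3 R) : R :=
  if j == 0 :> nat then p.1.1 else if j == 1%N :> nat then p.1.2 else p.2.

Lemma box_coord L j p : box3 L p -> -L <= coord3 j p <= L.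
Proof.
move=> [[]] /=; rewrite /itv2/= /coord3 => ? ? ?.
by case: ifP => // _; case: ifP.
Qed.

Lemma coord3_line j p t : coord3 j (p + t *: basis3 R j) = coord3 j p + t.
Proof.
rewrite /coord3 /basis3; case: j => -[|[|[|//]]] //= ?; by rewrite -[_ *: _]/(_ * _) mulr1.
Qed.

Lemma line_supp0 k j L p t : supp_in k -> dom O `<=` box3 L -> coord3 j p = 0 ->
  (t < - L) || (L < t) -> k (p + t *: basis3 R j) = 0.
Proof.
move=> sk OL pj tL; apply: (supp_in0 sk) => /OL /(@box_coord _ j).
by rewrite coord3_line pj add0r; case/orP: tL => /lt_geF ->; rewrite ?andbF.
Qed.

Lemma line_integral0 k j p : C1_supp j k -> coord3 j p = 0 ->
  (\int[@lebesgue_measure R]_t (partial j k (p + t *: basis3 R j))%:E = 0)%E.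
Proof.
move=> [ck dk pk sk] pj; have [L L0 OL] := dom_box3.
(* The bounds are widened by 1: [line_supp0] gives zeros strictly outside [-L, L] only, while the
   endpoints must be zeros too. *)
rewrite -[RHS](@integral_derive0 R (fun s : R => k (p + s *: basis3 R j)) (- (L + 1)) (L + 1)).
- by apply: eq_integral => t _; rewrite partial_line.
- lra.
- by move=> x; apply: derivable_line; exact: dk.
- have := @cont_line _ p (basis3 R j) pk.
  by under eq_fun do rewrite partial_line.
- move=> x xL; apply: (line_supp0 sk OL pj).
  by case/orP: xL => h; apply/orP; [left|right]; lra.
Qed.

Lemma line_bound k j p t : C1_supp j k -> coord3 j p = 0 ->
  (`|k (p + t *: basis3 R j)|%:E <=
   \int[@lebesgue_measure R]_s `|partial j k (p + s *: basis3 R j)|%:E)%E.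
Proof.
move=> [ck dk pk sk] pj; have [L L0 OL] := dom_box3.
apply: le_trans.
  apply: (@norm_le_integral_derive R (fun s : R => k (p + s *: basis3 R j)) (- (L + 1))).
  - by move=> x; apply: derivable_line; exact: dk.
  - have := @cont_line _ p (basis3 R j) pk.
    by under eq_fun do rewrite partial_line.
  - by move=> x xL; apply: (line_supp0 sk OL pj); apply/orP; left; lra.
by rewrite le_eqVlt; apply/orP; left; apply/eqP; apply: eq_integral => s _; rewrite partial_line.
Qed.

Lemma line0E x y z : [/\ (x, y, z) = ((0, y, z) + x *: basis3 R 0 : R3 R),
   (x, y, z) = ((x, 0, z) + y *: basis3 R 1 : R3 R) &
   (x, y, z) = ((x, y, 0) + z *: basis3 R 2%:R : R3 R)].
Proof.
by split; rewrite /basis3 /=; congr (_, _, _); rewrite /= -?[_ *: _]/(_ * _) ?mulr1 ?mulr0 ?add0r ?addr0.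
Qed.

Lemma slice_integrable k z : continuous k -> supp_in k ->
  (@lam2 R).-integrable setT
    (fun xy => (k (xy, z))%:E).
Proof.
move=> ck sk; have [M HM] := bounded_supp ck sk.
have [L L0 OL] := dom_box3.
pose D : set (measurableTypeR R * measurableTypeR R) := itv2 L `*` itv2 L.
have mD : measurable D by apply: measurableX; exact: measurable_itv2.
have -> : (fun xy => (k (xy, z))%:E) = (EFin \o (fun xy => k (xy, z))) \_ D.
  apply/funext => -[x y]; rewrite patchE; case: ifPn => // /negP; rewrite inE => h.
  by rewrite (supp_in0 sk)// => /OL [].
have mk : measurable_fun setT (fun xy => k (xy, z)).
  by apply: measurableT_comp (continuous_measurable3 ck) _; exact: measurable_pair2.
apply/integrable_restrict => //; rewrite setTI.
apply: measurable_bounded_integrable => //; first exact: lam2_box.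
  exact: measurable_funTS.
exists M; split; first exact: num_real.
by move=> N MN x _; apply: le_trans (HM _) _; exact: ltW.
Qed.

(** Fubini with the differentiated variable innermost, so that each inner integral vanishes along a
    line; the order of integration therefore depends on [j]. *)
Lemma integral_partial0 k j : C1_supp j k -> (\int[mu]_x (partial j k x)%:E = 0)%E.
Proof.
move=> Ck; have [ck dk pk sk] := Ck.
have spk := supp_in_partial (j:=j) sk.
have ipk := integrable_lebesgue3 pk spk.
rewrite integral_leb_dom; last by move=> x Ox; rewrite (supp_in0 spk).
case: j Ck {dk} pk spk ipk => -[|[|[|//]]] j3 Ck pk spk ipk.
- rewrite (integral_lebesgue3_z ipk).
  rewrite (eq_integral (cst 0%E)) ?integral0// => z _ /=.
  rewrite (integral_lam2_yx (slice_integrable z pk spk)).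
  rewrite (eq_integral (cst 0%E)) ?integral0// => y _ /=.
  rewrite -(@line_integral0 k (Ordinal j3) (0, y, z) Ck erefl).
  apply: eq_integral => x _; congr (partial _ _ _)%:E.
  by have [-> _ _] := line0E x y z; congr (_ + _ *: basis3 _ _); exact: val_inj.
- rewrite (integral_lebesgue3_z ipk).
  rewrite (eq_integral (cst 0%E)) ?integral0// => z _ /=.
  rewrite (integral_lam2_xy (slice_integrable z pk spk)).
  rewrite (eq_integral (cst 0%E)) ?integral0// => x _ /=.
  rewrite -(@line_integral0 k (Ordinal j3) (x, 0, z) Ck erefl).
  apply: eq_integral => y _; congr (partial _ _ _)%:E.
  by have [_ -> _] := line0E x y z; congr (_ + _ *: basis3 _ _); exact: val_inj.
- rewrite (integral_lebesgue3_xy ipk).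
  rewrite (eq_integral (cst 0%E)) ?integral0// => -[x y] _ /=.
  rewrite -(@line_integral0 k (Ordinal j3) (x, y, 0) Ck erefl).
  apply: eq_integral => z _; congr (partial _ _ _)%:E.
  by have [_ _ ->] := line0E x y z; congr (_ + _ *: basis3 _ _); exact: val_inj.
Qed.

End Calculus3.

(** * Stability properties of smooth functions *)

Section SmoothAlgebra.
Variable R : realType.
Implicit Types g k : R3 R -> R.

(** A coinduction principle: iterated partial derivatives never leave a class that is closed under
    [partial], so continuity and derivability need checking only once. *)
Lemma smooth_class (C : set (R3 R -> R)) :
  (forall g, C g -> continuous g /\
    forall j, (forall x, derivable g x (basis3 R j)) /\ C (partial j g)) ->
  forall g, C g -> smooth g.
Proof.
move=> HC g Cg s; have : C (foldr (@partial R) g s).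
  by elim: s => //= j s ih; exact: ((HC _ ih).2 j).2.
by move=> /HC[? h]; split=> // j x; exact: (h j).1.
Qed.

Lemma smooth_cont g : smooth g -> continuous g.
Proof. by move=> /(_ [::])[]. Qed.

Lemma smooth_deriv g : smooth g -> forall j x, derivable g x (basis3 R j).
Proof. by move=> /(_ [::])[]. Qed.

Lemma smooth_partial g j : smooth g -> smooth (partial j g).
Proof. by move=> sg s; rewrite -foldr_rcons; exact: sg. Qed.

(** The set of products of two smooth functions is not visibly closed under [partial]; the algebra
    generated by smooth functions is, by the Leibniz rule. *)
Inductive salg : (R3 R -> R) -> Prop :=
| salg_base g : smooth g -> salg g
| salg_add g k : salg g -> salg k -> salg (g + k)
| salg_mul g k : salg g -> salg k -> salg (g * k).

Lemma salg_smooth g : salg g -> smooth g.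
Proof.
move: g; apply: smooth_class => g; elim=> {g} [g sg|g k _ [cg hg] _ [ck hk]|g k sg [cg hg] sk [ck hk]].
- split=> [|j]; first exact: smooth_cont.
  by split; [exact: smooth_deriv|exact/salg_base/smooth_partial].
- split=> [|j]; first by move=> x; exact: (continuousD (cg x) (ck x)).
  have [[dg pg] [dk pk]] := (hg j, hk j).
  split; first by move=> x; exact: derivableD.
  rewrite (_ : partial j (g + k) = partial j g + partial j k); first exact: salg_add.
  by apply/funext => x; rewrite /partial deriveD.
- split=> [|j]; first by move=> x; exact: (continuousM (cg x) (ck x)).
  have [[dg pg] [dk pk]] := (hg j, hk j).
  split; first by move=> x; exact: derivableM.
  rewrite (_ : partial j (g * k) = g * partial j k + k * partial j g).
    by apply: salg_add; exact: salg_mul.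
  by apply/funext => x; rewrite /partial deriveM.
Qed.

Lemma smoothD g k : smooth g -> smooth k -> smooth (g + k).
Proof. by move=> sg sk; apply/salg_smooth/salg_add; exact: salg_base. Qed.

Lemma smoothM g k : smooth g -> smooth k -> smooth (g * k).
Proof. by move=> sg sk; apply/salg_smooth/salg_mul; exact: salg_base. Qed.

Lemma smooth_cst (c : R) : smooth (cst c : R3 R -> R).
Proof.
apply: (@smooth_class [set g | exists c, g = cst c]); last by exists c.
move=> _ [{}c ->]; split; first exact: cst_continuous.
move=> j; split; first by move=> x; exact: derivable_cst.
by exists 0; apply/funext => x; rewrite /partial derive_cst.
Qed.

Lemma smooth_prod (I : eqType) (s : seq I) (F : I -> R3 R -> R) :
  (forall i, smooth (F i)) -> smooth (\prod_(i <- s) F i).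
Proof.
move=> sF; elim: s => [|i s ih]; first by rewrite big_nil; exact: (smooth_cst 1).
by rewrite big_cons; exact: smoothM.
Qed.

Lemma coord3_lineE (i j : 'I_3) (x : R3 R) (s : R) :
  coord3 i (x + s *: basis3 R j) = coord3 i x + s * (i == j)%:R.
Proof.
by rewrite /coord3 /basis3; case: i j => -[|[|[|//]]] //= ? -[[|[|[|//]]]] //= ?.
Qed.

Lemma coord3_continuous (i : 'I_3) : continuous (coord3 i : R3 R -> R).
Proof.
case: i => -[|[|[|//]]] ? x; rewrite /coord3/=.
- by apply: (@continuous_comp _ _ _ (fst : R3 R -> _) fst); [exact: cvg_fst|exact: cvg_fst].
- by apply: (@continuous_comp _ _ _ (fst : R3 R -> _) snd); [exact: cvg_fst|exact: cvg_snd].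
- exact: cvg_snd.
Qed.

End SmoothAlgebra.

(** * Functions that are flat at the origin, for smooth cutoffs *)

Section FlatExp.
Variable R : realType.
Implicit Types (p q : {poly R}) (t : R).

(** The functions p(1/t) exp(-1/t), extended by 0 to t <= 0. The polynomial factor makes the family
    stable under differentiation. *)
Definition flat p t : R := if 0 < t then p.[t^-1] * expR (- t^-1) else 0.

(** Induction on the degree: half of the exponent bounds the quotient polynomial, and the other half
    absorbs the extra factor y through 1 + x <= exp x. *)
Lemma poly_expR_bound p (a : R) : 0 < a ->
  exists2 K : R, 0 <= K & forall y, 0 < y -> `|p.[y]| <= K * expR (a * y).
Proof.
elim/poly_ind: p a => [|p c ih] a a0.
  by exists 0 => // y _; rewrite horner0 normr0 mul0r.
have a20 : 0 < a / 2 by rewrite divr_gt0.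
have [K K0 HK] := ih _ a20.
exists (K * (a / 2)^-1 + `|c|); first by rewrite addr_ge0// mulr_ge0// invr_ge0 ltW.
move=> y y0; rewrite hornerMXaddC mulrDl (le_trans (ler_normD _ _))// lerD//; last first.
  by rewrite ler_peMr// -expR0 ler_expR mulr_ge0 ?ltW.
rewrite normrM (gtr0_norm y0).
have -> : a * y = a / 2 * y + a / 2 * y by rewrite -mulrDl -splitr.
rewrite expRD mulrACA; apply: ler_pM; [exact: normr_ge0|exact: ltW|exact: HK|].
rewrite -(@ler_pM2l _ (a / 2) a20) mulrA mulfV ?gt_eqF// mul1r.
by apply: le_trans (expR_ge1Dx _); rewrite lerDr.
Qed.

(** Applying [poly_expR_bound] to [p * 'X] instead of [p] buys the factor t. *)
Lemma flat_bound p : exists2 K : R, 0 <= K & forall t, `|flat p t| <= K * `|t|.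
Proof.
have [K K0 HK] := poly_expR_bound (p * 'X) ltr01.
exists K => // t; rewrite /flat; case: ifPn => [t0|_]; last by rewrite normr0 mulr_ge0.
have := HK t^-1; rewrite invr_gt0 => /(_ t0).
rewrite mul1r hornerMX !normrM (gtr0_norm t0) normfV (gtr0_norm t0) (ger0_norm (expR_ge0 _)).
rewrite ler_pdivrMr// expRN => h.
by rewrite ler_pdivrMr ?expR_gt0// (le_trans h)// mulrAC.
Qed.

Lemma flat_cvg0 p : flat p t @[t --> (0 : R)^'] --> (0 : R).
Proof.
have [K K0 HK] := flat_bound p.
apply/cvgrPdist_le => /= e e0.
have eK : 0 < e / (K + 1) by rewrite divr_gt0// ltr_wpDl.
near=> t; rewrite sub0r normrN (le_trans (HK t))//.
have : `|t| <= e / (K + 1).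
  near: t; apply: cvg_within; have := @nbhs0_le R R _ eK.
  exact.
rewrite ler_pdivlMr ?ltr_wpDl// => h; rewrite mulrC (le_trans _ h)//.
by rewrite ler_wpM2l// lerDl.
Unshelve. all: by end_near. Qed.

(** From the derivative (p(1/t) - p'(1/t)) t^-2 exp(-1/t) of p(1/t) exp(-1/t). *)
Definition dflat p : {poly R} := (p - p^`()) * 'X^2.

Lemma is_derive_flat p t : is_derive t 1 (flat p) (flat (dflat p) t).
Proof.
have [t0|t0|<-] := ltgtP 0 t.
- have -> : flat (dflat p) t = p.[t^-1] * (expR (- t^-1) * (t ^- 2)) +
     expR (- t^-1) * (p^`().[t^-1] * (- t ^- 2)).
    by rewrite /flat t0 /dflat hornerM hornerXn hornerD hornerN exprVn; ring.
  have tn0 : (id t : R) != 0 by rewrite gt_eqF.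
  have dV : is_derive t 1 (fun x : R => x^-1) (- t ^- 2).
    have := @is_deriveV R id t 1 1 tn0 (is_derive_id _ _).
    by rewrite /GRing.scale/= mulr1.
  have dN : is_derive t 1 (fun x : R => - x^-1) (t ^- 2).
    by have := is_deriveN dV; rewrite opprK.
  have dE : is_derive t 1 (fun x : R => expR (- x^-1)) (expR (- t^-1) * t ^- 2).
    by have := @is_derive1_comp R expR (fun x => - x^-1) t _ _ (is_derive_expR _) dN.
  have dP : is_derive t 1 (fun x : R => p.[x^-1]) (p^`().[t^-1] * (- t ^- 2)).
    by have := @is_derive1_comp R (horner p) (fun x => x^-1) t _ _ (is_derive_poly _ _) dV.
  have dM := is_deriveM dP dE.
  have near_eq : {near t, (fun x : R => p.[x^-1]) * (fun x : R => expR (- x^-1)) =1 flat p}.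
    near=> x; rewrite /flat ifT//; near: x; exact: lt_nbhsr.
  by apply: near_eq_is_derive near_eq dM; rewrite oner_eq0.
- rewrite {2}/flat ltNge ltW//=.
  have near_eq : {near t, (cst 0 : R -> R) =1 flat p}.
    near=> x; rewrite /flat ltNge ltW//; near: x; exact: lt_nbhsl.
  by apply: near_eq_is_derive near_eq (is_derive_cst _ _ _); rewrite oner_eq0.
- rewrite {2}/flat ltxx.
  (* At 0 the difference quotient of [flat p] is again a flat function, [flat (p * 'X)], which tends
     to 0. *)
  have E : (fun h : R => h^-1 *: ((flat p \o shift 0) (h *: (1 : R)) - flat p 0)) = flat (p * 'X).
    apply/funext => h /=; rewrite /shift/= addr0 -[h *: (1 : R)]/(h * 1) mulr1.
    rewrite /flat ltxx subr0; case: ifPn => _; last by rewrite scaler0.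
    by rewrite hornerMX -[_ *: _]/(_ * _); ring.
  have C := flat_cvg0 (p * 'X); rewrite -E in C.
  by apply: DeriveDef; [apply: cvgP C|exact: cvg_lim C].
Unshelve. all: by end_near. Qed.

Lemma flat_continuous p : continuous (flat p).
Proof.
move=> t; apply: differentiable_continuous; apply/derivable1_diffP.
by have [] := is_derive_flat p t.
Qed.

Lemma flat1_ge0 t : 0 <= flat 1 t.
Proof. by rewrite /flat; case: ifP => // _; rewrite hornerE mul1r expR_ge0. Qed.

Lemma flat1_gt0 t : 0 < t -> 0 < flat 1 t.
Proof. by move=> t0; rewrite /flat t0 hornerE mul1r expR_gt0. Qed.

Lemma flat1_le1 t : flat 1 t <= 1.
Proof.
rewrite /flat; case: ifPn => // t0; rewrite hornerE mul1r -expR0 ler_expR.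
by rewrite oppr_le0 invr_ge0 ltW.
Qed.

Lemma flat1_eq0 t : t <= 0 -> flat 1 t = 0.
Proof. by move=> t0; rewrite /flat ltNge t0. Qed.

Lemma flat1_cvg1 t : 0 < t -> flat 1 (n%:R * t) @[n --> \oo] --> (1 : R).
Proof.
move=> t0; have cE : {for (0 : R), continuous expR} by exact: continuous_expR.
rewrite -[X in _ --> X]expR0.
have h : (- ((n%:R + 1) * t)^-1 : R) @[n --> \oo] --> (0 : R).
  rewrite -oppr0; apply: cvgN.
  under eq_fun do rewrite invfM.
  rewrite -(mul0r t^-1); apply: cvgM; last exact: cvg_cst.
  under eq_fun do rewrite natr1.
  exact: cvg_harmonic.
rewrite -(cvg_shiftS _) /=.
have := cvg_comp _ _ h cE; apply: cvg_trans; apply: near_eq_cvg.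
near=> n; rewrite /= /flat ifT ?hornerE ?mul1r ?natr1//.
by rewrite mulr_gt0.
Unshelve. all: by end_near. Qed.

Lemma smooth_flat (p : {poly R}) (a b : R) (i : 'I_3) :
  smooth (fun x : R3 R => flat p (a * coord3 i x + b)).
Proof.
pose C : set (R3 R -> R) := [set g | exists c q, g = fun x => c * flat q (a * coord3 i x + b)].
apply: (@smooth_class R C); last by exists 1, p; apply/funext => x; rewrite mul1r.
move=> _ [c [q ->]]; split.
  move=> x; apply: cvgM; first exact: cvg_cst.
  apply: (@continuous_comp _ _ _ (fun x => a * coord3 i x + b) (flat q)); last exact: flat_continuous.
  by apply: cvgD; [apply: cvgM; [exact: cvg_cst|exact: coord3_continuous]|exact: cvg_cst].
move=> j.
have D x : is_derive x (basis3 R j) (fun x => c * flat q (a * coord3 i x + b))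
    (c * (flat (dflat q) (a * coord3 i x + b) * (a * (i == j)%:R))).
  apply: is_derive_of_line.
  under eq_fun do rewrite coord3_lineE.
  have dl : is_derive (0 : R) 1 (fun s : R => a * (coord3 i x + s * (i == j)%:R) + b) (a * (i == j)%:R).
    have -> : (fun s : R => a * (coord3 i x + s * (i == j)%:R) + b) =
       (fun s : R => (a * (i == j)%:R) * s + (a * coord3 i x + b)) by apply/funext => s; ring.
    set m := a * _; set k := _ + b.
    have := @is_deriveD _ _ _ _ _ (0 : R) 1 _ _ (@is_deriveZ R R R id m 0 1 1 (is_derive_id _ _))
      (@is_derive_cst R R R k 0 1).
    by rewrite addr0 -[m *: 1]/(m * 1) mulr1.
  have := @is_derive1_comp R (flat q) _ (0 : R) _ _ (is_derive_flat q _) dl.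
  rewrite mul0r addr0 => /(@is_deriveZ _ _ _ _ c).
  exact.
split; first by move=> x; have [] := D x.
exists (c * (a * (i == j)%:R)), (dflat q); apply/funext => x.
by rewrite /partial (@derive_val _ _ _ _ _ _ _ (D x)); ring.
Qed.

End FlatExp.

(** * Test functions *)

Section TestFunctions.
Variables (R : realType) (O : bounded_domain R).
Local Notation mu := (leb_dom O).
Implicit Types g k phi : R3 R -> R.

Lemma supp_in_compact g : supp_in O g -> compact (closure [set x | g x != 0]).
Proof.
move=> sg; have [L _ OL] := dom_box3 O.
have cI : compact (itv2 L : set (measurableTypeR R)).
  rewrite (_ : itv2 L = `[(- L)%R, L]%classic); first exact: segment_compact.
  by apply/seteqP; split=> x /=; rewrite in_itv.
have cbox : compact (box3 L) by apply: compact_setX => //; exact: compact_setX.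
apply: (subclosed_compact _ cbox); first exact: closed_closure.
exact: subset_trans sg OL.
Qed.

Lemma test_funP g : test_fun O g <-> smooth g /\ supp_in O g.
Proof.
by split=> [[? _ ?]|[? ?]] //; split=> //; exact: supp_in_compact.
Qed.

Lemma test_smooth g : test_fun O g -> smooth g. Proof. by move/test_funP => []. Qed.
Lemma test_supp g : test_fun O g -> supp_in O g. Proof. by move/test_funP => []. Qed.
Lemma test_cont g : test_fun O g -> continuous g. Proof. by move/test_smooth/smooth_cont. Qed.
Lemma test_meas g : test_fun O g -> measurable_fun setT g.
Proof. by move/test_cont/continuous_measurable3. Qed.
Lemma test_deriv g j x : test_fun O g -> derivable g x (basis3 R j).
Proof. by move=> /test_smooth/smooth_deriv. Qed.

Lemma test_bound g : test_fun O g -> exists2 M : R, 0 <= M & forall x, `|g x| <= M.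
Proof.
move=> tg; have [M HM] := bounded_supp (test_cont tg) (test_supp tg).
by exists M => //; exact: le_trans (HM point).
Qed.

Lemma test_fun_partial g j : test_fun O g -> test_fun O (partial j g).
Proof.
move=> /test_funP[sg ug]; apply/test_funP; split; first exact: smooth_partial.
exact: supp_in_partial.
Qed.

Lemma C1_supp_test j g : test_fun O g -> C1_supp O j g.
Proof.
move=> tg; split; [exact: test_cont|by move=> x; exact: test_deriv| |exact: test_supp].
exact/test_cont/test_fun_partial.
Qed.

Lemma supp_inM g k : supp_in O g -> supp_in O (g * k).
Proof.
move=> sg; apply: subset_trans sg; apply: closure_subset => x /=.
by apply: contraNN => /eqP gx; rewrite -[(g * k) x]/(g x * k x) gx mul0r.
Qed.

Lemma supp_inD g k : supp_in O g -> supp_in O k -> supp_in O (g + k).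
Proof.
move=> sg sk; apply: (@subset_trans _ (closure [set x | g x != 0] `|` closure [set x | k x != 0])).
  rewrite -closureU; apply: closure_subset => x /=.
  rewrite -[(g + k) x]/(g x + k x); have [->|? _] := eqVneq (g x) 0; last by left.
  by rewrite add0r; right.
by rewrite subUset.
Qed.

Lemma test_funM g k : test_fun O g -> smooth k -> test_fun O (g * k).
Proof.
move=> /test_funP[sg ug] sk; apply/test_funP; split; first exact: smoothM.
exact: supp_inM.
Qed.

Lemma test_funD g k : test_fun O g -> test_fun O k -> test_fun O (g + k).
Proof.
move=> /test_funP[sg ug] /test_funP[sk uk]; apply/test_funP.
by split; [exact: smoothD|exact: supp_inD].
Qed.

Lemma test_funZ (a : R) g : test_fun O g -> test_fun O (a *: g).
Proof.
move=> tg; rewrite (_ : a *: g = g * (cst a : R3 R -> R)).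
  by apply: test_funM => //; exact: smooth_cst.
by apply/funext => x; rewrite !fctE -[_ *: _]/(_ * _) mulrC.
Qed.

Lemma partialM j g k x : derivable g x (basis3 R j) -> derivable k x (basis3 R j) ->
  partial j (g * k) x = partial j g x * k x + g x * partial j k x.
Proof.
move=> dg dk; rewrite [LHS](deriveM dg dk) addrC; congr (_ + _).
exact: mulrC.
Qed.

Lemma partial_linear j (a : R) g k : test_fun O g -> test_fun O k ->
  partial j (a *: g + k) = a *: partial j g + partial j k.
Proof.
move=> tg tk; apply/funext => x; rewrite /partial deriveD ?deriveZ//.
all: by [exact: test_deriv|apply: derivableZ; exact: test_deriv].
Qed.

Lemma bounded_integrable g (M : R) : measurable_fun setT g -> (forall x, `|g x| <= M) ->
  mu.-integrable setT (EFin \o g).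
Proof. exact: bounded_integrable_dom. Qed.

Lemma test_integrable g : test_fun O g -> mu.-integrable setT (EFin \o g).
Proof. by move=> tg; have [M _ HM] := test_bound tg; apply: bounded_integrable HM; exact: test_meas. Qed.

Lemma test_ibp phi g j : test_fun O phi -> smooth g ->
  \int[mu]_x (g x * partial j phi x) = - \int[mu]_x (partial j g x * phi x).
Proof.
move=> tphi sg.
have t1 : test_fun O (phi * g) by exact: test_funM.
have i1 : mu.-integrable setT (EFin \o (fun x => g x * partial j phi x)).
  have := test_integrable (test_funM (test_fun_partial j tphi) sg).
  by apply: eq_integrable => // x _ /=; rewrite -[(_ * _) x]/(_ x * _ x) mulrC.
have i2 : mu.-integrable setT (EFin \o (fun x => partial j g x * phi x)).
  have := test_integrable (test_funM tphi (smooth_partial j sg)).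
  by apply: eq_integrable => // x _ /=; rewrite -[(_ * _) x]/(_ x * _ x) mulrC.
apply/eqP; rewrite -subr_eq0 opprK -RintegralD//; apply/eqP.
rewrite /Rintegral -[RHS]/(fine 0%E); congr fine.
rewrite -[RHS](integral_partial0 (C1_supp_test j t1)).
apply: eq_integral => x _; congr EFin.
rewrite partialM; [|exact: test_deriv|exact: smooth_deriv].
by rewrite [g x * _]mulrC [partial j g x * _]mulrC.
Qed.

End TestFunctions.

(** * The fundamental lemma of the calculus of variations *)

Section FundamentalLemma.
Variables (R : realType) (O : bounded_domain R).
Local Notation mu := (leb_dom O).

Definition obox (a b : 'I_3 -> R) : set (R3 R) := [set x | forall i, a i < coord3 i x < b i].
Definition cbox (a b : 'I_3 -> R) : set (R3 R) := [set x | forall i, a i <= coord3 i x <= b i].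

(** Each factor vanishes outside its side of the box and tends to 1 inside as n grows, so the bumps
    tend boundedly to the indicator of the open box. *)
Definition bump (a b : 'I_3 -> R) (n : R) : R3 R -> R :=
  \prod_(i < 3) ((fun x : R3 R => flat 1 (n * coord3 i x + (- (n * a i)))) *
               (fun x => flat 1 (- n * coord3 i x + n * b i))).

Lemma bumpE a b n x : bump a b n x =
  \prod_(i < 3) (flat 1 (n * (coord3 i x - a i)) * flat 1 (n * (b i - coord3 i x))).
Proof.
rewrite /bump; elim/big_rec2: _ => [//|i y f _ ih].
rewrite !fctE in ih *; rewrite ih; congr (flat 1 _ * flat 1 _ * _); ring.
Qed.

Lemma bump_smooth a b n : smooth (bump a b n).
Proof. by apply: smooth_prod => i; apply: smoothM; exact: smooth_flat. Qed.

Lemma bump_out a b n x : 0 < n -> ~ obox a b x -> bump a b n x = 0.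
Proof.
move=> n0 /existsNP[i hi]; rewrite bumpE (bigD1 i)//=.
have [h|h] := leP (coord3 i x) (a i).
  by rewrite flat1_eq0 ?mul0r// pmulr_rle0// subr_le0.
have [h'|h'] := leP (b i) (coord3 i x); last by exfalso; apply: hi; rewrite h h'.
by rewrite [X in _ * X * _]flat1_eq0 ?mulr0 ?mul0r// pmulr_rle0// subr_le0.
Qed.

Lemma bump_gt0 a b n x : 0 < n -> obox a b x -> 0 < bump a b n x.
Proof.
move=> n0 h; rewrite bumpE; apply: prodr_gt0 => i _; have /andP[h1 h2] := h i.
by apply: mulr_gt0; apply: flat1_gt0; rewrite mulr_gt0// subr_gt0.
Qed.

Lemma bump_bound a b n x : 0 <= bump a b n x <= 1.
Proof.
rewrite bumpE; elim/big_ind: _ => [|y z /andP[y0 y1] /andP[z0 z1]|i _]; rewrite ?ler01 ?lexx//.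
  by rewrite mulr_ge0//= -[leRHS]mulr1 ler_pM.
by rewrite mulr_ge0 ?flat1_ge0//= -[leRHS]mulr1 ler_pM ?flat1_ge0 ?flat1_le1.
Qed.

Lemma bump_cvg a b x : obox a b x -> bump a b n%:R x @[n --> \oo] --> (1 : R).
Proof.
move=> h; under eq_fun do rewrite bumpE.
suff : \prod_(i < 3) (flat 1 (n%:R * (coord3 i x - a i)) * flat 1 (n%:R * (b i - coord3 i x))) @[n --> \oo]
    --> \prod_(i < 3) ((1 : R) * 1) by rewrite big1// => i _; rewrite mulr1.
rewrite !big_ord_recl !big_ord0; under eq_fun do rewrite !big_ord_recl !big_ord0.
have c i : flat 1 (n%:R * (coord3 i x - a i)) * flat 1 (n%:R * (b i - coord3 i x)) @[n --> \oo] --> (1 * 1 : R).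
  by have /andP[h1 h2] := h i; apply: cvgM; apply: flat1_cvg1; rewrite subr_gt0.
apply: cvgM; first exact: c.
by apply: cvgM; [exact: c|apply: cvgM; [exact: c|exact: cvg_cst]].
Qed.

Lemma closed_cbox a b : closed (cbox a b).
Proof.
have -> : cbox a b = \bigcap_(i in [set: 'I_3]) (coord3 i @^-1` `[a i, b i]%classic).
  apply/seteqP; split=> x /= h i; first by move=> _; rewrite /= in_itv/=; exact: h.
  by have := h i I; rewrite /= in_itv.
apply: closed_bigI => i _; apply: closed_comp; last exact: itv_closed.
by move=> x _; exact: coord3_continuous.
Qed.

Lemma bump_test a b n : 0 < n -> cbox a b `<=` dom O -> test_fun O (bump a b n).
Proof.
move=> n0 abO; apply/test_funP; split; first exact: bump_smooth.
apply: subset_trans abO; rewrite [X in _ `<=` X](closure_id _).1; last exact: closed_cbox.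
apply: closure_subset => x /= hx i.
have : obox a b x by apply: contrapT => /(bump_out n0) h; rewrite h eqxx in hx.
by move/(_ i)/andP => [/ltW -> /ltW ->].
Qed.

Lemma measurable_coord3 i : measurable_fun setT (coord3 i : R3 R -> R).
Proof. by apply: continuous_measurable3; exact: coord3_continuous. Qed.

Lemma measurable_obox a b : measurable (obox a b).
Proof.
have -> : obox a b = \bigcap_(i in [set: 'I_3]) (coord3 i @^-1` `]a i, b i[%classic).
  apply/seteqP; split=> x /= h i; first by move=> _; rewrite /= in_itv/=; exact: h.
  by have := h i I; rewrite /= in_itv.
apply: fin_bigcap_measurable => // i _; rewrite -[X in measurable X]setTI.
exact: measurable_coord3.
Qed.

Lemma integral_obox0 (h : R3 R -> R) a b : mu.-integrable setT (EFin \o h) ->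
  (forall phi, test_fun O phi -> \int[mu]_x (h x * phi x) = 0) ->
  cbox a b `<=` dom O -> (\int[mu]_(x in obox a b) (h x)%:E = 0)%E.
Proof.
move=> ih h0 abO.
have mh : measurable_fun setT h by apply/measurable_EFinP; exact: (measurable_int mu ih).
have E n : (\int[mu]_x (h x * bump a b n.+1%:R x)%:E = 0)%E.
  have tb : test_fun O (bump a b n.+1%:R) by apply: bump_test.
  have h00 := h0 _ tb; rewrite -[LHS]fineK; first by congr EFin; exact: h00.
  apply: (integrable_fin_num measurableT); apply: le_integrable ih => //.
    by apply/measurable_EFinP; apply: measurable_funM => //; exact: test_meas tb.
  move=> x _ /=; rewrite lee_fin normrM ler_piMr// ger0_norm.
    by have /andP[] := bump_bound a b n.+1%:R x.
  by have /andP[] := bump_bound a b n.+1%:R x.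
rewrite integral_mkcond.
suff H : (\int[mu]_x (h x * bump a b n.+1%:R x)%:E @[n --> \oo] -->
    \int[mu]_x ((EFin \o h) \_ (obox a b)) x)%E.
  by move: H; under eq_fun do rewrite E; move=> H; exact: (cvg_unique _ H (cvg_cst _)).
apply: (@dominated_cvg _ _ _ mu setT measurableT _ _ (fun x => `|h x|%:E)).
- move=> n; apply/measurable_EFinP; apply: measurable_funM => //.
  by apply: continuous_measurable3; apply: smooth_cont; exact: bump_smooth.
- move=> x _; rewrite patchE; case: ifPn => [|/negP]; rewrite inE => hx.
    apply: cvg_EFin; first exact: nearW.
    rewrite -[X in _ --> X]mulr1; apply: cvgM; first exact: cvg_cst.
    by have := bump_cvg hx; rewrite -cvg_shiftS.
  by rewrite [X in X @ _ --> _](_ : _ = cst 0%E); [exact: cvg_cst|apply/funext => n; rewrite bump_out ?mulr0].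
- by [].
- exact: integrable_norm.
- move=> n x _ /=; rewrite lee_fin normrM ler_piMr// ger0_norm.
    by have /andP[] := bump_bound a b n.+1%:R x.
  by have /andP[] := bump_bound a b n.+1%:R x.
Qed.

(** Orthants form a pi-system that generates the Borel sets, and an orthant meets a box in a box;
    both facts feed the Dynkin argument of [obox_integral0]. *)
Definition orthant (a : 'I_3 -> R) : set (R3 R) := [set x | forall i, a i < coord3 i x].

Lemma measurable_orthantE : @measurable _ (R3 R) = <<s [set orthant a | a in setT] >>.
Proof.
set G := [set _ | _ in _].
apply/seteqP; split; last first.
  apply: smallest_sub; first exact: sigma_algebra_measurable.
  move=> _ [a _ <-]; have -> : orthant a = \bigcap_(i in [set: 'I_3]) (coord3 i @^-1` `]a i, +oo[%classic).
    apply/seteqP; split=> x /= h i.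
      by move=> _; rewrite /= in_itv/= andbT; exact: h.
    by have := h i I; rewrite /= in_itv/= andbT.
  apply: fin_bigcap_measurable => // i _; rewrite -[X in measurable X]setTI.
  exact: measurable_coord3.
have mc i : measurable_fun setT (coord3 i : g_sigma_algebraType G -> R).
  apply: (measurability _ (RGenOInfty.measurableE R)).
  move=> /= _ [_ [r ->]] <-; rewrite setTI.
  have -> : coord3 i @^-1` `]r, +oo[%classic =
     \bigcup_n orthant (fun k => if k == i then r else - n%:R).
    apply/seteqP; split=> [x|x [n _ /(_ i)]]; rewrite /= in_itv/= andbT; last by rewrite eqxx.
    move=> rx; pose n := (Num.truncn (\sum_k `|coord3 k x|)).+1.
    exists n => // k; case: eqP => [->//|_]; rewrite ltrNl.
    have hn : \sum_k `|coord3 k x| < n%:R by exact: truncnS_gt.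
    apply: le_lt_trans hn; rewrite (le_trans (ler_norm _))// normrN (bigD1 k)//=.
    by rewrite lerDl sumr_ge0.
  apply: bigcupT_measurable => n; apply: sub_sigma_algebra.
  by exists (fun k => if k == i then r else - n%:R).
have mid : measurable_fun setT (id : g_sigma_algebraType G -> R3 R).
  apply: (@eq_measurable_fun _ _ _ _ _ (fun x : g_sigma_algebraType G => (coord3 0 x, coord3 1 x, coord3 2%:R x) : R3 R)).
    by move=> [[x y] z] _.
  by apply: measurable_fun_pair; [apply: measurable_fun_pair|]; exact: mc.
move=> A mA; have := mid measurableT A mA; rewrite setTI.
exact.
Qed.

Lemma obox_integral0 (h : R3 R -> R) a b : mu.-integrable setT (EFin \o h) ->
  (forall phi, test_fun O phi -> \int[mu]_x (h x * phi x) = 0) ->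
  cbox a b `<=` dom O -> forall A, measurable A ->
  (\int[mu]_(x in A `&` obox a b) (h x)%:E = 0)%E.
Proof.
move=> ih h0 abO.
have mab := measurable_obox a b.
have ihS A : measurable A -> mu.-integrable A (EFin \o h).
  by move=> mA; apply: integrableS ih.
move=> A mA; have {mA} : <<s [set orthant a | a in setT] >> A by rewrite -measurable_orthantE.
move: A; apply: (@dynkin_induction _ (R3 R) _ [set A | (\int[mu]_(x in A `&` obox a b) (h x)%:E = 0)%E] measurable_orthantE) => /=.
- move=> _ _ [a1 _ <-] [a2 _ <-]; exists (fun i => Num.max (a1 i) (a2 i)) => //.
  apply/seteqP; split=> x /=.
    by move=> hx; split=> i; have := hx i; rewrite gt_max => /andP[].
  by move=> [h1 h2] i; rewrite gt_max h1 h2.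
- by rewrite setTI; exact: integral_obox0.
- move=> _ [c _ <-] /=.
  have -> : orthant c `&` obox a b = obox (fun i => Num.max (c i) (a i)) b.
    apply/seteqP; split=> x /=.
      by move=> [h1 h2] i; have /andP[h3 h4] := h2 i; rewrite gt_max h1 h3 h4.
    move=> hx; split=> i; have := hx i; rewrite gt_max => /andP[/andP[? ?] ?] //.
    exact/andP.
  apply: integral_obox0 => //; apply: subset_trans abO => x hx i.
  by have := hx i; rewrite ge_max => /andP[/andP[_ ->] ->].
- move=> S mS S0.
  have := integral_obox0 ih h0 abO.
  have -> : obox a b = (S `&` obox a b) `|` (~` S `&` obox a b).
    by rewrite -setIUl setUv setTI.
  rewrite integral_setU//; last 4 first.
  + exact: measurableI.
  + by apply: measurableI => //; exact: measurableC.
  + apply: measurable_funTS; exact: (measurable_int _ ih).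
  + by rewrite disj_set2E; apply/eqP; rewrite setIACA setICr set0I.
  by rewrite -setIUl setUv setTI S0 add0e.
- move=> F mF tF F0.
  rewrite setI_bigcupl integral_bigcup//.
  + by rewrite eseries0// => n _ _; exact: F0.
  + by apply: trivIset_setIr.
  + by move=> n; exact: measurableI.
  + by apply: ihS; apply: bigcupT_measurable => n; exact: measurableI.
Qed.

Lemma rat_box_cover (x : R3 R) : dom O x -> exists a b : {ffun 'I_3 -> rat},
  obox (fun i => ratr (a i)) (fun i => ratr (b i)) x /\
  cbox (fun i => ratr (a i)) (fun i => ratr (b i)) `<=` dom O.
Proof.
move=> Ox; have /nbhs_ballP[e /= e0 xe] : nbhs x (dom O).
  by apply: open_nbhs_nbhs; split=> //; exact: dom_open.
have Ha i : exists q : rat, coord3 i x - e / 2 < ratr q < coord3 i x.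
  have [|q] := @rat_in_itvoo R (coord3 i x - e / 2) (coord3 i x); first by rewrite gtrBl divr_gt0.
  by rewrite in_itv; exists q.
have Hb i : exists q : rat, coord3 i x < ratr q < coord3 i x + e / 2.
  have [|q] := @rat_in_itvoo R (coord3 i x) (coord3 i x + e / 2); first by rewrite ltrDl divr_gt0.
  by rewrite in_itv; exists q.
exists [ffun i => projT1 (cid (Ha i))], [ffun i => projT1 (cid (Hb i))]; split.
  move=> i; rewrite !ffunE; case: cid => q /= /andP[_ ->].
  by case: cid => r /= /andP[->].
move=> y hy; apply: xe; have hc i : `|coord3 i x - coord3 i y| < e.
  have := hy i; rewrite !ffunE; case: cid => q /= /andP[q1 _].
  case: cid => r /= /andP[_ r2] /andP[h1 h2]; rewrite ltr_norml; lra.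
by split; [split|]; [exact: (hc 0)|exact: (hc 1)|exact: (hc 2%:R)].
Qed.

(** In a box inside the domain the integral of [h] over every measurable set is 0, hence h = 0
    almost everywhere there; countably many rational boxes cover the domain. *)
Lemma fundamental_lemma (h : R3 R -> R) : mu.-integrable setT (EFin \o h) ->
  (forall phi, test_fun O phi -> \int[mu]_x (h x * phi x) = 0) ->
  h = cst 0 %[ae mu].
Proof.
move=> ih h0.
pose P (q : {ffun 'I_3 -> rat} * {ffun 'I_3 -> rat}) (x : R3 R) :=
  cbox (fun i => ratr (q.1 i)) (fun i => ratr (q.2 i)) `<=` dom O ->
  obox (fun i => ratr (q.1 i)) (fun i => ratr (q.2 i)) x -> h x = 0.
have HP q : \forall x \ae mu, P q x.
  have [qO|nqO] := pselect (cbox (fun i => ratr (q.1 i)) (fun i => ratr (q.2 i)) `<=` dom O); last first.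
    by apply: aeW => x; rewrite /P.
  set B := obox (fun i => ratr (q.1 i)) (fun i => ratr (q.2 i)).
  have mB : measurable B by exact: measurable_obox.
  have := @integral_ae_eq _ _ _ mu B mB (cst 0%E) (EFin \o h).
  have iB : mu.-integrable B (EFin \o h) by apply: integrableS ih.
  move=> /(_ iB (measurable_cst _)) H.
  have : ae_eq mu B (EFin \o h) (cst 0%E).
    apply: H => E EB mE; rewrite integral0.
    by have := obox_integral0 ih h0 qO mE; rewrite setIidl.
  by apply: filterS => x hx _ Bx; have [] := hx Bx.
(* Enumerating the rational boxes by [unpickle] reduces to a countable intersection of sets of full
   measure. *)
have Hall : \forall x \ae mu, forall n, (if unpickle n is Some q then P q x else True).
  by apply: ae_foralln => n; case: unpickle => [q|]; [exact: HP|exact: aeW].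
have HO : \forall x \ae mu, dom O x.
  exists (~` dom O); split=> //; first by apply: measurableC; apply: open_measurable3; exact: dom_open.
  by rewrite -[mu _]/(lebesgue3 R (~` dom O `&` dom O)) setICl measure0.
apply: filterS2 Hall HO => x Hx Ox _.
have [a [b [ab1 ab2]]] := rat_box_cover Ox.
by have := Hx (pickle (a, b)); rewrite pickleK; apply.
Qed.

End FundamentalLemma.

(** * Bilinear forms and L^2 *)

Section Forms.
Variables (R : realType) (V : lmodType R).

(** Only semidefinite, because fields are not identified almost everywhere here, and bilinear only
    on [P], because integrals of products are meaningful only between suitable fields. The L^2,
    gradient and H^1 products are all instances. *)
Record is_form (P : set V) (b : V -> V -> R) : Prop := IsForm {
  form_lin : forall (a : R) u v, P u -> P v -> P (a *: u + v) ;
  form0 : P 0 ;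
  form_sym : forall u v, P u -> P v -> b u v = b v u ;
  form_linl : forall (a : R) u v w, P u -> P v -> P w -> b (a *: u + v) w = a * b u w + b v w ;
  form_ge0 : forall u, P u -> 0 <= b u u }.

Variables (P : set V) (b : V -> V -> R).
Hypothesis bP : is_form P b.

Definition fnorm u := Num.sqrt (b u u).

Lemma fnorm_ge0 u : 0 <= fnorm u. Proof. exact: sqrtr_ge0. Qed.

Lemma fnorm_sqr u : P u -> fnorm u ^+ 2 = b u u.
Proof. by move=> Pu; rewrite sqr_sqrtr// (form_ge0 bP). Qed.

Lemma formZ_in (a : R) u : P u -> P (a *: u).
Proof. by move=> Pu; rewrite -[_ *: _]addr0; apply: (form_lin bP) => //; exact: (form0 bP). Qed.

Lemma formD_in u v : P u -> P v -> P (u + v).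
Proof. by move=> Pu Pv; rewrite -[u]scale1r; exact: (form_lin bP). Qed.

Lemma formB_in u v : P u -> P v -> P (u - v).
Proof. by move=> Pu Pv; rewrite addrC -scaleN1r; exact: (form_lin bP). Qed.

Lemma form_sum_in (I : Type) (s : seq I) (Q : pred I) (F : I -> V) :
  (forall i, Q i -> P (F i)) -> P (\sum_(i <- s | Q i) F i).
Proof. by move=> PF; elim/big_ind: _ => //; [exact: (form0 bP)|exact: formD_in]. Qed.

Lemma form0l w : P w -> b 0 w = 0.
Proof.
move=> Pw; have P0 := form0 bP; have := form_linl bP 1 P0 P0 Pw.
by rewrite scaler0 addr0 mul1r => /(congr1 (fun x => x - b 0 w)); rewrite subrr addrK.
Qed.

Lemma formZl (a : R) u w : P u -> P w -> b (a *: u) w = a * b u w.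
Proof.
move=> Pu Pw; have P0 := form0 bP.
by rewrite -[a *: u]addr0 (form_linl bP)// form0l// addr0.
Qed.

Lemma formDl u v w : P u -> P v -> P w -> b (u + v) w = b u w + b v w.
Proof. by move=> Pu Pv Pw; rewrite -[u in LHS]scale1r (form_linl bP)// mul1r. Qed.

Lemma formBl u v w : P u -> P v -> P w -> b (u - v) w = b u w - b v w.
Proof.
move=> Pu Pv Pw; rewrite addrC -scaleN1r (form_linl bP)// addrC mulN1r.
by [].
Qed.

Lemma formZr (a : R) u w : P u -> P w -> b u (a *: w) = a * b u w.
Proof.
by move=> Pu Pw; rewrite (form_sym bP) ?formZl// ?(form_sym bP Pw)//; exact: formZ_in.
Qed.

Lemma formDr u v w : P u -> P v -> P w -> b w (u + v) = b w u + b w v.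
Proof.
move=> Pu Pv Pw; rewrite (form_sym bP)//; last exact: formD_in.
by rewrite formDl// !(form_sym bP Pw).
Qed.

Lemma formBr u v w : P u -> P v -> P w -> b w (u - v) = b w u - b w v.
Proof.
move=> Pu Pv Pw; rewrite (form_sym bP)//; last exact: formB_in.
by rewrite formBl// !(form_sym bP Pw).
Qed.

Lemma form_suml (I : Type) (s : seq I) (Q : pred I) (F : I -> V) w : (forall i, P (F i)) -> P w ->
  b (\sum_(i <- s | Q i) F i) w = \sum_(i <- s | Q i) b (F i) w.
Proof.
move=> PF Pw; elim: s => [|i s ih]; first by rewrite !big_nil form0l.
rewrite !big_cons; case: ifP => // _; rewrite formDl ?ih//; exact: form_sum_in.
Qed.

Lemma form_sqD u v : P u -> P v -> b (u + v) (u + v) = b u u + 2 * b u v + b v v.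
Proof.
move=> Pu Pv; rewrite formDl ?formDr//; last exact: formD_in.
by rewrite (form_sym bP Pv Pu); ring.
Qed.

Lemma form_sqB u v : P u -> P v -> b (u - v) (u - v) = b u u - 2 * b u v + b v v.
Proof.
move=> Pu Pv; rewrite formBl ?formBr//; last exact: formB_in.
by rewrite (form_sym bP Pv Pu); ring.
Qed.

Lemma form_CS u v : P u -> P v -> `|b u v| <= fnorm u * fnorm v.
Proof.
move=> Pu Pv.
have q (s t : R) : 0 <= s ^+ 2 * b u u + 2 * s * t * b u v + t ^+ 2 * b v v.
  have := form_ge0 bP (formD_in (formZ_in s Pu) (formZ_in t Pv)).
  rewrite form_sqD ?formZl ?formZr//; try exact: formZ_in.
  by move=> h; apply: le_trans h _; rewrite le_eqVlt; apply/orP; left; apply/eqP; ring.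
have uu := fnorm_sqr Pu; have vv := fnorm_sqr Pv.
have u0 := fnorm_ge0 u; have v0 := fnorm_ge0 v.
suff h : b u v ^+ 2 <= (fnorm u * fnorm v) ^+ 2.
  by rewrite -[leLHS]sqrtr_sqr -[leRHS]ger0_norm ?mulr_ge0// -sqrtr_sqr ler_wsqrtr.
rewrite exprMn uu vv.
have := form_ge0 bP Pv; rewrite le_eqVlt => /predU1P[v00|v00].
  have [->|bn0] := eqVneq (b u v) 0; first by rewrite expr0n/= -v00 mulr0.
  (* When v has zero norm, these parameters make the quadratic form equal to -1. *)
  have := q 1 (- (b u u + 1) / (2 * b u v)); rewrite -v00.
  rewrite (_ : _ + _ + _ = -1); first by rewrite ler0N1.
  by field.
have := q (b v v) (- b u v); rewrite (_ : _ + _ + _ = b v v * (b u u * b v v - b u v ^+ 2)); last by ring.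
by rewrite pmulr_rge0// subr_ge0.
Qed.

Lemma fnormD u v : P u -> P v -> fnorm (u + v) <= fnorm u + fnorm v.
Proof.
move=> Pu Pv; have Puv := formD_in Pu Pv.
rewrite -[leLHS]ger0_norm ?fnorm_ge0// -[leRHS]ger0_norm ?addr_ge0 ?fnorm_ge0//.
rewrite -ler_sqr ?nnegrE// !real_normK ?num_real// fnorm_sqr// form_sqD// sqrrD !fnorm_sqr//.
have := form_CS Pu Pv; have := ler_norm (b u v); lra.
Qed.

Lemma fnormZ (a : R) u : P u -> fnorm (a *: u) = `|a| * fnorm u.
Proof.
move=> Pu; rewrite /fnorm formZl ?formZr//; last exact: formZ_in.
by rewrite mulrA -expr2 sqrtrM ?sqr_ge0// sqrtr_sqr.
Qed.

Lemma fnormN u : P u -> fnorm (- u) = fnorm u.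
Proof. by move=> Pu; rewrite -scaleN1r fnormZ// normrN1 mul1r. Qed.

Lemma fnormBC u v : P u -> P v -> fnorm (u - v) = fnorm (v - u).
Proof. by move=> Pu Pv; rewrite -fnormN ?opprB//; exact: formB_in. Qed.

Lemma fnorm_tri u v w : P u -> P v -> P w -> fnorm (u - w) <= fnorm (u - v) + fnorm (v - w).
Proof. by move=> Pu Pv Pw; rewrite -[u - w](subrKA v); apply: fnormD; exact: formB_in. Qed.

Lemma fnormB_le u v : P u -> P v -> fnorm u <= fnorm v + fnorm (u - v).
Proof. by move=> Pu Pv; rewrite -{1}[u](subrKC v); apply: fnormD => //; exact: formB_in. Qed.

(** Closure of [D] inside [P] for the seminorm; [inH], [inH10] and [inV] are instances of it by
    definition. *)
Definition fcl (D : set V) : set V :=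
  [set u | P u /\ forall eps : R, 0 < eps -> exists2 v, D v & fnorm (u - v) < eps].

Lemma fcl_lin (D : set V) : D `<=` P ->
  (forall (a : R) u v, D u -> D v -> D (a *: u + v)) ->
  forall (a : R) u v, fcl D u -> fcl D v -> fcl D (a *: u + v).
Proof.
move=> DP Dl a u v [Pu Hu] [Pv Hv]; split; first exact: (form_lin bP).
move=> e e0.
have e1 : 0 < e / 2 / (`|a| + 1) by rewrite !divr_gt0// ltr_wpDl.
have e2 : 0 < e / 2 by rewrite divr_gt0.
have [u' Du' hu] := Hu _ e1; have [v' Dv' hv] := Hv _ e2.
exists (a *: u' + v'); first exact: Dl.
have Pu' := DP _ Du'; have Pv' := DP _ Dv'.
rewrite opprD addrACA -scalerBr (le_lt_trans (fnormD _ _))//.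
- by apply: formZ_in; exact: formB_in.
- exact: formB_in.
rewrite fnormZ; last exact: formB_in.
rewrite [ltRHS]splitr ler_ltD//.
rewrite (@le_trans _ _ ((`|a| + 1) * fnorm (u - u')))//.
  by rewrite ler_wpM2r ?fnorm_ge0// lerDl.
by rewrite mulrC -ler_pdivlMr ?ltr_wpDl// ltW.
Qed.

Lemma fcl_closed (D : set V) u : P u -> D `<=` P ->
  (forall eps : R, 0 < eps -> exists2 v, fcl D v & fnorm (u - v) < eps) -> fcl D u.
Proof.
move=> Pu DP H; split=> // e e0; have e2 : 0 < e / 2 by rewrite divr_gt0.
have [v [Pv Hv] uv] := H _ e2; have [w Dw vw] := Hv _ e2.
exists w => //; rewrite (le_lt_trans (@fnorm_tri _ v _ _ _ _))//; first exact: DP.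
by rewrite [ltRHS]splitr ltrD.
Qed.

Lemma sub_fcl (D : set V) : D `<=` P -> D `<=` fcl D.
Proof.
move=> DP u Du; split; first exact: DP.
by move=> e e0; exists u => //; rewrite subrr /fnorm form0l ?sqrtr0//; exact: (form0 bP).
Qed.

End Forms.

(** * Square integrable functions: Fatou, almost everywhere subsequences, completeness *)

Section L2.
Context d (T : measurableType d) (R : realType) (mu : {measure set T -> \bar R}).
Hypothesis mu_fin : (mu setT < +oo)%E.
Implicit Types f g : T -> R.
Local Notation L2 f := (f \in Lfun mu 2%:E).

Definition ip f g : R := \int[mu]_x (f x * g x).

Lemma L2_measurable f : L2 f -> measurable_fun setT f.
Proof. by rewrite inE => /andP[]; rewrite inE. Qed.

Lemma L2P f : L2 f <-> measurable_fun setT f /\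
  mu.-integrable setT (EFin \o (fun x => f x ^+ 2)).
Proof.
split=> [Lf|[mf fi]]; first by split; [exact: L2_measurable|exact: Lfun2_integrable_sqr].
rewrite inE; apply/andP; split; rewrite inE//= /finite_norm unlock.
apply: poweR_lty; have /integrableP[_] := fi; apply: le_lt_trans.
rewrite le_eqVlt; apply/orP; left; apply/eqP; apply: eq_integral => x _ /=.
by rewrite powR_mulrn// normrX.
Qed.

Lemma L2_mul f g : L2 f -> L2 g -> mu.-integrable setT (EFin \o (fun x => f x * g x)).
Proof. by move=> Lf Lg; apply/Lfun1_integrable; exact: Lfun2_mul_Lfun1. Qed.

Lemma L2_lin (a : R) f g : L2 f -> L2 g -> L2 (a *: f + g).
Proof.
have p1 : (1 <= 2%:E :> \bar R)%E by rewrite lee_fin ler1n.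
by have [_ h] := Lfun_submod_closed mu p1 => Lf Lg; exact: h.
Qed.

Lemma L2_0 : L2 (0 : T -> R).
Proof.
have p1 : (1 <= 2%:E :> \bar R)%E by rewrite lee_fin ler1n.
by have [h _] := Lfun_submod_closed mu p1.
Qed.

Lemma L2_Z (a : R) f : L2 f -> L2 (a *: f).
Proof. by move=> Lf; rewrite -[_ *: _]addr0; apply: L2_lin => //; exact: L2_0. Qed.

Lemma L2_B f g : L2 f -> L2 g -> L2 (f - g).
Proof. by move=> Lf Lg; rewrite addrC -scaleN1r; exact: L2_lin. Qed.

Lemma ip_form : @is_form R (T -> R) [set f | L2 f] ip.
Proof.
split.
- by move=> a f g Lf Lg; exact: L2_lin.
- exact: L2_0.
- by move=> f g _ _; apply: eq_Rintegral => x _; rewrite mulrC.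
- move=> a f g h Lf Lg Lh; rewrite /ip.
  rewrite -RintegralZl//; last exact: L2_mul.
  rewrite -RintegralD//; last exact: L2_mul.
    by apply: eq_Rintegral => x _; rewrite !fctE mulrDl -mulrA.
  have := L2_mul (L2_Z a Lf) Lh.
  by apply: eq_integrable => // x _ /=; rewrite mulrA.
- by move=> f Lf; apply: Rintegral_ge0 => x _; rewrite -expr2 sqr_ge0.
Qed.

Lemma bounded_L2 f (M : R) : measurable_fun setT f -> (forall x, `|f x| <= M) -> L2 f.
Proof.
move=> mf fM; apply/L2P; split=> //; apply: measurable_bounded_integrable => //.
  exact: measurable_funX.
exists (M ^+ 2); split; first exact: num_real.
move=> N MN x _ /=; rewrite normrX; apply: le_trans (ltW MN).
by rewrite ler_sqr ?nnegrE ?(le_trans _ (fM x)).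
Qed.

Lemma L2_integrable f : L2 f -> mu.-integrable setT (EFin \o f).
Proof.
move=> Lf; have L1 : L2 (cst 1) by apply: (@bounded_L2 _ 1) => // x; rewrite normr1.
by have := L2_mul Lf L1; apply: eq_integrable => // x _ /=; rewrite mulr1.
Qed.

Lemma L2_mul_bounded f g (M : R) : L2 f -> measurable_fun setT g -> (forall x, `|g x| <= M) ->
  L2 (fun x => f x * g x).
Proof.
move=> Lf mg gM; have mf := L2_measurable Lf; apply/L2P; split; first exact: measurable_funM.
have /L2P[_ f2] := Lf.
have := integrableZl measurableT (M ^+ 2) f2; apply: le_integrable => //.
  by apply/measurable_EFinP; apply: measurable_funX; exact: measurable_funM.
move=> x _ /=; rewrite lee_fin exprMn normrM mulrC [leRHS]normrM ler_wpM2r//.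
rewrite !normrX ler_sqr ?nnegrE//; apply: le_trans (gM x) _; exact: ler_norm.
Qed.

Lemma ae_L2 f g : L2 f -> measurable_fun setT g -> f = g %[ae mu] -> L2 g.
Proof.
move=> /L2P[mf fi] mg fg; apply/L2P; split=> //; apply/integrableP; split.
  by apply/measurable_EFinP; exact: measurable_funX.
have /integrableP[_] := fi; apply: le_lt_trans.
rewrite le_eqVlt; apply/orP; left; apply/eqP; apply: ae_eq_integral => //.
- by apply: measurableT_comp => //; apply/measurable_EFinP; exact: measurable_funX.
- by apply: measurableT_comp => //; apply/measurable_EFinP; exact: measurable_funX.
- by apply: filterS fg => x h _ /=; rewrite h.
Qed.

Lemma ae_eq_ip f f' g g' : L2 f -> L2 f' -> L2 g -> L2 g' ->
  f = f' %[ae mu] -> g = g' %[ae mu] -> ip f g = ip f' g'.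
Proof.
move=> Lf Lf' Lg Lg' ff gg; rewrite /ip /Rintegral; congr fine.
apply: ae_eq_integral => //; [exact: (measurable_int mu (L2_mul Lf Lg))|
  exact: (measurable_int mu (L2_mul Lf' Lg'))|].
by apply: filterS2 ff gg => x h1 h2 _; rewrite h1// h2.
Qed.

Lemma sum_half_le n : \sum_(i < n) (2^-1 : R) ^+ i <= 2.
Proof.
suff -> : \sum_(i < n) (2^-1 : R) ^+ i = 2 - 2 * 2^-1 ^+ n.
  by rewrite gerBl mulr_ge0// exprn_ge0.
elim: n => [|n ih]; first by rewrite big_ord0 expr0 mulr1 subrr.
by rewrite big_ord_recr/= ih exprS; lra.
Qed.

(** The weights 4^n leave integrals of at most 2^-n, so the sum of the 4^n g_n^2 is finite almost
    everywhere; its square root is the constant C. *)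
Lemma fast_ae (g : nat -> T -> R) : (forall n, L2 (g n)) ->
  (forall n, ip (g n) (g n) <= (8^-1) ^+ n) ->
  \forall x \ae mu, exists C : R, forall n, `|g n x| <= C * (2^-1) ^+ n.
Proof.
move=> Lg gn.
pose h n x := ((4 : R) ^+ n * g n x ^+ 2)%:E.
have mh n : measurable_fun setT (h n).
  apply/measurable_EFinP; apply: measurable_funM => //; apply: measurable_funX.
  exact: L2_measurable.
have h0 n x : (0 <= h n x)%E by rewrite lee_fin mulr_ge0 ?sqr_ge0// exprn_ge0.
have Ih n : (\int[mu]_x h n x <= ((2^-1) ^+ n)%:E)%E.
  rewrite /h; under eq_integral do rewrite EFinM.
  have /L2P[_ i2] := Lg n.
  rewrite integralZl// -[X in (_ * X)%E]fineK ?(integrable_fin_num measurableT i2)//.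
  rewrite -EFinM lee_fin (_ : 2^-1 = 4 * 8^-1 :> R); last by field.
  rewrite exprMn ler_wpM2l ?exprn_ge0//; apply: le_trans (gn n).
  by rewrite /ip /Rintegral le_eqVlt; apply/orP; left; apply/eqP; congr fine; apply: eq_integral => x _; rewrite expr2.
have S_fin : (\int[mu]_x (\sum_(n <oo) h n x) < +oo)%E.
  rewrite integral_nneseries//; apply: (@le_lt_trans _ _ 2%:E); last exact: ltry.
  apply: lime_le; first by apply: is_cvg_nneseries => n _ _; exact: integral_ge0.
  apply: nearW => n; rewrite big_mkord.
  apply: (@le_trans _ _ (\sum_(i < n) ((2^-1 : R) ^+ i)%:E)%E); first by apply: lee_sum => i _; exact: Ih.
  by rewrite sumEFin lee_fin sum_half_le.
have Si : mu.-integrable setT (fun x => \sum_(n <oo) h n x)%E.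
  apply/integrableP; split; first exact: ge0_emeasurable_sum.
  by under eq_integral do rewrite gee0_abs ?nneseries_ge0//.
apply: filterS (integrable_ae measurableT Si) => x /(_ I) fx.
exists (Num.sqrt (fine (\sum_(n <oo) h n x)%E)) => n.
have : (h n x <= \sum_(n <oo) h n x)%E.
  apply: le_trans (nneseries_lim_ge n.+1 _); last by move=> *; exact: h0.
  by rewrite big_mkord big_ord_recr/= leeDr// sume_ge0.
rewrite -[X in (_ <= X)%E]fineK// lee_fin => hn.
have -> : `|g n x| = Num.sqrt ((4 : R) ^+ n * g n x ^+ 2) * 2^-1 ^+ n.
  rewrite sqrtrM ?exprn_ge0// sqrtr_sqr (_ : 4 = 2 ^+ 2 :> R); last by ring.
  have -> : Num.sqrt (((2 : R) ^+ 2) ^+ n) = 2 ^+ n.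
    by rewrite -exprM mulnC exprM sqrtr_sqr ger0_norm ?exprn_ge0.
  by rewrite mulrAC -exprMn mulfV// expr1n mul1r.
by rewrite ler_wpM2r ?exprn_ge0// ler_wsqrtr.
Qed.

Lemma geometric_cvgn (s : nat -> R) (C : R) :
  (forall n, `|s n.+1 - s n| <= C * (2^-1) ^+ n) -> cvgn s.
Proof.
move=> sC; have C0 : 0 <= C by have := sC 0; rewrite expr0 mulr1; exact: le_trans.
have h2 : `|2^-1 : R| < 1 by rewrite ger0_norm// invf_lt1// ltr1n.
have ct : cvgn (series (telescope s)).
  apply: normed_cvg.
  apply: (@series_le_cvg _ _ (geometric C 2^-1)).
  - by move=> n /=.
  - by move=> n /=; rewrite mulr_ge0// exprn_ge0.
  - by move=> n; exact: sC.
  - exact: is_cvg_geometric_series.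
have -> : s = (fun n => series (telescope s) n + s 0%N).
  by apply/funext => n; rewrite telescopeK subrK.
by apply: is_cvgD => //; exact: is_cvg_cst.
Qed.

(** Lets L^2 bounds pass to almost everywhere limits without a dominating function. *)
Lemma L2_fatou (f : nat -> T -> R) g (C : R) : (forall n, L2 (f n)) -> measurable_fun setT g ->
  (\forall x \ae mu, f n x @[n --> \oo] --> g x) ->
  (\forall n \near \oo, ip (f n) (f n) <= C) -> L2 g /\ ip g g <= C.
Proof.
move=> Lf mg fg fC.
have m2 n : measurable_fun setT (fun x => (f n x ^+ 2)%:E).
  by apply/measurable_EFinP; apply: measurable_funX; exact: L2_measurable.
have F := @fatou _ _ _ mu setT measurableT (fun n x => (f n x ^+ 2)%:E) m2.
have {}F : (\int[mu]_x (g x ^+ 2)%:E <= C%:E)%E.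
  have -> : (\int[mu]_x (g x ^+ 2)%:E = \int[mu]_x limn_einf (fun n => (f n x ^+ 2)%:E))%E.
    apply: ae_eq_integral => //.
    - by apply/measurable_EFinP; exact: measurable_funX.
    - have -> : (fun x => limn_einf (fun n => (f n x ^+ 2)%:E)) =
          (fun x => - limn_esup (fun n => - (f n x ^+ 2)%:E))%E.
        apply/funext => x; have -> : (limn_esup (fun n => - (f n x ^+ 2)%:E) =
            - limn_einf (fun n => (f n x ^+ 2)%:E))%E by exact: limn_esupN.
        by rewrite oppeK.
      apply: measurableT_comp => //; apply: measurable_fun_limn_esup => n.
      by apply: measurableT_comp => //; exact: m2.
    apply: filterS fg => x fgx _.
    rewrite limn_einf_lim; apply/esym/cvg_lim => //.
    apply: (@cvg_einfs _ (fun n => (f n x ^+ 2)%:E)).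
    apply: cvg_EFin; first exact: nearW.
    by rewrite expr2; under eq_fun do rewrite /= expr2; exact: cvgM.
  apply: le_trans; first by apply: F => n x _; rewrite lee_fin sqr_ge0.
  rewrite limn_einf_lim; apply: lime_le; first exact: is_cvg_einfs.
  near=> m; apply: ereal_inf_le; exists (\int[mu]_x (f m x ^+ 2)%:E)%E; first by exists m => /=.
  have /L2P[_ i2] := Lf m; rewrite -[X in (X <= _)%E]fineK ?(integrable_fin_num measurableT i2)//.
  rewrite lee_fin; have : ip (f m) (f m) <= C by near: m.
  by rewrite /ip /Rintegral; under [in X in X -> _]eq_integral do rewrite -expr2.
have Lg : L2 g.
  apply/L2P; split=> //; apply/integrableP; split.
    by apply/measurable_EFinP; exact: measurable_funX.
  apply: le_lt_trans (ltry C); apply: le_trans F.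
  by rewrite le_eqVlt; apply/orP; left; apply/eqP; apply: eq_integral => x _ /=; rewrite ger0_norm ?sqr_ge0.
split=> //; rewrite /ip /Rintegral -lee_fin fineK; last exact: (integrable_fin_num measurableT (L2_mul Lg Lg)).
by under eq_integral do rewrite -expr2.
Unshelve. all: by end_near. Qed.

Lemma extract_seq (P : nat -> nat -> Prop) : (forall k, \forall n \near \oo, P k n) ->
  exists phi : nat -> nat, (forall k, (phi k < phi k.+1)%N) /\ forall k n, (phi k <= n)%N -> P k n.
Proof.
move=> H; have H' k : exists N, forall n, (N <= n)%N -> P k n.
  by have [N _ HN] := H k; exists N => n Nn; exact: HN.
pose N k := projT1 (cid (H' k)).
have HN k n : (N k <= n)%N -> P k n by move: n; exact: (projT2 (cid (H' k))).
(* The partial sums of N_i + 1 are strictly increasing and exceed every single threshold. *)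
exists (fun k => (\sum_(i < k.+1) (N i).+1)%N); split.
  by move=> k; rewrite [X in (_ < X)%N]big_ord_recr/= -addn1 leq_add.
by move=> k n kn; apply: HN; apply: leq_trans kn; by rewrite big_ord_recr/= (leq_trans (leqnSn _))// leq_addl.
Qed.

Lemma ip_sub_ge0 f g : 0 <= ip (f - g) (f - g).
Proof. by apply: Rintegral_ge0 => x _; rewrite -expr2 sqr_ge0. Qed.

Lemma incr_ge (phi : nat -> nat) : (forall k, (phi k < phi k.+1)%N) -> forall k, (k <= phi k)%N.
Proof. by move=> h; elim=> // k ih; exact: leq_ltn_trans ih (h k). Qed.

Lemma L2_ae_subseq (f : nat -> T -> R) g : (forall n, L2 (f n)) -> L2 g ->
  ip (f n - g) (f n - g) @[n --> \oo] --> (0 : R) ->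
  exists phi : nat -> nat, (forall k, (k <= phi k)%N) /\
    \forall x \ae mu, f (phi n) x @[n --> \oo] --> g x.
Proof.
move=> Lf Lg fg.
have [phi [phi_lt Hphi]] : exists phi : nat -> nat, (forall k, (phi k < phi k.+1)%N) /\
   forall k n, (phi k <= n)%N -> ip (f n - g) (f n - g) <= (8^-1) ^+ k.
  apply: extract_seq => k; have e0 : 0 < (8^-1 : R) ^+ k by rewrite exprn_gt0// invr_gt0.
  move/cvgrPdist_le : fg => /(_ _ e0); apply: filterS => n.
  by rewrite sub0r normrN ger0_norm// ip_sub_ge0.
exists phi; split; first exact: incr_ge.
have := @fast_ae (fun k => f (phi k) - g) (fun k => L2_B (Lf _) Lg) (fun k => Hphi k (phi k) (leqnn _)).
apply: filterS => x [C HC].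
apply/subr_cvg0/norm_cvg0P.
have h2 : `|2^-1 : R| < 1 by rewrite ger0_norm// invf_lt1// ltr1n.
have C2 : (C * (2^-1) ^+ n) @[n --> \oo] --> (0 : R).
  by rewrite -(mulr0 C); apply: cvgM; [exact: cvg_cst|exact: cvg_expr].
apply: (squeeze_cvgr _ (cvg_cst 0) C2).
by apply: nearW => n; rewrite normr_ge0/=; exact: HC.
Qed.

(** Riesz-Fischer: a subsequence with squared gaps 8^-k converges almost everywhere by [fast_ae],
    and [L2_fatou] turns the Cauchy bound into norm convergence of the whole sequence. *)
Lemma L2_complete (f : nat -> T -> R) : (forall n, L2 (f n)) ->
  (forall e : R, 0 < e -> \forall n \near \oo, forall m, (n <= m)%N -> ip (f m - f n) (f m - f n) <= e) ->
  exists2 g, L2 g & ip (f n - g) (f n - g) @[n --> \oo] --> (0 : R).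
Proof.
move=> Lf fC.
have [phi [phi_lt Hphi]] : exists phi : nat -> nat, (forall k, (phi k < phi k.+1)%N) /\
   forall k n, (phi k <= n)%N -> forall m, (n <= m)%N -> ip (f m - f n) (f m - f n) <= (8^-1) ^+ k.
  by apply: extract_seq => k; apply: fC; rewrite exprn_gt0// invr_gt0.
have mono : {homo phi : i j / (i <= j)%N}.
  by apply: homo_leq => // [|k]; [exact: leq_trans|exact: ltnW].
pose h k := f (phi k.+1) - f (phi k).
have hae : \forall x \ae mu, cvgn (fun k => f (phi k) x).
  have := @fast_ae h (fun k => L2_B (Lf _) (Lf _)) (fun k => Hphi k _ (leqnn _) _ (ltnW (phi_lt k))).
  by apply: filterS => x [C HC]; exact: geometric_cvgn HC.
have [N [mN N0 HN]] := hae.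
(* Setting the limit to 0 on a measurable null set keeps it measurable. *)
pose g x := if x \in N then 0 else limn (fun k => f (phi k) x).
have cvg_g x : x \notin N -> f (phi k) x @[k --> \oo] --> g x.
  move=> xN; rewrite /g (negbTE xN).
  suff : cvgn (fun k => f (phi k) x) by [].
  by apply: contrapT => h'; move: xN => /negP; apply; rewrite inE; exact: HN.
have mg : measurable_fun setT g.
  apply: (@measurable_fun_cvg _ _ _ _ (fun k x => \1_(~` N) x * f (phi k) x)).
    move=> k; apply: measurable_funM; last exact: L2_measurable.
    by apply: measurable_indic; exact: measurableC.
  move=> x _; have [xN|xN] := boolP (x \in N).
    rewrite /g xN indicE in_setC xN; under eq_fun do rewrite mul0r; exact: cvg_cst.
  by rewrite indicE in_setC xN; under eq_fun do rewrite mul1r; exact: cvg_g.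
have aeg : \forall x \ae mu, f (phi k) x @[k --> \oo] --> g x.
  exists N; split=> // x /=; apply: contra_notP => xN; apply: cvg_g.
  by apply/negP; rewrite inE.
have key k n : (phi k <= n)%N -> L2 (g - f n) /\ ip (g - f n) (g - f n) <= (8^-1) ^+ k.
  move=> kn; apply: (@L2_fatou (fun m => f (phi m) - f n)).
  - by move=> m; exact: L2_B.
  - by apply: measurable_funB => //; exact: L2_measurable.
  - by apply: filterS aeg => x hx; apply: cvgB => //; exact: cvg_cst.
  - near=> m; apply: Hphi => //; apply: (leq_trans _ (incr_ge phi_lt m)).
    by near: m; exact: nbhs_infty_ge.
have Lg : L2 g.
  have [h1 _] := key 0 _ (leqnn _).
  by rewrite -[g](subrK (f (phi 0%N))) -[g - _]scale1r; exact: L2_lin.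
exists g => //; apply/cvgrPdist_le => /= e e0.
have h2 : `|8^-1 : R| < 1 by rewrite ger0_norm// invf_lt1// ltr1n.
have /cvgrPdist_le/(_ _ e0) [k _ /(_ k (leqnn _))] := cvg_expr h2.
rewrite sub0r normrN ger0_norm ?exprn_ge0// => ke.
near=> n; rewrite sub0r normrN ger0_norm ?ip_sub_ge0//.
apply: le_trans ke; have [|_] := key k n; first by near: n; exact: nbhs_infty_ge.
apply: le_trans; rewrite le_eqVlt; apply/orP; left; apply/eqP.
by apply: eq_Rintegral => x _; rewrite !fctE; ring.
Unshelve. all: by end_near. Qed.

End L2.

(** * Weak derivatives and the spaces V and H^1_0 *)

Lemma form_sub (R : realType) (W : lmodType R) (P Q : set W) b : is_form P b -> Q `<=` P ->
  (forall (a : R) (u v : W), Q u -> Q v -> Q (a *: u + v)) -> Q 0 -> is_form Q b.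
Proof.
move=> [l z s ll p] QP Ql Q0; split=> //.
- by move=> u v /QP ? /QP; exact: s.
- by move=> a u v w /QP ? /QP ? /QP; exact: ll.
- by move=> u /QP; exact: p.
Qed.

Section WeakDerivatives.
Variables (R : realType) (O : bounded_domain R).
Local Notation mu := (leb_dom O).
Local Notation L2 f := (f \in Lfun mu 2%:E).
Implicit Types (g h phi : R3 R -> R) (u v w : vfield R).

Lemma mu_fin : (mu setT < +oo)%E. Proof. exact: leb_dom_fin. Qed.

Lemma test_L2 phi : test_fun O phi -> L2 phi.
Proof.
move=> tp; have [M _ HM] := test_bound tp.
by apply: (@bounded_L2 _ _ _ mu mu_fin _ M) => //; exact: test_meas tp.
Qed.

Lemma ipE g h : ip mu g h = \int[mu]_x (g x * h x). Proof. by []. Qed.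

Lemma L2_test_eq0 h : L2 h -> (forall phi, test_fun O phi -> ip mu h phi = 0) -> h = cst 0 %[ae mu].
Proof.
move=> Lh h0; apply: fundamental_lemma => //; exact: (L2_integrable mu_fin).
Qed.

Lemma ae_sub_eq0 g h : g - h = cst 0 %[ae mu] -> g = h %[ae mu].
Proof. by apply: filterS => x h0 _; apply/eqP; rewrite -subr_eq0; apply/eqP; exact: h0. Qed.

Lemma weak_partial_uniq j g h h' : is_weak_partial O j g h -> is_weak_partial O j g h' ->
  h = h' %[ae mu].
Proof.
move=> [Lh Hh] [Lh' Hh']; apply: ae_sub_eq0; apply: L2_test_eq0; first exact: L2_B.
move=> phi tp; rewrite (formBl (ip_form mu)) ?inE//; last exact: test_L2.
apply/eqP; rewrite subr_eq0 -eqr_opp; apply/eqP.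
by rewrite !ipE -Hh// Hh'.
Qed.

Lemma is_weak_partial_lin j (a : R) g g' h h' : L2 g -> L2 g' ->
  is_weak_partial O j g h -> is_weak_partial O j g' h' ->
  is_weak_partial O j (a *: g + g') (a *: h + h').
Proof.
move=> Lg Lg' [Lh Hh] [Lh' Hh']; split; first exact: L2_lin.
move=> phi tp; have Lp := test_L2 tp; have Ldp := test_L2 (test_fun_partial j tp).
rewrite -[LHS]/(ip mu (a *: g + g') (partial j phi)) -[in RHS]/(ip mu (a *: h + h') phi).
rewrite !(form_linl (ip_form mu))//.
have -> : ip mu g (partial j phi) = - ip mu h phi by exact: Hh.
have -> : ip mu g' (partial j phi) = - ip mu h' phi by exact: Hh'.
by rewrite mulrN opprD.
Qed.

Lemma is_weak_partial_test j phi : test_fun O phi -> is_weak_partial O j phi (partial j phi).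
Proof.
move=> tp; split; first exact/test_L2/test_fun_partial.
by move=> psi tpsi; apply: test_ibp => //; exact: test_smooth tp.
Qed.

Lemma weak_partialP j g : (exists h, is_weak_partial O j g h) ->
  is_weak_partial O j g (weak_partial O j g).
Proof. by move=> gh; exact: (@getPex _ [set h | is_weak_partial O j g h] gh). Qed.

Lemma weak_partial_ae j g h : is_weak_partial O j g h -> weak_partial O j g = h %[ae mu].
Proof. by move=> gh; apply: (@weak_partial_uniq j g) => //; apply: weak_partialP; exists h. Qed.

Lemma inH1_wp u i j : inH1 O u -> is_weak_partial O j (u i) (weak_partial O j (u i)).
Proof. by move=> [_ h]; exact/weak_partialP/h. Qed.

Lemma inH1_L2 u : inH1 O u -> L2field O u. Proof. by case. Qed.

Lemma wp_L2 u i j : inH1 O u -> L2 (weak_partial O j (u i)).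
Proof. by move=> /(@inH1_wp _ i j)[]. Qed.

Lemma inH1_lin (a : R) u v : inH1 O u -> inH1 O v -> inH1 O (a *: u + v).
Proof.
move=> Hu Hv; split; first by apply: L2field_lin; exact: inH1_L2.
move=> i j; exists (a *: weak_partial O j (u i) + weak_partial O j (v i)).
apply: is_weak_partial_lin; [exact: (inH1_L2 Hu)|exact: (inH1_L2 Hv)|exact: inH1_wp|exact: inH1_wp].
Qed.

(** Only almost everywhere: [weak_partial] picks a representative by choice, and the choice is not
    linear. *)
Lemma wp_lin_ae (a : R) u v i j : inH1 O u -> inH1 O v ->
  weak_partial O j ((a *: u + v) i) = a *: weak_partial O j (u i) + weak_partial O j (v i) %[ae mu].
Proof.
move=> Hu Hv; apply: weak_partial_ae.
apply: is_weak_partial_lin; [exact: (inH1_L2 Hu)|exact: (inH1_L2 Hv)|exact: inH1_wp|exact: inH1_wp].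
Qed.

Lemma test_field_inH1 u : test_field O u -> inH1 O u.
Proof.
move=> tu; split=> [i|i j]; first exact/test_L2/tu.
by exists (partial j (u i)); apply: is_weak_partial_test.
Qed.

Lemma wp_test_ae u i j : test_field O u -> weak_partial O j (u i) = partial j (u i) %[ae mu].
Proof. by move=> tu; apply: weak_partial_ae; exact: is_weak_partial_test. Qed.

Lemma test_field_lin (a : R) u v : test_field O u -> test_field O v -> test_field O (a *: u + v).
Proof.
move=> tu tv i; rewrite -[(a *: u + v) i]/(a *: u i + v i).
by apply: test_funD => //; exact: test_funZ.
Qed.

Lemma solenoidal_lin (a : R) u v : solenoidal_test O u -> solenoidal_test O v ->
  solenoidal_test O (a *: u + v).
Proof.
move=> [tu du] [tv dv]; split; first exact: test_field_lin.
move=> x; rewrite (eq_bigr (fun i => a * partial i (u i) x + partial i (v i) x)).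
  by rewrite big_split/= -mulr_sumr du dv mulr0 addr0.
move=> i _; rewrite -[(a *: u + v) i]/(a *: u i + v i) (partial_linear _ _ (tu i) (tv i)).
by [].
Qed.

Lemma dot_gradE u v : dot_grad O u v =
  \sum_i \sum_j ip mu (weak_partial O j (u i)) (weak_partial O j (v i)).
Proof. by []. Qed.

Lemma dotL2E u v : dotL2 O u v = \sum_i ip mu (u i) (v i). Proof. by []. Qed.

Lemma dotL2_form : is_form (L2field O) (dotL2 O).
Proof.
split.
- by move=> a u v; exact: L2field_lin.
- by move=> i; exact: L2_0.
- by move=> u v _ _; exact: dotL2C.
- move=> a u v w Lu Lv Lw; rewrite dotL2Dl ?dotL2Zl//; exact: L2fieldZ.
- by move=> u _; exact: dotL2_ge0.
Qed.

Lemma inH1_0 : inH1 O 0.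
Proof. by apply: test_field_inH1 => i; exact: test_fun0. Qed.

Lemma dot_grad_form : is_form (inH1 O) (dot_grad O).
Proof.
split.
- exact: inH1_lin.
- exact: inH1_0.
- by move=> u v Hu Hv; apply: eq_bigr => i _; apply: eq_bigr => j _; apply: eq_Rintegral => x _; rewrite mulrC.
- move=> a u v w Hu Hv Hw; rewrite !dot_gradE mulr_sumr -big_split; apply: eq_bigr => i _ /=.
  rewrite mulr_sumr -big_split; apply: eq_bigr => j _ /=.
  have Lu := wp_L2 i j Hu; have Lv := wp_L2 i j Hv; have Lw := wp_L2 i j Hw.
  rewrite -(form_linl (ip_form mu) a Lu Lv Lw); apply: ae_eq_ip.
  + by apply: wp_L2; exact: inH1_lin.
  + exact: L2_lin.
  + exact: Lw.
  + exact: Lw.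
  + exact: wp_lin_ae.
  + exact: aeW.
- move=> u Hu; apply: sumr_ge0 => i _; apply: sumr_ge0 => j _.
  by apply: Rintegral_ge0 => x _; rewrite -expr2 sqr_ge0.
Qed.

Lemma inH1I u : L2field O u -> (forall i j, exists h, is_weak_partial O j (u i) h) -> inH1 O u.
Proof. by []. Qed.

Definition dotH1 u v := dotL2 O u v + dot_grad O u v.

Lemma dotH1_form : is_form (inH1 O) dotH1.
Proof.
have [l1 z1 s1 ll1 p1] := dotL2_form; have [l2 z2 s2 ll2 p2] := dot_grad_form.
split.
- exact: l2.
- exact: z2.
- by move=> u v Hu Hv; rewrite /dotH1 (s1 _ _ (inH1_L2 Hu) (inH1_L2 Hv)) (s2 _ _ Hu Hv).
- move=> a u v w Hu Hv Hw.
  rewrite /dotH1 (ll1 _ _ _ _ (inH1_L2 Hu) (inH1_L2 Hv) (inH1_L2 Hw)) (ll2 _ _ _ _ Hu Hv Hw).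
  by rewrite mulrDr addrACA.
- by move=> u Hu; apply: addr_ge0; [exact: p1 (inH1_L2 Hu)|exact: p2].
Qed.

Lemma inH10E : inH10 O = fcl (inH1 O) dotH1 (test_field O). Proof. by []. Qed.
Lemma inVE : inV O = fcl (inH10 O) (dot_grad O) (solenoidal_test O). Proof. by []. Qed.
Lemma normL2E u : normL2 O u = fnorm (dotL2 O) u. Proof. by []. Qed.
Lemma norm_gradE u : norm_grad O u = fnorm (dot_grad O) u. Proof. by []. Qed.
Lemma inHE : inH O = fcl (L2field O) (dotL2 O) (solenoidal_test O). Proof. by []. Qed.

Opaque dotL2 dot_grad test_fun inH1 L2field smooth.

Lemma inH10_H1 u : inH10 O u -> inH1 O u. Proof. by case. Qed.
Lemma inV_H10 u : inV O u -> inH10 O u. Proof. by case. Qed.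
Lemma inV_H1 u : inV O u -> inH1 O u. Proof. by move=> /inV_H10/inH10_H1. Qed.
Lemma inV_L2 u : inV O u -> L2field O u. Proof. by move=> /inV_H1/inH1_L2. Qed.

Lemma test_field_H10 u : test_field O u -> inH10 O u.
Proof. by apply: (sub_fcl dotH1_form) => v; exact: test_field_inH1. Qed.

Lemma inH10_lin (a : R) u v : inH10 O u -> inH10 O v -> inH10 O (a *: u + v).
Proof.
apply: (fcl_lin dotH1_form); first by move=> w; exact: test_field_inH1.
exact: test_field_lin.
Qed.

Lemma inH10_0 : inH10 O 0.
Proof. by apply: test_field_H10 => i; exact: test_fun0. Qed.

Lemma grad_form10 : is_form (inH10 O) (dot_grad O).
Proof.
apply: (form_sub dot_grad_form); [exact: inH10_H1|exact: inH10_lin|exact: inH10_0].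
Qed.

Lemma solenoidal_V u : solenoidal_test O u -> inV O u.
Proof. by apply: (sub_fcl grad_form10) => v [tv _]; exact: test_field_H10. Qed.

Lemma inV_lin (a : R) u v : inV O u -> inV O v -> inV O (a *: u + v).
Proof.
apply: (fcl_lin grad_form10); first by move=> w [tw _]; exact: test_field_H10.
exact: solenoidal_lin.
Qed.

Lemma inV_0 : inV O 0.
Proof. exact/solenoidal_V/solenoidal_test0. Qed.

Lemma grad_formV : is_form (inV O) (dot_grad O).
Proof. by apply: (form_sub grad_form10); [exact: inV_H10|exact: inV_lin|exact: inV_0]. Qed.

Lemma normL2_le_H1 u : inH1 O u -> normL2 O u <= normH1 O u.
Proof. by move=> Hu; apply: ler_wsqrtr; rewrite lerDl (form_ge0 dot_grad_form). Qed.

Lemma norm_grad_le_H1 u : inH1 O u -> norm_grad O u <= normH1 O u.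
Proof. by move=> Hu; apply: ler_wsqrtr; rewrite lerDr dotL2_ge0. Qed.

End WeakDerivatives.

Opaque dotL2 dot_grad test_fun inH1 L2field smooth normL2 norm_grad normH1.

(** * The Poincare inequality *)

Section Poincare.
Variables (R : realType) (O : bounded_domain R).
Local Notation mu := (leb_dom O).
Local Notation L2 f := (f \in Lfun mu 2%:E).
Implicit Types (g h phi : R3 R -> R) (u v w : vfield R).

Lemma smooth_coord i (c : R) : smooth (fun x : R3 R => coord3 i x + c).
Proof.
pose C : set (R3 R -> R) := [set g | exists a b, g = fun x => a * coord3 i x + b].
apply: (@smooth_class R C); last by exists 1, c; apply/funext => x; rewrite mul1r.
move=> _ [a [b ->]]; split.
  move=> x; apply: cvgD; last exact: cvg_cst.
  by apply: cvgM; [exact: cvg_cst|exact: coord3_continuous].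
move=> j.
have D x : is_derive x (basis3 R j) (fun x => a * coord3 i x + b) (a * (i == j)%:R).
  apply: is_derive_of_line; under eq_fun do rewrite coord3_lineE.
  have -> : (fun s : R => a * (coord3 i x + s * (i == j)%:R) + b) =
       (fun s : R => (a * (i == j)%:R) * s + (a * coord3 i x + b)) by apply/funext => s; ring.
  set m := a * _; set k := _ + b.
  have := @is_deriveD _ _ _ _ _ (0 : R) 1 _ _ (@is_deriveZ R R R id m 0 1 1 (is_derive_id _ _))
      (@is_derive_cst R R R k 0 1).
  by rewrite addr0 -[m *: 1]/(m * 1) mulr1.
split; first by move=> x; have [] := D x.
exists 0, (a * (i == j)%:R); apply/funext => x.
by rewrite /partial (@derive_val _ _ _ _ _ _ _ (D x)) mul0r add0r.
Qed.

Lemma partial_coord j (c : R) x : partial j (fun x : R3 R => coord3 j x + c) x = 1.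
Proof.
apply: (@derive_val _ _ _ _ _ _ _ _); apply: is_derive_of_line.
under eq_fun do rewrite coord3_lineE eqxx mulr1 -addrA addrC -addrA.
have := @is_deriveD _ _ _ _ _ (0 : R) 1 _ _ (is_derive_id (0 : R) 1) (@is_derive_cst R R R (c + coord3 j x) 0 1).
by rewrite addr0.
Qed.

(** The derivative of g^2 (x_j - c) in direction j is g^2 + 2 g d_j g (x_j - c) and has integral 0;
    Young absorbs the last term. The factor delta^2 matters: on thin slabs it forces the eigenvalues
    to be unbounded. *)
Lemma poincare_slab g j (c delta : R) : test_fun O g ->
  (forall x, g x != 0 -> c <= coord3 j x <= c + delta) ->
  ip mu g g <= 4 * delta ^+ 2 * ip mu (partial j g) (partial j g).
Proof.
move=> tg gs.
have sg := test_smooth tg; have tdg := test_fun_partial j tg.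
pose w := fun x : R3 R => coord3 j x - c.
have sw : smooth w by exact: smooth_coord.
have tgg : test_fun O (g * g) by exact: test_funM.
have tK : test_fun O (g * g * w) by exact: test_funM.
have I0 := integral_partial0 (C1_supp_test j tK).
have Lg := test_L2 tg; have Ldg := test_L2 tdg.
have igg := L2_mul Lg Lg; have idd := L2_mul Ldg Ldg.
(* Young's inequality and |x_j - c| <= delta on the support make [F] a lower bound of
   [partial j (g * g * w)]. *)
pose F x := (1 / 2) * (g x * g x) - 2 * delta ^+ 2 * (partial j g x * partial j g x).
have i1 : mu.-integrable setT (EFin \o (fun x => (1/2) * (g x * g x))).
  by have := integrableZl measurableT (1/2) igg.
have i2 : mu.-integrable setT (EFin \o (fun x => 2 * delta ^+ 2 * (partial j g x * partial j g x))).
  by have := integrableZl measurableT (2 * delta ^+ 2) idd.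
have iF : mu.-integrable setT (EFin \o F) by have := integrableB measurableT i1 i2.
have iK : mu.-integrable setT (EFin \o partial j (g * g * w)).
  by apply: test_integrable; exact: test_fun_partial.
have pK x : partial j (g * g * w) x = g x * g x + 2 * g x * partial j g x * w x.
  rewrite partialM; [|exact: test_deriv tgg|exact: smooth_deriv].
  rewrite partialM; [|exact: test_deriv tg|exact: test_deriv tg].
  by rewrite partial_coord !fctE; ring.
have FK x : F x <= partial j (g * g * w) x.
  rewrite pK /F; have [->|gx] := eqVneq (g x) 0.
    have : 0 <= 2 * delta ^+ 2 * (partial j g x * partial j g x).
      by apply: mulr_ge0; [apply: mulr_ge0; rewrite ?sqr_ge0|rewrite -expr2 sqr_ge0].
    by lra.
  have /andP[w1 w2] := gs _ gx.
  have w3 : w x ^+ 2 <= delta ^+ 2.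
    by rewrite ler_sqr ?nnegrE /w; lra.
  have h1 : 0 <= (g x + 2 * (partial j g x * w x)) ^+ 2 by exact: sqr_ge0.
  have h2 : 0 <= (partial j g x) ^+ 2 * (delta ^+ 2 - w x ^+ 2).
    by rewrite mulr_ge0 ?sqr_ge0// subr_ge0.
  by nra.
have : \int[mu]_x F x <= 0.
  have -> : 0 = \int[mu]_x partial j (g * g * w) x by rewrite /Rintegral I0.
  by apply: le_Rintegral => //.
rewrite /F RintegralB// !RintegralZl//.
rewrite -/(ip mu g g) -/(ip mu (partial j g) (partial j g)); lra.
Qed.

Lemma dot_grad_test u v : test_field O u -> test_field O v ->
  dot_grad O u v = \sum_i \sum_j ip mu (partial j (u i)) (partial j (v i)).
Proof.
move=> tu tv; apply: eq_bigr => i _; apply: eq_bigr => j _.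
apply: ae_eq_ip; [exact: wp_L2 (test_field_inH1 tu)|exact/test_L2/test_fun_partial/tu|
 exact: wp_L2 (test_field_inH1 tv)|exact/test_L2/test_fun_partial/tv|exact: wp_test_ae|exact: wp_test_ae].
Qed.

Lemma poincare_test : exists2 K : R, 0 < K &
  forall u, test_field O u -> normL2 O u <= K * norm_grad O u.
Proof.
have [L L0 OL] := dom_box3 O.
exists (4 * L); first by rewrite mulr_gt0.
move=> u tu.
have L40 : 0 <= 4 * L by apply: mulr_ge0 => //; exact: ltW.
suff h : dotL2 O u u <= (4 * L * norm_grad O u) ^+ 2.
  have g0 : 0 <= norm_grad O u by rewrite norm_gradE; exact: fnorm_ge0.
  rewrite -[leRHS]ger0_norm; last exact: mulr_ge0.
  by rewrite -sqrtr_sqr normL2E; exact: ler_wsqrtr.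
rewrite exprMn norm_gradE (fnorm_sqr (dot_grad_form O)); last exact: test_field_inH1.
rewrite dot_grad_test// dotL2E mulr_sumr; apply: ler_sum => i _.
have tui := tu i.
have := @poincare_slab (u i) 0 (- L) (2 * L) tui.
have h x : u i x != 0 -> - L <= coord3 0 x <= - L + 2 * L.
  move=> ux; have Ox : dom O x by apply: contrapT => /(supp_in0 (test_supp tui)) h; rewrite h eqxx in ux.
  by have /(@box_coord _ _ 0) := OL _ Ox; rewrite (_ : - L + 2 * L = L)//; ring.
move=> /(_ h) /le_trans; apply.
rewrite (_ : 4 * (2 * L) ^+ 2 = (4 * L) ^+ 2); last by ring.
apply: ler_wpM2l; first exact: sqr_ge0.
rewrite (bigD1 0)//= lerDl.
by apply: sumr_ge0 => j _; apply: Rintegral_ge0 => x _; rewrite -expr2 sqr_ge0.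
Qed.

Lemma poincare : exists2 K : R, 0 < K &
  forall u, inH10 O u -> normL2 O u <= K * norm_grad O u.
Proof.
have [K K0 HK] := poincare_test; exists K => // u [Hu Hd].
apply/ler_addgt0Pr => e e0.
(* Replacing u by phi costs |u - phi| on the left and K |grad (u - phi)| on the right, in total at
   most 1 + K times the H^1 distance. *)
have e1 : 0 < e / (1 + K) by rewrite divr_gt0// addr_gt0.
have [phi tp up] := Hd _ e1; have Hp := test_field_inH1 tp.
have Hup : inH1 O (u - phi) by exact: (formB_in (dot_grad_form O)).
have h1 := normL2_le_H1 Hup; have h2 := norm_grad_le_H1 Hup.
have h3 : normL2 O u <= normL2 O phi + normL2 O (u - phi).
  by rewrite !normL2E; apply: (fnormB_le (dotL2_form O)); exact: inH1_L2.
have h4 : norm_grad O phi <= norm_grad O u + norm_grad O (u - phi).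
  rewrite !norm_gradE (fnormBC (dot_grad_form O) Hu Hp).
  exact: (fnormB_le (dot_grad_form O) Hp Hu).
have h5 := HK _ tp.
have h6 : K * norm_grad O phi <= K * (norm_grad O u + norm_grad O (u - phi)) by apply: ler_wpM2l; [exact: ltW|exact: h4].
have h7 : normH1 O (u - phi) * (1 + K) < e by rewrite -ltr_pdivlMr ?addr_gt0.
have h8 : K * norm_grad O (u - phi) <= K * normH1 O (u - phi) by apply: ler_wpM2l; [exact: ltW|exact: h2].
move: (normL2 O u) (normL2 O phi) (norm_grad O u) (norm_grad O phi) (normL2 O (u - phi)) (norm_grad O (u - phi)) (normH1 O (u - phi)) h1 h2 h3 h4 h5 h6 h7 h8 => a b c d m n p *.
by lra.
Qed.

Lemma inV_H u : inV O u -> inH O u.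
Proof.
have [K K0 HK] := poincare.
move=> Vu; have [H10u Hd] := Vu; split; first exact: inV_L2.
move=> e e0; have eK : 0 < e / K by rewrite divr_gt0.
have [phi sp up] := Hd _ eK; exists phi => //.
have h : inH10 O (u - phi).
  by apply: (formB_in (grad_form10 O) H10u); apply: test_field_H10; case: sp.
by apply: le_lt_trans (HK _ h) _; rewrite mulrC -ltr_pdivlMr.
Qed.

(** Bridges plain fields, in terms of which the spaces are defined, and the almost everywhere
    classes of [Hspace], where B lives and the eigenbasis is complete. *)
Lemma toH u : inH O u -> exists U : Hspace O, forall i, U i = u i %[ae mu].
Proof.
move=> Hu; have [Lu Hd] := Hu.
pose c i : {mfun_ mu, R3 R >-> R} := (\pi_({mfun_ mu, R3 R >-> R}) (mfun_Sub (mem_set (L2field_meas i Lu))))%qT.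
have ce i : (c i : R3 R -> R) = u i %[ae mu].
  have /eqquotP/asboolP := reprK (c i); rewrite /=.
  exact.
have cm i : measurable_fun setT (c i : R3 R -> R) by exact: (@measurable_funPT _ _ _ _ (repr (c i))).
have Lc : L2field O (fun i => c i : R3 R -> R).
  move=> i; apply: ae_L2 (Lu i) (cm i) _; apply: filterS (ce i) => x h1 /h1 ->; by [].
have cH : inH O (fun i => c i : R3 R -> R).
  split=> // e e0; have [phi sp up] := Hd _ e0; exists phi => //.
  have Lp : L2field O phi by move=> i; apply: test_L2; case: sp.
  suff -> : normL2 O ((fun i => c i : R3 R -> R) - phi) = normL2 O (u - phi) by [].
  rewrite !normL2E; congr Num.sqrt; rewrite !dotL2E; apply: eq_bigr => i _.
  apply: ae_eq_ip; try exact: (L2fieldB _ _ i).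
  - by apply: filterS (ce i) => x h1 h2; rewrite !fctE h1.
  - by apply: filterS (ce i) => x h1 h2; rewrite !fctE h1.
by exists (MkH cH) => i; exact: ce.
Qed.

End Poincare.

(** * The Ladyzhenskaya inequality and the convection form *)

Section Ladyzhenskaya.
Variables (R : realType) (O : bounded_domain R).
Local Notation mu := (leb_dom O).
Local Notation leb := (@lebesgue_measure R).
Implicit Types (g h : R3 R -> R).

(** The planar Loomis-Whitney argument: a bound by a function of y times a function of x separates
    under Tonelli. *)
Lemma product_bound2 (h : measurableTypeR R * measurableTypeR R -> \bar R) (a1 a2 : R -> \bar R) :
  measurable_fun setT h -> (forall x, 0 <= h x)%E ->
  measurable_fun setT a1 -> measurable_fun setT a2 ->
  (forall x, 0 <= a1 x)%E -> (forall x, 0 <= a2 x)%E ->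
  (forall x y, h (x, y) <= a1 y * a2 x)%E ->
  (\int[@lam2 R]_x h x <= (\int[leb]_y a1 y) * (\int[leb]_x a2 x))%E.
Proof.
move=> mh h0 ma1 ma2 a10 a20 ha; rewrite tonelli_lam2_yx//.
have -> : ((\int[leb]_y a1 y) * (\int[leb]_x a2 x) = \int[leb]_y (a1 y * \int[leb]_x a2 x))%E.
  rewrite ge0_integralZr//; exact: integral_ge0.
apply: ge0_le_integral => //.
- by move=> y _; exact: integral_ge0.
- exact: (@measurable_fun_fubini_tonelli_G _ _ _ _ R leb h).
- by apply: emeasurable_funM => //; exact: measurable_cst.
- move=> y _; rewrite -ge0_integralZl//.
  apply: ge0_le_integral => //.
  + by apply: measurable_fun_pair1.
  + by apply: emeasurable_funM => //; exact: measurable_cst.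
Qed.

(** Young's inequality is optimised at t = p / (2 m); when m = 0, the choice t = (X + 1) / p already
    contradicts p > 0. On the slices z = const this stands in for Cauchy-Schwarz. *)
Lemma sq_le_of_young (p m X : R) : 0 <= p -> 0 <= m -> 0 <= X ->
  (forall t : R, 0 < t -> p <= t * m + t^-1 * X) -> p ^+ 2 <= 4 * m * X.
Proof.
move=> p0 m0 X0 H.
move: p0; rewrite le_eqVlt => /predU1P[<-|p0].
  by rewrite expr0n/= !mulr_ge0.
move: m0; rewrite le_eqVlt => /predU1P[m0|m0].
  have t0 : 0 < (X + 1) / p * 1 by rewrite mulr1 divr_gt0// ltr_wpDl.
  have := H _ t0; rewrite -m0 mulr0 add0r mulr1 invf_div => h.
  have : p / (X + 1) * X < p; last by lra.
  by rewrite mulrAC -mulrA gtr_pMr// ltr_pdivrMr ?ltr_wpDl// mul1r ltrDl.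
have t0 : 0 < p / (2 * m) by rewrite divr_gt0// mulr_gt0.
have := H _ t0; rewrite invf_div => h.
have h2 : p * (p / (2 * m)) <= p / (2 * m) * m * (p / (2 * m)) + X.
  apply: le_trans (ler_wpM2r (ltW t0) h) _; rewrite le_eqVlt; apply/orP; left; apply/eqP.
  by field; rewrite !gt_eqF.
have e1 : p / (2 * m) * m = p / 2 by field; rewrite gt_eqF.
rewrite e1 in h2.
have : p ^+ 2 / (4 * m) <= X.
  have e2 : p * (p / (2 * m)) = 2 * (p ^+ 2 / (4 * m)) by field; rewrite gt_eqF.
  have e3 : p / 2 * (p / (2 * m)) = p ^+ 2 / (4 * m) by field; rewrite gt_eqF.
  by move: h2; rewrite e2 e3; lra.
by rewrite ler_pdivrMr ?mulr_gt0// mulrC.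
Qed.

Lemma young_prod (a b c e f S : R) : a ^+ 2 <= 4 * f * c -> b ^+ 2 <= 4 * f * e ->
  f * c <= S * c -> f * e <= S * e -> a * b <= 2 * S * (c + e).
Proof. by move=> h1 h2 h3 h4; have := sqr_ge0 (a - b); rewrite sqrrB; lra. Qed.

Lemma slice_fin g z : continuous g -> supp_in O g -> (forall x, 0 <= g x) ->
  (\int[@lam2 R]_xy (g (xy, z))%:E)%E \is a fin_num.
Proof.
by move=> cg sg g0; apply: (integrable_fin_num measurableT); exact: slice_integrable cg sg.
Qed.

Lemma partial_sq j g x : test_fun O g -> partial j (g * g) x = 2 * (g x * partial j g x).
Proof.
move=> tg; rewrite partialM; [|exact: test_deriv tg|exact: test_deriv tg].
by ring.
Qed.

Lemma young2 (t a b : R) : 0 < t -> `|2 * (a * b)| <= t * (a * a) + t^-1 * (b * b).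
Proof.
move=> t0; have tn : t != 0 by rewrite gt_eqF.
have h (c : R) : 2 * (a * c) <= t * (a * a) + t^-1 * (c * c).
  have : 0 <= t^-1 * (t * a - c) ^+ 2 by rewrite mulr_ge0 ?sqr_ge0// invr_ge0 ltW.
  suff -> : t^-1 * (t * a - c) ^+ 2 = t * (a * a) + t^-1 * (c * c) - 2 * (a * c) by lra.
  by field.
rewrite ler_norml h andbT; have := h (- b); rewrite mulrN mulrNN mulrN; lra.
Qed.

(** On a slice z = const, g^2 is at most the integral of |d_0 (g^2)| along x, and that of |d_1
    (g^2)| along y, so the integral of g^4 is at most P_0 P_1, where P_j^2 <= 4 m X_j. The slice
    mass m(z) is bounded by S uniformly in z by the same argument along z; integration in z
    concludes. *)
Lemma ladyzhenskaya_test g : test_fun O g ->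
  ip mu (g * g) (g * g) <=
  2 * (ip mu g g + ip mu (partial 2%:R g) (partial 2%:R g)) *
      (ip mu (partial 0 g) (partial 0 g) + ip mu (partial 1 g) (partial 1 g)).
Proof.
move=> tg.
have tgg : test_fun O (g * g) by apply: test_funM => //; exact: test_smooth tg.
have td j : test_fun O (partial j g) by exact: test_fun_partial.
have tdd j : test_fun O (partial j g * partial j g) by apply: test_funM => //; exact/test_smooth/td.
have tg4 : test_fun O ((g * g) * (g * g)) by apply: test_funM => //; exact: test_smooth tgg.
have sq0 (k : R3 R -> R) x : 0 <= (k * k) x by rewrite -[(k * k) x]/(k x * k x) -expr2 sqr_ge0.
have tpgg j : test_fun O (partial j (g * g)) by exact: test_fun_partial.
have cgg := test_cont tgg; have sgg := test_supp tgg.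
have fg x : (g * g) x = `|(g * g) x| by rewrite ger0_norm// sq0.
have toR (k : R3 R -> R) : test_fun O k -> (\int[lebesgue3 R]_x (k x)%:E = (\int[mu]_x k x)%:E)%E.
  move=> tk; rewrite -(@integral_leb_dom _ O); last by move=> x Ox; rewrite (supp_in0 (test_supp tk) Ox).
  by rewrite /Rintegral fineK// (integrable_fin_num measurableT)//; exact: test_integrable.
have mpE (k : R3 R -> R) : test_fun O k -> measurable_fun setT (fun x => (k x)%:E).
  by move=> tk; apply/measurable_EFinP; exact: test_meas tk.
have mpN (k : R3 R -> R) : test_fun O k -> measurable_fun setT (fun x => `|k x|%:E).
  by move=> tk; apply/measurable_EFinP; apply: measurableT_comp => //; exact: test_meas tk.
pose m z := (\int[@lam2 R]_xy ((g * g) (xy, z))%:E)%E.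
pose X j z := (\int[@lam2 R]_xy ((partial j g * partial j g) (xy, z))%:E)%E.
pose P j z := (\int[@lam2 R]_xy `|partial j (g * g) (xy, z)|%:E)%E.
have m_fin z : m z \is a fin_num by apply: slice_fin.
have X_fin j z : X j z \is a fin_num.
  by apply: slice_fin => //; [exact: test_cont (tdd j)|exact: test_supp (tdd j)].
have m0 z : (0 <= m z)%E by apply: integral_ge0 => xy _; rewrite lee_fin.
have X0 j z : (0 <= X j z)%E by apply: integral_ge0 => xy _; rewrite lee_fin.
have P0 j z : (0 <= P j z)%E by apply: integral_ge0 => xy _; rewrite lee_fin.
have Pm j (t : R) z : 0 < t -> (P j z <= (t * fine (m z) + t^-1 * fine (X j z))%:E)%E.
  move=> t0; rewrite EFinD !EFinM !fineK//.
  have s1 (k : R3 R -> R) : test_fun O k -> measurable_fun setT (fun xy => (k (xy, z))%:E).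
    by move=> tk; apply: (measurable_fun_pair1 z (mpE _ tk)).
  have ti0 : 0 <= t^-1 by rewrite invr_ge0 ltW.
  have t0' := ltW t0.
  rewrite -ge0_integralZl_EFin//; [|by move=> *; rewrite lee_fin|exact: s1].
  rewrite -ge0_integralZl_EFin//; [|by move=> *; rewrite lee_fin|exact: s1].
  rewrite -ge0_integralD//.
  - apply: ge0_le_integral => //.
    + exact: (measurable_fun_pair1 z (mpN _ (tpgg j))).
    + by apply: emeasurable_funD; apply: emeasurable_funM => //; exact: s1.
    + move=> xy _; rewrite -!EFinM -EFinD lee_fin partial_sq//; exact: young2.
  - by move=> xy _; rewrite -EFinM lee_fin mulr_ge0.
  - by apply: emeasurable_funM => //; exact: s1.
  - by move=> xy _; rewrite -EFinM lee_fin mulr_ge0.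
  - by apply: emeasurable_funM => //; exact: s1.
have P_fin j z : P j z \is a fin_num.
  by rewrite ge0_fin_numE//; apply: le_lt_trans (Pm j 1 z ltr01) (ltry _).
have P2 j z : fine (P j z) ^+ 2 <= 4 * fine (m z) * fine (X j z).
  apply: sq_le_of_young; [exact: fine_ge0|exact: fine_ge0|exact: fine_ge0|].
  by move=> t t0; rewrite -lee_fin fineK//; exact: Pm.
pose S := ip mu g g + ip mu (partial 2%:R g) (partial 2%:R g).
have mS z : (m z <= S%:E)%E.
  pose a3 xy := (\int[leb]_z0 `|partial 2%:R (g * g) (xy, z0)|%:E)%E.
  have h1 : (m z <= \int[@lam2 R]_xy a3 xy)%E.
    apply: ge0_le_integral => //.
    - by move=> xy _; rewrite lee_fin.
    - exact: (measurable_fun_pair1 z (mpE _ tgg)).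
    - by apply: (@measurable_fun_fubini_tonelli_F _ _ _ _ R leb (fun x => `|partial 2%:R (g * g) x|%:E)); [exact: mpN|move=> x; rewrite lee_fin].
    move=> [x y] _.
    have := @line_bound _ O (g * g) 2%:R (x, y, 0) z (C1_supp_test _ tgg) erefl.
    have [_ _ Ez] := line0E x y z.
    rewrite -Ez -fg => /le_trans; apply; rewrite le_eqVlt; apply/orP; left; apply/eqP.
    apply: eq_integral => z0 _; have [_ _ Ez0] := line0E x y z0.
    by rewrite {1}Ez0.
  apply: (le_trans h1).
  rewrite -(@tonelli_lebesgue3_xy R (fun x => `|partial 2%:R (g * g) x|%:E)); last 2 first.
  - exact: mpN.
  - by move=> x; rewrite lee_fin.
  apply: (@le_trans _ _ (\int[lebesgue3 R]_x (((g * g) + (partial 2%:R g * partial 2%:R g)) x)%:E)%E).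
    apply: ge0_le_integral => //.
    - exact: mpN.
    - by apply: mpE; exact: test_funD.
    - move=> x _; rewrite lee_fin partial_sq//.
      by have := @young2 1 (g x) (partial 2%:R g x) ltr01; rewrite invr1 !mul1r.
  rewrite toR; last exact: test_funD.
  rewrite lee_fin /S /ip -RintegralD//; first exact: test_integrable tgg.
  exact: test_integrable (tdd _).
have S0 : 0 <= S.
  by rewrite -lee_fin; exact: le_trans (m0 0) (mS 0).
have key z : (\int[@lam2 R]_xy (((g * g) * (g * g)) (xy, z))%:E <= (2 * S)%:E * (X 0%R z + X 1%R z))%E.
  have PQ : (\int[@lam2 R]_xy (((g * g) * (g * g)) (xy, z))%:E <= P 0%R z * P 1%R z)%E.
    pose h1 xy := (`|partial 0 (g * g) (xy, z)|%:E)%E.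
    pose h2 xy := (`|partial 1 (g * g) (xy, z)|%:E)%E.
    have mh1 : measurable_fun setT h1 by exact: (measurable_fun_pair1 z (mpN _ (tpgg 0))).
    have mh2 : measurable_fun setT h2 by exact: (measurable_fun_pair1 z (mpN _ (tpgg 1))).
    have h10 xy : (0 <= h1 xy)%E by rewrite lee_fin.
    have h20 xy : (0 <= h2 xy)%E by rewrite lee_fin.
    have E0 : P 0 z = (\int[leb]_y \int[leb]_x h1 (x, y))%E := tonelli_lam2_yx mh1 h10.
    have E1 : P 1 z = (\int[leb]_x \int[leb]_y h2 (x, y))%E := tonelli_lam2_xy mh2 h20.
    rewrite E0 E1.
    apply: product_bound2.
    - exact: (measurable_fun_pair1 z (mpE _ tg4)).
    - by move=> xy; rewrite lee_fin; exact: sq0.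
    - exact: (@measurable_fun_fubini_tonelli_G _ _ _ _ R leb h1 mh1 h10).
    - exact: (@measurable_fun_fubini_tonelli_F _ _ _ _ R leb h2 mh2 h20).
    - move=> y; apply: integral_ge0 => x _; exact: h10.
    - move=> x; apply: integral_ge0 => y _; exact: h20.
    move=> x y; rewrite -[((g * g) * (g * g)) (x, y, z)]/((g * g) (x, y, z) * (g * g) (x, y, z)) EFinM.
    have [Ex Ey _] := line0E x y z.
    apply: lee_pmul; [by rewrite lee_fin; exact: sq0|by rewrite lee_fin; exact: sq0| |].
      have := @line_bound _ O (g * g) 0 (0, y, z) x (C1_supp_test _ tgg) erefl.
      rewrite -Ex -fg => /le_trans; apply; rewrite le_eqVlt; apply/orP; left; apply/eqP.
      apply: eq_integral => x0 _; have [Ex0 _ _] := line0E x0 y z.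
      by rewrite /h1 {1}Ex0.
    have := @line_bound _ O (g * g) 1 (x, 0, z) y (C1_supp_test _ tgg) erefl.
    rewrite -Ey -fg => /le_trans; apply; rewrite le_eqVlt; apply/orP; left; apply/eqP.
    apply: eq_integral => y0 _; have [_ Ey0 _] := line0E x y0 z.
    by rewrite /h2 {1}Ey0.
  apply: (le_trans PQ).
  rewrite -[P 0%R z]fineK// -[P 1%R z]fineK// -[X 0%R z]fineK// -[X 1%R z]fineK//.
  rewrite -EFinM -EFinD -EFinM lee_fin.
  have mSz : fine (m z) <= S by rewrite -lee_fin fineK.
  have x00 : 0 <= fine (X 0%R z) by exact: fine_ge0.
  have x10 : 0 <= fine (X 1%R z) by exact: fine_ge0.
  have p2 := P2 0 z; have q2 := P2 1 z.
  have s0 : fine (m z) * fine (X 0%R z) <= S * fine (X 0%R z) by exact: ler_wpM2r.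
  have s1 : fine (m z) * fine (X 1%R z) <= S * fine (X 1%R z) by exact: ler_wpM2r.
  exact: young_prod p2 q2 s0 s1.
have mX j : measurable_fun setT (X j).
  by apply: (@measurable_fun_fubini_tonelli_G _ _ _ _ R (@lam2 R) (fun x => ((partial j g * partial j g) x)%:E)); [exact: mpE|move=> x; rewrite lee_fin].
rewrite -lee_fin; have -> : (ip mu (g * g) (g * g))%:E = (\int[lebesgue3 R]_x (((g * g) * (g * g)) x)%:E)%E.
  by rewrite toR.
rewrite tonelli_lebesgue3_z; [|exact: mpE tg4|by move=> x; rewrite lee_fin].
apply: (@le_trans _ _ (\int[leb]_z ((2 * S)%:E * (X 0%R z + X 1%R z)))%E).
  apply: ge0_le_integral => //.
  - by move=> z _; apply: integral_ge0 => xy _; rewrite lee_fin.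
  - by apply: (@measurable_fun_fubini_tonelli_G _ _ _ _ R (@lam2 R) (fun x => (((g * g) * (g * g)) x)%:E)); [exact: mpE|move=> x; rewrite lee_fin].

  - by apply: emeasurable_funM; [exact: measurable_cst|exact: emeasurable_funD].
rewrite ge0_integralZl_EFin//; last 3 first.
- by move=> z _; exact: adde_ge0.
- exact: emeasurable_funD.
- by rewrite mulr_ge0.
have EX j : (\int[leb]_z X j z = (ip mu (partial j g) (partial j g))%:E)%E.
  rewrite /X -(@tonelli_lebesgue3_z R (fun x => ((partial j g * partial j g) x)%:E)).
  - by rewrite toR.
  - exact: mpE.
  - by move=> x; rewrite lee_fin.
have E2 : (\int[leb]_z (X 0%R z + X 1%R z) =
    (ip mu (partial 0 g) (partial 0 g) + ip mu (partial 1 g) (partial 1 g))%:E)%E.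
  apply: etrans (ge0_integralD _ measurableT _ (mX 0) _ (mX 1)) _.
  - by move=> z _; exact: X0.
  - by move=> z _; exact: X0.
  by rewrite EFinD; congr (_ + _)%E; exact: EX.
apply: (@le_trans _ _ ((2 * S)%:E * (ip mu (partial 0 g) (partial 0 g) + ip mu (partial 1 g) (partial 1 g))%:E)%E).
  by rewrite le_eqVlt; apply/orP; left; apply/eqP; congr (_ * _)%E; exact: E2.
by rewrite -EFinM lee_fin.
Qed.

End Ladyzhenskaya.

Opaque dotL2 dot_grad test_fun inH1 L2field smooth normL2 norm_grad normH1 ip.

Section RealEstimates.
Variable R : realType.
Implicit Types (K C A a e x y z : R).

Lemma sum_ge_term (F : 'I_3 -> R) i : (forall k, 0 <= F k) -> F i <= \sum_k F k.
Proof. by move=> F0; rewrite (bigD1 i)//= lerDl sumr_ge0. Qed.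

Lemma sqrtr_mul4 K x : 0 <= K -> Num.sqrt (K * x ^+ 4) = Num.sqrt K * x ^+ 2.
Proof.
move=> K0; rewrite sqrtrM// (_ : x ^+ 4 = (x ^+ 2) ^+ 2); last by rewrite -exprM.
by rewrite sqrtr_sqr ger0_norm ?sqr_ge0.
Qed.

Lemma sqrtr_mul_sqr a x y : 0 <= a -> 0 <= x -> 0 <= y ->
  Num.sqrt (a * x ^+ 2 * (a * y ^+ 2)) = a * (x * y).
Proof.
move=> a0 x0 y0; rewrite (_ : a * x ^+ 2 * _ = (a * (x * y)) ^+ 2); last by ring.
by rewrite sqrtr_sqr ger0_norm ?mulr_ge0.
Qed.

Lemma poincare_arith (a b n K : R) : a <= K * n -> b <= n -> 2 * (a + b) <= 2 * (K + 1) * n.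
Proof. lra. Qed.

Lemma mul_le2 (C a b x y : R) : 0 <= a -> 0 <= b -> a <= C * x -> b <= C * y ->
  a * b <= C ^+ 2 * (x * y).
Proof.
by move=> a0 b0 h1 h2; rewrite (_ : C ^+ 2 * _ = C * x * (C * y)); [exact: ler_pM|ring].
Qed.

Lemma trilinear_arith (K Kq C2 x1 x2 x3 x4 z1 z2 y1 y2 y3 y4 : R) :
  y1 <= K * (x1 * x2 * x4) -> y2 <= K * (x3 * x1 * x4) -> y3 <= Kq * z1 -> y4 <= Kq * z2 ->
  Kq * z1 <= Kq * (C2 * (x1 * x2)) -> Kq * z2 <= Kq * (C2 * (x3 * x1)) ->
  y1 + y2 + (y3 + y4) <= (K * x4 + Kq * C2) * (x1 * x2 + x3 * x1).
Proof.
move=> *.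
rewrite (_ : (K * x4 + _) * _ = K * (x1 * x2 * x4) + K * (x3 * x1 * x4) + (Kq * (C2 * (x1 * x2)) + Kq * (C2 * (x3 * x1)))); last by ring.
lra.
Qed.

Lemma small_arith (A e x1 x2 x3 : R) : 0 <= A -> x1 <= e -> 0 <= x1 -> 0 <= x2 -> 0 <= x3 ->
  x3 <= x2 + e -> e <= 1 -> A * (x1 * x2 + x3 * x1) <= A * (2 * x2 + 1) * e.
Proof.
move=> A0 h1 h2 h3 h4 h5 h6; rewrite -mulrA ler_wpM2l// [_ * e]mulrC.
by rewrite [x3 * x1]mulrC -mulrDr; apply: ler_pM => //; lra.
Qed.

Lemma small_le0 (D B : R) : 0 <= B -> (forall e : R, 0 < e -> e <= 1 -> D <= B * e) -> D <= 0.
Proof.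
move=> B0 H; apply/ler_addgt0Pr => e e0; rewrite add0r.
have B1 : 0 < B + 1 by rewrite ltr_wpDl.
have [h|h] := leP (e / (B + 1)) 1.
  apply: le_trans (H _ (divr_gt0 e0 B1) h) _.
  by rewrite mulrA ler_pdivrMr// mulrC ler_wpM2l ?ltW// ltrDl.
apply: le_trans (H 1 ltr01 (lexx _)) _; rewrite mulr1.
by move: h; rewrite ltr_pdivlMr// mul1r => h; apply: le_trans (ltW h); rewrite lerDl.
Qed.

End RealEstimates.

(** * The trilinear convection form and its integration by parts *)

Section Convection.
Variables (R : realType) (O : bounded_domain R).
Local Notation mu := (leb_dom O).
Local Notation L2 f := (f \in Lfun mu 2%:E).
Local Notation nL2 := (fnorm (@ip _ (R3 R) R mu)).
Implicit Types (g h : R3 R -> R) (u v w p phi : vfield R).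

Lemma norm_grad_ge0 u : 0 <= norm_grad O u. Proof. by rewrite norm_gradE; exact: fnorm_ge0. Qed.
Lemma normL2_ge0 u : 0 <= normL2 O u. Proof. by rewrite normL2E; exact: fnorm_ge0. Qed.

Lemma eq_ip g g' h h' : (forall x, g x * h x = g' x * h' x) -> ip mu g h = ip mu g' h'.
Proof. by move=> E; rewrite !ipE; apply: eq_Rintegral => x _; exact: E. Qed.

Lemma ip_ge0 g : 0 <= ip mu g g.
Proof. by rewrite ipE; apply: Rintegral_ge0 => x _; rewrite -expr2 sqr_ge0. Qed.

Lemma ip_le_dotL2 u i : ip mu (u i) (u i) <= dotL2 O u u.
Proof. by rewrite dotL2E (bigD1 i)//= lerDl sumr_ge0// => k _; exact: ip_ge0. Qed.

Lemma nL2_le_normL2 u i : nL2 (u i) <= normL2 O u.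
Proof. by rewrite normL2E; apply: ler_wsqrtr; exact: ip_le_dotL2. Qed.

Lemma nL2_le_grad u i j : nL2 (weak_partial O j (u i)) <= norm_grad O u.
Proof.
rewrite norm_gradE; apply: ler_wsqrtr; rewrite dot_gradE.
have h k : 0 <= \sum_l ip mu (weak_partial O l (u k)) (weak_partial O l (u k)).
  by apply: sumr_ge0 => l _; exact: ip_ge0.
apply: le_trans (sum_ge_term i h).
apply: (@sum_ge_term _ (fun l => ip mu (weak_partial O l (u i)) (weak_partial O l (u i)))) => l.
exact: ip_ge0.
Qed.

Lemma L4_test : exists2 K : R, 0 < K & forall u i, test_field O u ->
  ip mu (u i * u i) (u i * u i) <= K * norm_grad O u ^+ 4.
Proof.
have [K K0 HK] := poincare_test O.
exists (2 * (K ^+ 2 + 1)); first by rewrite mulr_gt0// ltr_wpDl// sqr_ge0.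
move=> u i tu; apply: le_trans (ladyzhenskaya_test (tu i)) _.
have Hu := test_field_inH1 tu.
have gE : norm_grad O u ^+ 2 = \sum_i \sum_j ip mu (partial j (u i)) (partial j (u i)).
  by rewrite norm_gradE (fnorm_sqr (dot_grad_form O) Hu) (dot_grad_test tu tu).
have gi : \sum_j ip mu (partial j (u i)) (partial j (u i)) <= norm_grad O u ^+ 2.
  rewrite gE [leRHS](bigD1 i)//= lerDl; apply: sumr_ge0 => k _; apply: sumr_ge0 => l _; exact: ip_ge0.
have E3 (F : 'I_3 -> R) : \sum_j F j = F 0 + F 1 + F 2%:R.
  rewrite !big_ord_recr big_ord0/= add0r; congr (F _ + F _ + F _); exact: val_inj.
rewrite E3 in gi.
have l2 : ip mu (u i) (u i) <= K ^+ 2 * norm_grad O u ^+ 2.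
  apply: le_trans (ip_le_dotL2 _ _) _.
  rewrite -(fnorm_sqr (dotL2_form O) (inH1_L2 Hu)) -exprMn.
  rewrite ler_sqr ?nnegrE ?fnorm_ge0 ?mulr_ge0 ?norm_grad_ge0 ?(ltW K0)//.
  by rewrite -normL2E; exact: HK.
have g0 := ip_ge0 (partial 0 (u i)); have g1 := ip_ge0 (partial 1 (u i)); have g2 := ip_ge0 (partial 2%:R (u i)).
have n0 := sqr_ge0 (norm_grad O u).
have ui := ip_ge0 (u i).
rewrite (_ : norm_grad O u ^+ 4 = norm_grad O u ^+ 2 * norm_grad O u ^+ 2); last by rewrite -exprD.
move: (norm_grad O u ^+ 2) gi l2 n0 => n gi l2 n0; rewrite [leRHS]mulrA.
apply: ler_pM.
- by rewrite mulr_ge0// addr_ge0.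
- by apply: addr_ge0; [exact: g0|exact: g1].
- apply: poincare_arith; first exact: l2.
  by apply: le_trans gi; rewrite lerDr; apply: addr_ge0; [exact: g0|exact: g1].
- by apply: le_trans gi; rewrite lerDl; exact: g2.
Qed.

Lemma cvg_inv_nat : (n.+1%:R^-1 : R) @[n --> \oo] --> (0 : R).
Proof. exact: cvg_harmonic. Qed.

Lemma H10_approx u : inH10 O u -> exists phi : nat -> vfield R,
  (forall n, test_field O (phi n)) /\ forall n, normH1 O (u - phi n) < n.+1%:R^-1.
Proof.
move=> [Hu Hd].
have h n : exists p, test_field O p /\ normH1 O (u - p) < n.+1%:R^-1.
  by have [|p tp up] := Hd (n.+1%:R^-1); [rewrite invr_gt0|exists p].
exists (fun n => projT1 (cid (h n))); split=> n; by have [] := projT2 (cid (h n)).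
Qed.

Lemma ae_sub_cvg u (phi : nat -> vfield R) i : L2field O u -> (forall n, L2field O (phi n)) ->
  (forall n, normL2 O (u - phi n) < n.+1%:R^-1) ->
  exists s : nat -> nat, (forall k, (k <= s k)%N) /\
    \forall x \ae mu, phi (s n) i x @[n --> \oo] --> u i x.
Proof.
move=> Lu Lp H; have Lui : L2 (u i) by move: i; exact: Lu.
have Lpi n : L2 (phi n i) by move: i {Lui}; exact: Lp.
apply: (L2_ae_subseq Lpi Lui).
apply: (squeeze_cvgr _ (cvg_cst 0) cvg_inv_nat).
apply: nearW => n; rewrite ip_ge0/=.
have le1 : normL2 O (u - phi n) <= 1.
  by apply: le_trans (ltW (H n)) _; rewrite invf_le1// ler1n.
have -> : ip mu (phi n i - u i) (phi n i - u i) = ip mu ((u - phi n) i) ((u - phi n) i).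
  by apply: eq_ip => x; rewrite !fctE; ring.
apply: le_trans (ip_le_dotL2 _ _) _.
rewrite -(fnorm_sqr (dotL2_form O) (L2fieldB Lu (Lp n))) -normL2E.
apply: le_trans (ltW (H n)); rewrite expr2 ler_piMr// normL2_ge0//.
Qed.

Lemma normL2_eq0_ae u i : L2field O u -> normL2 O u = 0 -> u i = cst 0 %[ae mu].
Proof. by move=> Lu u0; exact: normL2_eq0. Qed.

(** Approximation in H^1, an almost everywhere convergent subsequence, and Fatou. The factor 2^4
    comes from |grad phi_n| <= 2 |grad u| for large n, which requires |grad u| > 0; otherwise u = 0
    almost everywhere by Poincare. *)
Lemma L4_H10 : exists2 K : R, 0 < K & forall u i, inH10 O u ->
  L2 (u i * u i) /\ ip mu (u i * u i) (u i * u i) <= K * norm_grad O u ^+ 4.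
Proof.
have [K K0 HK] := L4_test; have [K' K'0 HK'] := poincare O.
exists (K * 2 ^+ 4); first by rewrite mulr_gt0// exprn_gt0.
move=> u i H10u; have Hu := inH10_H1 H10u; have Lu := inH1_L2 Hu.
have Lui : L2 (u i) by move: i; exact: Lu.
have mui := L2_measurable Lui.
have [g0|gn0] := eqVneq (norm_grad O u) 0.
  have u0 : normL2 O u = 0.
    by apply/eqP; rewrite eq_le normL2_ge0 andbT; apply: le_trans (HK' _ H10u) _; rewrite g0 mulr0.
  have uu0 : u i * u i = cst 0 %[ae mu].
    by apply: filterS (normL2_eq0_ae i Lu u0) => x h /h h'; rewrite !fctE h' mul0r.
  have Luu : L2 (u i * u i).
    apply: (@ae_L2 _ _ _ mu 0); [exact: L2_0|exact: measurable_funM|].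
    by apply: filterS uu0 => x h /h ->.
  split=> //; rewrite (@ae_eq_ip _ _ _ mu _ 0 _ 0)//; try exact: L2_0.
  have -> : ip mu 0 0 = 0 := form0l (ip_form mu) (L2_0 mu).
  by rewrite g0 expr0n/= mulr0.
have gp : 0 < norm_grad O u by rewrite lt_neqAle eq_sym gn0 norm_grad_ge0.
have [phi [tp Hp]] := H10_approx H10u.
have Hpn n : inH1 O (phi n) by exact: test_field_inH1.
have Hup n : inH1 O (u - phi n) by exact: (formB_in (dot_grad_form O)).
have Lp n : L2field O (phi n) by exact: inH1_L2.
have HpL n : normL2 O (u - phi n) < n.+1%:R^-1 by apply: le_lt_trans (normL2_le_H1 (Hup n)) (Hp n).
have [s [s_ge ae_s]] := ae_sub_cvg i Lu Lp HpL.
apply: (@L2_fatou _ _ _ mu (fun n => phi (s n) i * phi (s n) i)).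
- by move=> n; apply: test_L2; apply: test_funM; [exact: tp|exact: test_smooth (tp _ i)].
- exact: measurable_funM.
- by apply: filterS ae_s => x hx; exact: (cvgM hx hx).
near=> n.
apply: le_trans (HK _ _ (tp _)) _; rewrite -mulrA ler_pM2l// -exprMn.
rewrite lerXn2r ?nnegrE ?norm_grad_ge0 ?mulr_ge0 ?norm_grad_ge0//.
have h1 : norm_grad O (phi (s n)) <= norm_grad O u + norm_grad O (u - phi (s n)).
  rewrite !norm_gradE (fnormBC (dot_grad_form O) Hu (Hpn _)).
  exact: (fnormB_le (dot_grad_form O)).
apply: (le_trans h1); rewrite mulr_natl mulr2n lerD2l.
apply: le_trans (norm_grad_le_H1 (Hup _)) _; apply: le_trans (ltW (Hp _)) _.
have : (n.+1%:R^-1 : R) <= norm_grad O u.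
  near: n; have /cvgrPdist_le/(_ _ gp) := cvg_inv_nat.
  by apply: filterS => n; rewrite sub0r normrN ger0_norm ?invr_ge0.
by apply: le_trans; rewrite lef_pV2 ?posrE// ler_nat ltnS.
Unshelve. all: by end_near. Qed.

(** The two undifferentiated factors are grouped because [u j * w i] lies in L^2 by the L^4 bound,
    so that [tri] is a sum of L^2 products. *)
Definition tri u v w : R := \sum_i \sum_j ip mu (u j * w i) (weak_partial O j (v i)).

Lemma L2_prod u w j i : inH10 O u -> inH10 O w -> L2 (u j * w i).
Proof.
move=> Hu Hw; have [K K0 HK] := L4_H10.
have [Luu _] := HK u j Hu; have [Lww _] := HK w i Hw.
have Lu : L2 (u j) by move: j {Luu}; exact: inH1_L2 (inH10_H1 Hu).
have Lw : L2 (w i) by move: i {Lww}; exact: inH1_L2 (inH10_H1 Hw).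
apply/L2P; split; first by apply: measurable_funM; [exact: L2_measurable Lu|exact: L2_measurable Lw].
have := L2_mul Luu Lww; apply: eq_integrable => // x _ /=.
by rewrite !fctE; congr EFin; ring.
Qed.

Lemma nL2_prod : exists2 K : R, 0 < K & forall u w j i, inH10 O u -> inH10 O w ->
  nL2 (u j * w i) <= K * (norm_grad O u * norm_grad O w).
Proof.
have [K K0 HK] := L4_H10; exists (Num.sqrt K); first by rewrite sqrtr_gt0.
move=> u w j i Hu Hw.
have [Luu uu] := HK u j Hu; have [Lww ww] := HK w i Hw.
have gu := norm_grad_ge0 u; have gw := norm_grad_ge0 w.
have sq v k : ip mu (v k * v k) (v k * v k) <= K * norm_grad O v ^+ 4 ->
    nL2 (v k * v k) <= Num.sqrt K * norm_grad O v ^+ 2.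
  by move=> h; rewrite -sqrtr_mul4 ?(ltW K0)//; exact: ler_wsqrtr.
have h1 := sq _ _ uu; have h2 := sq _ _ ww.
rewrite -(sqrtr_mul_sqr (sqrtr_ge0 K) gu gw); apply: ler_wsqrtr.
have -> : ip mu (u j * w i) (u j * w i) = ip mu (u j * u j) (w i * w i).
  by apply: eq_ip => x; rewrite !fctE; ring.
apply: le_trans (ler_norm _) _; apply: le_trans (form_CS (ip_form mu) Luu Lww) _.
by apply: (ler_pM _ _ h1 h2); exact: fnorm_ge0.
Qed.

Lemma convectionE u v w : inH10 O u -> inH1 O v -> inH10 O w -> convection O u v w = tri u v w.
Proof.
move=> Hu Hv Hw; rewrite /convection /tri /Rintegral.
have I i j : mu.-integrable setT (fun x => (u j x * weak_partial O j (v i) x * w i x)%:E).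
  have := L2_mul (L2_prod j i Hu Hw) (wp_L2 i j Hv); apply: eq_integrable => // x _ /=.
  by rewrite !fctE; congr EFin; ring.
under eq_integral => x _.
  rewrite (_ : (\sum_i \sum_j _)%:E = \sum_i \sum_j (u j x * weak_partial O j (v i) x * w i x)%:E)%E; last first.
    by rewrite -sumEFin; apply: eq_bigr => i _; rewrite sumEFin.
  over.
rewrite integral_sum//=; last by move=> i; apply: integrable_sum.
have fi i j : (\int[mu]_x (u j x * weak_partial O j (v i) x * w i x)%:E)%E \is a fin_num.
  exact: (integrable_fin_num measurableT).
rewrite (eq_bigr (fun i => \sum_j \int[mu]_x (u j x * weak_partial O j (v i) x * w i x)%:E)%E); last first.
  by move=> i _; rewrite integral_sum.
rewrite -sum_fine; last by move=> i _; apply/sum_fin_numP => j _ _.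
apply: eq_bigr => i _; rewrite -sum_fine; last by move=> j _.
apply: eq_bigr => j _; rewrite ipE /Rintegral; congr fine; apply: eq_integral => x _.
by rewrite !fctE; congr EFin; ring.
Qed.

Lemma tri_bound : exists2 K : R, 0 < K & forall u v w, inH10 O u -> inH1 O v -> inH10 O w ->
  `|tri u v w| <= K * (norm_grad O u * norm_grad O v * norm_grad O w).
Proof.
have [K K0 HK] := nL2_prod; exists (9 * K); first by rewrite mulr_gt0.
move=> u v w Hu Hv Hw.
have T i j : `|ip mu (u j * w i) (weak_partial O j (v i))| <= K * (norm_grad O u * norm_grad O v * norm_grad O w).
  apply: le_trans (form_CS (ip_form mu) (L2_prod j i Hu Hw) (wp_L2 i j Hv)) _.
  rewrite [norm_grad O u * norm_grad O v * _]mulrAC mulrA.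
  by apply: ler_pM; [exact: fnorm_ge0|exact: fnorm_ge0|exact: HK|exact: nL2_le_grad].
apply: le_trans (ler_norm_sum _ _ _) _.
apply: (@le_trans _ _ (\sum_(i < 3) \sum_(j < 3) (K * (norm_grad O u * norm_grad O v * norm_grad O w)))).
  by apply: ler_sum => i _; apply: le_trans (ler_norm_sum _ _ _) _; apply: ler_sum => j _; exact: T.
rewrite !sumr_const !card_ord -mulrnA -[leLHS]mulr_natl mulrA; exact: lexx.
Qed.

Lemma tri_lin3 (a : R) u v w w' : inH10 O u -> inH1 O v -> inH10 O w -> inH10 O w' ->
  tri u v (a *: w + w') = a * tri u v w + tri u v w'.
Proof.
move=> Hu Hv Hw Hw'; rewrite /tri mulr_sumr -big_split; apply: eq_bigr => i _.
rewrite mulr_sumr -big_split; apply: eq_bigr => j _ /=.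
rewrite -(form_linl (ip_form mu) a (L2_prod j i Hu Hw) (L2_prod j i Hu Hw') (wp_L2 i j Hv)).
by apply: eq_ip => x; rewrite !fctE; congr (_ * _); rewrite mulrDr; congr (_ + _); exact: mulrCA.
Qed.

Lemma tri_sub1 u u' v w : inH10 O u -> inH10 O u' -> inH1 O v -> inH10 O w ->
  tri (u - u') v w = tri u v w - tri u' v w.
Proof.
move=> Hu Hu' Hv Hw; rewrite /tri -sumrB; apply: eq_bigr => i _.
rewrite -sumrB; apply: eq_bigr => j _.
rewrite -(formBl (ip_form mu) (L2_prod j i Hu Hw) (L2_prod j i Hu' Hw) (wp_L2 i j Hv)).
by apply: eq_ip => x; rewrite !fctE mulrBl.
Qed.

Lemma tri_sub2 u v v' w : inH10 O u -> inH1 O v -> inH1 O v' -> inH10 O w ->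
  tri u (v - v') w = tri u v w - tri u v' w.
Proof.
move=> Hu Hv Hv' Hw; rewrite /tri -sumrB; apply: eq_bigr => i _.
rewrite -sumrB; apply: eq_bigr => j _.
rewrite -(formBr (ip_form mu) (wp_L2 i j Hv) (wp_L2 i j Hv') (L2_prod j i Hu Hw)).
apply: ae_eq_ip.
- exact: L2_prod.
- exact: L2_prod.
- by apply: wp_L2; exact: (formB_in (dot_grad_form O)).
- by apply: L2_B; exact: wp_L2.
- exact: aeW.
- have := wp_lin_ae (-1) i j Hv' Hv; rewrite !scaleN1r.
  by rewrite [- v' + v]addrC [- weak_partial _ _ _ + _]addrC.
Qed.

(** Up to sign, what [tri u v phi] becomes for divergence-free u when the derivative is moved onto
    [phi]. It is bounded by the L^2 norms of both arguments, with no gradient. *)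
Definition quad (phi : vfield R) u v : R := \sum_i \sum_j ip mu (u j * partial j (phi i)) (v i).

Lemma L2_mul_dtest phi u i j : test_field O phi -> L2field O u -> L2 (u j * partial j (phi i)).
Proof.
move=> tp Lu; have td := test_fun_partial j (tp i).
have [M M0 HM] := test_bound td.
apply: (L2_mul_bounded _ (test_meas td) HM); move: j {td HM}; exact: Lu.
Qed.

Lemma quad_bound phi : test_field O phi -> exists2 K : R, 0 <= K & forall u v,
  L2field O u -> L2field O v -> `|quad phi u v| <= K * (normL2 O u * normL2 O v).
Proof.
move=> tp.
have hM i j : exists M : R, 0 <= M /\ forall x, `|partial j (phi i) x| <= M.
  by have [M M0 HM] := test_bound (test_fun_partial j (tp i)); exists M.
pose M i j := projT1 (cid (hM i j)).
have M0 i j : 0 <= M i j by have [] := projT2 (cid (hM i j)).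
have HM i j x : `|partial j (phi i) x| <= M i j by have [_] := projT2 (cid (hM i j)).
exists (\sum_i \sum_j M i j); first by apply: sumr_ge0 => i _; apply: sumr_ge0.
move=> u v Lu Lv; apply: le_trans (ler_norm_sum _ _ _) _.
rewrite mulr_suml; apply: ler_sum => i _; apply: le_trans (ler_norm_sum _ _ _) _.
rewrite mulr_suml; apply: ler_sum => j _.
have Lvi : L2 (v i) by move: i; exact: Lv.
have Luj : L2 (u j) by move: j; exact: Lu.
have Lud := L2_mul_dtest i j tp Lu.
apply: le_trans (form_CS (ip_form mu) Lud Lvi) _.
rewrite mulrA; apply: ler_pM; [exact: fnorm_ge0|exact: fnorm_ge0| |exact: nL2_le_normL2].
apply: (@le_trans _ _ (M i j * nL2 (u j))); last first.
  by apply: ler_wpM2l => //; exact: nL2_le_normL2.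
rewrite -[M i j]ger0_norm// -sqrtr_sqr -sqrtrM ?sqr_ge0//; apply: ler_wsqrtr.
rewrite !ipE -RintegralZl//; last exact: L2_mul.
apply: le_Rintegral => //.
- exact: L2_mul.
- have := integrableZl measurableT (M i j ^+ 2) (L2_mul Luj Luj).
  by apply: eq_integrable => // x _ /=; rewrite EFinM.
move=> x _; rewrite !fctE.
rewrite (_ : _ * _ * _ = partial j (phi i) x ^+ 2 * (u j x * u j x)); last by ring.
apply: ler_wpM2r; first by rewrite -expr2 sqr_ge0.
by rewrite -[leLHS]real_normK ?num_real// ler_sqr ?nnegrE.
Qed.

Lemma quad_sub1 phi u u' v : test_field O phi -> L2field O u -> L2field O u' -> L2field O v ->
  quad phi (u - u') v = quad phi u v - quad phi u' v.
Proof.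
move=> tp Lu Lu' Lv; rewrite /quad -sumrB; apply: eq_bigr => i _.
rewrite -sumrB; apply: eq_bigr => j _.
have Lvi : L2 (v i) by move: i; exact: Lv.
rewrite -(formBl (ip_form mu) (L2_mul_dtest i j tp Lu) (L2_mul_dtest i j tp Lu') Lvi).
by apply: eq_ip => x; rewrite !fctE mulrBl.
Qed.

Lemma quad_sub2 phi u v v' : test_field O phi -> L2field O u -> L2field O v -> L2field O v' ->
  quad phi u (v - v') = quad phi u v - quad phi u v'.
Proof.
move=> tp Lu Lv Lv'; rewrite /quad -sumrB; apply: eq_bigr => i _.
rewrite -sumrB; apply: eq_bigr => j _.
have Lvi : L2 (v i) by move: i; exact: Lv.
have Lvi' : L2 (v' i) by move: i {Lvi}; exact: Lv'.
by rewrite -(formBr (ip_form mu) Lvi Lvi' (L2_mul_dtest i j tp Lu)).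
Qed.

(** Integration by parts leaves a second term, which contains the divergence of [p] and so
    vanishes. *)
Lemma tri_test p phi : solenoidal_test O p -> test_field O phi ->
  tri p p phi = - quad phi p p.
Proof.
move=> [tp dp] tphi.
have Lp i : L2 (p i) by apply: test_L2; exact: tp.
have E i j : ip mu (p j * phi i) (weak_partial O j (p i)) =
    - ip mu (p j * partial j (phi i)) (p i) - ip mu (partial j (p j)) (p i * phi i).
  have tpp : test_fun O (p j * phi i) by apply: test_funM; [exact: tp|exact: test_smooth (tphi i)].
  have tdp : test_fun O (partial j (p i)) by exact: test_fun_partial.
  rewrite (@ae_eq_ip _ _ _ mu _ (p j * phi i) _ (partial j (p i))); last 6 first.
  - exact: test_L2.
  - exact: test_L2.
  - exact: wp_L2 (test_field_inH1 tp).
  - exact: test_L2.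
  - exact: aeW.
  - exact: wp_test_ae.
  have := test_ibp j tpp (test_smooth (tp i)).
  have L1 : L2 (p j * partial j (phi i)) by apply: L2_mul_dtest => //; exact: Lp.
  have tdj : test_fun O (partial j (p j)) by exact: test_fun_partial.
  have tpi : test_fun O (p i * phi i) by apply: test_funM; [exact: tp|exact: test_smooth (tphi i)].
  have -> : \int[mu]_x (p i x * partial j (p j * phi i) x) =
     ip mu (p j * partial j (phi i)) (p i) + ip mu (partial j (p j)) (p i * phi i).
    rewrite !ipE -RintegralD//; [|exact: L2_mul|by apply: L2_mul; exact: test_L2].
    apply: eq_Rintegral => x _; rewrite partialM; [|exact: test_deriv (tp j)|exact: test_deriv (tphi i)].
    by rewrite !fctE; ring.
  move=> h; rewrite -opprD h opprK ipE; apply: eq_Rintegral => x _; exact: mulrC.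
rewrite /tri /quad; under eq_bigr => i _ do (under eq_bigr => j _ do rewrite E).
rewrite -sumrN; apply: eq_bigr => i _; rewrite sumrB sumrN.
suff -> : \sum_j ip mu (partial j (p j)) (p i * phi i) = 0 by rewrite subr0.
have tpi : test_fun O (p i * phi i) by apply: test_funM; [exact: tp|exact: test_smooth (tphi i)].
rewrite -(form_suml (ip_form mu)).
- rewrite (_ : \sum_j _ = 0); first by rewrite (form0l (ip_form mu))//; exact: test_L2.
  by apply/funext => x; rewrite fct_sumE; exact: dp.
- by move=> j; apply: test_L2; apply: test_fun_partial; exact: tp.
- exact: test_L2.
Qed.

(** Both sides are continuous for the gradient norm, so the identity for solenoidal test fields
    passes to their closure V. *)
Lemma tri_ibp u phi : inV O u -> test_field O phi -> tri u u phi = - quad phi u u.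
Proof.
move=> Vu tp; have [K K0 HK] := tri_bound; have [Kq Kq0 HKq] := quad_bound tp.
have [C C0 HC] := poincare O.
have H10u := inV_H10 Vu; have Hu := inH10_H1 H10u; have Lu := inH1_L2 Hu.
have H10p := test_field_H10 tp.
apply/eqP; rewrite -subr_eq0 opprK -normr_eq0 eq_le normr_ge0 andbT.
set D := `|_|.
pose A := K * norm_grad O phi + Kq * C ^+ 2.
have A0 : 0 <= A by rewrite addr_ge0// mulr_ge0 ?sqr_ge0 ?norm_grad_ge0// ltW.
have gu := norm_grad_ge0 u.
apply: (@small_le0 _ _ (A * (2 * norm_grad O u + 1))).
  by apply: mulr_ge0 => //; rewrite addr_ge0// mulr_ge0.
move=> e e0 e1; have [_ Hd] := Vu; have [p sp up] := Hd _ e0.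
have [tpp _] := sp; have H10pp := test_field_H10 tpp; have Hpp := test_field_inH1 tpp.
have Lpp := inH1_L2 Hpp.
have H10d : inH10 O (u - p) by exact: (formB_in (grad_form10 O)).
have Hd' := inH10_H1 H10d; have Ld := inH1_L2 Hd'.
have E : tri u u phi + quad phi u u =
  (tri (u - p) u phi + tri p (u - p) phi) + (quad phi (u - p) u + quad phi p (u - p)).
  rewrite tri_sub1// tri_sub2// quad_sub1// quad_sub2// (tri_test sp tp).
  by ring.
have gp : norm_grad O p <= norm_grad O u + e.
  have : norm_grad O p <= norm_grad O u + norm_grad O (u - p).
    rewrite !norm_gradE (fnormBC (dot_grad_form O) Hu Hpp).
    exact: (fnormB_le (dot_grad_form O)).
  by move=> h; apply: le_trans h _; rewrite lerD2l ltW.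
have g0 := norm_grad_ge0 p; have gd0 := norm_grad_ge0 (u - p); have gphi := norm_grad_ge0 phi.
have b1 := HK _ _ _ H10d Hu H10p; have b2 := HK _ _ _ H10pp Hd' H10p.
have b3 := HKq _ _ Ld Lu; have b4 := HKq _ _ Lpp Ld.
have c1 := HC _ H10u; have c2 := HC _ H10pp; have c3 := HC _ H10d.
have n1 := normL2_ge0 u; have n2 := normL2_ge0 p; have n3 := normL2_ge0 (u - p).
have b3' : normL2 O (u - p) * normL2 O u <= C ^+ 2 * (norm_grad O (u - p) * norm_grad O u).
  exact: mul_le2.
have b4' : normL2 O p * normL2 O (u - p) <= C ^+ 2 * (norm_grad O p * norm_grad O (u - p)).
  exact: mul_le2.
have b3'' := ler_wpM2l Kq0 b3'; have b4'' := ler_wpM2l Kq0 b4'.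
have Dle : D <= A * (norm_grad O (u - p) * norm_grad O u + norm_grad O p * norm_grad O (u - p)).
  rewrite /D E; apply: le_trans (ler_normD _ _) _.
  apply: le_trans (lerD (ler_normD _ _) (ler_normD _ _)) _.
  exact: trilinear_arith b1 b2 b3 b4 b3'' b4''.
apply: (le_trans Dle); exact: small_arith A0 (ltW up) gd0 gu g0 gp e1.
Qed.

End Convection.

(** * The Stokes eigenbasis *)

Section OrthogonalSums.
Variables (R : realType) (V : lmodType R) (P : set V) (b : V -> V -> R) (bP : is_form P b).
Variables (e : nat -> V) (l : nat -> R).
Hypothesis eP : forall n, P (e n).
Hypothesis be : forall m n, b (e m) (e n) = l n * (m == n)%:R.

(** One computation serves two products: [l] is 1 for [dotL2] and [lam] for [dot_grad]. *)
Definition osum (c : nat -> R) k : V := \sum_(n < k) c n *: e n.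

Lemma osumS c k : osum c k.+1 = osum c k + c k *: e k.
Proof. by rewrite /osum big_ord_recr. Qed.

Lemma osum_in c k : P (osum c k).
Proof. by apply: (form_sum_in bP) => i _; exact: (formZ_in bP). Qed.

Lemma form_osumr u c k : P u -> b u (osum c k) = \sum_(n < k) c n * b u (e n).
Proof.
move=> Pu; rewrite (form_sym bP Pu (osum_in c k)) /osum (form_suml bP) => [|i|//]; last exact: (formZ_in bP).
by apply: eq_bigr => i _; rewrite (formZl bP)// (form_sym bP).
Qed.

Lemma form_osum_e c k n : b (osum c k) (e n) = (n < k)%:R * (c n * l n).
Proof.
rewrite (form_sym bP (osum_in c k) (eP n)) form_osumr//.
have [nk|kn] := ltnP n k.
  rewrite (bigD1 (Ordinal nk))//= be eqxx mulr1 big1 ?addr0 ?mul1r// => i ik.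
  by rewrite be [_ == _]eq_sym (_ : _ == _ = false) ?mulr0 ?mulr0//; apply/negbTE; rewrite -(inj_eq val_inj) in ik.
rewrite mul0r big1// => i _; rewrite be (_ : _ == _ = false) ?mulr0//.
by apply/negbTE; rewrite gtn_eqF// (leq_trans (ltn_ord i)).
Qed.

Lemma form_osum c k : b (osum c k) (osum c k) = \sum_(n < k) l n * c n ^+ 2.
Proof.
rewrite form_osumr; last exact: osum_in.
by apply: eq_bigr => i _; rewrite form_osum_e ltn_ord mul1r expr2; ring.
Qed.

Lemma form_sub_osum u c k : P u -> (forall n, b u (e n) = l n * c n) ->
  b (u - osum c k) (u - osum c k) = b u u - \sum_(n < k) l n * c n ^+ 2.
Proof.
move=> Pu uc; rewrite (form_sqB bP Pu (osum_in c k)) form_osum form_osumr//.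
have -> : \sum_(n < k) c n * b u (e n) = \sum_(n < k) l n * c n ^+ 2.
  by apply: eq_bigr => i _; rewrite uc; ring.
ring.
Qed.

Lemma form_osumB c k m : (k <= m)%N ->
  b (osum c m - osum c k) (osum c m - osum c k) =
  \sum_(n < m) l n * c n ^+ 2 - \sum_(n < k) l n * c n ^+ 2.
Proof.
move=> km; rewrite (form_sqB bP (osum_in c m) (osum_in c k)) !form_osum form_osumr; last exact: osum_in.
have -> : \sum_(n < k) c n * b (osum c m) (e n) = \sum_(n < k) l n * c n ^+ 2.
  apply: eq_bigr => i _; rewrite form_osum_e (leq_trans (ltn_ord i) km) mul1r; ring.
ring.
Qed.

End OrthogonalSums.

Section SeriesFacts.
Variable R : realType.
Implicit Types (x l : nat -> R).

Definition wsum l x k : R := \sum_(n < k) l n * x n ^+ 2.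

Lemma wsumS l x k : wsum l x k.+1 = wsum l x k + l k * x k ^+ 2.
Proof. by rewrite /wsum big_ord_recr. Qed.

Lemma wsum_nd l x : (forall n, 0 <= l n) -> nondecreasing_seq (wsum l x).
Proof.
by move=> l0; apply/nondecreasing_seqP => k; rewrite wsumS lerDl mulr_ge0 ?sqr_ge0.
Qed.

Lemma wsum_ge0 l x k : (forall n, 0 <= l n) -> 0 <= wsum l x k.
Proof. by move=> l0; apply: sumr_ge0 => n _; rewrite mulr_ge0 ?sqr_ge0. Qed.

End SeriesFacts.

(** * Solenoidal test fields of small support *)

Section CurlBump.
Variable R : realType.
Implicit Types (h : R3 R -> R) (x : R3 R).

Definition dir_const (j : 'I_3) h := forall x (s : R), h (x + s *: basis3 R j) = h x.

Lemma dir_const_partial0 j h x : dir_const j h -> partial j h x = 0.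
Proof.
move=> hj; have D : is_derive x (basis3 R j) h 0.
  by apply: is_derive_of_line; under eq_fun do rewrite hj; exact: is_derive_cst.
exact: (@derive_val _ _ _ _ _ _ _ D).
Qed.

Lemma dir_const_partial i j h : dir_const j h -> dir_const j (partial i h).
Proof.
move=> hj x s; rewrite /partial /derive; congr (lim _).
by under eq_fun do rewrite /= hj addrA hj.
Qed.

Lemma dir_constM j h k : dir_const j h -> dir_const j k -> dir_const j (h * k).
Proof. by move=> hj kj x s; rewrite !fctE hj kj. Qed.

Lemma dir_const_flat (i j : 'I_3) (a b : R) p : i != j ->
  dir_const j (fun x => flat p (a * coord3 i x + b)).
Proof. by move=> ij x s; rewrite coord3_lineE (negbTE ij) mulr0 addr0. Qed.

(** Each factor is constant in one of the two directions, so both orders of differentiation give d_i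
    h times d_j k. A bump is such a product, and the divergence of its curl needs just this
    commutation. *)
Lemma partial_comm_prod i j h k x : smooth h -> smooth k -> dir_const j h -> dir_const i k ->
  partial j (partial i (h * k)) x = partial i (partial j (h * k)) x.
Proof.
move=> sh sk hj ki.
have -> : partial i (h * k) = partial i h * k.
  apply/funext => y; rewrite partialM; [|exact: smooth_deriv|exact: smooth_deriv].
  by rewrite (dir_const_partial0 _ ki) mulr0 addr0 !fctE.
have -> : partial j (h * k) = h * partial j k.
  apply/funext => y; rewrite partialM; [|exact: smooth_deriv|exact: smooth_deriv].
  by rewrite (dir_const_partial0 _ hj) mul0r add0r !fctE.
rewrite partialM; [|exact: smooth_deriv (smooth_partial _ sh) _ _|exact: smooth_deriv].
rewrite partialM; [|exact: smooth_deriv|exact: smooth_deriv (smooth_partial _ sk) _ _].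
rewrite (dir_const_partial0 _ (dir_const_partial i hj)) (dir_const_partial0 _ (dir_const_partial j ki)).
by rewrite mul0r add0r mulr0 addr0.
Qed.

Lemma bump_partial_comm (a b : 'I_3 -> R) (n : R) x :
  partial 1 (partial 0 (bump a b n)) x = partial 0 (partial 1 (bump a b n)) x.
Proof.
rewrite /bump big_ord_recl; apply: partial_comm_prod.
- by apply: smoothM; exact: smooth_flat.
- by apply: smooth_prod => i; apply: smoothM; exact: smooth_flat.
- by apply: dir_constM; exact: dir_const_flat.
- rewrite !big_ord_recl big_ord0 mulr1.
  by apply: dir_constM; apply: dir_constM; exact: dir_const_flat.
Qed.

End CurlBump.

Section CurlField.
Variables (R : realType) (O : bounded_domain R).
Local Notation mu := (leb_dom O).

(** The curl of (0, 0, zeta). *)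
Definition curl_field (zeta : R3 R -> R) : vfield R :=
  fun i => if i == 0 then partial 1 zeta else if i == 1 then - partial 0 zeta else cst 0.

Lemma partial_opp j (g : R3 R -> R) x : test_fun O g -> partial j (- g) x = - partial j g x.
Proof.
move=> tg; have := partial_linear j (-1) tg (test_fun0 O).
have -> : (-1) *: g + cst 0 = - g by apply/funext => y; rewrite !fctE addr0 scaleN1r.
move=> ->; rewrite !fctE scaleN1r (_ : partial j (cst 0) x = 0) ?addr0//; exact: derive_cst.
Qed.

Lemma sum_ord3 (F : 'I_3 -> R) : \sum_i F i = F 0 + F 1 + F 2%:R.
Proof.
rewrite !big_ord_recl big_ord0 addr0 addrA; congr (_ + F _ + F _); exact: val_inj.
Qed.

Lemma curl_bump_solenoidal a b : cbox a b `<=` dom O ->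
  solenoidal_test O (curl_field (bump a b (1 : R))).
Proof.
move=> abO; have tb := bump_test ltr01 abO.
have t0 := test_fun_partial 0 tb; have t1 := test_fun_partial 1 tb.
split=> [i|x].
  rewrite /curl_field; case: ifPn => _ //; case: ifPn => _; last exact: test_fun0.
  have -> : - partial 0 (bump a b 1) = (-1) *: partial 0 (bump a b 1).
    by apply/funext => x; rewrite !fctE scaleN1r.
  exact: (test_funZ (-1) t0).
rewrite sum_ord3.
have -> : curl_field (bump a b 1) 0 = partial 1 (bump a b 1) by [].
have -> : curl_field (bump a b 1) 1 = - partial 0 (bump a b 1) by [].
have -> : curl_field (bump a b 1) 2%:R = cst 0 by [].
rewrite (partial_opp _ _ t0) (_ : partial _ (cst 0) x = 0); last exact: derive_cst.
by rewrite -bump_partial_comm addr0 subrr.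
Qed.

Lemma curl_bump_out a b i x : ~ cbox a b x -> curl_field (bump a b 1) i x = 0.
Proof.
move=> hx; have bx j : partial j (bump a b 1) x = 0.
  apply: partial_near0.
  have : nbhs x (~` cbox a b) by apply: open_nbhs_nbhs; split=> //; rewrite openC; exact: closed_cbox.
  apply: filterS => y hy; apply: bump_out => //; apply: contra_not hy => h k.
  by have /andP[/ltW -> /ltW ->] := h k.
rewrite /curl_field; case: ifP => _ //; case: ifP => _ //.
by rewrite !fctE bx oppr0.
Qed.

Lemma small_cbox (d : R) : 0 < d -> exists a b : 'I_3 -> R,
  [/\ cbox a b `<=` dom O, forall i, a i < b i & b 0 - a 0 <= d /\ b 1 - a 1 <= d].
Proof.
move=> d0; have [x Ox] := dom_nonempty O; have /nbhs_ballP[e /= e0 xe] : nbhs x (dom O).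
  by apply: open_nbhs_nbhs; split=> //; exact: dom_open.
pose m := Num.min (e / 2) (d / 2); have m0 : 0 < m by rewrite lt_min !divr_gt0.
have md : m <= d / 2 by rewrite /m ge_min lexx orbT.
have me : m <= e / 2 by rewrite /m ge_min lexx.
exists (fun i => coord3 i x - m), (fun i => coord3 i x + m); split; [|by move=> i; lra|split; lra].
move=> y hy; apply: xe; have hc i : `|coord3 i x - coord3 i y| < e.
  have /andP[h1 h2] := hy i; rewrite ltr_norml; lra.
by split; [split|]; [exact: (hc 0)|exact: (hc 1)|exact: (hc 2%:R)].
Qed.

Lemma leb_dom_obox_gt0 a b : cbox a b `<=` dom O -> (forall i, a i < b i) -> (0 < mu (obox a b))%E.
Proof.
move=> abO ab; have I : obox a b `&` dom O = obox a b.
  by apply/setIidPl => x hx; apply: abO => i; have /andP[/ltW -> /ltW ->] := hx i.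
have -> : mu (obox a b) = lebesgue3 R (obox a b) by rewrite -[in RHS]I.
have -> : obox a b = (`]a 0, b 0[%classic `*` `]a 1, b 1[%classic) `*` `]a 2%:R, b 2%:R[%classic.
  apply/seteqP; split=> x /=; rewrite !in_itv/=.
    by move=> h; split; [split|]; [exact: (h 0)|exact: (h 1)|exact: (h 2%:R)].
  move=> [[h0 h1] h2]; case=> -[|[|[|//]]] p.
  - by rewrite (_ : Ordinal p = 0); [exact: h0|exact: val_inj].
  - by rewrite (_ : Ordinal p = 1); [exact: h1|exact: val_inj].
  - by rewrite (_ : Ordinal p = 2%:R); [exact: h2|exact: val_inj].
pose X : set (measurableTypeR R) := `]a 0, b 0[%classic.
pose Y : set (measurableTypeR R) := `]a 1, b 1[%classic.
pose Z : set (measurableTypeR R) := `]a 2%:R, b 2%:R[%classic; rewrite -/X -/Y -/Z.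
have mX : measurable X by exact: measurable_itv.
have mY : measurable Y by exact: measurable_itv.
have mZ : measurable Z by exact: measurable_itv.
have -> : lebesgue3 R (X `*` Y `*` Z) = (@lam2 R (X `*` Y) * lebesgue_measure Z)%E.
  by apply: product_measure1E mZ; exact: measurableX.
have -> : @lam2 R (X `*` Y) = (lebesgue_measure X * lebesgue_measure Y)%E.
  by apply: product_measure1E.
by rewrite !lebesgue_measure_itv/= !lte_fin !ab -!EFinD -!EFinM lte_fin !mulr_gt0// subr_gt0.
Qed.

(** If d_1 of the bump had zero norm, Poincare in direction 1 would make the bump vanish almost
    everywhere, but it is positive on a box of positive measure. *)
Lemma curl_bump_neq0 a b : cbox a b `<=` dom O -> (forall i, a i < b i) ->
  dotL2 O (curl_field (bump a b 1)) (curl_field (bump a b 1)) != 0.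
Proof.
move=> abO ab; apply/eqP; rewrite dotL2E => h.
have tb := bump_test ltr01 abO.
have i0 : ip mu (partial 1 (bump a b 1)) (partial 1 (bump a b 1)) = 0.
  exact: (@psumr_eq0P _ _ xpredT _ (fun i _ => ip_ge0 O (curl_field (bump a b 1) i)) h 0 isT).
have supp x : bump a b 1 x != 0 -> a 1 <= coord3 1 x <= a 1 + (b 1 - a 1).
  move=> hx; have : obox a b x by apply: contrapT => /(bump_out ltr01) h'; rewrite h' eqxx in hx.
  by move/(_ 1)/andP => [/ltW -> /ltW]; rewrite addrCA subrr addr0.
have := poincare_slab tb supp; rewrite i0 mulr0 => h1.
have ip0 : ip mu (bump a b 1) (bump a b 1) = 0 by apply/eqP; rewrite eq_le h1 ip_ge0.
have Lb := test_L2 tb.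
have : bump a b 1 = cst 0 %[ae mu].
  apply: L2_test_eq0 => // phi /test_L2 Lphi; apply/eqP; rewrite -normr_le0.
  by apply: le_trans (form_CS (ip_form mu) Lb Lphi) _; rewrite /fnorm ip0 sqrtr0 mul0r.
case=> N [mN N0 hN].
have := leb_dom_obox_gt0 abO ab; rewrite ltNge => /negP; apply.
rewrite -N0; apply: le_measure; rewrite ?inE//; first exact: measurable_obox.
move=> x hx; apply: hN => /= h'; have := bump_gt0 ltr01 hx; by rewrite h'// ltxx.
Qed.

End CurlField.

Lemma cvgn_ext (R : realType) (u v : nat -> R) (l l' : R) : v @ \oo --> l' ->
  (forall n, u n = v n) -> l = l' -> u @ \oo --> l.
Proof. by move=> + /funext -> ->. Qed.

Lemma cvg0_geP (R : realType) (u : nat -> R) : (forall n, 0 <= u n) ->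
  u @ \oo --> (0 : R) <-> forall eps : R, 0 < eps -> \forall n \near \oo, u n <= eps.
Proof.
move=> u0; split.
  move=> /cvgrPdist_le h eps eps0; apply: filterS (h _ eps0) => n.
  by rewrite sub0r normrN ger0_norm.
move=> h; apply/cvgrPdist_le => eps eps0; apply: filterS (h _ eps0) => n.
by rewrite sub0r normrN ger0_norm.
Qed.

Lemma cvgn_sum (R : realType) (I : Type) (r : seq I) (f : I -> nat -> R) (l : I -> R) :
  (forall i, f i @ \oo --> l i) -> \sum_(i <- r) f i n @[n --> \oo] --> \sum_(i <- r) l i.
Proof.
move=> h; elim: r => [|i r ih].
  by rewrite big_nil; under eq_fun do rewrite big_nil; exact: cvg_cst.
by rewrite big_cons; under eq_fun do rewrite big_cons; apply: cvgD => //; exact: h.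
Qed.

Lemma cvgn_le_cst (R : realType) (u : nat -> R) (l C : R) : u @ \oo --> l ->
  (forall n, u n <= C) -> l <= C.
Proof.
move=> ul uC; rewrite -(cvg_lim _ ul)//; apply: limr_le; first by apply/cvg_ex; exists l.
exact: nearW.
Qed.

Lemma subrK_mid (V : zmodType) (u p a b : V) : u - a = (u - p - (a - b)) + (p - b).
Proof. by rewrite opprB -addrA [(b - a) + _]addrC !subrKA. Qed.

Lemma sub_swap (V : zmodType) (a b c : V) : b = a - c -> c = a - b.
Proof. by move=> ->; rewrite subKr. Qed.

(** * Eigenfunction expansions in H and in V *)

Section Eigenbasis.
Variables (R : realType) (O : bounded_domain R).
Variables (lam : nat -> R) (e : nat -> Hspace O).
Hypothesis lam_e : stokes_eigenbasis lam e.
Local Notation mu := (leb_dom O).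
Local Notation En := (fun n => hfun (e n) : vfield R).

Definition crd (u : vfield R) (n : nat) : R := dotL2 O u (e n).
(** The squared norm |grad P_k u|^2 in coordinates. It makes sense on all of H, is weakly continuous
    and increases with k to the enstrophy; most limits of the enstrophy and of [ell] are taken
    through it. *)
Definition enk k (u : vfield R) : R := wsum lam (crd u) k.

Lemma Pk_osum k u : Pk e k u = osum En (crd u) k. Proof. by []. Qed.

Lemma eV n : inV O (e n).
Proof. by have [h _ _ _] := lam_e; case: (h n). Qed.

Lemma eL2 n : L2field O (e n). Proof. exact: hfun_L2. Qed.

Lemma orthoL2 m n : dotL2 O (e m) (e n) = 1 * (m == n)%:R.
Proof. by have [_ h _ _] := lam_e; rewrite mul1r. Qed.

Lemma eig v n : inV O v -> dot_grad O v (e n) = lam n * crd v n.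
Proof.
move=> Vv; have [h _ _ _] := lam_e; have [_ _ hn] := h n.
rewrite (form_sym (grad_formV O) Vv (eV n)) hn// (formZl (dotL2_form O) _ (eL2 n) (inV_L2 Vv)).
by rewrite /crd (form_sym (dotL2_form O) (eL2 n) (inV_L2 Vv)).
Qed.

Lemma ortho_grad m n : dot_grad O (e m) (e n) = lam n * (m == n)%:R.
Proof. by rewrite eig ?/crd ?orthoL2 ?mul1r//; exact: eV. Qed.

(** Poincare applied to e_n, whose L^2 norm is 1 and whose squared gradient norm is [lam n]. *)
Lemma lam_gt0 n : 0 < lam n.
Proof.
have [K K0 HK] := @poincare R O; have := HK _ (inV_H10 (eV n)).
have := ortho_grad n n; rewrite eqxx mulr1 => h.
have n1 : normL2 O (e n) = 1 by rewrite normL2E /fnorm orthoL2 eqxx mulr1 sqrtr1.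
rewrite n1 norm_gradE /fnorm h => h1.
by rewrite ltNge; apply/negP => /ler0_sqrtr s0; move: h1; rewrite s0 mulr0 ler10.
Qed.

Lemma lam_ge0 n : 0 <= lam n. Proof. exact: ltW (lam_gt0 n). Qed.

Lemma lam_nd m n : (m <= n)%N -> lam m <= lam n.
Proof. by have [_ _ _ h] := lam_e => /h. Qed.

Lemma osum_V c k : inV O (osum En c k).
Proof. by apply: (osum_in (grad_formV O)); exact: eV. Qed.

Lemma Pk_V k u : inV O (Pk e k u). Proof. by rewrite Pk_osum; exact: osum_V. Qed.

Lemma sub_Pk_V k u : inV O u -> inV O (u - Pk e k u).
Proof. by move=> Vu; exact: (formB_in (grad_formV O) Vu (Pk_V k u)). Qed.

Lemma norm_grad_sqr u : inH1 O u -> norm_grad O u ^+ 2 = dot_grad O u u.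
Proof. by move=> Hu; rewrite norm_gradE (fnorm_sqr (dot_grad_form O)). Qed.

Lemma normL2_sqr u : L2field O u -> normL2 O u ^+ 2 = dotL2 O u u.
Proof. by move=> Hu; rewrite normL2E (fnorm_sqr (dotL2_form O)). Qed.

Lemma norm_grad_Pk k u : norm_grad O (Pk e k u) ^+ 2 = enk k u.
Proof.
rewrite norm_grad_sqr; last exact: inV_H1 (Pk_V k u).
by rewrite Pk_osum (form_osum (grad_formV O) eV ortho_grad).
Qed.

Lemma enk_ge0 k u : 0 <= enk k u. Proof. exact: wsum_ge0 lam_ge0. Qed.

Lemma enk_nd u : nondecreasing_seq (enk^~ u). Proof. exact: wsum_nd lam_ge0. Qed.

Lemma L2_sub_Pk k u : L2field O u ->
  dotL2 O (u - Pk e k u) (u - Pk e k u) = dotL2 O u u - \sum_(n < k) crd u n ^+ 2.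
Proof.
move=> Lu; rewrite (form_sub_osum (dotL2_form O) eL2 orthoL2 k Lu (c := crd u)) => [|n]; last by rewrite mul1r.
by congr (_ - _); apply: eq_bigr => i _; rewrite mul1r.
Qed.

Lemma grad_sub_Pk k u : inV O u ->
  dot_grad O (u - Pk e k u) (u - Pk e k u) = dot_grad O u u - enk k u.
Proof. by move=> Vu; rewrite (form_sub_osum (grad_formV O) eV ortho_grad k Vu (c := crd u)) => // n; exact: eig. Qed.

Lemma bessel k u : L2field O u -> \sum_(n < k) crd u n ^+ 2 <= dotL2 O u u.
Proof. by move=> Lu; rewrite -subr_ge0 -L2_sub_Pk// dotL2_ge0. Qed.

Lemma enk_le_grad k u : inV O u -> enk k u <= norm_grad O u ^+ 2.
Proof.
move=> Vu; rewrite norm_grad_sqr; last exact: inV_H1.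
rewrite -subr_ge0 -grad_sub_Pk//; apply: (form_ge0 (grad_formV O)).
exact: sub_Pk_V.
Qed.

Lemma crd_ae u v n : L2field O u -> L2field O v -> (forall i, u i = v i %[ae mu]) -> crd u n = crd v n.
Proof.
move=> Lu Lv uv; rewrite /crd !dotL2E; apply: eq_bigr => i _.
have Le := eL2 n i; apply: (ae_eq_ip (Lu i) (Lv i) Le Le (uv i)).
by apply: filterE.
Qed.

Lemma dotL2_ae u v : L2field O u -> L2field O v -> (forall i, u i = v i %[ae mu]) ->
  dotL2 O u u = dotL2 O v v.
Proof.
move=> Lu Lv uv; rewrite !dotL2E; apply: eq_bigr => i _.
exact: (ae_eq_ip (Lu i) (Lv i) (Lu i) (Lv i) (uv i)).
Qed.

Lemma parseval u : inH O u -> \sum_(n < k) crd u n ^+ 2 @[k --> \oo] --> dotL2 O u u.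
Proof.
move=> Hu; have Lu : L2field O u by case: Hu.
(* Completeness of the basis is given for elements of [Hspace], so u is replaced by its class. *)
have [U UE] := toH Hu; have LU := hfun_L2 U.
have cE n : crd u n = crd U n by apply/esym/crd_ae.
rewrite -(dotL2_ae LU Lu UE).
under eq_fun do under eq_bigr do rewrite cE.
have [_ _ h _] := lam_e.
have h2 : dotL2 O (hfun U - Pk e k U) (hfun U - Pk e k U) @[k --> \oo] --> (0 : R).
  apply: (cvgn_ext (cvgM (h U) (h U))) => [k|]; last by rewrite mulr0.
  rewrite -normL2_sqr; first by rewrite !fctE expr2.
  by apply: L2fieldB => //; exact: inV_L2 (Pk_V k _).
apply: (cvgn_ext (cvgB (cvg_cst (dotL2 O U U)) h2)) => [k|]; last by rewrite subr0.
by rewrite !fctE L2_sub_Pk// subKr.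
Qed.

Definition lap (phi : vfield R) : vfield R := fun i => \sum_j partial j (partial j (phi i)).

Lemma sumf_test (F : 'I_3 -> R3 R -> R) : (forall j, test_fun O (F j)) -> test_fun O (\sum_j F j).
Proof.
move=> tF; elim/big_ind: _ => // [|f g]; [exact: (test_fun0 O)|exact: test_funD].
Qed.

Lemma lap_L2 phi : test_field O phi -> L2field O (lap phi).
Proof. by move=> tp i; apply: test_L2; apply: sumf_test => j; do 2! apply: test_fun_partial. Qed.

Lemma dot_grad_lap phi v : test_field O phi -> inH1 O v -> dot_grad O phi v = - dotL2 O (lap phi) v.
Proof.
move=> tp Hv; rewrite dot_gradE dotL2E -sumrN; apply: eq_bigr => i _.
have td j : test_fun O (partial j (phi i)) by exact: test_fun_partial.
have Lp := test_field_inH1 tp.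
have Lv := inH1_L2 Hv i.
rewrite (form_suml (ip_form mu)) => [|j|]; [|apply: test_L2; exact: test_fun_partial|exact: Lv].
rewrite -sumrN; apply: eq_bigr => j _.
have [Lw hw] := inH1_wp i j Hv.
rewrite (ae_eq_ip (wp_L2 i j Lp) (test_L2 (td j)) Lw Lw (wp_test_ae i j tp)); last by apply: filterE.
have C f g : ip mu f g = \int[mu]_x (g x * f x) by rewrite ipE; apply: eq_Rintegral => x _; exact: mulrC.
by rewrite !C (hw _ (td j)) opprK.
Qed.

(** By orthogonality |grad (phi - P_k phi)|^2 = (grad phi, grad (phi - P_k phi)); moving both
    derivatives onto the smooth phi bounds this by |lap phi| |phi - P_k phi|, which tends to 0 by
    Parseval in L^2. *)
Lemma grad_parseval_test phi : solenoidal_test O phi ->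
  dot_grad O (phi - Pk e k phi) (phi - Pk e k phi) @[k --> \oo] --> (0 : R).
Proof.
move=> sp; have tp : test_field O phi by case: sp.
have Vp := solenoidal_V sp; have Lp := inV_L2 Vp.
have Vd k := sub_Pk_V k Vp.
have L2d : dotL2 O (phi - Pk e k phi) (phi - Pk e k phi) @[k --> \oo] --> (0 : R).
  apply: (cvgn_ext (cvgB (cvg_cst (dotL2 O phi phi)) (parseval (inV_H Vp)))) => [k|].
    by rewrite L2_sub_Pk.
  by rewrite subrr.
have nd : normL2 O (phi - Pk e k phi) @[k --> \oo] --> (0 : R).
  by have := continuous_cvg _ (@sqrt_continuous R 0) L2d; rewrite sqrtr0; exact.
have H : normL2 O (lap phi) * normL2 O (phi - Pk e k phi) @[k --> \oo] --> (0 : R).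
  by apply: (cvgn_ext (cvgM (cvg_cst (normL2 O (lap phi))) nd)) => //; rewrite mulr0.
apply: squeeze_cvgr (cvg_cst 0) H; apply: nearW => k; apply/andP; split.
  exact: form_ge0 (grad_formV O) _ (Vd k).
have -> : dot_grad O (phi - Pk e k phi) (phi - Pk e k phi) = dot_grad O phi (phi - Pk e k phi).
  rewrite grad_sub_Pk// (formBr (grad_formV O) Vp (Pk_V k phi) Vp); congr (_ - _).
  rewrite Pk_osum (form_osumr (grad_formV O) eV _ _ Vp) /enk /wsum; apply: eq_bigr => i _.
  by rewrite eig// expr2; ring.
rewrite (dot_grad_lap tp (inV_H1 (Vd k))).
apply: le_trans (ler_norm _) _; rewrite normrN !normL2E.
exact: (form_CS (dotL2_form O) (lap_L2 tp) (inV_L2 (Vd k))).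
Qed.

Lemma PkB k u v : L2field O u -> L2field O v -> Pk e k (u - v) = Pk e k u - Pk e k v.
Proof.
move=> Lu Lv; rewrite /Pk -sumrB; apply: eq_bigr => i _.
by rewrite (formBl (dotL2_form O) Lu Lv (eL2 i)) scalerBl.
Qed.

Lemma norm_grad_sub_Pk_le k u : inV O u -> norm_grad O (u - Pk e k u) <= norm_grad O u.
Proof.
move=> Vu; have h := grad_sub_Pk k Vu; rewrite !norm_gradE /fnorm h; apply: ler_wsqrtr.
by rewrite lerBlDr lerDl enk_ge0.
Qed.

(** Density of the solenoidal test fields in V, as I - P_k does not increase the gradient norm. *)
Lemma grad_Pk_cvg u : inV O u -> norm_grad O (u - Pk e k u) @[k --> \oo] --> (0 : R).
Proof.
move=> Vu; apply/cvg0_geP => [n|eps eps0]; first exact: norm_grad_ge0.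
have e2 : 0 < eps / 2 by rewrite divr_gt0.
have [_ /(_ _ e2) [phi sp up]] := Vu.
have Vp := solenoidal_V sp.
have h : norm_grad O (phi - Pk e k phi) @[k --> \oo] --> (0 : R).
  by have := continuous_cvg _ (@sqrt_continuous R 0) (grad_parseval_test sp); rewrite sqrtr0; exact.
move/cvg0_geP : h => /(_ (fun=> norm_grad_ge0 _ _) _ e2).
apply: filterS => k hk; have Vup : inV O (u - phi) by exact: (formB_in (grad_formV O) Vu Vp).
have E : u - Pk e k u = (u - phi - Pk e k (u - phi)) + (phi - Pk e k phi).
  by rewrite (PkB k (inV_L2 Vu) (inV_L2 Vp)); exact: subrK_mid.
rewrite {}E norm_gradE; apply: le_trans (fnormD (grad_formV O) (sub_Pk_V k Vup) (sub_Pk_V k Vp)) _.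
rewrite -!norm_gradE [leRHS]splitr; apply: lerD hk.
exact: le_trans (norm_grad_sub_Pk_le k Vup) (ltW up).
Qed.

Lemma norm_grad_sub_Pk_sqr k u : inV O u ->
  norm_grad O (u - Pk e k u) ^+ 2 = norm_grad O u ^+ 2 - enk k u.
Proof.
move=> Vu; etransitivity; first exact: norm_grad_sqr (inV_H1 (sub_Pk_V k Vu)).
rewrite (grad_sub_Pk k Vu); congr (_ - _); apply/esym; exact: norm_grad_sqr (inV_H1 Vu).
Qed.

Lemma enk_cvg u : inV O u -> enk k u @[k --> \oo] --> norm_grad O u ^+ 2.
Proof.
move=> Vu; have h := grad_Pk_cvg Vu.
apply: (cvgn_ext (cvgB (cvg_cst (norm_grad O u ^+ 2)) (cvgM h h))) => [k|]; last by rewrite mulr0 subr0.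
transitivity (norm_grad O u ^+ 2 - norm_grad O (u - Pk e k u) ^+ 2).
  exact: sub_swap (norm_grad_sub_Pk_sqr k Vu).
by rewrite [_ ^+ 2 in X in _ - X]expr2.
Qed.

(** A bound L on the eigenvalues would give |grad phi|^2 <= L |phi|^2 for every solenoidal test
    field, contrary to Poincare on a thin slab. All compactness of V in H below comes from here. *)
Lemma lam_unbounded (L : R) : exists n, L < lam n.
Proof.
apply: contrapT => /forallNP lamL.
have lL n : lam n <= L by rewrite leNgt; apply/negP.
have L0 : 0 < L by exact: lt_le_trans (lam_gt0 0) (lL 0).
have gl phi : solenoidal_test O phi -> dot_grad O phi phi <= L * dotL2 O phi phi.
  move=> sp; have Vp := solenoidal_V sp.
  rewrite -norm_grad_sqr; last exact: inV_H1.
  apply: (cvgn_le_cst (enk_cvg Vp)) => k; apply: le_trans (ler_wpM2l (ltW L0) (bessel k (inV_L2 Vp))).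
  by rewrite mulr_sumr; apply: ler_sum => n _; apply: ler_wpM2r; rewrite ?sqr_ge0.
(* Chosen so that 4 d^2 L = 1/2 < 1. *)
pose d := Num.sqrt (8 * L)^-1.
have d2 : d ^+ 2 = (8 * L)^-1 by rewrite sqr_sqrtr// invr_ge0 mulr_ge0// ltW.
have d0 : 0 < d by rewrite sqrtr_gt0 invr_gt0 mulr_gt0.
have [a [b [abO ab [ab0 _]]]] := small_cbox O d0.
have sp := curl_bump_solenoidal abO; have := curl_bump_neq0 abO ab.
set z := curl_field _ in sp *; have [tz _] := sp.
apply/negP/negPn/eqP; apply/eqP; rewrite eq_le dotL2_ge0 andbT.
have bs i x : z i x != 0 -> a 0 <= coord3 0 x <= a 0 + d.
  move=> hx; have /(_ 0)/andP[-> h] : cbox a b x.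
    by apply: contrapT => /curl_bump_out => /(_ i) h; move: hx; rewrite /z h eqxx.
  by rewrite (le_trans h)// -lerBlDl.
have z1 : dotL2 O z z <= 4 * d ^+ 2 * dot_grad O z z.
  rewrite dot_grad_test// dotL2E mulr_sumr; apply: ler_sum => i _.
  apply: le_trans (poincare_slab (tz i) (bs i)) _; apply: ler_wpM2l.
    by rewrite mulr_ge0 ?sqr_ge0.
  by rewrite (bigD1 0)//= lerDl; apply: sumr_ge0 => j _; exact: ip_ge0.
have c0 : 0 <= 4 * d ^+ 2 by rewrite mulr_ge0 ?sqr_ge0.
have := le_trans z1 (ler_wpM2l c0 (gl _ sp)).
rewrite mulrA d2 (_ : 4 * (8 * L)^-1 * L = 2^-1); last by field; rewrite gt_eqF.
move: (dotL2 O z z) => t; lra.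
Qed.

Lemma normL2_sub_Pk_cvg u : inH O u -> dotL2 O (u - Pk e k u) (u - Pk e k u) @[k --> \oo] --> (0 : R).
Proof.
move=> Hu; have Lu : L2field O u by case: Hu.
apply: (cvgn_ext (cvgB (cvg_cst (dotL2 O u u)) (parseval Hu))) => [k|]; last by rewrite subrr.
exact: L2_sub_Pk.
Qed.

Lemma wpB_ae u v i j : inH1 O u -> inH1 O v ->
  weak_partial O j ((u - v) i) = weak_partial O j (u i) - weak_partial O j (v i) %[ae mu].
Proof.
move=> Hu Hv; have := wp_lin_ae (-1) i j Hv Hu.
have -> : (-1) *: v + u = u - v by rewrite scaleN1r addrC.
apply: filterS => x h /h ->; by rewrite !fctE scaleN1r addrC.
Qed.

Lemma ip_wpB u v i j : inH1 O u -> inH1 O v ->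
  ip mu (weak_partial O j (u i) - weak_partial O j (v i)) (weak_partial O j (u i) - weak_partial O j (v i))
  = ip mu (weak_partial O j ((u - v) i)) (weak_partial O j ((u - v) i)).
Proof.
move=> Hu Hv; have Huv : inH1 O (u - v) by exact: (formB_in (dot_grad_form O) Hu Hv).
have L1 := wp_L2 i j Huv.
have L2' := formB_in (ip_form mu) (wp_L2 i j Hu) (wp_L2 i j Hv).
have h := wpB_ae i j Hu Hv; apply/esym; exact: (ae_eq_ip L1 L2' L1 L2' h h).
Qed.

Lemma ip_wp_le_dot_grad u i j : ip mu (weak_partial O j (u i)) (weak_partial O j (u i)) <= dot_grad O u u.
Proof.
rewrite dot_gradE; apply: le_trans (sum_ge_term i (F := fun i => \sum_j ip mu (weak_partial O j (u i)) (weak_partial O j (u i))) _).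
  by apply: (sum_ge_term (F := fun j => ip mu (weak_partial O j (u i)) (weak_partial O j (u i)))) => k; exact: ip_ge0.
by move=> k; apply: sumr_ge0 => l _; exact: ip_ge0.
Qed.

Lemma fnorm_cvg0 (f : nat -> R3 R -> R) : ip mu (f n) (f n) @[n --> \oo] --> (0 : R) ->
  fnorm (@ip _ (R3 R) R mu) (f n) @[n --> \oo] --> (0 : R).
Proof. by move=> h; have := continuous_cvg _ (@sqrt_continuous R 0) h; rewrite sqrtr0; exact. Qed.

Lemma is_weak_partial_lim j (g h : R3 R -> R) (gn hn : nat -> R3 R -> R) :
  g \in Lfun mu 2%:E -> h \in Lfun mu 2%:E -> (forall n, gn n \in Lfun mu 2%:E) ->
  (forall n, is_weak_partial O j (gn n) (hn n)) ->
  ip mu (g - gn n) (g - gn n) @[n --> \oo] --> (0 : R) ->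
  ip mu (hn n - h) (hn n - h) @[n --> \oo] --> (0 : R) -> is_weak_partial O j g h.
Proof.
move=> Lg Lh Lgn wn /fnorm_cvg0 cg /fnorm_cvg0 ch; split=> // phi tp.
have Lp := test_L2 tp; have Ldp := test_L2 (test_fun_partial j tp).
have Lhn n : hn n \in Lfun mu 2%:E by case: (wn n).
rewrite -!ipE; apply/eqP; rewrite -subr_eq0 opprK -normr_le0.
set D := `|_|.
have H : fnorm (ip mu) (g - gn n) * fnorm (ip mu) (partial j phi) +
         fnorm (ip mu) (hn n - h) * fnorm (ip mu) phi @[n --> \oo] --> (0 : R).
  apply: (cvgn_ext (cvgD (cvgM cg (cvg_cst (fnorm (ip mu) (partial j phi)))) (cvgM ch (cvg_cst (fnorm (ip mu) phi))))) => //.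
  by rewrite !mul0r addr0.
rewrite -(cvg_lim _ H)//; apply: limr_ge; first by apply/cvg_ex; exists 0.
apply: nearW => n.
have E : ip mu g (partial j phi) + ip mu h phi = ip mu (g - gn n) (partial j phi) - ip mu (hn n - h) phi.
  rewrite (formBl (ip_form mu) Lg (Lgn n) Ldp) (formBl (ip_form mu) (Lhn n) Lh Lp).
  have [_ /(_ _ tp)] := wn n; rewrite -!ipE => ->.
  ring.
rewrite /D E; apply: le_trans (ler_normB _ _) _; apply: lerD.
  exact: (form_CS (ip_form mu) (formB_in (ip_form mu) Lg (Lgn n)) Ldp).
exact: (form_CS (ip_form mu) (formB_in (ip_form mu) (Lhn n) Lh) Lp).
Qed.

Lemma enk_cauchy u (C : R) : (forall k, enk k u <= C) -> forall eps : R, 0 < eps ->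
  \forall n \near \oo, forall m, (n <= m)%N -> enk m u - enk n u <= eps.
Proof.
move=> uC eps eps0; have nd := enk_nd u.
have c : cvgn (enk^~ u) by apply: nondecreasing_is_cvgn => //; exists C => _ [k _ <-].
move/cvgrPdist_le : (c) => /(_ _ eps0); apply: filterS => n h m nm.
have hm : enk m u <= limn (enk^~ u) by exact: nondecreasing_cvgn_le.
have := le_trans (ler_norm _) h; move: hm; set a := limn _; lra.
Qed.

Lemma dot_grad_PkB k m u : (k <= m)%N ->
  dot_grad O (Pk e m u - Pk e k u) (Pk e m u - Pk e k u) = enk m u - enk k u.
Proof. by move=> km; rewrite !Pk_osum (form_osumB (grad_formV O) eV ortho_grad _ km). Qed.

(** Increments of [enk] are squared gradient distances between projections, so the weak derivatives
    of P_k u are Cauchy in L^2, and their limits are weak derivatives of u. Membership in V thus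
    becomes a countable family of weakly continuous bounds. *)
Lemma enk_bounded_V u (C : R) : inH O u -> (forall k, enk k u <= C) -> inV O u.
Proof.
move=> Hu uC; have Lu : L2field O u by case: Hu.
have HP k : inH1 O (Pk e k u) := inV_H1 (Pk_V k u).
have G i j : exists2 g, g \in Lfun mu 2%:E &
    ip mu (weak_partial O j (Pk e n u i) - g) (weak_partial O j (Pk e n u i) - g) @[n --> \oo] --> (0 : R).
  apply: (@L2_complete _ _ _ mu (fun n => weak_partial O j (Pk e n u i))); first by move=> n; exact: wp_L2.
  move=> eps eps0; apply: filterS (enk_cauchy uC eps0) => n h m nm.
  rewrite (ip_wpB i j (HP m) (HP n)); apply: le_trans (ip_wp_le_dot_grad _ i j) _.
  by rewrite (dot_grad_PkB u nm); exact: h.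
have [g Hg] : exists g : 'I_3 -> 'I_3 -> R3 R -> R, forall i j, g i j \in Lfun mu 2%:E /\
    ip mu (weak_partial O j (Pk e n u i) - g i j) (weak_partial O j (Pk e n u i) - g i j) @[n --> \oo] --> (0 : R).
  by exists (fun i j => projT1 (cid2 (G i j))) => i j; case: cid2.
have dcv : dotL2 O (u - Pk e k u) (u - Pk e k u) @[k --> \oo] --> (0 : R) := normL2_sub_Pk_cvg Hu.
have wpu i j : is_weak_partial O j (u i) (g i j).
  have [Lg hg] := Hg i j.
  apply: (is_weak_partial_lim (Lu i) Lg (fun n => inH1_L2 (HP n) i) (fun n => inH1_wp i j (HP n)) _ hg).
  apply: squeeze_cvgr (cvg_cst 0) dcv; apply: nearW => k; apply/andP; split; first exact: ip_ge0.
  exact: (ip_le_dotL2 O (u - Pk e k u) i).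
have H1u : inH1 O u by apply: inH1I => // i j; exists (g i j).
have gcv : dot_grad O (u - Pk e k u) (u - Pk e k u) @[k --> \oo] --> (0 : R).
  apply: (@cvgn_ext _ _ (fun k => \sum_i \sum_j ip mu (weak_partial O j (Pk e k u i) - g i j) (weak_partial O j (Pk e k u i) - g i j)) _ (\sum_(i < 3) \sum_(j < 3) 0)).
  - by apply: cvgn_sum => i; apply: cvgn_sum => j; case: (Hg i j).
  - move=> k; rewrite dot_gradE; apply: eq_bigr => i _; apply: eq_bigr => j _.
    have [Lg _] := Hg i j.
    rewrite -(ip_wpB i j H1u (HP k)).
    transitivity (ip mu (g i j - weak_partial O j (Pk e k u i)) (g i j - weak_partial O j (Pk e k u i))).
      have L1 := formB_in (ip_form mu) (wp_L2 i j H1u) (wp_L2 i j (HP k)).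
      have L2' := formB_in (ip_form mu) Lg (wp_L2 i j (HP k)).
      have E : weak_partial O j (u i) - weak_partial O j (Pk e k u i) = g i j - weak_partial O j (Pk e k u i) %[ae mu].
        by apply: filterS (weak_partial_ae (wpu i j)) => x h /h; rewrite !fctE => ->.
      exact: (ae_eq_ip L1 L2' L1 L2' E E).
    by apply: eq_ip => x; rewrite !fctE -[LHS]mulrNN !opprB.
  - by rewrite big1// => i _; rewrite big1.
have H10u : inH10 O u.
  rewrite inH10E; apply: (fcl_closed (dotH1_form O) H1u); first by move=> v; exact: test_field_inH1.
  move=> eps eps0.
  have hcv : dotH1 O (u - Pk e k u) (u - Pk e k u) @[k --> \oo] --> (0 : R).
    by apply: (cvgn_ext (cvgD dcv gcv)) => //; rewrite addr0.
  have hn : fnorm (dotH1 O) (u - Pk e k u) @[k --> \oo] --> (0 : R).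
    by have := continuous_cvg _ (@sqrt_continuous R 0) hcv; rewrite sqrtr0; exact.
  have e2 : 0 < eps / 2 by rewrite divr_gt0.
  move/cvg0_geP : hn => /(_ (fun=> fnorm_ge0 _ _) _ e2) [k _ /(_ k (leqnn k)) hk].
  exists (Pk e k u); first by rewrite -inH10E; exact: inV_H10 (Pk_V k u).
  by apply: le_lt_trans hk _; rewrite ltr_pdivrMr// ltr_pMr// ltr1n.
rewrite inVE; apply: (fcl_closed (grad_form10 O) H10u).
  by move=> v /solenoidal_V/inV_H10.
move=> eps eps0.
have hn : fnorm (dot_grad O) (u - Pk e k u) @[k --> \oo] --> (0 : R).
  by have := continuous_cvg _ (@sqrt_continuous R 0) gcv; rewrite sqrtr0; exact.
have e2 : 0 < eps / 2 by rewrite divr_gt0.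
move/cvg0_geP : hn => /(_ (fun=> fnorm_ge0 _ _) _ e2) [k _ /(_ k (leqnn k)) hk].
exists (Pk e k u); first by rewrite -inVE; exact: Pk_V.
by apply: le_lt_trans hk _; rewrite ltr_pdivrMr// ltr_pMr// ltr1n.
Qed.

Lemma lam_large (L : R) : \forall n \near \oo, L < lam n.
Proof.
have [n Ln] := lam_unbounded L; exists n => //= m nm.
exact: lt_le_trans Ln (lam_nd nm).
Qed.

End Eigenbasis.

(** * Weak continuity and ultrafilters *)

Section Ultrafilters.

Lemma ultra_fmap (T U : Type) (f : T -> U) (F : set_system T) : UltraFilter F -> UltraFilter (f @ F).
Proof.
move=> uF; split; first exact: fmap_proper_filter.
move=> G pG FG; apply/seteqP; split=> [A GA|]; last exact: FG.
have [//|h] := in_ultra_setVsetC (f @^-1` A) uF.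
exfalso; apply: (@filter_not_empty _ G pG).
have : G (A `&` ~` A) by apply: filterI GA _; exact: FG.
by rewrite setICr.
Qed.

Lemma free_ultrafilter : exists U : set_system nat, UltraFilter U /\ \oo `<=` U.
Proof. exact: ultraFilterLemma. Qed.

Variables (R : realType) (I : Type) (U : set_system I).
Implicit Type r s : I -> R.

Lemma cvgF_le {pU : ProperFilter U} r (l c : R) : r @ U --> l -> (\forall i \near U, r i <= c) -> l <= c.
Proof. by move=> rl h; apply: (@closed_cvg _ _ _ _ r [set x | x <= c] _ h _ rl); exact: closed_le. Qed.

Lemma cvgF_ge {pU : ProperFilter U} r (l c : R) : r @ U --> l -> (\forall i \near U, c <= r i) -> c <= l.
Proof. by move=> rl h; apply: (@closed_cvg _ _ _ _ r [set x | c <= x] _ h _ rl); exact: closed_ge. Qed.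

Lemma cvgF_ler {pU : ProperFilter U} r s (a b : R) : r @ U --> a -> s @ U --> b ->
  (\forall i \near U, r i <= s i) -> a <= b.
Proof.
move=> ra sb h; rewrite -subr_ge0; apply: cvgF_ge (cvgB sb ra) _.
by apply: filterS h => i; rewrite !fctE subr_ge0.
Qed.

Lemma cvgF_uniq {pU : ProperFilter U} r (a b : R) : r @ U --> a -> r @ U --> b -> a = b.
Proof. by move=> ra rb; rewrite -(cvg_lim _ ra)// (cvg_lim _ rb). Qed.

Lemma ultra_lim (uU : UltraFilter U) r (C : R) : (\forall i \near U, `|r i| <= C) ->
  exists l : R, r @ U --> l.
Proof.
move=> h; have := @segment_compact R (- C) C; rewrite compact_ultra => /(_ (r @ U) (ultra_fmap r uU)).
case; last by move=> l [_ rl]; exists l.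
by apply: filterS h => i; rewrite ler_norml /= in_itv.
Qed.

End Ultrafilters.

(** * Weakly continuous functionals on H and on B *)

Section WeakTopology.
Variables (R : realType) (O : bounded_domain R).
Local Notation H := (Hspace O).
Implicit Types (F : set_system H) (h : H -> R) (u v : H).

Definition wcvg F u := forall v, dotL2 O w v @[w --> F] --> dotL2 O u v.
(** Stated for arbitrary filters, so that it applies at once to ultrafilters, to images of sequences
    and to norm neighbourhoods. *)
Definition wcont h := forall F u, Filter F -> wcvg F u -> h @ F --> h u.

Lemma wcont_cst (c : R) : wcont (cst c).
Proof. by move=> F u FF _; exact: cvg_cst. Qed.

Lemma wcontD h k : wcont h -> wcont k -> wcont (fun u => h u + k u).
Proof. by move=> ch ck F u FF Fu; apply: cvgD; [exact: ch|exact: ck]. Qed.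

Lemma wcontM h k : wcont h -> wcont k -> wcont (fun u => h u * k u).
Proof. by move=> ch ck F u FF Fu; apply: cvgM; [exact: ch|exact: ck]. Qed.

Lemma wcontZ (c : R) h : wcont h -> wcont (fun u => c * h u).
Proof. by move=> ch; apply: wcontM ch; exact: wcont_cst. Qed.

Lemma wcont_sum (I : Type) (s : seq I) (h : I -> H -> R) : (forall i, wcont (h i)) ->
  wcont (fun u => \sum_(i <- s) h i u).
Proof.
move=> ch; elim: s => [|i s ih].
  by under [X in wcont X]eq_fun do rewrite big_nil; exact: wcont_cst.
by under [X in wcont X]eq_fun do rewrite big_cons; exact: wcontD.
Qed.

Lemma wcont_comp (a : R -> R) h : continuous a -> wcont h -> wcont (fun u => a (h u)).
Proof. by move=> ca ch F u FF Fu; apply: continuous_cvg; [exact: ca|exact: ch]. Qed.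

Lemma wcont_dot (w : vfield R) : inH O w -> wcont (fun u => dotL2 O u w).
Proof.
move=> Hw; have [W WE] := toH Hw; have Lw : L2field O w by case: Hw.
have E (u : H) : dotL2 O u w = dotL2 O u W.
  rewrite !dotL2E; apply: eq_bigr => i _.
  have Lu := hfun_L2 u i; have LW := hfun_L2 W i.
  by apply: (ae_eq_ip Lu Lu (Lw i) LW) (ae_eq_sym (WE i)); exact: filterE.
move=> F u FF /(_ W) h; under eq_fun do rewrite E; rewrite E; exact: h.
Qed.

(** Norm convergence implies weak convergence; this is what makes weakly continuous functionals
    Borel. *)
Lemma wcvg_nbhs u : wcvg (nbhs u) u.
Proof.
move=> v; apply/cvgrPdist_le => eps eps0.
have Lv := hfun_L2 v; have Lu := hfun_L2 u.
have n0 : 0 < normL2 O v + 1 by apply: ltr_wpDl => //; exact: normL2_ge0.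
have := nbhsx_ballx u (eps / (normL2 O v + 1)) (divr_gt0 eps0 n0).
apply: filterS => w.
rewrite metric_structure.ballEmdist /= /mdist/= /distH => hw.
have Lw := hfun_L2 w; rewrite -(formBl (dotL2_form O) Lu Lw Lv).
apply: le_trans (form_CS (dotL2_form O) (L2fieldB Lu Lw) Lv) _; rewrite -!normL2E.
have h1 : normL2 O (hfun u - hfun w) * normL2 O v <= normL2 O (hfun u - hfun w) * (normL2 O v + 1).
  by apply: ler_wpM2l; [exact: normL2_ge0|rewrite lerDl].
by apply: le_trans h1 _; rewrite -ler_pdivlMr//; exact: ltW.
Qed.

Lemma wcont_continuous h : wcont h -> continuous h.
Proof. by move=> ch u; exact: (ch _ u _ (wcvg_nbhs (u:=u))). Qed.

Lemma wcont_meas h : wcont h -> measurable_fun setT (h : Hborel O -> R).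
Proof.
move=> /wcont_continuous ch; apply: (measurability _ (RGenOpens.measurableE R)).
move=> _ [_ [a [b ->]] <-]; rewrite setTI; apply: sub_sigma_algebra.
by move/continuousP : ch; apply; exact: interval_open.
Qed.

Variables (B : set H) (wB : weakly_compact B).

Lemma B_ultra F : UltraFilter F -> F B -> exists2 u, B u & wcvg F u.
Proof.
move=> uF FB; have := wB; rewrite /weakly_compact compact_ultra => /(_ F uF FB) [u [Bu Fu]].
exists u => // v.
have c := @initial_continuous _ _ (fun u : H => (fun v => dotL2 O u v) : prod_topology (fun _ : H => R)).
have h1 := cvg_comp _ _ Fu (c u).
have h2 := @proj_continuous H (fun _ => R) v (fun v => dotL2 O u v : R).
exact: cvg_comp h1 h2.
Qed.

(** Otherwise some sequence in B has |h(u_n)| > n, and its weak limit along a free ultrafilter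
    contradicts continuity. *)
Lemma wcont_bounded h : wcont h -> exists C : R, forall u, B u -> `|h u| <= C.
Proof.
move=> ch; apply: contrapT => /forallNP hC.
have pick n : exists u, B u /\ n%:R < `|h u|.
  apply: contrapT => /forallNP hn; apply: (hC n%:R) => u Bu.
  by rewrite leNgt; apply/negP => hu; apply: (hn u).
have [u uP] := choice pick.
have [U [uU oU]] := free_ultrafilter.
have UB : (u @ U) B.
  by apply: (@filterS _ U _ setT) => [n _|]; [case: (uP n)|exact: filterT].
have [v Bv] := B_ultra (ultra_fmap u uU) UB.
move=> /(ch _ _ _) hv; have {}hv : h (u n) @[n --> U] --> h v by exact: hv.
have hn : `|h (u n)| @[n --> U] --> `|h v| by exact: cvg_norm.
have hU : \forall n \near U, `|h v| + 1 <= `|h (u n)|.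
  have : \forall n \near \oo, `|h v| + 1 <= n%:R :> R by exact: nbhs_infty_ger.
  by move/oU; apply: filterS => n /le_trans; apply; exact: ltW (uP n).2.
have h3 : `|h v| + 1 <= `|h v| by exact: (cvgF_ge hn hU).
by move: h3; rewrite gerDl ler10.
Qed.

End WeakTopology.

(** * Tame functionals and their limits under bounded enstrophy *)

Section Tame.
Variables (R : realType) (O : bounded_domain R).
Variables (lam : nat -> R) (e : nat -> Hspace O).
Hypothesis lam_e : stokes_eigenbasis lam e.
Variables (B : set (Hspace O)) (wB : weakly_compact B).
Local Notation H := (Hspace O).
Local Notation E u := (norm_grad O u ^+ 2).
Local Notation En := (fun n => hfun (e n) : vfield R).

Definition BV : set H := [set u | B u /\ inV O u].

(** The error is harmless in two ways: it is uniformly small on families of bounded enstrophy, and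
    it integrates to O(eta) against laws of finite mean enstrophy. *)
Definition tame (G : H -> R) := forall eta : R, 0 < eta ->
  exists2 h, wcont h & forall u, BV u -> `|G u - h u| <= eta * (1 + E u).

Lemma E_ge0 (u : vfield R) : 0 <= E u. Proof. exact: sqr_ge0. Qed.

Lemma tame_wcont h : wcont h -> tame h.
Proof.
move=> ch eta eta0; exists h => // u _; rewrite subrr normr0.
by apply: mulr_ge0; [exact: ltW|apply: addr_ge0 => //; exact: E_ge0].
Qed.

Lemma half_le (R' : realType) (a b x y eta E : R') : `|a - x| <= eta / 2 * E -> `|b - y| <= eta / 2 * E ->
  `|a + b - (x + y)| <= eta * E.
Proof.
move=> h1 h2; rewrite opprD addrACA (le_trans (ler_normD _ _))//.
by rewrite (_ : eta * E = eta / 2 * E + eta / 2 * E) ?lerD// -mulrDl -splitr.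
Qed.

Lemma tameD G1 G2 : tame G1 -> tame G2 -> tame (fun u => G1 u + G2 u).
Proof.
move=> t1 t2 eta eta0; have e2 : 0 < eta / 2 by rewrite divr_gt0.
have [h1 c1 H1] := t1 _ e2; have [h2 c2 H2] := t2 _ e2.
exists (fun u => h1 u + h2 u); first exact: wcontD.
by move=> u Ku; exact: half_le (H1 u Ku) (H2 u Ku).
Qed.

Lemma tame_sum (I : Type) (s : seq I) (G : I -> H -> R) : (forall i, tame (G i)) ->
  tame (fun u => \sum_(i <- s) G i u).
Proof.
move=> ch; elim: s => [|i s ih].
  by under [X in tame X]eq_fun do rewrite big_nil; apply: tame_wcont; exact: wcont_cst.
by under [X in tame X]eq_fun do rewrite big_cons; exact: tameD.
Qed.

Lemma tame_ext G1 G2 : (forall u, BV u -> G1 u = G2 u) -> tame G1 -> tame G2.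
Proof.
move=> G12 t1 eta eta0; have [h ch hh] := t1 _ eta0; exists h => // u Ku.
by rewrite -G12//; exact: hh.
Qed.

Lemma tameZ (c : R) G : tame G -> tame (fun u => c * G u).
Proof.
move=> tG eta eta0; have c0 : 0 < `|c| + 1 by rewrite ltr_wpDl.
have [h ch hh] := tG _ (divr_gt0 eta0 c0).
exists (fun u => c * h u); first exact: wcontZ.
move=> u Ku; rewrite -mulrBr normrM; apply: le_trans (ler_wpM2l (normr_ge0 c) (hh u Ku)) _.
have E0 : 0 <= 1 + E u by apply: addr_ge0 => //; exact: E_ge0.
rewrite mulrA; apply: ler_wpM2r => //.
by rewrite mulrCA ler_piMr ?(ltW eta0)// ler_pdivrMr// mul1r lerDl.
Qed.

Lemma tameN G : tame G -> tame (fun u => - G u).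
Proof. by move=> /(tameZ (-1)); under [X in tame X -> _]eq_fun do rewrite mulN1r. Qed.

Lemma tame_bound G : tame G -> exists2 C : R, 0 <= C & forall u, BV u -> `|G u| <= C * (1 + E u).
Proof.
move=> /(_ 1 ltr01) [h ch hh]; have [C hC] := wcont_bounded wB ch.
exists (`|C| + 1); first exact: addr_ge0.
move=> u Ku; have E1 : 1 <= 1 + E u by rewrite lerDl; exact: E_ge0.
rewrite -[G u](subrK (h u)) mulrDl addrC; apply: le_trans (ler_normD _ _) _; apply: lerD; last exact: hh.
have h1 := hC u Ku.1; apply: le_trans h1 _; apply: le_trans (ler_norm _) _.
by rewrite ler_peMr.
Qed.

Lemma clampP (R' : realType) (A a x : R') : `|a| <= A ->
  `|Num.max (- A) (Num.min A x)| <= A /\ `|a - Num.max (- A) (Num.min A x)| <= `|a - x|.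
Proof.
move=> aA; have := aA; rewrite ler_norml => /andP[a1 a2]; have A0 := le_trans (normr_ge0 _) aA.
have [h1|h1] := leP A x; rewrite ?(min_l h1) ?(min_r (ltW h1)).
  have AA : - A <= A by lra.
  rewrite (max_r AA).
  by split; [rewrite ger0_norm|rewrite distrC [leRHS]distrC !ger0_norm; lra].
have [h2|h2] := leP x (- A); rewrite ?(max_l h2) ?(max_r (ltW h2)).
  by split; [rewrite normrN ger0_norm|rewrite !ger0_norm; lra].
by split => //; rewrite ler_norml; apply/andP; split; lra.
Qed.

Lemma clamp_continuous (R' : realType) (A : R') : continuous (fun x : R' => Num.max (- A) (Num.min A x)).
Proof.
move=> x; apply: (@continuous_max R' R' (cst (- A)) (cst A \min idfun) x); first exact: cvg_cst.
by apply: (@continuous_min R' R' (cst A) idfun x); [exact: cvg_cst|exact: cvg_id].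
Qed.

Lemma mul_approx (R' : realType) (a g x y C A d1 d2 eta E : R') : `|a| <= A -> 0 <= A -> 0 <= C ->
  `|g - y| <= d1 * E -> `|y| <= C -> `|a - x| <= d2 * E -> A * d1 + C * d2 <= eta -> 0 <= E ->
  `|a * g - x * y| <= eta * E.
Proof.
move=> ha A0 C0 hg hy hx hd E0.
have -> : a * g - x * y = a * (g - y) + y * (a - x) by ring.
apply: le_trans (ler_normD _ _) _; rewrite !normrM.
apply: (@le_trans _ _ (A * (d1 * E) + C * (d2 * E))); first by apply: lerD; apply: ler_pM.
by rewrite !mulrA -mulrDl ler_wpM2r.
Qed.

Lemma tameM a G (A : R) : (forall u, BV u -> `|a u| <= A) -> tame a -> tame G ->
  tame (fun u => a u * G u).
Proof.
move=> aA ta tG eta eta0.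
have [->|/set0P[u0 Ku0]] := eqVneq BV set0.
  by exists (cst 0) => [|//]; exact: wcont_cst.
have A0 : 0 <= A := le_trans (normr_ge0 _) (aA _ Ku0).
have d10 : 0 < eta / (2 * (A + 1)) by rewrite divr_gt0// mulr_gt0// ltr_wpDl.
(* The approximant of [G] comes first: its bound [C] on B then fixes the accuracy required of the
   approximant of [a]. *)
have [h ch hh] := tG _ d10; have [C hC] := wcont_bounded wB ch.
have C0 : 0 <= C := le_trans (normr_ge0 _) (hC _ Ku0.1).
have d20 : 0 < eta / (2 * (C + 1)) by rewrite divr_gt0// mulr_gt0// ltr_wpDl.
have [k ck hk] := ta _ d20.
exists (fun u => Num.max (- A) (Num.min A (k u)) * h u).
  by apply: wcontM => //; exact: (wcont_comp (@clamp_continuous R A) ck).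
move=> u Ku; have [_ cl] := clampP (k u) (aA u Ku).
have cl' := le_trans cl (hk u Ku).
have E0 : 0 <= 1 + E u by apply: addr_ge0 => //; exact: E_ge0.
apply: (mul_approx (aA u Ku) A0 C0 (hh u Ku) (hC u Ku.1) cl' _ E0).
have half (x : R) : 0 <= x -> x * (eta / (2 * (x + 1))) <= eta / 2.
  move=> x0; have x1 : 0 < x + 1 by rewrite ltr_wpDl.
  rewrite (_ : x * _ = eta / 2 * (x / (x + 1))); last by field; rewrite gt_eqF.
  by rewrite ler_piMr ?divr_ge0 ?(ltW eta0)// ler_pdivrMr// mul1r lerDl.
by rewrite [leRHS]splitr lerD// half.
Qed.

Lemma wcont_crd n : wcont (fun u : H => crd e u n).
Proof. by apply: wcont_dot; exact: (inV_H (eV lam_e n)). Qed.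

Lemma wcont_enk k : wcont (fun u : H => enk lam e k u).
Proof.
apply: wcont_sum => i; apply: wcontZ.
by under [X in wcont X]eq_fun do rewrite expr2; apply: wcontM; exact: wcont_crd.
Qed.

Lemma BV_enk_le k u : BV u -> enk lam e k u <= E u.
Proof. by move=> [_ Vu]; exact: enk_le_grad. Qed.

Lemma dist3_le (R' : realType) (a b x y eps : R') : `|a - x| <= eps / 4 -> `|b - y| <= eps / 4 ->
  `|x - y| <= eps / 2 -> `|a - b| <= eps.
Proof.
rewrite !ler_norml => /andP[? ?] /andP[? ?] /andP[? ?].
apply/andP; split; lra.
Qed.

(** The [enk] are weakly continuous, so the limit inherits their bounds and lies in V; lower
    semicontinuity of the enstrophy follows by letting k grow. Tame functionals converge because
    their error is uniform under the bound C. *)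
Lemma BV_limit (I : Type) (U : set_system I) (u : I -> H) (C : R) : UltraFilter U ->
  (\forall i \near U, BV (u i) /\ E (u i) <= C) ->
  exists v, [/\ BV v, forall c : R, (\forall i \near U, E (u i) <= c) -> E v <= c &
    forall G, tame G -> G (u i) @[i --> U] --> G v].
Proof.
move=> uU hU; have UB : (u @ U) B by apply: filterS hU => i [[]].
have [v Bv cv] := B_ultra wB (ultra_fmap u uU) UB.
have wc h : wcont h -> h (u i) @[i --> U] --> h v by move=> ch; exact: (ch (u @ U) v _ cv).
have UV : \forall i \near U, BV (u i) by apply: filterS hU => i [].
have Hv : inH O v := hclass_inH v.
have Vv : inV O v.
  apply: (enk_bounded_V lam_e (C := C) Hv) => k.
  apply: (cvgF_le (wc _ (@wcont_enk k))).
  by apply: filterS hU => i [Ki h]; exact: le_trans (BV_enk_le k Ki) h.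
have lE (c : R) : (\forall i \near U, E (u i) <= c) -> E v <= c.
  move=> hc; apply: (cvgn_le_cst (enk_cvg lam_e Vv)) => k.
  apply: (cvgF_le (wc _ (@wcont_enk k))).
  by apply: filterS2 hc UV => i h Ki; exact: le_trans (BV_enk_le k Ki) h.
have EC : E v <= C by apply: lE; apply: filterS hU => i [].
exists v; split=> //.
move=> G tG; apply/cvgrPdist_le => eps eps0.
have C0 : 0 <= C.
  by have [i [_ h]] := filter_ex hU; apply: le_trans h; exact: E_ge0.
have CC : 0 < 4 * (1 + C) by rewrite mulr_gt0// ltr_pwDl.
have [h ch hh] := tG _ (divr_gt0 eps0 CC).
have e2 : 0 < eps / 2 by rewrite divr_gt0.
have /cvgrPdist_le/(_ _ e2) h1 := wc _ ch.
apply: filterS2 h1 hU => i h1 [Ki Ei].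
have b1 := hh v (conj Bv Vv); have b2 := hh _ Ki.
have q (x : R) : x <= C -> eps / (4 * (1 + C)) * (1 + x) <= eps / 4.
  move=> xC; rewrite invfM mulrA -mulrA ler_piMr//; first by rewrite divr_ge0// ltW.
  by rewrite mulrC ler_pdivrMr ?mul1r ?lerD2l// ltr_pwDl.
have b1' := le_trans b1 (q _ EC).
have b2' := le_trans b2 (q _ Ei).
exact: dist3_le b1' b2' h1.
Qed.

End Tame.

(** * Functionals that are weakly continuous up to the enstrophy *)

Lemma amgm_sq (R : realType) (y w r : R) : r ^+ 2 <= y * w -> (2 * r) ^+ 2 <= (y + w) ^+ 2.
Proof.
move=> h; have := sqr_ge0 (y - w).
rewrite (_ : (y + w) ^+ 2 = (y - w) ^+ 2 + 4 * (y * w)); last by ring.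
rewrite (_ : (2 * r) ^+ 2 = 4 * r ^+ 2); last by ring.
lra.
Qed.

Section TameFunctionals.
Variables (R : realType) (O : bounded_domain R).
Variables (lam : nat -> R) (e : nat -> Hspace O).
Hypothesis lam_e : stokes_eigenbasis lam e.
Variables (B : set (Hspace O)) (wB : weakly_compact B).
Local Notation H := (Hspace O).
Local Notation E u := (norm_grad O u ^+ 2).
Local Notation En := (fun n => hfun (e n) : vfield R).
Local Notation BV := (BV B).
Local Notation tame := (tame B).

Lemma small_tail (c : nat -> R) (K eta : R) : 0 < eta -> (forall L : R, \forall n \near \oo, L < c n) ->
  0 <= K -> exists n, 0 < c n /\ K / c n <= eta.
Proof.
move=> eta0 cL K0; have [n _ /(_ n (leqnn n)) hn] := cL (K / eta).
have cn0 : 0 < c n by apply: le_lt_trans hn; rewrite divr_ge0// ltW.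
exists n; split=> //; rewrite ler_pdivrMr//.
by move: hn; rewrite ltr_pdivrMr// mulrC => /ltW.
Qed.

(** The modes from k on have eigenvalues of at least lam k: the compact embedding of V in H in
    quantitative form. *)
Lemma L2_tail k (u : vfield R) : inV O u ->
  lam k * dotL2 O (u - Pk e k u) (u - Pk e k u) <= E u.
Proof.
move=> Vu; have Lu := inV_L2 Vu; rewrite (L2_sub_Pk lam_e k Lu).
have step m : (k <= m)%N -> lam k * (\sum_(n < m) crd e u n ^+ 2 - \sum_(n < k) crd e u n ^+ 2)
    <= enk lam e m u - enk lam e k u.
  move=> /subnKC <-; elim: (m - k)%N => [|j ih]; first by rewrite addn0 !subrr mulr0.
  rewrite addnS big_ord_recr /enk wsumS /= [in leRHS]addrAC [X in lam k * X]addrAC mulrDr; apply: lerD ih _.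
  by rewrite ler_wpM2r ?sqr_ge0//; apply: (lam_nd lam_e); exact: leq_addr.
have cv : lam k * (\sum_(n < m) crd e u n ^+ 2 - \sum_(n < k) crd e u n ^+ 2) @[m --> \oo]
    --> lam k * (dotL2 O u u - \sum_(n < k) crd e u n ^+ 2).
  apply: cvgM; first exact: cvg_cst.
  by apply: cvgB; [exact: (parseval lam_e (inV_H Vu))|exact: cvg_cst].
have h : \forall m \near \oo, lam k * (\sum_(n < m) crd e u n ^+ 2 - \sum_(n < k) crd e u n ^+ 2) <= E u.
  exists k => // m km; apply: le_trans (step m km) _.
  apply: (@le_trans _ _ (enk lam e m u)); first by rewrite gerBl; exact: (enk_ge0 lam_e).
  exact: (enk_le_grad lam_e).
by apply: (cvgF_le cv h).
Qed.

Lemma L2_le_E (u : vfield R) : inV O u -> lam 0 * dotL2 O u u <= E u.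
Proof.
by move=> Vu; have := L2_tail 0 Vu; rewrite /Pk big_ord0 subr0.
Qed.

Definition N (u : vfield R) : R := dotL2 O u u.

Lemma N_ge0 u : 0 <= N u. Proof. exact: dotL2_ge0. Qed.

Definition Npart k (u : vfield R) : R := \sum_(n < k) crd e u n ^+ 2.

Lemma wcont_Npart k : wcont (fun u : H => Npart k u).
Proof.
apply: wcont_sum => i.
by under [X in wcont X]eq_fun do rewrite expr2; apply: wcontM; exact: (wcont_crd lam_e (n := i)).
Qed.

Lemma N_tail k (u : vfield R) : inV O u -> 0 <= N u - Npart k u <= (lam k)^-1 * E u.
Proof.
move=> Vu; rewrite /N /Npart -(L2_sub_Pk lam_e k (inV_L2 Vu)) dotL2_ge0/=.
rewrite mulrC ler_pdivlMr; last exact: (lam_gt0 lam_e).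
by rewrite mulrC; exact: L2_tail.
Qed.

Lemma unif_cont (a : R -> R) (r eps : R) : continuous a -> 0 < eps ->
  exists2 d : R, 0 < d & forall x y, 0 <= x <= r -> 0 <= y <= r -> `|x - y| < d -> `|a x - a y| <= eps.
Proof.
move=> ca eps0; apply: contrapT => hn.
have pick n : exists xy : R * R, [/\ 0 <= xy.1 <= r, 0 <= xy.2 <= r,
    `|xy.1 - xy.2| < n.+1%:R^-1 & eps < `|a xy.1 - a xy.2|].
  apply: contrapT => /forallNP hx; apply: hn; exists n.+1%:R^-1 => [|x y x1 y1 xy]; first by rewrite invr_gt0.
  by rewrite leNgt; apply/negP => h; apply: (hx (x, y)).
have [xy xyP] := choice pick.
have [U [uU oU]] := free_ultrafilter.
have [l xl] : exists l : R, (xy n).1 @[n --> U] --> l.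
  apply: (ultra_lim uU (C := r)); apply: (@filterS _ U _ setT) => [n _|]; last exact: filterT.
  by have [/andP[h1 h2] _ _ _] := xyP n; rewrite ger0_norm.
have [l' yl] : exists l : R, (xy n).2 @[n --> U] --> l.
  apply: (ultra_lim uU (C := r)); apply: (@filterS _ U _ setT) => [n _|]; last exact: filterT.
  by have [_ /andP[h1 h2] _ _] := xyP n; rewrite ger0_norm.
have ll' : l = l'.
  have d0 : `|(xy n).1 - (xy n).2| @[n --> U] --> (0 : R).
    have : `|(xy n).1 - (xy n).2| @[n --> \oo] --> (0 : R).
      apply: squeeze_cvgr (cvg_cst 0) (@cvg_inv_nat R); apply: nearW => n.
      by have [_ _ /ltW -> _] := xyP n; rewrite normr_ge0.
    by move=> h; apply: cvg_trans h; exact: cvg_app.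
  have d1 : `|(xy n).1 - (xy n).2| @[n --> U] --> `|l - l'| by apply: cvg_norm; exact: cvgB.
  have : `|l - l'| = 0 by exact: (cvgF_uniq d1 d0).
  by move/normr0_eq0/subr0_eq.
have d1 : `|a (xy n).1 - a (xy n).2| @[n --> U] --> `|a l - a l'|.
  by apply: cvg_norm; apply: cvgB; [apply: continuous_cvg xl; exact: ca|apply: continuous_cvg yl; exact: ca].
have h : \forall n \near U, eps <= `|a (xy n).1 - a (xy n).2|.
  by apply: (@filterS _ U _ setT) => [n _|]; [have [_ _ _ /ltW] := xyP n|exact: filterT].
have : eps <= `|a l - a l'| by exact: (cvgF_ge d1 h).
by rewrite ll' subrr normr0 leNgt eps0.
Qed.

(** Three cases. If N u > r, then E u is so large that the trivial bound 2 A suffices. If the tail N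
    u - Npart k u is below d, uniform continuity on [0, r] applies. Otherwise [N_tail] makes E u at
    least d lam k, and 2 A suffices again. *)
Lemma tame_aN (a : R -> R) (A : R) : continuous a -> (forall x, 0 <= x -> `|a x| <= A) -> 
  tame (fun u => a (N u)).
Proof.
move=> ca aA eta eta0.
have A0 : 0 <= A := le_trans (normr_ge0 _) (aA 0 (lexx _)).
have l0 := lam_gt0 lam_e 0.
pose r := 2 * A / (eta * lam 0).
have [d d0 hd] := unif_cont r ca eta0.
have K0 : 0 <= 2 * A / d by rewrite divr_ge0 ?mulr_ge0// ltW.
have [k [lk hk]] := @small_tail lam (2 * A / d) eta eta0 (lam_large lam_e) K0.
exists (fun u : H => a (Npart k u)); first exact: (wcont_comp ca (@wcont_Npart k)).
move=> u [_ Vu].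
have E0 : 0 <= E u := E_ge0 _ _.
have /andP[t1 t2] := N_tail k Vu.
have Nk0 : 0 <= Npart k u by apply: sumr_ge0 => n _; rewrite sqr_ge0.
have a1 := aA _ (N_ge0 u); have a2 := aA _ Nk0.
have big : `|a (N u) - a (Npart k u)| <= 2 * A.
  by apply: le_trans (ler_normB _ _) _; rewrite mulrDl mul1r lerD.
have LE := L2_le_E Vu; rewrite -/(N u) in LE.
move: (E u) (N u) (Npart k u) E0 t1 t2 Nk0 a1 a2 big LE => {u Vu} x n m E0 t1 t2 Nk0 a1 a2 big LE.
have [rn|nr] := ltP r n.
  apply: le_trans big _; move: rn; rewrite /r ltr_pdivrMr ?mulr_gt0// => rn.
  have h : eta * (lam 0 * n) <= eta * x by rewrite ler_wpM2l// ltW.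
  by rewrite mulrDr mulr1; lra.
have [dm|md] := ltP (n - m) d.
  apply: (@le_trans _ _ eta); last by apply: ler_peMr; [exact: ltW|rewrite lerDl].
  apply: hd; rewrite ?(N_ge0 u) ?nr ?Nk0 ?andbT//=; [by lra|by lra|by rewrite ger0_norm].
apply: le_trans big _.
have h1 : d <= (lam k)^-1 * x := le_trans md t2.
have h2 : 2 * A / d / lam k * x <= eta * x by rewrite ler_wpM2r.
have h3 : 2 * A / d * d <= 2 * A / d * ((lam k)^-1 * x) by rewrite ler_wpM2l// divr_ge0 ?mulr_ge0// ltW.
rewrite -mulrA mulVf ?gt_eqF// mulr1 in h3.
by rewrite mulrDr mulr1; move: h2 h3; rewrite mulrA; lra.
Qed.

Lemma dual_osum (L : vfield R -> R) c k : inVdual O L -> L (osum En c k) = \sum_(n < k) c n * L (e n).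
Proof.
move=> [Llin _]; have L0 : L 0 = 0.
  have := Llin 1 0 0 (inV_0 O) (inV_0 O); rewrite scaler0 addr0 mul1r => /eqP.
  by rewrite -[X in X == _]addr0 (inj_eq (addrI _)) => /eqP.
elim: k => [|k ih]; first by rewrite /osum !big_ord0.
rewrite osumS addrC Llin ?ih; [by rewrite [in RHS]big_ord_recr addrC|exact: (eV lam_e)|exact: (osum_V lam_e)].
Qed.

(* The coefficients [L (e n) / lam n] represent [L] in V, so [L (e n)^2 / lam n] is summable. *)
Lemma dual_summable (L : vfield R -> R) : inVdual O L ->
  exists C : R, forall k, wsum (fun n => (lam n)^-1) (fun n => L (e n)) k <= C.
Proof.
move=> dL; have [Llin [C LC]] := dL; exists (C ^+ 2) => k.
set s := wsum _ _ _.
have s0 : 0 <= s by apply: wsum_ge0 => n; rewrite invr_ge0; exact: (lam_ge0 lam_e).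
pose c n := L (e n) / lam n; pose v := osum En c k.
have Vv : inV O v := osum_V lam_e c k.
have Lv : L v = s.
  by rewrite /v dual_osum// /s /wsum; apply: eq_bigr => n _; rewrite /c expr2; ring.
have gv : dot_grad O v v = s.
  rewrite (form_osum (grad_formV O) (eV lam_e) (ortho_grad lam_e)) /s /wsum.
  by apply: eq_bigr => n _; rewrite /c; field; rewrite gt_eqF// (lam_gt0 lam_e).
have := LC v Vv; rewrite Lv norm_gradE /fnorm gv ger0_norm// => h.
have s2 : s ^+ 2 <= C ^+ 2 * s.
  have := h; rewrite -(ler_pXn2r (n := 2)) ?nnegrE//; last exact: le_trans h.
  by rewrite exprMn sqr_sqrtr.
have [->|sn] := eqVneq s 0; first exact: sqr_ge0.
have sp : 0 < s by rewrite lt_def sn.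
by rewrite -(ler_pM2r sp) -expr2.
Qed.

(** Cauchy-Schwarz on the block of indices from k to m, with weights l and 1 / l, proved by adding
    one term at a time. *)
Lemma dual_tail_CS (a x l : nat -> R) k m : (forall n, 0 < l n) -> (k <= m)%N ->
  (\sum_(n < m) x n * a n - \sum_(n < k) x n * a n) ^+ 2 <=
  (wsum (fun n => (l n)^-1) a m - wsum (fun n => (l n)^-1) a k) * (wsum l x m - wsum l x k).
Proof.
move=> l0 km.
pose A j := wsum (fun n => (l n)^-1) a (k + j) - wsum (fun n => (l n)^-1) a k.
pose X j := wsum l x (k + j) - wsum l x k.
pose S j := \sum_(n < (k + j)%N) x n * a n - \sum_(n < k) x n * a n.
suff H j : [/\ 0 <= A j, 0 <= X j & S j ^+ 2 <= A j * X j].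
  by rewrite -(subnKC km); case: (H (m - k)%N).
elim: j => [|j [A0 X0 ih]]; first by rewrite /A /X /S addn0 !subrr expr2 !mul0r.
set n := (k + j)%N.
have eA : A j.+1 = A j + (l n)^-1 * a n ^+ 2 by rewrite /A addnS wsumS addrAC.
have eX : X j.+1 = X j + l n * x n ^+ 2 by rewrite /X addnS wsumS addrAC.
have eS : S j.+1 = S j + x n * a n by rewrite /S addnS big_ord_recr addrAC.
rewrite eA eX eS; have ln := l0 n.
have p0 : 0 <= (l n)^-1 * a n ^+ 2 by rewrite mulr_ge0 ?sqr_ge0// invr_ge0 ltW.
have q0 : 0 <= l n * x n ^+ 2 by rewrite mulr_ge0 ?sqr_ge0// ltW.
split; [exact: addr_ge0|exact: addr_ge0|].
have pq : (l n)^-1 * a n ^+ 2 * (l n * x n ^+ 2) = (x n * a n) ^+ 2 by field; rewrite gt_eqF.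
move: (A j) (X j) (S j) (x n * a n) ((l n)^-1 * a n ^+ 2) (l n * x n ^+ 2) A0 X0 ih p0 q0 pq => a' b s t p q a0 b0 ih p0 q0 pq.
suff h : 2 * (s * t) <= a' * q + p * b.
  by rewrite sqrrD mulrDl !mulrDr pq -mulr_natl; lra.
have h2 : (s * t) ^+ 2 <= (a' * q) * (p * b).
  by rewrite exprMn -pq (_ : a' * q * (p * b) = a' * b * (p * q)); [rewrite ler_wpM2r// mulr_ge0|ring].
have z0 : 0 <= a' * q + p * b by rewrite addr_ge0// mulr_ge0.
apply: le_trans (ler_norm _) _; rewrite -[leRHS]ger0_norm// -ler_sqr ?nnegrE// !real_normK ?num_real//.
exact: amgm_sq h2.
Qed.

Lemma abs_le_of_sq (x d t : R) : 0 <= d -> 0 <= t -> x ^+ 2 <= d ^+ 2 * t -> `|x| <= d * (1 + t).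
Proof.
move=> d0 t0 h; have dt : 0 <= d * (1 + t) by rewrite mulr_ge0// addr_ge0.
rewrite -[leRHS]ger0_norm// -ler_sqr ?nnegrE// !real_normK ?num_real//.
apply: le_trans h _; rewrite exprMn ler_wpM2l ?sqr_ge0// sqrrD expr1n mul1r.
by have := sqr_ge0 t; rewrite -mulr_natl; lra.
Qed.

(** The approximant is L (P_k u), a finite sum of coordinates. By [dual_summable] the rest of L has
    dual norm at most eta once k is large. *)
Lemma tame_dual (L : vfield R -> R) : inVdual O L -> tame (fun u => L u).
Proof.
move=> dL eta eta0; have [Llin [CL LC]] := dL.
have [C hC] := dual_summable dL.
pose a n := L (e n); pose l n := lam n.
have l0 n : 0 < l n := lam_gt0 lam_e n.
have w0 : nondecreasing_seq (wsum (fun n => (lam n)^-1) a).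
  by apply: wsum_nd => n; rewrite invr_ge0 ltW.
have c : cvgn (wsum (fun n => (lam n)^-1) a).
  by apply: nondecreasing_is_cvgn => //; exists C => _ [k _ <-].
have e20 : 0 < eta ^+ 2 by rewrite exprn_gt0.
move/cvgrPdist_le : (c) => /(_ _ e20) [k _ /(_ k (leqnn k)) hk].
exists (fun u : H => \sum_(n < k) crd e u n * a n).
  apply: wcont_sum => n; apply: wcontM; first exact: (wcont_crd lam_e (n := n)).
  exact: wcont_cst.
move=> u [_ Vu].
have LP m : L (Pk e m u) = \sum_(n < m) crd e u n * a n by rewrite Pk_osum dual_osum.
have b m : (k <= m)%N -> `|L (Pk e m u) - \sum_(n < k) crd e u n * a n| <= eta * (1 + E u).
  move=> km; apply: abs_le_of_sq; [exact: ltW|exact: E_ge0|].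
  rewrite LP; apply: le_trans (dual_tail_CS a (crd e u) l0 km) _.
  apply: ler_pM.
  - by rewrite subr_ge0; exact: w0.
  - by rewrite subr_ge0; apply: wsum_nd km => n; exact: ltW.
  - apply: le_trans hk; apply: le_trans (ler_norm _); rewrite lerD2r.
    exact: nondecreasing_cvgn_le.
  - apply: (@le_trans _ _ (enk lam e m u)); last exact: (enk_le_grad lam_e).
    by rewrite gerBl; exact: (enk_ge0 lam_e).
have cv : L (Pk e m u) @[m --> \oo] --> L u.
  apply/subr_cvg0; apply/cvgrPdist_le => eps eps0.
  have h : `|CL| * norm_grad O (hfun u - Pk e m u) @[m --> \oo] --> (0 : R).
    by apply: (cvgn_ext (cvgM (cvg_cst `|CL|) (grad_Pk_cvg lam_e Vu))) => //; rewrite mulr0.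
  move/cvgrPdist_le : h => /(_ _ eps0); apply: filterS => m; rewrite !sub0r !normrN => h.
  have Vd := sub_Pk_V lam_e m Vu.
  have E1 : L (Pk e m u) - L u = - L (hfun u - Pk e m u).
    have := Llin (-1) (hfun u - Pk e m u) u Vd Vu.
    have -> : -1 *: (hfun u - Pk e m u) + hfun u = Pk e m u by rewrite scaleN1r opprB subrK.
    by move=> ->; rewrite mulN1r addrK.
  rewrite E1 normrN; apply: le_trans (LC _ Vd) _; apply: le_trans (ler_norm _) _.
  by rewrite normrM; move: h; rewrite normrM normr_id.
have cv' : `|L (Pk e m u) - \sum_(n < k) crd e u n * a n| @[m --> \oo] -->
     `|L u - \sum_(n < k) crd e u n * a n|.
  by apply: cvg_norm; apply: cvgB => //; exact: cvg_cst.
have h : \forall m \near \oo, `|L (Pk e m u) - \sum_(n < k) crd e u n * a n| <= eta * (1 + E u).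
  by exists k.
by apply: (cvgF_le cv' h).
Qed.

Lemma dual_dot_grad w : inV O w -> inVdual O (fun u => dot_grad O u w).
Proof.
move=> Vw; split=> [a u v Vu Vv|]; first exact: (form_linl (grad_formV O)).
exists (norm_grad O w) => u Vu; rewrite mulrC !norm_gradE; exact: (form_CS (grad_formV O)).
Qed.

End TameFunctionals.

Lemma cvg_row (R : realType) (I : Type) (F : set_system I) m (r : I -> 'rV[R]_m) (l : 'rV[R]_m) :
  Filter F -> (forall j, r i 0 j @[i --> F] --> l 0 j) -> r @ F --> l.
Proof.
move=> FF h A [P Pn PA].
have : \forall i \near F, forall j, P 0 j (r i 0 j).
  by apply: filter_forall => j; exact: (h j _ (Pn 0 j)).
by apply: filterS => i hi; apply: PA => k j; rewrite ord1; exact: hi.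
Qed.

Lemma tri_quad_arith (R : realType) (Kq n1 n2 n3 q1 q2 : R) : 0 <= Kq -> q1 <= Kq * (n1 * n2) ->
  q2 <= Kq * (n3 * n1) -> n3 <= n2 -> 0 <= n1 -> q1 + q2 <= 2 * Kq * (n1 * n2).
Proof.
move=> K0 h1 h2 h3 n0; have : Kq * (n3 * n1) <= Kq * (n1 * n2).
  by rewrite ler_wpM2l// mulrC ler_wpM2l.
by rewrite mulrDl mulrDl !mul1r; lra.
Qed.

Lemma quad_small_arith (R : realType) (Kq lk l0 n1 n2 E eta : R) : 0 <= Kq -> 0 < lk -> 0 < l0 ->
  0 <= n1 -> 0 <= n2 -> lk * n1 ^+ 2 <= E -> l0 * n2 ^+ 2 <= E -> 0 < eta ->
  (2 * Kq) ^+ 2 / l0 / eta ^+ 2 / lk <= 1 -> 2 * Kq * (n1 * n2) <= eta * (1 + E).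
Proof.
move=> K0 lk0 l00 n10 n20 h1 h2 eta0 h.
have E0 : 0 <= E by apply: le_trans h1; rewrite mulr_ge0 ?sqr_ge0// ltW.
have E10 : 0 <= eta * E by rewrite mulr_ge0// ltW.
apply: (@le_trans _ _ (eta * E)); last by apply: ler_wpM2l; [exact: ltW|rewrite lerDr].
rewrite -ler_sqr ?nnegrE// ?mulr_ge0//.
have p : (lk * n1 ^+ 2) * (l0 * n2 ^+ 2) <= E * E.
  by apply: ler_pM => //; rewrite mulr_ge0 ?sqr_ge0// ltW.
have -> : (2 * Kq * (n1 * n2)) ^+ 2 = (2 * Kq) ^+ 2 / l0 / eta ^+ 2 / lk * (eta ^+ 2 * ((lk * n1 ^+ 2) * (l0 * n2 ^+ 2))).
  by field; rewrite !gt_eqF.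
have z : 0 <= eta ^+ 2 * ((lk * n1 ^+ 2) * (l0 * n2 ^+ 2)).
  by rewrite !mulr_ge0 ?sqr_ge0// ltW.
apply: le_trans (ler_wpM2r z h) _; rewrite mul1r exprMn ler_wpM2l ?sqr_ge0// expr2.
Qed.

(** * Tameness of the convection term and of the transport functional *)

Section TameConvection.
Variables (R : realType) (O : bounded_domain R).
Variables (lam : nat -> R) (e : nat -> Hspace O).
Hypothesis lam_e : stokes_eigenbasis lam e.
Variables (B : set (Hspace O)) (wB : weakly_compact B).
Local Notation H := (Hspace O).
Local Notation E u := (norm_grad O u ^+ 2).
Local Notation En := (fun n => hfun (e n) : vfield R).
Local Notation BV := (BV B).
Local Notation tame := (tame B).

Lemma quad_lin1 phi (a : R) u u' v : test_field O phi -> L2field O u -> L2field O u' -> L2field O v ->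
  quad O phi (a *: u + u') v = a * quad O phi u v + quad O phi u' v.
Proof.
move=> tp Lu Lu' Lv; rewrite /quad mulr_sumr -big_split; apply: eq_bigr => i _ /=.
rewrite mulr_sumr -big_split; apply: eq_bigr => j _ /=.
have Lvi : v i \in Lfun (leb_dom O) 2%:E by move: i; exact: Lv.
rewrite -(form_linl (ip_form _) a (L2_mul_dtest i j tp Lu) (L2_mul_dtest i j tp Lu') Lvi).
by apply: eq_ip => x; rewrite !fctE mulrDl scalerAl.
Qed.

Lemma quad_lin2 phi (a : R) u v v' : test_field O phi -> L2field O u -> L2field O v -> L2field O v' ->
  quad O phi u (a *: v + v') = a * quad O phi u v + quad O phi u v'.
Proof.
move=> tp Lu Lv Lv'; rewrite /quad mulr_sumr -big_split; apply: eq_bigr => i _ /=.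
rewrite mulr_sumr -big_split; apply: eq_bigr => j _ /=.
have Lvi := Lv i; have Lvi' := Lv' i.
have Lu2 := L2_mul_dtest i j tp Lu.
rewrite (form_sym (ip_form _) Lu2 Lvi) (form_sym (ip_form _) Lu2 Lvi').
rewrite -(form_linl (ip_form _) a Lvi Lvi' Lu2).
by apply: eq_ip => x; rewrite !fctE mulrC.
Qed.

Lemma L2_osum c k : L2field O (osum En c k).
Proof. exact: inV_L2 (osum_V lam_e c k). Qed.

Lemma L2field0 : L2field O 0.
Proof. exact: inV_L2 (inV_0 O). Qed.

Lemma quad_osum phi c d k m : test_field O phi ->
  quad O phi (osum En c k) (osum En d m) = \sum_(i < k) c i * \sum_(j < m) d j * quad O phi (e i) (e j).
Proof.
move=> tp.
have q0l v : L2field O v -> quad O phi 0 v = 0.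
  move=> Lv; have := quad_lin1 1 tp L2field0 L2field0 Lv; rewrite scaler0 addr0 mul1r => /eqP.
  by rewrite -[X in X == _]addr0 (inj_eq (addrI _)) => /eqP.
have q0r u : L2field O u -> quad O phi u 0 = 0.
  move=> Lu; have := quad_lin2 1 tp Lu L2field0 L2field0; rewrite scaler0 addr0 mul1r => /eqP.
  by rewrite -[X in X == _]addr0 (inj_eq (addrI _)) => /eqP.
have qr u j : L2field O u -> quad O phi u (osum En d j) = \sum_(i < j) d i * quad O phi u (e i).
  move=> Lu; elim: j => [|j ih]; first by rewrite /osum !big_ord0 q0r.
  rewrite osumS addrC (quad_lin2 _ tp Lu (eL2 e j) (L2_osum d j)) ih.
  by rewrite [in RHS]big_ord_recr addrC.
elim: k => [|k ih]; first by rewrite {1}/osum !big_ord0 (q0l _ (L2_osum d m)).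
rewrite osumS addrC (quad_lin1 _ tp (eL2 e k) (L2_osum c k) (L2_osum d m)) ih.
by rewrite [in RHS]big_ord_recr addrC /= qr//; exact: eL2.
Qed.

Lemma normL2_Pk_le k u : L2field O u -> normL2 O (Pk e k u) <= normL2 O u.
Proof.
move=> Lu; rewrite !normL2E /fnorm; apply: ler_wsqrtr.
rewrite Pk_osum (form_osum (dotL2_form O) (eL2 e) (orthoL2 lam_e)).
apply: le_trans (bessel lam_e k Lu); apply: ler_sum => n _; by rewrite mul1r.
Qed.

(** Replacing u by P_k u costs at most 2 Kq |u - P_k u| |u|, where the first factor is small against
    |grad u| by [L2_tail]. *)
Lemma tame_quad phi : test_field O phi -> tame (fun u => quad O phi u u).
Proof.
move=> tp eta eta0; have [Kq Kq0 HK] := quad_bound tp.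
have l00 := lam_gt0 lam_e 0.
have c0 : 0 <= (2 * Kq) ^+ 2 / lam 0 / eta ^+ 2.
  by rewrite !divr_ge0 ?sqr_ge0// ltW.
have [k [lk hk]] := small_tail ltr01 (lam_large lam_e) c0.
exists (fun u : H => quad O phi (Pk e k u) (Pk e k u)).
  under [X in wcont X]eq_fun do rewrite Pk_osum quad_osum//.
  apply: wcont_sum => i; apply: wcontM; first exact: (wcont_crd lam_e (n := i)).
  apply: wcont_sum => j; apply: wcontM; first exact: (wcont_crd lam_e (n := j)).
  exact: wcont_cst.
move=> u [_ Vu]; have Lu := inV_L2 Vu.
have LP := inV_L2 (Pk_V lam_e k u); have Ld := inV_L2 (sub_Pk_V lam_e k Vu).
have -> : quad O phi u u - quad O phi (Pk e k u) (Pk e k u) =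
   quad O phi (hfun u - Pk e k u) u + quad O phi (Pk e k u) (hfun u - Pk e k u).
  rewrite (quad_sub1 tp Lu LP Lu) (quad_sub2 tp LP Lu LP).
  by rewrite addrA subrK.
apply: le_trans (ler_normD _ _) _.
apply: le_trans (tri_quad_arith Kq0 (HK _ _ Ld Lu) (HK _ _ LP Ld) (normL2_Pk_le k Lu) (normL2_ge0 _ _)) _.
apply: (quad_small_arith Kq0 lk l00 (normL2_ge0 _ _) (normL2_ge0 _ _) _ _ eta0 hk).
  by rewrite (normL2_sqr Ld); exact: L2_tail.
by rewrite (normL2_sqr Lu); exact: (L2_le_E lam_e).
Qed.

(** Tameness is closed under approximation to within small multiples of 1 + E; this gives room to
    replace w in V by a test field. *)
Lemma tame_approx G : (forall eta : R, 0 < eta -> exists2 G', tame G' &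
  forall u, BV u -> `|G u - G' u| <= eta * (1 + E u)) -> tame G.
Proof.
move=> h eta eta0; have e2 : 0 < eta / 2 by rewrite divr_gt0.
have [G' tG' GG'] := h _ e2; have [k ck hk] := tG' _ e2.
exists k => // u Ku; have := half_le (GG' u Ku) (hk u Ku).
by rewrite addrKA.
Qed.

(** For a test field phi close to w, [tri_ibp] turns the term into an L^2 form. The remainder is at
    most K |grad u|^2 |grad (w - phi)|, exactly the growth that tameness allows. *)
Lemma tame_tri w : inV O w -> tame (fun u => tri O u u w).
Proof.
move=> Vw; apply: tame_approx => eta eta0.
have [K K0 HK] := @tri_bound R O.
have eK : 0 < eta / K by rewrite divr_gt0.
have [_ /(_ _ eK) [phi sp wp]] := Vw; have tp : test_field O phi by case: sp.
have Vp := solenoidal_V sp.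
exists (fun u => - quad O phi u u); first by apply: tameN; exact: tame_quad.
move=> u [_ Vu]; rewrite -(tri_ibp Vu tp).
have Hu := inV_H10 Vu; have Hw := inV_H10 Vw; have Hp := inV_H10 Vp.
have -> : tri O u u w - tri O u u phi = tri O u u (w - phi).
  have := tri_lin3 (-1) Hu (inV_H1 Vu) Hp Hw.
  by rewrite scaleN1r addrC mulN1r [RHS]addrC.
have Hd := inV_H10 (formB_in (grad_formV O) Vw Vp).
apply: le_trans (HK _ _ _ Hu (inV_H1 Vu) Hd) _.
rewrite -[norm_grad O u * norm_grad O u]expr2.
have E0 := E_ge0 O u.
have h : norm_grad O (w - phi) * K <= eta by rewrite -ler_pdivlMr//; exact: ltW.
rewrite mulrCA mulrC [K * _]mulrC.
apply: le_trans (ler_wpM2r E0 h) _; apply: ler_wpM2l; [exact: ltW|by rewrite lerDr].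
Qed.

Variables (nu : R) (f : vfield R -> R) (fV' : inVdual O f).

Lemma dual0 (L : vfield R -> R) : inVdual O L -> L 0 = 0.
Proof.
move=> [Llin _]; have := Llin 1 0 0 (inV_0 O) (inV_0 O); rewrite scaler0 addr0 mul1r => /eqP.
by rewrite -[X in X == _]addr0 (inj_eq (addrI _)) => /eqP.
Qed.

Lemma Fns_dual u : inV O u -> inVdual O (Fns O nu f u).
Proof.
move=> Vu; have Hu := inV_H10 Vu; have [flin [C fC]] := fV'.
have [K K0 HK] := @tri_bound R O.
split=> [a v w Vv Vw|].
  rewrite /Fns flin//; have Hv := inV_H10 Vv; have Hw := inV_H10 Vw.
  have Hvw := inV_H10 (inV_lin a Vv Vw).
  rewrite !(convectionE Hu (inV_H1 Vu))// (tri_lin3 a Hu (inV_H1 Vu) Hv Hw).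
  rewrite (form_sym (grad_formV O) Vu (inV_lin a Vv Vw)) (form_linl (grad_formV O) a Vv Vw Vu).
  rewrite (form_sym (grad_formV O) Vv Vu) (form_sym (grad_formV O) Vw Vu).
  by move: (dot_grad O u v) (dot_grad O u w) (tri O u u v) (tri O u u w) => x y z t; ring.
exists (C + `|nu| * norm_grad O u + K * (norm_grad O u * norm_grad O u)) => w Vw.
rewrite /Fns (convectionE Hu (inV_H1 Vu) (inV_H10 Vw)).
apply: le_trans (ler_normB _ _) _; rewrite mulrDl; apply: lerD.
  apply: le_trans (ler_normB _ _) _; rewrite mulrDl; apply: lerD; first exact: fC.
  rewrite normrM -mulrA; apply: ler_wpM2l; first exact: normr_ge0.
  rewrite !norm_gradE; exact: (form_CS (grad_formV O)).
rewrite -mulrA; exact: HK _ _ _ Hu (inV_H1 Vu) (inV_H10 Vw).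
Qed.

Lemma tame_Fns w : inV O w -> tame (fun u => Fns O nu f u w).
Proof.
move=> Vw.
apply: (@tame_ext _ _ _ (fun u => f w + (- (nu * dot_grad O u w) + - tri O u u w))).
  move=> u [_ Vu]; rewrite /Fns (convectionE (inV_H10 Vu) (inV_H1 Vu) (inV_H10 Vw)).
  by rewrite addrA.
apply: tameD; first by apply: tame_wcont; exact: wcont_cst.
apply: tameD; apply: tameN; last exact: tame_tri.
by apply: tameZ; exact: (tame_dual lam_e B (dual_dot_grad Vw)).
Qed.

Definition cyl_coef (Psi : cyl O) j (u : vfield R) : R :=
  'D_(delta_mx 0 j) (@cyl_psi _ _ Psi) (\row_i dotL2 O u (@cyl_w _ _ Psi i)).

Arguments cyl_coef : clear implicits.

Lemma cyl_diffE Psi u : cyl_diff Psi (dotL2 O u) = \sum_j cyl_coef Psi j u *: @cyl_w _ _ Psi j.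
Proof. by []. Qed.

Lemma wcont_cyl_coef Psi j : wcont (fun u : H => cyl_coef Psi j u).
Proof.
move=> F u FF Fu; have [_ c _] := cyl_psiC1 Psi.
have hr : (\row_i dotL2 O (hfun w) (@cyl_w _ _ Psi i)) @[w --> F] --> (\row_i dotL2 O (hfun u) (@cyl_w _ _ Psi i)).
  apply: cvg_row => i; under eq_fun do rewrite mxE; rewrite mxE.
  exact: (wcont_dot (inV_H (@cyl_wV _ _ Psi i))).
exact: (continuous_cvg _ (c j _) hr).
Qed.

Definition Fcyl (Psi : cyl O) (u : vfield R) : R := Fns O nu f u (cyl_diff Psi (dotL2 O u)).

Lemma FcylE Psi u : inV O u -> Fcyl Psi u = \sum_j cyl_coef Psi j u * Fns O nu f u (@cyl_w _ _ Psi j).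
Proof.
move=> Vu; have [Flin _] := Fns_dual Vu; have F0 := dual0 (Fns_dual Vu).
rewrite /Fcyl cyl_diffE.
suff [_ //] : inV O (\sum_j cyl_coef Psi j u *: @cyl_w _ _ Psi j) /\
  Fns O nu f u (\sum_j cyl_coef Psi j u *: @cyl_w _ _ Psi j) = \sum_j cyl_coef Psi j u * Fns O nu f u (@cyl_w _ _ Psi j).
apply: (big_ind2 (fun v x => inV O v /\ Fns O nu f u v = x)).
- by split; [exact: inV_0|].
- move=> v x w y [Vv <-] [Vw <-]; split; first exact: (formD_in (grad_formV O)).
  by have := Flin 1 v w Vv Vw; rewrite scale1r mul1r.
- move=> j _; have Vj := @cyl_wV _ _ Psi j; split; first exact: (formZ_in (grad_formV O)).
  by have := Flin (cyl_coef Psi j u) _ 0 Vj (inV_0 O); rewrite addr0 F0 addr0.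
Qed.

Lemma tame_Fcyl Psi : tame (fun u => Fcyl Psi u).
Proof.
apply: (@tame_ext _ _ _ (fun u : H => \sum_j cyl_coef Psi j u * Fns O nu f u (@cyl_w _ _ Psi j))).
  by move=> u [_ Vu]; rewrite FcylE.
apply: tame_sum => j; have cj := @wcont_cyl_coef Psi j.
have [C hC] := wcont_bounded wB cj.
apply: (tameM wB (A := C)) => [u [Bu _]||]; [exact: hC|exact: tame_wcont|].
exact: tame_Fns (@cyl_wV _ _ Psi j).
Qed.

Lemma bracketE k Psi (u : vfield R) : bracket nu f e k Psi u = enk lam e k u + Fcyl Psi u.
Proof. by rewrite /bracket (norm_grad_Pk lam_e). Qed.

Lemma tame_bracket k Psi : tame (fun u => bracket nu f e k Psi u).
Proof.
apply: (@tame_ext _ _ _ (fun u : H => enk lam e k u + Fcyl Psi u)).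
  by move=> u _; rewrite bracketE.
by apply: tameD; [apply: tame_wcont; exact: (wcont_enk lam_e)|exact: tame_Fcyl].
Qed.

End TameConvection.

(** * Maxima over B_f *)

Section PairArithmetic.
Variable R : realType.

(* A linear function on the admissible weights of a pair is maximal at an extreme point. *)
Lemma extreme_weights (t1 t2 l1 l2 g1 g2 : R) : 0 <= t1 -> 0 <= t2 -> t1 + t2 = 1 -> l1 <= 0 ->
  t1 * l1 + t2 * l2 <= 0 ->
  [\/ t1 * g1 + t2 * g2 <= g1,
      l2 <= 0 /\ t1 * g1 + t2 * g2 <= g2 |
      [/\ l1 < 0, 0 < l2 & exists s1 s2 : R, [/\ 0 < s1 < 1, s2 = 1 - s1,
          s1 * l1 + s2 * l2 = 0 & t1 * g1 + t2 * g2 <= s1 * g1 + s2 * g2]]].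
Proof.
move=> t10 t20 t12 l10 tl.
have [g21|g12] := leP g2 g1.
  apply: Or31; have -> : t1 = 1 - t2 by rewrite -t12 addrK.
  by have : t2 * (g2 - g1) <= 0 by [rewrite mulr_ge0_le0// subr_le0|]; lra.
have [l20|l20] := leP l2 0.
  apply: Or32; split=> //; have -> : t2 = 1 - t1 by rewrite -t12 addrAC subrr add0r.
  by have : t1 * (g1 - g2) <= 0 by [rewrite mulr_ge0_le0// subr_le0 ltW|]; lra.
move: l10; rewrite le_eqVlt => /orP[/eqP l1e|l1n].
  apply: Or31; have t2e : t2 = 0.
    apply/eqP; rewrite eq_le t20 andbT.
    by move: tl; rewrite l1e mulr0 add0r pmulr_lle0.
  by move: t12; rewrite t2e addr0 => ->; rewrite mul1r mul0r addr0.
apply: Or33; split=> //; have d0 : 0 < l2 - l1 by lra.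
exists (l2 / (l2 - l1)), (1 - l2 / (l2 - l1)); split=> //.
- by rewrite divr_gt0//= ltr_pdivrMr// mul1r; lra.
- by field; rewrite gt_eqF.
have h : t2 <= 1 - l2 / (l2 - l1).
  rewrite (_ : 1 - _ = (- l1) / (l2 - l1)); last by field; rewrite gt_eqF.
  rewrite ler_pdivlMr//; have t1e : t1 = 1 - t2 by rewrite -t12 addrK.
  by move: tl; rewrite t1e; lra.
have -> : t1 = 1 - t2 by rewrite -t12 addrK.
set s := 1 - _ in h *; have -> : l2 / (l2 - l1) = 1 - s by rewrite /s subKr.
have : 0 <= (s - t2) * (g2 - g1) by rewrite mulr_ge0// subr_ge0// ltW.
lra.
Qed.

Lemma energy_arith (nu C x l fu : R) : 0 < nu -> `|fu| <= C * x -> l = nu * x ^+ 2 - fu ->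
  nu / 2 * x ^+ 2 <= l + C ^+ 2 / (2 * nu).
Proof.
move=> nu0 h ->; have h1 := le_trans (ler_norm _) h.
have : 0 <= (nu * x - C) ^+ 2 / (2 * nu) by rewrite divr_ge0 ?sqr_ge0// mulr_ge0// ltW.
rewrite (_ : (nu * x - C) ^+ 2 / (2 * nu) = nu / 2 * x ^+ 2 - C * x + C ^+ 2 / (2 * nu)); last by field; rewrite gt_eqF.
lra.
Qed.

Lemma mix_le (t1 t2 a x1 x2 y1 y2 c : R) : 0 <= t1 -> 0 <= t2 -> t1 + t2 = 1 ->
  a * x1 <= y1 + c -> a * x2 <= y2 + c -> t1 * y1 + t2 * y2 <= 0 -> a * (t1 * x1 + t2 * x2) <= c.
Proof.
move=> t10 t20 t12 h1 h2 h3.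
have := ler_wpM2l t10 h1; have := ler_wpM2l t20 h2.
have -> : t1 = 1 - t2 by rewrite -t12 addrK.
move: h3; have -> : t1 = 1 - t2 by rewrite -t12 addrK.
lra.
Qed.

End PairArithmetic.

Section Maximum.
Variables (R : realType) (O : bounded_domain R).
Variables (lam : nat -> R) (e : nat -> Hspace O).
Hypothesis lam_e : stokes_eigenbasis lam e.
Variables (B : set (Hspace O)) (wB : weakly_compact B).
Variables (nu : R) (nu0 : 0 < nu) (f : vfield R -> R) (fV' : inVdual O f).
Local Notation H := (Hspace O).
Local Notation E u := (norm_grad O u ^+ 2).
Local Notation BV := (BV B).
Local Notation tame := (tame B).

Lemma tame_f : tame (fun u => f u). Proof. exact: (tame_dual lam_e B fV'). Qed.

Lemma tame_N : tame (fun u => N O u).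
Proof.
move=> eta eta0; have [k [lk hk]] := small_tail eta0 (lam_large lam_e) ler01.
exists (fun u : H => Npart e k u); first exact: (wcont_Npart lam_e).
move=> u [_ Vu]; have /andP[h1 h2] := N_tail lam_e k Vu.
rewrite ger0_norm//; apply: le_trans h2 _; rewrite -[_^-1]mul1r.
apply: ler_pM => //; [by rewrite divr_ge0// ltW|exact: E_ge0|by rewrite lerDr].
Qed.

Lemma E_le_ell : exists2 C : R, 0 <= C & forall u, inV O u -> nu / 2 * E u <= ell O nu f u + C.
Proof.
have [_ [C fC]] := fV'; exists (C ^+ 2 / (2 * nu)) => [|u Vu].
  by rewrite divr_ge0 ?sqr_ge0// mulr_ge0// ltW.
exact: (energy_arith nu0 (fC u Vu)).
Qed.

(** [ell] is only weakly lower semicontinuous. Its minorants [ellk] are tame and increase to it, so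
    upper bounds on [ell] survive weak limits. *)
Definition ellk k (u : vfield R) : R := nu * enk lam e k u - f u.

Lemma tame_ellk k : tame (fun u => ellk k u).
Proof.
apply: tameD; last by apply: tameN; exact: tame_f.
by apply: tameZ; apply: tame_wcont; exact: (wcont_enk lam_e).
Qed.

Lemma ellk_le k u : inV O u -> ellk k u <= ell O nu f u.
Proof.
move=> Vu; rewrite /ellk /ell lerD2r; apply: ler_wpM2l; first exact: ltW.
exact: (enk_le_grad lam_e k Vu).
Qed.

Lemma ellk_cvg u : inV O u -> ellk k u @[k --> \oo] --> ell O nu f u.
Proof.
move=> Vu; apply: cvgB; last exact: cvg_cst.
by apply: cvgM; [exact: cvg_cst|exact: (enk_cvg lam_e Vu)].
Qed.

(** A relaxation of [Bf] by closed conditions: weights may vanish, and the mean of [ell] may be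
    negative. Limits are easier to keep inside it, and by [adm_Bf] it gives the same maxima. *)
Definition adm : set (R * R * H * H) := [set b | let: (t1, t2, u1, u2) := b in
  [/\ [/\ 0 <= t1, 0 <= t2 & t1 + t2 = 1], BV u1 /\ BV u2, N O u1 = N O u2,
      ell O nu f u1 <= 0 & t1 * ell O nu f u1 + t2 * ell O nu f u2 <= 0]].

Definition wsum2 (g : H -> R) (b : R * R * H * H) : R :=
  let: (t1, t2, u1, u2) := b in t1 * g u1 + t2 * g u2.

Lemma adm1 u : BV u -> ell O nu f u <= 0 -> adm (1, 0, u, u).
Proof.
move=> Ku lu; have z : 1 * ell O nu f u + 0 * ell O nu f u <= 0 by rewrite mul1r mul0r addr0.
by split; [split; [exact: ler01|exact: lexx|exact: addr0]|split|by []|exact: lu|exact: z].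
Qed.

Lemma Bf_adm : Bf nu f B `<=` adm.
Proof.
move=> [[[t1 t2] u1] u2] [[u [Bu Vu lu [-> -> -> ->]]]|[[/andP[t10 t11] t2E] [[B1 V1] [B2 V2]] n12 /andP[l1 l2] l12]].
  exact: adm1 (conj Bu Vu) lu.
have t20 : 0 <= t2 by rewrite t2E subr_ge0 ltW.
split; [by split; [exact: ltW|exact: t20|rewrite t2E addrCA subrr addr0]|by []| |exact: ltW|by rewrite l12].
by rewrite /N -!normL2_sqr ?n12//; exact: hfun_L2.
Qed.

Lemma adm_Bf g b : adm b -> exists2 b', Bf nu f B b' & wsum2 g b <= wsum2 g b'.
Proof.
case: b => [[[t1 t2] u1] u2] [[t10 t20 t12] [[B1 V1] [B2 V2]] n12 l1 l12].
have [h|[l2 h]|[l1n l2p [s1 [s2 [s10 s2E sl h]]]]] := extreme_weights (g u1) (g u2) t10 t20 t12 l1 l12.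
- exists (1, 0, u1, u1); first by left; exists u1.
  by rewrite /= mul1r mul0r addr0.
- exists (1, 0, u2, u2); first by left; exists u2.
  by rewrite /= mul1r mul0r addr0.
exists (s1, s2, u1, u2); last exact: h.
right; split=> //; last by rewrite l1n l2p.
by rewrite !normL2E /fnorm; congr Num.sqrt.
Qed.

(** [ell] controls nu / 2 times the enstrophy. For the second point this yields a bound only after
    multiplication by its weight. *)
Lemma adm_energy : exists2 M0 : R, 0 <= M0 & forall t1 t2 u1 u2, adm (t1, t2, u1, u2) ->
  E u1 <= M0 /\ t1 * E u1 + t2 * E u2 <= M0.
Proof.
have [C C0 HC] := E_le_ell; have n2 : 0 < nu / 2 by rewrite divr_gt0.
exists (C / (nu / 2)); first by rewrite divr_ge0// ltW.
move=> t1 t2 u1 u2 [[t10 t20 t12] [[B1 V1] [B2 V2]] _ l1 l12].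
have h1 := HC _ V1; have h2 := HC _ V2.
rewrite !ler_pdivlMr// ![_ * (nu / 2)]mulrC; split; last exact: (mix_le t10 t20 t12 h1 h2 l12).
by apply: le_trans h1 _; rewrite gerDr.
Qed.

Lemma wsum2_bounded g : tame g -> exists C : R, forall b, adm b -> `|wsum2 g b| <= C.
Proof.
move=> /(tame_bound wB)[C C0 HC]; have [M0 M00 HM] := adm_energy.
exists (C * (1 + M0)); case=> [[[t1 t2] u1] u2] ab; have [_ hE] := HM _ _ _ _ ab.
have [[t10 t20 t12] [K1 K2] _ _ _] := ab.
apply: le_trans (ler_normD _ _) _; rewrite !normrM (ger0_norm t10) (ger0_norm t20).
apply: (@le_trans _ _ (t1 * (C * (1 + E u1)) + t2 * (C * (1 + E u2)))).
  by apply: lerD; apply: ler_wpM2l => //; exact: HC.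
rewrite mulrCA [t2 * _]mulrCA -mulrDr; apply: ler_wpM2l => //.
by rewrite !mulrDr !mulr1 addrACA t12 lerD2l.
Qed.

(** The limit is taken with [ellk] in place of [ell], and only then does k grow. *)
Lemma ell_limit (U : set_system nat) (uU : UltraFilter U) (t1 t2 : nat -> R) (u1 u2 : nat -> H) (s1 s2 : R) (v1 v2 : H) :
  inV O v1 -> inV O v2 -> t1 @ U --> s1 -> t2 @ U --> s2 ->
  (forall G, tame G -> G (u1 i) @[i --> U] --> G v1) ->
  (forall G, tame G -> G (u2 i) @[i --> U] --> G v2) ->
  (forall n, [/\ 0 <= t1 n, 0 <= t2 n, inV O (u1 n), inV O (u2 n) &
     t1 n * ell O nu f (u1 n) + t2 n * ell O nu f (u2 n) <= 0]) ->
  s1 * ell O nu f v1 + s2 * ell O nu f v2 <= 0.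
Proof.
move=> V1 V2 ct1 ct2 c1 c2 h.
have cv : s1 * ellk k v1 + s2 * ellk k v2 @[k --> \oo] --> s1 * ell O nu f v1 + s2 * ell O nu f v2.
  by apply: cvgD; (apply: cvgM; [exact: cvg_cst|exact: ellk_cvg]).
apply: (cvgn_le_cst cv) => k.
have cU : t1 i * ellk k (u1 i) + t2 i * ellk k (u2 i) @[i --> U] --> s1 * ellk k v1 + s2 * ellk k v2.
  by apply: cvgD; apply: cvgM => //; [exact: (c1 _ (@tame_ellk k))|exact: (c2 _ (@tame_ellk k))].
apply: (cvgF_le cU); apply: (@filterS _ U _ setT) => [n _|]; last exact: filterT.
have [h1 h2 h3 h4 h5] := h n; apply: le_trans h5; apply: lerD.
  by apply: ler_wpM2l => //; exact: ellk_le.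
by apply: ler_wpM2l => //; exact: ellk_le.
Qed.

(** A maximising sequence is followed along an ultrafilter. The first points have bounded enstrophy
    because [ell] <= 0 there; the second points may have unbounded enstrophy, but only if their
    weight tends to 0. *)
Lemma adm_max g : tame g -> adm !=set0 -> exists2 b, adm b & forall b', adm b' -> wsum2 g b' <= wsum2 g b.
Proof.
move=> tg [b0 ab0]; have [C HC] := wsum2_bounded tg; have [M0 M00 HM] := adm_energy.
pose S : set R := [set wsum2 g b | b in adm].
have Ssup : has_sup S.
  split; first by exists (wsum2 g b0), b0.
  by exists C => _ [b ab <-]; apply: le_trans (ler_norm _) _; exact: HC.
have pick n : exists b, adm b /\ sup S - n.+1%:R^-1 < wsum2 g b.
  have n0 : (0 : R) < n.+1%:R^-1 by rewrite invr_gt0.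
  by have [_ [b ab <-] hb] := sup_adherent n0 Ssup; exists b.
have [b bP] := choice pick.
suff [b1 ab1 h1] : exists2 b1, adm b1 & sup S <= wsum2 g b1.
  exists b1 => // b' ab'; apply: le_trans h1; apply: ub_le_sup; first by case: Ssup.
  by exists b'.
have [U [uU oU]] := free_ultrafilter.
pose t1 n := (b n).1.1.1; pose t2 n := (b n).1.1.2; pose u1 n := (b n).1.2; pose u2 n := (b n).2.
have bE n : b n = (t1 n, t2 n, u1 n, u2 n) by rewrite /t1 /t2 /u1 /u2; case: (b n) => [[[]]].
have ab n : adm (t1 n, t2 n, u1 n, u2 n) by rewrite -bE; case: (bP n).
have UT (P : nat -> Prop) : (forall n, P n) -> \forall n \near U, P n.
  by move=> hP; apply: (@filterS _ U _ setT) => [n _|]; [exact: hP|exact: filterT].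
have [s1 ct1] : exists s : R, t1 @ U --> s.
  apply: (ultra_lim uU (C := 1)); apply: UT => n; have [[h1 h2 h3] _ _ _ _] := ab n.
  by rewrite ger0_norm// -h3 lerDl.
have [s2 ct2] : exists s : R, t2 @ U --> s.
  apply: (ultra_lim uU (C := 1)); apply: UT => n; have [[h1 h2 h3] _ _ _ _] := ab n.
  by rewrite ger0_norm// -h3 lerDr.
have s10 : 0 <= s1 by apply: (cvgF_ge ct1); apply: UT => n; have [[]] := ab n.
have s20 : 0 <= s2 by apply: (cvgF_ge ct2); apply: UT => n; have [[]] := ab n.
have s12 : s1 + s2 = 1.
  apply: (cvgF_uniq (cvgD ct1 ct2)); rewrite (_ : t1 + t2 = cst 1); first exact: cvg_cst.
  by apply/funext => n; have [[_ _ <-] _ _ _ _] := ab n; rewrite !fctE.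
have [v1 [K1 _ c1]] : exists v, [/\ BV v, forall c : R, (\forall i \near U, E (u1 i) <= c) -> E v <= c &
    forall G, tame G -> G (u1 i) @[i --> U] --> G v].
  apply: (BV_limit lam_e wB (C := M0)); apply: UT => n.
  by have [h _] := HM _ _ _ _ (ab n); have [_ []] := ab n.
have V1 : inV O v1 by case: K1.
have supS (l : R) : wsum2 g (b n) @[n --> U] --> l -> sup S <= l.
  move=> cl; have h0 : sup S - n.+1%:R^-1 @[n --> U] --> sup S.
    have h : sup S - n.+1%:R^-1 @[n --> \oo] --> sup S.
      by apply: (cvgn_ext (cvgB (cvg_cst (sup S)) (@cvg_inv_nat R))) => //; rewrite subr0.
    by apply: cvg_trans h; exact: cvg_app.
  by apply: (cvgF_ler h0 cl); apply: UT => n; have [_ /ltW] := bP n.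
have l1 : ell O nu f v1 <= 0.
  have z1 : (fun=> 1 : R) @ U --> (1 : R) by exact: cvg_cst.
  have z0 : (fun=> 0 : R) @ U --> (0 : R) by exact: cvg_cst.
  have := ell_limit uU V1 V1 z1 z0 c1 c1.
  rewrite mul1r mul0r addr0; apply=> n; have [_ [[_ Vn] _] _ ln _] := ab n.
  by split=> //; rewrite mul1r mul0r addr0.
(* If the weight is lost, t2 E(u2) stays bounded while t2 tends to 0; tameness then sends t2 g(u2)
   to 0, and the one-point pair at v1 attains the supremum. *)
have [s2z|s2p] := eqVneq s2 0.
  have s1e : s1 = 1 by rewrite -s12 s2z addr0.
  exists (1, 0, v1, v1); first exact: adm1.
  apply: supS; rewrite /= mul1r mul0r.
  rewrite (_ : (fun n => wsum2 g (b n)) = (fun n => t1 n * g (u1 n) + t2 n * g (u2 n))); last first.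
    by apply/funext => n; rewrite bE.
  apply: cvgD; first by rewrite -[X in _ --> X]mul1r -s1e; apply: cvgM => //; exact: c1.
  apply/cvgrPdist_le => eps eps0.
  have m0 : 0 < 2 * (1 + M0) by rewrite mulr_gt0// ltr_pwDl.
  have [h ch hh] := tg _ (divr_gt0 eps0 m0).
  have [Ch hCh] := wcont_bounded wB ch.
  have e2 : 0 < eps / 2 by rewrite divr_gt0.
  have ct2' : t2 n * `|Ch| @[n --> U] --> (0 : R).
    have := cvgM ct2 (cvg_cst `|Ch|); rewrite s2z mul0r; exact.
  move/cvgrPdist_le : ct2' => /(_ _ e2); apply: filterS => n; rewrite !sub0r !normrN.
  have [[t10 t20 t12] [_ K2] _ _ _] := ab n; have [_ hE] := HM _ _ _ _ (ab n).
  rewrite !normrM normr_id (ger0_norm t20) => ht.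
  have t2E : t2 n * (1 + E (u2 n)) <= 1 + M0.
    rewrite mulrDr mulr1; apply: lerD; first by rewrite -t12 lerDr.
    by apply: le_trans hE; rewrite lerDr; apply: mulr_ge0 => //; exact: E_ge0.
  have gb : `|g (u2 n)| <= `|Ch| + eps / (2 * (1 + M0)) * (1 + E (u2 n)).
    rewrite -[g (u2 n)](subrK (h (u2 n))) addrC; apply: le_trans (ler_normD _ _) _.
    by apply: lerD; [apply: le_trans (hCh _ K2.1) (ler_norm _)|exact: hh].
  apply: le_trans (ler_wpM2l t20 gb) _; rewrite mulrDr [leRHS]splitr; apply: lerD => //.
  rewrite mulrCA; apply: le_trans (ler_wpM2l (ltW (divr_gt0 eps0 m0)) t2E) _.
  by rewrite le_eqVlt; apply/orP; left; apply/eqP; field; rewrite gt_eqF// ltr_pwDl.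
have s2p' : 0 < s2 by rewrite lt_def s2p.
have [v2 [K2 _ c2]] : exists v, [/\ BV v, forall c : R, (\forall i \near U, E (u2 i) <= c) -> E v <= c &
    forall G, tame G -> G (u2 i) @[i --> U] --> G v].
  (* The weight is eventually at least s2 / 2, which bounds the enstrophy of the second points. *)
  apply: (BV_limit lam_e wB (C := M0 / (s2 / 2))).
  have s22 : 0 < s2 / 2 by rewrite divr_gt0.
  have : \forall n \near U, s2 / 2 <= t2 n.
    move/cvgrPdist_le : ct2 => /(_ _ s22); apply: filterS => n.
    by move=> /(le_trans (ler_norm _)); lra.
  apply: filterS => n hn; have [_ [_ K2n] _ _ _] := ab n; split=> //.
  have [[t10 t20 _] _ _ _ _] := ab n; have [_ hE] := HM _ _ _ _ (ab n).
  rewrite ler_pdivlMr// mulrC; apply: le_trans (ler_wpM2r (E_ge0 _ _) hn) _.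
  by apply: le_trans hE; rewrite lerDr; apply: mulr_ge0 => //; exact: E_ge0.
have V2 : inV O v2 by case: K2.
exists (s1, s2, v1, v2); last first.
  apply: supS; rewrite (_ : (fun n => wsum2 g (b n)) = (fun n => t1 n * g (u1 n) + t2 n * g (u2 n))); last first.
    by apply/funext => n; rewrite bE.
  by apply: cvgD; apply: cvgM => //; [exact: c1|exact: c2].
split=> //.
  apply: (cvgF_uniq (c1 _ tame_N)).
  rewrite (_ : (fun i => N O (u1 i)) = (fun i => N O (u2 i))); first exact: (c2 _ tame_N).
  by apply/funext => n; have [_ _ ->] := ab n.
apply: (ell_limit uU V1 V2 ct1 ct2 c1 c2) => n.
by have [[? ? _] [[_ ?] [_ ?]] _ _ ?] := ab n.
Qed.

Lemma objectiveE k Psi b : objective nu f e k Psi b = wsum2 (fun u => bracket nu f e k Psi u) b.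
Proof. by case: b => [[[]]]. Qed.

Lemma Bf_max k Psi : Bf nu f B !=set0 ->
  exists m, is_max [set objective nu f e k Psi b | b in Bf nu f B] m.
Proof.
move=> [b0 Bb0].
have tg := tame_bracket lam_e wB nu fV' k Psi.
have [b ab hb] := adm_max tg (ex_intro _ _ (Bf_adm Bb0)).
have [b' Bb' hb'] := adm_Bf (fun u => bracket nu f e k Psi u) ab.
exists (objective nu f e k Psi b'); split; first by exists b'.
move=> _ [c Bc <-]; rewrite !objectiveE; apply: le_trans (hb _ (Bf_adm Bc)) hb'.
Qed.

End Maximum.

(** * Lagrange multipliers for the energy inequality *)

Section MultiplierArithmetic.
Variable R : realType.

Lemma coercive_arith (nu c E g l h K Ch C : R) : 0 < nu -> 0 < c -> 0 <= E ->
  `|g - h| <= c * nu / 4 * (1 + E) -> `|h| <= Ch -> nu / 2 * E <= l + C -> K <= g - c * l ->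
  E <= (Ch + c * nu / 4 + c * C - K) / (c * nu / 4).
Proof.
move=> nu0 c0 E0 h1 h2 h3 h4; have d0 : 0 < c * nu / 4 by rewrite divr_gt0// mulr_gt0.
rewrite ler_pdivlMr//.
have h5 := ler_wpM2l (ltW c0) h3.
move: h1 h2; rewrite !ler_norml => /andP[_ h1] /andP[_ h2].
rewrite (_ : c * (nu / 2 * E) = 2 * (E * (c * nu / 4))) in h5; last by field.
rewrite (_ : c * nu / 4 * (1 + E) = c * nu / 4 + E * (c * nu / 4)) in h1; last by ring.
move: (E * (c * nu / 4)) (c * nu / 4) h1 h5 => X Y h1 h5; rewrite mulrDr in h5; lra.
Qed.

Lemma balanced_weights (l1 l2 : R) : 0 < l2 - l1 ->
  l2 / (l2 - l1) * l1 + (1 - l2 / (l2 - l1)) * l2 = 0.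
Proof. by move=> d0; field; rewrite gt_eqF. Qed.

(* [l2 / (l2 - l1)] is the weight of [l1] for which the mean of [l1] and [l2] vanishes. *)
Lemma slope_le (g1 g2 l1 l2 M : R) : l1 < 0 -> 0 < l2 ->
  (l2 / (l2 - l1)) * g1 + (1 - l2 / (l2 - l1)) * g2 <= M ->
  (g2 - M) / l2 <= (M - g1) / (- l1).
Proof.
move=> l10 l20 h; have d0 : 0 < l2 - l1 by lra.
have nl : 0 < - l1 by lra.
rewrite ler_pdivrMr// mulrAC ler_pdivlMr//.
have : ((l2 / (l2 - l1)) * g1 + (1 - l2 / (l2 - l1)) * g2) * (l2 - l1) <= M * (l2 - l1).
  by rewrite ler_wpM2r// ltW.
rewrite (_ : (_ + _) * (l2 - l1) = l2 * g1 - l1 * g2); last by field; rewrite gt_eqF.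
by lra.
Qed.

Lemma sum_mul_le (s : seq R) (c w : R -> R) : (forall r, 0 <= c r) -> (forall r, 0 <= w r) ->
  \sum_(r <- s) c r * w r <= (\sum_(r <- s) c r) * \sum_(r <- s) w r.
Proof.
move=> c0 w0; elim: s => [|r s ih]; first by rewrite !big_nil mulr0.
rewrite !big_cons mulrDl !mulrDr -addrA lerD2l; apply: le_trans ih _.
by rewrite addrA lerDr addr_ge0// mulr_ge0// sumr_ge0.
Qed.

(** A weighted mean of inequalities g - c_r l <= K, with the normalisation multiplied out; the
    weight [w0] belongs to the multiplier 1. *)
Lemma weighted_le (s : seq R) (c w : R -> R) (w0 g l K : R) : w0 * (g - l) <= w0 * K ->
  (forall r, w r * (g - c r * l) <= w r * K) ->
  g * (w0 + \sum_(r <- s) w r) - (w0 + \sum_(r <- s) c r * w r) * l <= K * (w0 + \sum_(r <- s) w r).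
Proof.
move=> h0 h; elim: s => [|r s ih]; first by rewrite !big_nil; move: h0; lra.
rewrite !big_cons; have := h r; move: ih.
move: (\sum_(j <- s) w j) (\sum_(j <- s) c j * w j) => W C; lra.
Qed.

End MultiplierArithmetic.

Section Multiplier.
Variables (R : realType) (O : bounded_domain R).
Variables (lam : nat -> R) (e : nat -> Hspace O).
Hypothesis lam_e : stokes_eigenbasis lam e.
Variables (B : set (Hspace O)) (wB : weakly_compact B).
Variables (nu : R) (nu0 : 0 < nu) (f : vfield R -> R) (fV' : inVdual O f).
Local Notation H := (Hspace O).
Local Notation E u := (norm_grad O u ^+ 2).
Local Notation BV := (BV B).
Local Notation tame := (tame B).
Local Notation ell := (ell O nu f).
Variables (g : H -> R) (tg : tame g) (M : R).
Hypothesis gM : forall b, Bf nu f B b -> wsum2 g b <= M.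

Lemma Bf_pair (s : R) (u v : H) : 0 < s < 1 -> BV u -> BV v -> N O u = N O v ->
  ell u < 0 -> 0 < ell v -> s * ell u + (1 - s) * ell v = 0 -> Bf nu f B (s, 1 - s, u, v).
Proof.
move=> s01 [Bu Vu] [Bv Vv] Nuv lu lv sl; right; split; [split; [exact: s01|exact: erefl]|by []| | |exact: sl].
  by rewrite !normL2E /fnorm -[dotL2 O u u]/(N O u) Nuv.
by rewrite lu lv.
Qed.

(** A positive multiple of [ell] dominates the enstrophy, while tameness makes the growth of [g] as
    slow as required. For this reason the multipliers of single spheres are kept strictly
    positive. *)
Lemma coercive (c K : R) : 0 < c -> exists C : R, forall u, BV u -> K <= g u - c * ell u -> E u <= C.
Proof.
move=> c0; have [C C0 HC] := E_le_ell nu0 fV'.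
have d0 : 0 < c * nu / 4 by rewrite divr_gt0// mulr_gt0.
have [h ch hh] := tg d0; have [Ch hCh] := wcont_bounded wB ch.
exists ((Ch + c * nu / 4 + c * C - K) / (c * nu / 4)) => u Ku Kg.
exact: (coercive_arith nu0 c0 (E_ge0 _ _) (hh u Ku) (hCh u Ku.1) (HC u Ku.2) Kg).
Qed.

(** Coercivity bounds the enstrophy along the sequence, so [BV_limit] applies, and N passes to the
    limit because it is tame. *)
Lemma sequence_limit (c K r : R) (u : nat -> H) : 0 < c ->
  (forall n, [/\ BV (u n), K <= g (u n) - c * ell (u n) & `|N O (u n) - r| <= n.+1%:R^-1]) ->
  exists v U, [/\ BV v, UltraFilter U, \oo `<=` U, N O v = r &
    forall G, tame G -> G (u n) @[n --> U] --> G v].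
Proof.
move=> c0 hu; have [U [uU oU]] := free_ultrafilter.
have [C HC] := coercive K c0.
have UT (P : nat -> Prop) : (forall n, P n) -> \forall n \near U, P n.
  by move=> hP; apply: (@filterS _ U _ setT) => [n _|]; [exact: hP|exact: filterT].
have [v [Kv _ cv]] : exists v, [/\ BV v, forall c : R, (\forall i \near U, E (u i) <= c) -> E v <= c &
    forall G, tame G -> G (u i) @[i --> U] --> G v].
  apply: (BV_limit lam_e wB (C := C)); apply: UT => n; have [Kn gn _] := hu n.
  by split => //; exact: HC.
exists v, U; split=> //.
have h1 : `|N O (u n) - r| @[n --> U] --> `|N O v - r|.
  by apply: cvg_norm; apply: cvgB; [exact: (cv _ (tame_N lam_e B))|exact: cvg_cst].
have h2 : `|N O (u n) - r| @[n --> U] --> (0 : R).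
  have : `|N O (u n) - r| @[n --> \oo] --> (0 : R).
    apply: squeeze_cvgr (cvg_cst 0) (@cvg_inv_nat R); apply: nearW => n.
    by have [_ _ ->] := hu n; rewrite normr_ge0.
  by move=> h; apply: cvg_trans h; exact: cvg_app.
have : `|N O v - r| = 0 by exact: (cvgF_uniq h1 h2).
by move/normr0_eq0/subr0_eq.
Qed.

Lemma gM1 u : BV u -> ell u <= 0 -> g u <= M.
Proof.
move=> [Bu Vu] lu; have := @gM (1, 0, u, u); rewrite /= mul1r mul0r addr0; apply.
by left; exists u.
Qed.

Lemma ell_ge : exists C : R, forall u, inV O u -> - C <= ell u.
Proof.
have [C C0 HC] := E_le_ell nu0 fV'; exists C => u Vu; have := HC u Vu.
have : 0 <= nu / 2 * E u by rewrite mulr_ge0 ?E_ge0// divr_ge0// ltW.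
by move=> h1 h2; have h3 := le_trans h1 h2; rewrite -subr_ge0 opprK.
Qed.

(** Makes a multiplier strictly positive at the cost of eps, since [ell] is bounded below. *)
Lemma perturb_slope (c d x l C eps : R) : x - c * l <= M -> 0 < d -> 0 < eps -> - C <= l ->
  d * (`|C| + 1) <= eps -> x - (c + d) * l < M + eps.
Proof.
move=> h d0 eps0 hl hd; have [l0|l0] := leP 0 l.
  have : 0 <= d * l by rewrite mulr_ge0// ltW.
  by rewrite mulrDl; lra.
have h1 : d * (- l) <= d * `|C|.
  by rewrite ler_wpM2l ?(ltW d0)//; apply: le_trans (ler_norm _); lra.
rewrite mulrDl; move: hd; rewrite mulrDr mulr1; lra.
Qed.

(** On one sphere a multiplier must separate the slopes (g - M) / ell at points with ell > 0 from
    those at points with ell < 0, and the bound on two-point members of [Bf] says exactly that these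
    are ordered. Without points of negative [ell] the slopes may be unbounded, and the slack eps is
    needed. *)
Lemma level_multiplier (r eps : R) : 0 < eps ->
  exists2 c : R, 0 < c & forall u, BV u -> N O u = r -> g u - c * ell u < M + eps.
Proof.
move=> eps0.
have [[u0 [K0 N0 l0]]|noneg] := pselect (exists u, [/\ BV u, N O u = r & ell u < 0]).
  pose S : set R := [set x | x = 0 \/ exists u, [/\ BV u, N O u = r, 0 < ell u & x = (g u - M) / ell u]].
  have Sle u : BV u -> N O u = r -> ell u < 0 -> forall x, S x -> x <= (M - g u) / (- ell u).
    move=> Ku Nu lu x [->|[v [Kv Nv lv ->]]].
      by rewrite divr_ge0 ?subr_ge0 ?oppr_ge0 ?(ltW lu)//; apply: gM1 => //; exact: ltW.
    apply: slope_le => //; have d0 : 0 < ell v - ell u by lra.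
    have s01 : 0 < ell v / (ell v - ell u) < 1.
      by rewrite divr_gt0//= ltr_pdivrMr// mul1r ltrDl oppr_gt0.
    have sl := balanced_weights d0.
    exact: (gM (Bf_pair s01 Ku Kv (etrans Nu (esym Nv)) lu lv sl)).
  have S0 : S 0 by left.
  have Ssup : has_sup S by split; [exists 0|exists ((M - g u0) / (- ell u0)); exact: Sle].
  have c00 : 0 <= sup S by apply: ub_le_sup => //; case: Ssup.
  have cP u : BV u -> N O u = r -> g u - sup S * ell u <= M.
    move=> Ku Nu; have [lu|lu|lu] := ltgtP (ell u) 0.
    - have : sup S <= (M - g u) / (- ell u) by apply: ge_sup; [by case: Ssup|exact: Sle].
      by rewrite ler_pdivlMr ?oppr_gt0// mulrN; lra.
    - have : (g u - M) / ell u <= sup S by apply: ub_le_sup; [by case: Ssup|right; exists u].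
      by rewrite ler_pdivrMr//; lra.
    - by rewrite lu mulr0 subr0; apply: gM1 => //; rewrite lu.
  have [C HC] := ell_ge.
  have C1 : 0 < `|C| + 1 by rewrite ltr_wpDl.
  have d0 : 0 < eps / (`|C| + 1) by rewrite divr_gt0.
  exists (sup S + eps / (`|C| + 1)); first by rewrite ltr_wpDl.
  move=> u Ku Nu; apply: (perturb_slope (cP u Ku Nu) d0 eps0 (HC u Ku.2)).
  by rewrite divfK ?gt_eqF.
(* No point of the sphere has negative [ell]. If every multiplier n + 1 fails, the failures u_n have
   [ell] = O(1/n), and their limit has [ell] <= 0 and g >= M + eps. *)
apply: contrapT => hn.
have lge u : BV u -> N O u = r -> 0 <= ell u.
  by move=> Ku Nu; rewrite leNgt; apply/negP => lu; apply: noneg; exists u.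
have pick (n : nat) : exists u, [/\ BV u, N O u = r & M + eps <= g u - n.+1%:R * ell u].
  apply: contrapT => /forallNP hx; apply: hn; exists n.+1%:R => [|u Ku Nu]; first by [].
  by rewrite ltNge; apply/negP => h; apply: (hx u).
have [u uP] := choice pick.
have u1 n : M + eps <= g (u n) - 1 * ell (u n).
  have [Kn Nn h] := uP n; apply: le_trans h _; rewrite lerD2l lerN2; apply: ler_wpM2r; first exact: lge.
  by rewrite ler1n.
have [v [U [Kv uU oU Nv cv]]] : exists v U, [/\ BV v, UltraFilter U, \oo `<=` U, N O v = r &
    forall G, tame G -> G (u n) @[n --> U] --> G v].
  apply: (@sequence_limit 1 (M + eps) r u ltr01) => n; have [Kn Nn _] := uP n; split=> //.
  by rewrite Nn subrr normr0 invr_ge0.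
have UT (P : nat -> Prop) : (forall n, P n) -> \forall n \near U, P n.
  by move=> hP; apply: (@filterS _ U _ setT) => [n _|]; [exact: hP|exact: filterT].
have gv : M + eps <= g v.
  apply: (cvgF_ge (cv _ tg)); apply: UT => n; have [Kn Nn h] := uP n; apply: le_trans h _.
  by rewrite gerBl mulr_ge0//; exact: lge.
have lv : ell v <= 0.
  apply: (cvgn_le_cst (ellk_cvg lam_e Kv.2)) => k.
  have [C HC] := coercive (M + eps) ltr01.
  have [Cg Cg0 HCg] := tame_bound wB tg.
  have c0 : (Cg * (1 + C) - (M + eps)) * n.+1%:R^-1 @[n --> U] --> (0 : R).
    have : (Cg * (1 + C) - (M + eps)) * n.+1%:R^-1 @[n --> \oo] --> (0 : R).
      by apply: (cvgn_ext (cvgM (cvg_cst _) (@cvg_inv_nat R))) => //; rewrite mulr0.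
    by move=> h; apply: cvg_trans h; exact: cvg_app.
  apply: (cvgF_ler (cv _ (tame_ellk lam_e B nu fV' k)) c0); apply: UT => n.
  have [Kn Nn h] := uP n.
  apply: le_trans (ellk_le lam_e nu0 f k Kn.2) _.
  rewrite ler_pdivlMr// mulrC.
  have h1 := le_trans (ler_norm _) (HCg _ Kn).
  have h2 : Cg * (1 + E (u n)) <= Cg * (1 + C) by apply: ler_wpM2l => //; rewrite lerD2l; exact: HC.
  have h3 := le_trans h1 h2.
  by move: h h3; set x := _ * ell _; set y := g _; set z := Cg * _; lra.
have := le_trans gv (gM1 Kv lv); rewrite gerDl leNgt eps0; exact/negP.
Qed.

(** A multiplier that is strict on one sphere works on nearby spheres: a sequence of failures would
    converge, by coercivity, to a failure on the sphere itself. *)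
Lemma local_multiplier (r eps : R) : 0 < eps -> exists p : R * R, [/\ 0 < p.1, 0 < p.2 &
  forall u, BV u -> `|N O u - r| < p.1 -> g u - p.2 * ell u <= M + eps].
Proof.
move=> eps0; have [c c0 hc] := level_multiplier r eps0.
apply: contrapT => hn.
have pick (n : nat) : exists u, [/\ BV u, M + eps <= g u - c * ell u & `|N O u - r| <= n.+1%:R^-1].
  apply: contrapT => /forallNP hx; apply: hn; exists (n.+1%:R^-1, c); split; [by rewrite /= invr_gt0|exact: c0|].
  move=> u Ku /= Nu; rewrite leNgt; apply/negP => h; apply: (hx u); split=> //; exact: ltW.
have [u uP] := choice pick.
have [v [U [Kv uU oU Nv cv]]] := sequence_limit c0 uP.
have := hc v Kv Nv; rewrite ltNge => /negP; apply.
have h1 : g v - c * ellk lam e nu f k v @[k --> \oo] --> g v - c * ell v.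
  apply: cvgB; first exact: cvg_cst.
  by apply: cvgM; [exact: cvg_cst|exact: (ellk_cvg lam_e Kv.2)].
have h2 k : M + eps <= g v - c * ellk lam e nu f k v.
  have t : tame (fun u => g u + - (c * ellk lam e nu f k u)).
    by apply: tameD => //; apply: tameN; apply: tameZ; exact: (tame_ellk lam_e B nu fV').
  apply: (cvgF_ge (cv _ t)); apply: (@filterS _ U _ setT) => [n _|]; last exact: filterT.
  have [Kn h _] := uP n; apply: le_trans h _; rewrite lerD2l lerN2; apply: ler_wpM2l; first exact: ltW.
  exact: (ellk_le lam_e nu0 f k Kn.2).
by apply: (cvgF_ge h1); exact: nearW.
Qed.

(** Failures of the multiplier 1 have bounded enstrophy by coercivity, hence bounded L^2 norm. *)
Lemma far_multiplier (eps : R) : exists2 r0 : R, 0 <= r0 &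
  forall u, BV u -> r0 < N O u -> g u - ell u <= M + eps.
Proof.
have [C HC] := coercive (M + eps) ltr01.
have l0 := lam_gt0 lam_e 0.
exists (`|C| / lam 0); first by rewrite divr_ge0// ltW.
move=> u Ku; rewrite ltr_pdivrMr// => hN; rewrite leNgt; apply/negP => h.
have h1 : E u <= C by apply: HC => //; rewrite mul1r; exact: ltW.
have := L2_le_E lam_e Ku.2; rewrite -/(N O u) mulrC => h2.
have := lt_le_trans hN (le_trans h2 (le_trans h1 (ler_norm _))); by rewrite ltxx.
Qed.

(** A partition of unity in |u|^2: finitely many local multipliers cover [0, r0 + 1], and the
    multiplier 1 takes over beyond r0. The quotient of [num] by [den] is their weighted mean. *)
Lemma multiplier (eps : R) : 0 < eps -> exists L : R -> R, [/\ continuous L, forall x, 0 <= L x,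
  exists C : R, forall x, `|L x| <= C & forall u, BV u -> g u - L (N O u) * ell u <= M + eps].
Proof.
move=> eps0; have [p hp] := choice (fun r => @local_multiplier r eps eps0).
have [r0 r00 hr0] := far_multiplier eps.
have : compact `[0, r0 + 1]%classic by exact: segment_compact.
rewrite compact_cover => /(_ R setT (fun r => ball r (p r).1)) [].
- by move=> r _; apply: ball_open; case: (hp r).
- by move=> r _; exists r => //; apply: ballxx; case: (hp r).
move=> D'' _ Dcov; pose D' : seq R := finmap.enum_fset D''.
pose w r (x : R) := Num.max 0 ((p r).1 - `|x - r|).
pose w0 (x : R) := Num.max 0 (x - r0).
pose den x := w0 x + \sum_(r <- D') w r x.
pose num x := w0 x + \sum_(r <- D') (p r).2 * w r x.
have w_ge0 r x : 0 <= w r x by rewrite /w le_max lexx.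
have w0_ge0 x : 0 <= w0 x by rewrite /w0 le_max lexx.
have c_ge0 r : 0 <= (p r).2 by apply: ltW; case: (hp r).
have num_ge0 x : 0 <= num x by rewrite addr_ge0// sumr_ge0// => r _; rewrite mulr_ge0.
have den_gt0 x : 0 <= x -> 0 < den x.
  move=> x0; have [xr|rx] := leP x r0; last first.
    apply: ltr_pwDl; last by apply: sumr_ge0.
    by rewrite /w0 lt_max subr_gt0 rx orbT.
  have /Dcov [r /= Dr xr'] : `[0, r0 + 1]%classic x by rewrite /= in_itv/= x0/=; lra.
  apply: ltr_wpDl => //; rewrite (big_rem r)//=; apply: ltr_pwDl; last by apply: sumr_ge0.
  by rewrite /w lt_max subr_gt0 orbC; move: xr'; rewrite /ball/= distrC => ->.
have w_cont r : continuous (w r).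
  move=> x; apply: (@continuous_max R R (cst 0) (fun x => (p r).1 - `|x - r|) x); first exact: cvg_cst.
  apply: cvgB; first exact: cvg_cst.
  by apply: cvg_norm; apply: cvgB; [exact: cvg_id|exact: cvg_cst].
have w0_cont : continuous w0.
  move=> x; apply: (@continuous_max R R (cst 0) (fun x => x - r0) x); first exact: cvg_cst.
  by apply: cvgB; [exact: cvg_id|exact: cvg_cst].
have sum_cont (F : R -> R -> R) : (forall r, continuous (F r)) -> continuous (fun x => \sum_(r <- D') F r x).
  move=> cF x; apply: cvg_big; first exact: add_continuous.
  by move=> r _; exact: cF.
have den_cont : continuous den.
  by move=> x; apply: cvgD; [exact: w0_cont|exact: (sum_cont w w_cont x)].
have num_cont : continuous num.
  move=> x; apply: cvgD; first exact: w0_cont.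
  apply: (sum_cont (fun r x => (p r).2 * w r x)) => r y.
  by apply: cvgM; [exact: cvg_cst|exact: w_cont].
(* Positivity of [den] is known on [0, +oo[ only; composing with the positive part gives continuity
   on the whole line. *)
pose pos (x : R) := Num.max 0 x.
have pos_ge0 x : 0 <= pos x by rewrite /pos le_max lexx.
have pos_cont : continuous pos.
  by move=> x; apply: (@continuous_max R R (cst 0) idfun x); [exact: cvg_cst|exact: cvg_id].
exists (fun x => num (pos x) / den (pos x)); split.
- move=> x; apply: cvgM; first by apply: continuous_comp; [exact: pos_cont|exact: num_cont].
  apply: cvgV; first by rewrite gt_eqF// den_gt0.
  by apply: continuous_comp; [exact: pos_cont|exact: den_cont].
- by move=> x; rewrite divr_ge0// ltW// den_gt0.
- exists (1 + \sum_(r <- D') (p r).2) => x.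
  have d0 := den_gt0 _ (pos_ge0 x).
  rewrite ger0_norm ?divr_ge0// ?(ltW d0)// ler_pdivrMr// mulrDl mul1r.
  have h1 := sum_mul_le D' c_ge0 (w_ge0^~ (pos x)).
  have h2 : 0 <= (\sum_(r <- D') (p r).2) * w0 (pos x) by rewrite mulr_ge0// sumr_ge0.
  have h3 : 0 <= \sum_(r <- D') w r (pos x) by apply: sumr_ge0.
  by rewrite /num /den mulrDr; lra.
- move=> u Ku; have N0 := N_ge0 O u.
  have -> : pos (N O u) = N O u by rewrite /pos max_r.
  have d0 := den_gt0 _ N0.
  rewrite -(ler_pM2r d0) mulrBl [_ * ell u * _]mulrAC divfK ?gt_eqF//.
  apply: weighted_le => [|r].
    rewrite /w0; have [h|h] := ltP r0 (N O u); last by rewrite max_l ?subr_le0// !mul0r.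
    by rewrite ler_wpM2l ?w0_ge0//; exact: hr0.
  rewrite /w; have [h|h] := ltP `|N O u - r| (p r).1; last by rewrite max_l ?subr_le0// !mul0r.
  have [_ _ hr] := hp r; apply: ler_wpM2l; first exact: w_ge0.
  exact: hr.
Qed.

End Multiplier.

Lemma energy_weight_primitive (R : realType) (L : R -> R) (C : R) : continuous L ->
  (forall x, 0 <= L x) -> (forall x, `|L x| <= C) -> exists psi, energy_weight psi L.
Proof.
move=> cL L0 LC.
(* Starting the primitive at -1 makes 0 an interior point, where the two-sided derivative exists. *)
pose psi (x : R) := \int[lebesgue_measure]_(t in `[-1, x]) L t.
have iL a b : lebesgue_measure.-integrable `[a, b] (EFin \o L).
  by apply: continuous_compact_integrable; [exact: segment_compact|exact: continuous_subspaceT].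
exists psi; split.
- by move=> x _; apply: Rintegral_ge0.
- move=> x y x0 xy; rewrite /psi /Rintegral; apply: fine_le.
  + by apply: integrable_fin_num => //; exact: iL.
  + by apply: integrable_fin_num => //; exact: iL.
  + apply: ge0_subset_integral => //; first exact: (measurable_int _ (iL _ _)).
      by move=> z _; rewrite lee_fin.
    by move=> z /=; rewrite !in_itv/= => /andP[-> /le_trans]; exact.
- move=> x x0.
  have [dpsi dE] : derivable psi x 1 /\ (psi^`())%classic x = L x.
    apply: (@continuous_FTC1 R L (BLeft (-1)) x (x + 1)) => //; first by rewrite ltrDl.
      by rewrite /Order.lt/=; lra.
    exact: cL.
  have h : h^-1 * (psi (x + h) - psi x) @[h --> (0 : R)^'] --> L x.
    rewrite -dE derive1E; have := dpsi; rewrite /derivable /derive => hd.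
    have E : (fun h : R => h^-1 *: ((psi \o shift x) (h *: 1) - psi x)) = (fun h => h^-1 * (psi (x + h) - psi x)).
      by apply/funext => h /=; rewrite [h *: 1]mulr1 [h + x]addrC.
    by rewrite -E; exact: hd.
  by apply: cvg_trans h; apply: cvg_app; exact: cvg_within.
- exact: continuous_subspaceT.
- by exists C.
Qed.

(** * Weak duality *)

Section MeasurableStructure.
Variables (R : realType) (O : bounded_domain R).
Variables (lam : nat -> R) (e : nat -> Hspace O).
Hypothesis lam_e : stokes_eigenbasis lam e.
Variables (B : set (Hspace O)) (wB : weakly_compact B).
Local Notation H := (Hspace O).
Local Notation HB := (Hborel O).
Local Notation E u := (norm_grad O u ^+ 2).
Local Notation BV := (BV B).

Definition Vset : set HB := [set u : HB | inV O (hfun u)].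

Lemma dot_inj (u v : H) : (forall w : H, dotL2 O u w = dotL2 O v w) -> u = v.
Proof.
move=> uv; apply: distH_eq0; rewrite /distH normL2E /fnorm.
have Lu := hfun_L2 u; have Lv := hfun_L2 v; have Ld := L2fieldB Lu Lv.
rewrite (formBl (dotL2_form O) Lu Lv Ld) (formBr (dotL2_form O) Lu Lv Lu) (formBr (dotL2_form O) Lu Lv Lv).
by rewrite !uv !subrr sqrtr0.
Qed.

(** A norm limit is also a weak limit, and weak limits are unique; hence B is norm closed and
    Borel. *)
Lemma B_closed : closed B.
Proof.
move=> u; rewrite closureEcvg => -[G pG [Gu GB]].
have [U [uU GU]] := ultraFilterLemma pG.
have UB : U B by apply: GU; apply: GB; exact: (fun x => id).
have [v Bv cv] := B_ultra wB uU UB.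
suff -> : u = v by [].
apply: dot_inj => w.
have cu : dotL2 O (hfun x) w @[x --> U] --> dotL2 O u w.
  have h := @wcvg_nbhs _ _ u w; apply: cvg_trans h; apply: cvg_app.
  exact: (subset_trans Gu GU).
exact: (cvgF_uniq cu (cv w)).
Qed.

Lemma measurable_B : measurable (B : set HB).
Proof.
rewrite -[B]setCK; apply: measurableC; apply: sub_sigma_algebra.
by apply: closed_openC; exact: B_closed.
Qed.

Lemma enk_meas k : measurable_fun setT (fun u : HB => enk lam e k (hfun u)).
Proof. by apply: wcont_meas; exact: (wcont_enk lam_e). Qed.

(** By [enk_bounded_V], V is the set where the [enk] are bounded, which makes it Borel in H. *)
Lemma Vset_E : Vset = \bigcup_(C in [set: nat]) \bigcap_(k in [set: nat])
  [set u : HB | enk lam e k (hfun u) <= C%:R].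
Proof.
apply/seteqP; split=> u; last first.
  move=> [C _ h]; have Hu : inH O (hfun u) := hclass_inH u.
  by apply: (enk_bounded_V lam_e (C := C%:R) Hu) => k; exact: h.
move=> Vu; exists (Num.truncn (E (hfun u))).+1 => // k _ /=.
by apply: le_trans (enk_le_grad lam_e k Vu) _; apply: ltW; exact: truncnS_gt.
Qed.

Lemma measurable_V : measurable Vset.
Proof.
rewrite Vset_E; apply: bigcup_measurable => C _; apply: bigcap_measurable => [|k _]; first by exists 0%N.
have := @enk_meas k measurableT _ (measurable_itv `]-oo, C%:R]); rewrite setTI.
by congr measurable; apply/seteqP; split=> u /=; rewrite in_itv.
Qed.

Lemma measurable_BV : measurable (BV : set HB).
Proof.
rewrite (_ : BV = (B : set HB) `&` Vset); first by apply: measurableI; [exact: measurable_B|exact: measurable_V].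
by apply/seteqP; split.
Qed.

Lemma E_meas : measurable_fun Vset (fun u : HB => E (hfun u)).
Proof.
apply: (measurable_fun_cvg (h := fun k (u : HB) => enk lam e k (hfun u))).
  by move=> k; apply: measurable_funTS; exact: enk_meas.
by move=> u Vu; exact: (enk_cvg lam_e).
Qed.

Lemma N_meas : measurable_fun setT (fun u : HB => N O (hfun u)).
Proof.
apply: (measurable_fun_cvg (h := fun k (u : HB) => Npart e k (hfun u))).
  by move=> k; apply: wcont_meas; exact: (wcont_Npart lam_e).
by move=> u _; apply: (parseval lam_e); exact: hclass_inH.
Qed.

(** Tameness over all of H, with tolerances 1 / (n + 1), exhibits [G] on V as a pointwise limit of
    weakly continuous functionals. *)
Lemma tame_meas (G : H -> R) : tame setT G -> measurable_fun Vset (G : HB -> R).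
Proof.
move=> tG; have n0 n : (0 : R) < n.+1%:R^-1 by rewrite invr_gt0.
have pick n : exists h, wcont h /\ forall u : H, inV O (hfun u) -> `|G u - h u| <= n.+1%:R^-1 * (1 + E (hfun u)).
  by have [h ch hh] := tG _ (n0 n); exists h; split=> // u Vu; exact: (hh u (conj I Vu)).
have [h hP] := choice pick.
apply: (measurable_fun_cvg (h := fun n => (h n : HB -> R))).
  by move=> n; apply: measurable_funTS; apply: wcont_meas; case: (hP n).
move=> u Vu; apply/cvgrPdist_le => eps eps0.
have cE : n.+1%:R^-1 * (1 + E (hfun u)) @[n --> \oo] --> (0 : R).
  by apply: (cvgn_ext (cvgM (@cvg_inv_nat R) (cvg_cst (1 + E (hfun u))))) => //; rewrite mul0r.
have p0 : 0 <= 1 + E (hfun u) by apply: addr_ge0 => //; exact: E_ge0.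
move/cvgrPdist_le : cE => /(_ _ eps0); apply: filterS => n; rewrite sub0r normrN ger0_norm; last first.
  by rewrite mulr_ge0// invr_ge0.
by move=> h1; have [_ hn] := hP n; apply: le_trans h1; exact: hn.
Qed.

Variables (nu : R) (f : vfield R -> R) (fV' : inVdual O f).

Lemma f_meas : measurable_fun Vset (fun u : HB => f (hfun u)).
Proof. by apply: tame_meas; exact: (tame_dual lam_e setT fV'). Qed.

Lemma ell_meas : measurable_fun Vset (fun u : HB => ell O nu f (hfun u)).
Proof.
apply: measurable_funB; last exact: f_meas.
by apply: measurable_funM; [exact: measurable_cst|exact: E_meas].
Qed.

Lemma Fcyl_meas (Psi : cyl O) : measurable_fun Vset (fun u : HB => @Fcyl R O nu f Psi (hfun u)).
Proof.
have E0 : {in Vset, (fun u : HB => \sum_j @cyl_coef R O Psi j (hfun u) * Fns O nu f (hfun u) (@cyl_w _ _ Psi j))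
    =1 (fun u : HB => @Fcyl R O nu f Psi (hfun u))}.
  by move=> u; rewrite inE => Vu; rewrite (FcylE nu fV' Psi Vu).
apply: (eq_measurable_fun _ E0).
apply: measurable_sum => j; apply: measurable_funM.
  by apply: measurable_funTS; apply: wcont_meas; exact: wcont_cyl_coef.
have t : tame setT (fun u : H => Fns O nu f (hfun u) (@cyl_w _ _ Psi j)).
  by apply: (tame_Fns lam_e) => //; exact: (@cyl_wV _ _ Psi j).
exact: (tame_meas t).
Qed.

Lemma enstrophy_ge0 (u : HB) : (0 <= enstrophy O (hfun u))%E.
Proof. by rewrite /enstrophy; case: ifP => _ //; rewrite lee_fin; exact: E_ge0. Qed.

Lemma enstrophy_V (u : HB) : Vset u -> enstrophy O (hfun u) = (E (hfun u))%:E.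
Proof. by move=> Vu; rewrite /enstrophy; case: ifP => // /asboolP. Qed.

(** Off V the [enk] are unbounded by [enk_bounded_V], which matches the value +oo of the
    enstrophy. *)
Lemma enstrophy_cvg (u : HB) : (enk lam e k (hfun u))%:E @[k --> \oo] --> enstrophy O (hfun u).
Proof.
rewrite /enstrophy; case: ifPn => [/asboolP Vu|/asboolP nV].
  by apply: cvg_EFin; [exact: nearW|exact: (enk_cvg lam_e Vu)].
have nd : nondecreasing_seq (fun k => (enk lam e k (hfun u))%:E).
  by move=> m n mn; rewrite lee_fin; exact: (enk_nd lam_e).
have := ereal_nondecreasing_cvgn nd; set s := ereal_sup _.
suff -> : s = +oo%E by [].
apply/eqP; rewrite eq_le leey/= leNgt; apply/negP => sy; apply: nV.
have s0 : (0 <= s)%E.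
  apply: (@le_trans _ _ (enk lam e 0 (hfun u))%:E); first by rewrite lee_fin (enk_ge0 lam_e).
  by apply: ereal_sup_ubound; exists 0%N.
have sf : s \is a fin_num by rewrite ge0_fin_numE.
have Hu : inH O (hfun u) := hclass_inH u.
apply: (enk_bounded_V lam_e (C := fine s) Hu) => k.
by rewrite -lee_fin fineK//; apply: ereal_sup_ubound; exists k.
Qed.

Lemma enstrophy_meas : measurable_fun setT (fun u : HB => enstrophy O (hfun u)).
Proof.
apply: (emeasurable_fun_cvg (fun k (u : HB) => (enk lam e k (hfun u))%:E)).
  by move=> k; apply/measurable_EFinP; exact: enk_meas.
by move=> u _; exact: enstrophy_cvg.
Qed.

End MeasurableStructure.

(** * Integration against laws of finite mean enstrophy carried by B *)

Section Integrals.
Variables (R : realType) (O : bounded_domain R).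
Variables (lam : nat -> R) (e : nat -> Hspace O).
Hypothesis lam_e : stokes_eigenbasis lam e.
Variables (B : set (Hspace O)) (wB : weakly_compact B).
Variables (nu : R) (nu0 : 0 < nu) (f : vfield R -> R) (fV' : inVdual O f).
Local Notation H := (Hspace O).
Local Notation HB := (Hborel O).
Local Notation E u := (norm_grad O u ^+ 2).
Local Notation BV := (BV B).
Local Notation V := (@Vset R O).
Variable mu : probability HB R.
Hypothesis muB : mu (~` B) = 0%E.
Hypothesis muE : (\int[mu]_u enstrophy O (hfun u) < +oo)%E.

Let mB : measurable (B : set HB) := measurable_B wB.
Let mV : measurable V := measurable_V lam_e.

Lemma mu_VC : mu (~` V) = 0%E.
Proof.
have ie : mu.-integrable setT (fun u : HB => enstrophy O (hfun u)).
  apply/integrableP; split; first exact: (enstrophy_meas lam_e).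
  by under eq_integral do rewrite gee0_abs ?enstrophy_ge0//.
have [N [mN N0 hN]] := integrable_ae measurableT ie.
apply/eqP; rewrite eq_le measure_ge0 andbT -N0; apply: le_measure; rewrite ?inE//.
  exact: measurableC.
move=> u nV; apply: hN => /= /(_ I); rewrite /enstrophy; case: ifP => // /asboolP Vu _; exact: (nV Vu).
Qed.

Lemma integrable_V (G : H -> R) (C : R) : measurable_fun V (G : HB -> R) ->
  (forall u, BV u -> `|G u| <= C * (1 + E u)) -> mu.-integrable V (EFin \o (G : HB -> R)).
Proof.
move=> mG GC.
have mBc : measurable (~` (B : set HB)) by exact: measurableC.
have mG' : measurable_fun V (EFin \o (G : HB -> R)) by apply/measurable_EFinP.
apply/(negligible_integrable mBc mV mG' muB); rewrite setDE setCK.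
have mD : measurable (V `&` (B : set HB)) by exact: measurableI.
have iE : mu.-integrable (V `&` (B : set HB)) (fun u : HB => (1 + enstrophy O (hfun u))%E).
  apply: integrableD => //.
    exact: (@finite_measure_integrable_cst _ _ _ mu _ 1).
  apply: (@integrableS _ _ _ _ setT) => //.
  apply/integrableP; split; first exact: (enstrophy_meas lam_e).
  by under eq_integral do rewrite gee0_abs ?enstrophy_ge0//.
apply: (le_integrable mD _ _ (integrableZl mD C iE)).
  by apply: measurable_funS mG' => //; exact: subIsetl.
move=> u [Vu Bu]; rewrite /= enstrophy_V// -EFinD -EFinM !abse_EFin lee_fin.
by apply: le_trans (ler_norm _); exact: (GC u (conj Bu Vu)).
Qed.

Lemma integral_BV (G : H -> R) (C : R) : measurable_fun V (G : HB -> R) ->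
  (forall u, BV u -> `|G u| <= C * (1 + E u)) ->
  (\int[mu]_(u in V) (G u)%:E = \int[mu]_(u in (BV : set HB)) (G u)%:E)%E.
Proof.
move=> mG GC; have iG := integrable_V mG GC.
have mBc : measurable (~` (B : set HB)) by exact: measurableC.
rewrite (negligible_integral mBc mV iG muB); congr (integral _ _ _).
by rewrite setDE setCK setIC.
Qed.

Lemma mu_BV : mu (BV : set HB) = 1%E.
Proof.
have mBc : measurable (~` (B : set HB)) by exact: measurableC.
have mVc : measurable (~` V) by exact: measurableC.
have bE : (BV : set HB) = ~` (~` V `|` ~` (B : set HB)) by rewrite setCU !setCK setIC.
rewrite bE probability_setC; last exact: measurableU.
have -> : mu (~` V `|` ~` (B : set HB)) = 0%E.
  by apply: null_set_setU => //; exact: mu_VC.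
by rewrite sube0.
Qed.

Lemma integral_enk_V k : (\int[mu]_u (enk lam e k (hfun u))%:E = \int[mu]_(u in V) (enk lam e k (hfun u))%:E)%E.
Proof.
have mVc : measurable (~` V) by exact: measurableC.
have me : measurable_fun setT (fun u : HB => (enk lam e k (hfun u))%:E).
  by apply/measurable_EFinP; exact: (enk_meas lam_e).
rewrite -(setCK V) -setTD; apply: ge0_negligible_integral => //.
- by move=> u _; rewrite lee_fin (enk_ge0 lam_e).
- exact: mu_VC.
Qed.

Lemma ell_bound : exists2 C : R, 0 <= C & forall u, inV O u -> `|ell O nu f u| <= C * (1 + E u).
Proof.
have [_ [C fC]] := fV'; exists (nu + `|C|) => [|u Vu]; first by rewrite addr_ge0// ltW.
apply: le_trans (ler_normB _ _) _; rewrite mulrDl; apply: lerD.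
  by rewrite normrM (gtr0_norm nu0) ger0_norm ?E_ge0// ler_wpM2l ?(ltW nu0)// lerDr.
apply: le_trans (fC u Vu) _.
have g0 := norm_grad_ge0 O u.
apply: (@le_trans _ _ (`|C| * norm_grad O u)); first by rewrite ler_wpM2r// ler_norm.
apply: ler_wpM2l => //; have := sqr_ge0 (norm_grad O u - 1).
by move: (norm_grad O u) g0 => x x0; rewrite sqrrB1 -mulr_natl; nra.
Qed.

End Integrals.

Section UpperBound.
Variables (R : realType) (O : bounded_domain R).
Variables (lam : nat -> R) (e : nat -> Hspace O).
Hypothesis lam_e : stokes_eigenbasis lam e.
Variables (B : set (Hspace O)) (wB : weakly_compact B).
Variables (nu : R) (nu0 : 0 < nu) (f : vfield R -> R) (fV' : inVdual O f).
Local Notation H := (Hspace O).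
Local Notation HB := (Hborel O).
Local Notation E u := (norm_grad O u ^+ 2).
Local Notation BV := (BV B).
Local Notation V := (@Vset R O).

Lemma dual_upper_bound (mu : probability HB R) k (Psi : cyl O) (M : R) : fpsss_on nu f B mu ->
  (forall b, Bf nu f B b -> objective nu f e k Psi b <= M) ->
  (\int[mu]_u (enk lam e k (hfun u))%:E <= M%:E)%E.
Proof.
move=> [[muE mu2 mu3] muB] HM.
have mV : measurable V := measurable_V lam_e.
have mD : measurable (BV : set HB) := measurable_BV lam_e wB.
apply/lee_addgt0Pr => eps eps0.
have tg := tame_bracket lam_e wB nu fV' k Psi.
have gM b : Bf nu f B b -> wsum2 (fun u : H => bracket nu f e k Psi u) b <= M.
  by move=> Bb; rewrite -objectiveE; exact: HM.
have [L [cL L0 [CL LC] hL]] := multiplier lam_e wB nu0 fV' tg gM eps0.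
(* The multiplier is itself the derivative of an admissible energy weight, so the energy inequality
   applies with it. *)
have [psi wpsi] := energy_weight_primitive cL L0 LC.
have := mu2 _ _ wpsi; have := mu3 Psi.
have [CF CF0 hF] := tame_bound wB (tame_Fcyl lam_e wB nu fV' Psi).
have [Cl Cl0 hl] := ell_bound nu0 fV'.
have mF : measurable_fun V (fun u : HB => @Fcyl R O nu f Psi (hfun u)) := Fcyl_meas lam_e nu fV' Psi.
have mL : measurable_fun V (fun u : HB => L (N O (hfun u)) * ell O nu f (hfun u)).
  apply: measurable_funM; last exact: (ell_meas lam_e nu fV').
  apply: measurable_funTS; apply: (measurableT_comp _ (N_meas lam_e)).
  exact: continuous_measurable_fun.
have mE : measurable_fun V (fun u : HB => enk lam e k (hfun u)).
  by apply: measurable_funTS; exact: (enk_meas lam_e).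
have bL (u : H) : BV u -> `|L (N O (hfun u)) * ell O nu f (hfun u)| <= (CL * Cl) * (1 + E (hfun u)).
  move=> [_ Vu]; rewrite normrM -mulrA; apply: ler_pM => //; exact: hl.
have bE (u : H) : BV u -> `|enk lam e k (hfun u)| <= 1 * (1 + E (hfun u)).
  move=> Ku; rewrite mul1r ger0_norm ?(enk_ge0 lam_e)//; apply: le_trans (BV_enk_le lam_e k Ku) _.
  by rewrite lerDr.
have IF := integral_BV lam_e wB muB muE mF hF.
have IL := integral_BV lam_e wB muB muE mL bL.
have IE := integral_BV lam_e wB muB muE mE bE.
have BVV : (BV : set HB) `<=` V by move=> u [].
have iF := integrableS mV mD BVV (integrable_V lam_e wB muB muE mF hF).
have iL := integrableS mV mD BVV (integrable_V lam_e wB muB muE mL bL).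
have iE := integrableS mV mD BVV (integrable_V lam_e wB muB muE mE bE).
have E0 : (\int[mu]_(u in V) (Fns O nu f (hfun u) (cyl_diff Psi (dotL2 O (hfun u))))%:E =
           \int[mu]_(u in (BV : set HB)) (@Fcyl R O nu f Psi (hfun u))%:E)%E by rewrite -IF.
have El : (\int[mu]_(u in V) (L (normL2 O (hfun u) ^+ 2) * ell O nu f (hfun u))%:E =
           \int[mu]_(u in (BV : set HB)) (L (N O (hfun u)) * ell O nu f (hfun u))%:E)%E.
  rewrite -IL; apply: eq_integral => u _; rewrite normL2_sqr//; exact: hfun_L2.
rewrite E0 El (integral_enk_V lam_e muE) IE => F0 Ll.
have iEF := integrableD mD iE iF.
have iEFL := integrableB mD iEF iL.
have : (\int[mu]_(u in (BV : set HB)) ((enk lam e k (hfun u))%:E + (@Fcyl R O nu f Psi (hfun u))%:E -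
    (L (N O (hfun u)) * ell O nu f (hfun u))%:E) <= \int[mu]_(u in (BV : set HB)) (cst (M + eps)%:E u))%E.
  apply: le_integral => //.
    exact: finite_measure_integrable_cst.
  move=> u; rewrite inE => Ku.
  by have := hL u Ku; rewrite (bracketE lam_e) -lee_fin; exact.
have -> : (\int[mu]_(u in (BV : set HB)) cst (M + eps)%:E u = (M + eps)%:E)%E.
  rewrite (integral_cst mu mD) -[RHS]mule1; congr (_ * _)%E.
  exact: (mu_BV lam_e wB muB muE).
rewrite integralB// integralD// F0 adde0 EFinD => h.
apply: le_trans h; rewrite -[leLHS]sube0; apply: leeB => //.
Qed.

End UpperBound.

(** * Linear combinations of cylindrical functionals *)

Section SquareOfPositivePart.
Variable R : realType.
Implicit Types t : R.

Definition pos t : R := Num.max 0 t.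
(** Squaring makes the positive part C^1. *)
Definition possq t : R := pos t ^+ 2.

Lemma pos_ge0 t : 0 <= pos t. Proof. by rewrite /pos le_max lexx. Qed.

Lemma pos_le t : pos t <= `|t|.
Proof. by rewrite /pos ge_max normr_ge0 ler_norm. Qed.

Lemma pos_continuous : continuous pos.
Proof.
by move=> x; apply: (@continuous_max R R (cst 0) idfun x); [exact: cvg_cst|exact: cvg_id].
Qed.

Lemma possq_continuous : continuous possq.
Proof. by move=> x; rewrite /possq; under eq_fun do rewrite expr2; apply: cvgM; exact: pos_continuous. Qed.

Lemma possq_eq0 t : t <= 0 -> possq t = 0.
Proof. by move=> t0; rewrite /possq /pos max_l// expr2 mul0r. Qed.

Lemma is_derive_possq t : is_derive t 1 possq (2 * pos t).
Proof.
have [t0|t0|<-] := ltgtP 0 t.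
- have E : \near t, t ^+ 2 = possq t.
    near=> s; have s0 : 0 < s by near: s; exact: lt_nbhsr.
    by rewrite /possq /pos max_r// ltW.
  have -> : 2 * pos t = 2 * t by rewrite /pos max_r// ltW.
  have D : is_derive t 1 (fun s : R => s ^+ 2) (2 * t).
    have -> : (fun s : R => s ^+ 2) = id * id by apply/funext => s; rewrite expr2.
    have := is_deriveM (is_derive_id t 1) (is_derive_id t 1).
    by rewrite -[t *: 1]/(t * 1) mulr1 mulrDl mul1r.
  apply: DeriveDef.
    by apply: (near_eq_derivable (f := fun s : R => s ^+ 2)) => //; case: D.
  by rewrite -(near_eq_derive _ E)//; exact: derive_val.
- have E : \near t, cst 0 t = possq t.
    near=> s; have s0 : s < 0 by near: s; exact: lt_nbhsl.
    by rewrite /= possq_eq0// ltW.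
  have -> : 2 * pos t = 0 by rewrite /pos max_l ?mulr0// ltW.
  apply: DeriveDef.
    by apply: (near_eq_derivable (f := cst 0)) => //; exact: derivable_cst.
  by rewrite -(near_eq_derive _ E)//; exact: derive_cst.
have -> : 2 * pos 0 = 0 by rewrite /pos max_l// mulr0.
have L : h^-1 *: ((possq \o shift 0) (h *: 1) - possq 0) @[h --> (0 : R)^'] --> (0 : R).
  apply/cvgrPdist_le => eps eps0; near=> h.
  have -> : (possq \o shift 0) (h *: 1) - possq 0 = possq h.
    by rewrite [possq 0]possq_eq0// subr0 /= addr0 [h *: 1]mulr1.
  rewrite sub0r normrN normrM normfV.
  have h0 : `|h| != 0 by rewrite normr_eq0; near: h; exact: nbhs_dnbhs_neq.
  have hp : 0 < `|h| by rewrite lt_def h0 normr_ge0.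
  rewrite mulrC ler_pdivrMr//.
  have he : `|h| <= eps.
    near: h; apply: dnbhs0_le => //.
  rewrite /possq ger0_norm ?sqr_ge0//.
  apply: le_trans (_ : `|h| ^+ 2 <= _); last by rewrite expr2 ler_wpM2r.
  by rewrite ler_sqr ?nnegrE ?pos_ge0// pos_le.
apply: DeriveDef; first by apply/cvg_ex; exists 0.
exact: (cvg_lim _ L).
Unshelve. all: by end_near. Qed.

(* A C^1 bump equal to 1 on [-C, C] and supported in [-C-1, C+1] is possq (1 - cutoff C t). *)
Definition cutoff (C t : R) : R := possq (t - C) + possq (- t - C).

Lemma cutoff_ge0 C t : 0 <= cutoff C t.
Proof. by rewrite addr_ge0// sqr_ge0. Qed.

Lemma cutoff_eq0 C t : `|t| <= C -> cutoff C t = 0.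
Proof.
rewrite ler_norml => /andP[h1 h2]; rewrite /cutoff !possq_eq0 ?addr0//; lra.
Qed.

Definition dcutoff (C t : R) : R := 2 * pos (t - C) - 2 * pos (- t - C).

Lemma dcutoff_eq0 C t : `|t| <= C -> dcutoff C t = 0.
Proof.
rewrite ler_norml => /andP[h1 h2]; rewrite /dcutoff /pos !max_l ?mulr0 ?subr0//; lra.
Qed.

Lemma is_derive_cutoff C t : is_derive t 1 (cutoff C) (dcutoff C t).
Proof.
have A : is_derive t 1 (fun s : R => s - C) 1.
  by have := is_deriveD (is_derive_id t 1) (is_derive_cst (- C) t 1); rewrite addr0.
have B : is_derive t 1 (fun s : R => - s - C) (- 1).
  by have := is_deriveD (is_deriveN (is_derive_id t 1)) (is_derive_cst (- C) t 1); rewrite addr0.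
have := is_deriveD (is_derive1_comp (is_derive_possq _) A) (is_derive1_comp (is_derive_possq _) B).
by rewrite mulr1 mulrN1.
Qed.

Lemma dcutoff_continuous C : continuous (dcutoff C).
Proof.
move=> t; apply: cvgB; (apply: cvgM; first exact: cvg_cst).
  apply: (@continuous_comp _ _ _ (fun t => t - C) pos); last exact: pos_continuous.
  by apply: cvgB; [exact: cvg_id|exact: cvg_cst].
apply: (@continuous_comp _ _ _ (fun t => - t - C) pos); last exact: pos_continuous.
by apply: cvgB; [apply: cvgN; exact: cvg_id|exact: cvg_cst].
Qed.

Lemma cutoff_continuous C : continuous (cutoff C).
Proof.
move=> t; apply: cvgD.
  apply: (@continuous_comp _ _ _ (fun t => t - C) possq); last exact: possq_continuous.
  by apply: cvgB; [exact: cvg_id|exact: cvg_cst].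
apply: (@continuous_comp _ _ _ (fun t => - t - C) possq); last exact: possq_continuous.
by apply: cvgB; [apply: cvgN; exact: cvg_id|exact: cvg_cst].
Qed.

Lemma cutoff_lt1 C t : 0 <= C -> cutoff C t < 1 -> `|t| <= C + 1.
Proof.
move=> C0 h; rewrite ler_norml; apply/andP; split; rewrite leNgt; apply/negP => ht; move: h; rewrite ltNge => /negP; apply.
  rewrite /cutoff ler_wpDl ?sqr_ge0// /possq /pos max_r; last by lra.
  by rewrite expr_ge1//; lra.
rewrite /cutoff ler_wpDr ?sqr_ge0// /possq /pos max_r; last by lra.
by rewrite expr_ge1//; lra.
Qed.

End SquareOfPositivePart.

(** * C^1 functions and cutoffs on row vectors *)

Section RowCalculus.
Variables (R : realType) (m : nat).
Local Notation RV := 'rV[R]_m.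
Local Notation e_ j := (delta_mx 0 j : 'rV[R]_m).
Implicit Types (g : RV -> R) (x y : RV).

Lemma line_is_derive g x v (s : R) : derivable g (x + s *: v) v ->
  is_derive s (1 : R) (fun t : R => g (x + t *: v)) ('D_v g (x + s *: v)).
Proof. by move=> dg; apply: DeriveDef; [exact: derivable_line|exact: derive_line]. Qed.

Lemma row_line x (s : R) i j : (x + s *: e_ j) 0 i = x 0 i + s * (i == j)%:R.
Proof. by rewrite !mxE eqxx. Qed.

Lemma axis_lipschitz g (C : R) x j (t : R) : (forall y i, derivable g y (e_ i)) ->
  (forall y i, `|'D_(e_ i) g y| <= C) -> `|g (x + t *: e_ j) - g x| <= C * `|t|.
Proof.
move=> dg gC.
have pos_case y (s : R) : 0 <= s -> `|g (y + s *: e_ j) - g y| <= C * `|s|.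
  move=> s0.
  have D r : is_derive r (1 : R) (fun t : R => g (y + t *: e_ j)) ('D_(e_ j) g (y + r *: e_ j)).
    exact: line_is_derive.
  have [|c _] := @MVT_segment R (fun t : R => g (y + t *: e_ j)) (fun r => 'D_(e_ j) g (y + r *: e_ j)) 0 s s0.
  + by apply: derivable_within_continuous => r _; case: (D r).
  by rewrite scale0r addr0 subr0 => ->; rewrite normrM ler_wpM2r.
have [t0|t0] := leP 0 t; first exact: pos_case.
rewrite distrC -[X in _ <= C * X]normrN.
rewrite (_ : g x = g (x + t *: e_ j + (- t) *: e_ j)); last by rewrite -addrA -scalerDl subrr scale0r addr0.
by apply: pos_case; rewrite oppr_ge0 ltW.
Qed.

(** The mean value theorem on a path from y to x that changes one coordinate at a time. *)
Lemma lipschitz_of_partials g (C : R) x y : (forall y i, derivable g y (e_ i)) ->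
  (forall y i, `|'D_(e_ i) g y| <= C) -> `|g x - g y| <= C * \sum_j `|x 0 j - y 0 j|.
Proof.
move=> dg gC.
suff H (s : seq 'I_m) : `|g (y + \sum_(j <- s) (x 0 j - y 0 j) *: e_ j) - g y| <= C * \sum_(j <- s) `|x 0 j - y 0 j|.
  have := H (index_enum _).
  suff -> : y + \sum_j (x 0 j - y 0 j) *: e_ j = x by [].
  have := row_sum_delta (x - y); under eq_bigr do rewrite !mxE.
  by move=> <-; rewrite addrCA subrr addr0.
elim: s => [|j s ih]; first by rewrite !big_nil addr0 subrr normr0 mulr0.
rewrite !big_cons mulrDr [_ *: _ + _]addrC addrA.
set z := y + _ in ih *.
rewrite -[g _ - g y](subrKA (g z)); apply: le_trans (ler_normD _ _) _.
by apply: lerD => //; exact: axis_lipschitz.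
Qed.

Lemma continuous_of_partials g (C : R) : (forall y i, derivable g y (e_ i)) ->
  (forall y i, `|'D_(e_ i) g y| <= C) -> continuous g.
Proof.
move=> dg gC x; have FF := nbhs_filter (x : RV); apply/cvgrPdist_le => eps eps0.
have h0 : C * (\sum_j `|x 0 j - x 0 j|) = 0.
  by rewrite big1 ?mulr0// => j _; rewrite subrr normr0.
have h : C * (\sum_j `|x 0 j - y 0 j|) @[y --> x] --> C * (\sum_j `|x 0 j - x 0 j|).
  apply: cvgM; first exact: cvg_cst.
  apply: cvg_big; first exact: add_continuous.
  by move=> j _; apply: cvg_norm; apply: cvgB; [exact: cvg_cst|exact: coord_continuous].
rewrite h0 in h.
move/cvgrPdist_le : h => /(_ _ eps0) h2.
apply: (@filterS _ (nbhs x) FF _ _ _ h2) => y; rewrite sub0r normrN.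
by move=> /(le_trans (ler_norm _)); apply: le_trans; exact: lipschitz_of_partials.
Qed.

Lemma near_off_support g x : ~ closure [set y | g y != 0] x -> \near x, g x = 0.
Proof.
move=> gx; have : nbhs x (~` closure [set y | g y != 0]).
  by apply: open_nbhs_nbhs; split=> //; apply: closed_openC; exact: closed_closure.
apply: filterS => y; apply: contra_notP => /eqP ?; exact: subset_closure.
Qed.

(** Derivability along the axes does not by itself give joint continuity. The partial derivatives
    are bounded, being continuous and zero off a compact set, so the function is Lipschitz. *)
Lemma C1_compact_continuous g : C1_compact g -> continuous g.
Proof.
move=> [dg cg sg].
have bd j : exists C : R, forall x, `|'D_(e_ j) g x| <= C.
  have cK : compact ((fun x => 'D_(e_ j) g x) @` closure [set x | g x != 0]).
    apply: continuous_compact => //; exact: continuous_subspaceT (cg j).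
  have [M [_ HM]] := compact_bounded cK.
  exists (`|M| + 1) => x; have [Kx|nKx] := pselect (closure [set x | g x != 0] x).
    apply: (HM (`|M| + 1)); first by rewrite (le_lt_trans (ler_norm M))// ltrDl.
    by exists x.
  rewrite (_ : 'D_(e_ j) g x = 0) ?normr0 ?addr_ge0//.
  rewrite -(@derive_cst _ RV R 0 x (e_ j)); apply: near_eq_derive.
  exact: near_off_support nKx.
have [C hC] := choice bd.
apply: (@continuous_of_partials g (\sum_j `|C j|)) => // y i.
apply: le_trans (hC i y) _; apply: le_trans (ler_norm _) _.
by rewrite (bigD1 i)//= lerDl sumr_ge0.
Qed.

(** A C^1 function that is 1 on the cube of half-side C and 0 outside the cube of half-side C +
    1. *)
Definition row_cutoff (C : R) x : R := possq (1 - \sum_j cutoff C (x 0 j)).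

Lemma sum_cutoff_derive (C : R) x j :
  is_derive x (e_ j) (fun x => \sum_i cutoff C (x 0 i)) (dcutoff C (x 0 j)).
Proof.
apply: is_derive_of_line.
have E : (fun s : R => \sum_i cutoff C ((x + s *: e_ j) 0 i)) =
   (fun s => cutoff C (x 0 j + s) + \sum_(i | i != j) cutoff C (x 0 i)).
  apply/funext => s; rewrite (bigD1 j)//= row_line eqxx mulr1; congr (_ + _).
  by apply: eq_bigr => i ij; rewrite row_line (negbTE ij) mulr0 addr0.
rewrite E.
have A : is_derive (0 : R) 1 (fun s : R => x 0 j + s) 1.
  by have := is_deriveD (is_derive_cst (x 0 j) (0 : R) 1) (is_derive_id (0 : R) 1); rewrite add0r.
have D := is_derive_cutoff C (x 0 j + 0).
have := is_deriveD (@is_derive1_comp R (cutoff C) (fun s => x 0 j + s) 0 _ _ D A)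
  (is_derive_cst (\sum_(i | i != j) cutoff C (x 0 i)) (0 : R) 1).
by rewrite addr0 mulr1 addr0.
Qed.

Lemma row_cutoff_derive (C : R) x j : is_derive x (e_ j) (row_cutoff C)
  (2 * pos (1 - \sum_i cutoff C (x 0 i)) * - dcutoff C (x 0 j)).
Proof.
apply: is_derive_of_line.
have [dS ES] := sum_cutoff_derive C (x + (0 : R) *: e_ j) j.
have S0 := @line_is_derive (fun x => \sum_i cutoff C (x 0 i)) x (e_ j) 0 dS; rewrite ES in S0.
have S1 := is_deriveB (is_derive_cst (1 : R) (0 : R) 1) S0.
have := is_derive1_comp (is_derive_possq _) S1.
by rewrite /= !fctE scale0r addr0 sub0r.
Qed.

Lemma row_cutoff1 (C : R) x : (forall i, `|x 0 i| <= C) -> row_cutoff C x = 1.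
Proof.
move=> h; rewrite /row_cutoff big1 => [|i _]; last exact: cutoff_eq0.
by rewrite subr0 /possq /pos max_r// expr1n.
Qed.

Lemma row_cutoff_support (C : R) x i : 0 <= C -> row_cutoff C x != 0 -> `|x 0 i| <= C + 1.
Proof.
move=> C0 h; apply: cutoff_lt1 => //; rewrite ltNge; apply/negP => h1; move/eqP : h; apply.
apply: possq_eq0; rewrite subr_le0; apply: le_trans h1 _.
by rewrite (bigD1 i)//= lerDl sumr_ge0// => j _; exact: cutoff_ge0.
Qed.

Lemma row_cutoff_continuous C : continuous (row_cutoff C).
Proof.
move=> x; have FF := nbhs_filter (x : RV).
apply: (@continuous_comp _ _ _ (fun x : RV => 1 - \sum_j cutoff C (x 0 j)) (@possq R)); last exact: possq_continuous.
apply: cvgB; first exact: cvg_cst.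
apply: cvg_big; first exact: add_continuous.
move=> j _; apply: (@continuous_comp _ _ _ (fun x : RV => x 0 j) (cutoff C)); last exact: cutoff_continuous.
exact: coord_continuous.
Qed.

Lemma row_cutoff_partial_continuous C j :
  continuous (fun x : RV => 2 * pos (1 - \sum_i cutoff C (x 0 i)) * - dcutoff C (x 0 j)).
Proof.
move=> x; have FF := nbhs_filter (x : RV); apply: cvgM.
  apply: cvgM; first exact: cvg_cst.
  apply: (@continuous_comp _ _ _ (fun x : RV => 1 - \sum_j cutoff C (x 0 j)) (@pos R)); last exact: pos_continuous.
  apply: cvgB; first exact: cvg_cst.
  apply: cvg_big; first exact: add_continuous.
  move=> i _; apply: (@continuous_comp _ _ _ (fun x : RV => x 0 i) (cutoff C)); last exact: cutoff_continuous.
  exact: coord_continuous.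
apply: cvgN; apply: (@continuous_comp _ _ _ (fun x : RV => x 0 j) (dcutoff C)); last exact: dcutoff_continuous.
exact: coord_continuous.
Qed.

Lemma C1_compact_cutoff g (C : R) : 0 <= C -> continuous g -> (forall x j, derivable g x (e_ j)) ->
  (forall j, continuous (fun x => 'D_(e_ j) g x)) -> C1_compact (g * row_cutoff C) /\
  forall x j, (forall i, `|x 0 i| <= C) -> 'D_(e_ j) (g * row_cutoff C) x = 'D_(e_ j) g x.
Proof.
move=> C0 cg dg cdg.
have D x j : is_derive x (e_ j) (g * row_cutoff C)
    (g x * (2 * pos (1 - \sum_i cutoff C (x 0 i)) * - dcutoff C (x 0 j)) + row_cutoff C x * 'D_(e_ j) g x).
  have := is_deriveM (DeriveDef (dg x j) erefl) (row_cutoff_derive C x j).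
  exact.
have DE x j : 'D_(e_ j) (g * row_cutoff C) x =
    g x * (2 * pos (1 - \sum_i cutoff C (x 0 i)) * - dcutoff C (x 0 j)) + row_cutoff C x * 'D_(e_ j) g x.
  exact: (@derive_val _ _ _ _ _ _ _ (D x j)).
split; last first.
  move=> x j h; rewrite DE row_cutoff1// mul1r dcutoff_eq0; last exact: h.
  by rewrite oppr0 !mulr0 add0r.
split.
- by move=> x j; case: (D x j).
- move=> j; have -> : (fun x => 'D_(e_ j) (g * row_cutoff C) x) = (fun x =>
    g x * (2 * pos (1 - \sum_i cutoff C (x 0 i)) * - dcutoff C (x 0 j)) + row_cutoff C x * 'D_(e_ j) g x).
    by apply/funext => x; exact: DE.
  move=> x; have FF := nbhs_filter (x : RV).
  apply: cvgD; first by apply: cvgM; [exact: cg|exact: row_cutoff_partial_continuous].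
  by apply: cvgM; [exact: row_cutoff_continuous|exact: cdg].
have cbox : compact [set v : RV | forall i, `[- (C + 1), C + 1]%classic (v ord0 i)].
  exact: (@rV_compact R m (fun=> `[- (C + 1), C + 1]%classic) (fun i => @segment_compact R _ _)).
apply: (subclosed_compact _ cbox); first exact: closed_closure.
have clb : closed [set v : RV | forall i, `[- (C + 1), C + 1]%classic (v ord0 i)].
  by apply: compact_closed => //; exact: norm_hausdorff.
rewrite [X in _ `<=` X](closure_id _).1//; apply: closure_subset => x /= hx i.
rewrite in_itv/= -ler_norml; apply: row_cutoff_support => //.
by apply: contraNN hx => /eqP h; rewrite !fctE h mulr0.
Qed.

End RowCalculus.

(** * Linear combinations of transport functionals *)

Section CylinderCombinations.
Variables (R : realType) (O : bounded_domain R).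
Variables (lam : nat -> R) (e : nat -> Hspace O).
Hypothesis lam_e : stokes_eigenbasis lam e.
Variables (B : set (Hspace O)) (wB : weakly_compact B).
Variables (nu : R) (f : vfield R -> R) (fV' : inVdual O f).
Local Notation H := (Hspace O).
Local Notation BV := (BV B).
Local Notation FC := (@Fcyl R O nu f).
Local Notation cw P := (@cyl_w R O P).
Local Notation cpsi P := (@cyl_psi R O P).

Lemma cyl_zero : exists Psi : cyl O, forall u : H, BV u -> FC Psi u = 0.
Proof.
have w0 : 'I_0 -> vfield R by case.
have w0V : forall j : 'I_0, inV O (w0 j) by case.
have c0 : C1_compact (cst 0 : 'rV[R]_0 -> R).
  split; [by move=> x; case|by case|].
  have -> : [set x : 'rV[R]_0 | @cst _ R 0 x != 0] = set0.
    by apply/seteqP; split=> x //=; rewrite eqxx.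
  by rewrite closure0; exact: compact0.
exists (Cyl w0V c0) => u [_ Vu]; rewrite (FcylE nu fV' _ Vu).
by apply: big1; case.
Qed.

Lemma cyl_range (Psi : cyl O) : exists2 C : R, 0 <= C & forall u : H, B u -> forall i, `|dotL2 O u (cw Psi i)| <= C.
Proof.
have bd i := wcont_bounded wB (wcont_dot (inV_H (@cyl_wV _ _ Psi i))).
have [C hC] := choice bd; exists (\sum_i `|C i|); first exact: sumr_ge0.
move=> u Bu i; apply: le_trans (hC i u Bu) _; apply: le_trans (ler_norm _) _.
by rewrite (bigD1 i)//= lerDl sumr_ge0.
Qed.

Lemma lsubmx_continuous m1 m2 : continuous (fun x : 'rV[R]_(m1 + m2) => lsubmx x).
Proof.
move=> x; have FF := nbhs_filter (x : 'rV[R]_(m1 + m2)).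
apply: cvg_row => j; under eq_fun do rewrite mxE; rewrite mxE.
exact: coord_continuous.
Qed.

Lemma rsubmx_continuous m1 m2 : continuous (fun x : 'rV[R]_(m1 + m2) => rsubmx x).
Proof.
move=> x; have FF := nbhs_filter (x : 'rV[R]_(m1 + m2)).
apply: cvg_row => j; under eq_fun do rewrite mxE; rewrite mxE.
exact: coord_continuous.
Qed.

Lemma split_lshiftE m1 m2 (i : 'I_m1) : fintype.split (lshift m2 i) = inl i.
Proof.
by have [k /lshift_inj ->|k /eqP] := split_ordP (lshift m2 i); rewrite ?eq_lrshift.
Qed.

Lemma split_rshiftE m1 m2 (i : 'I_m2) : fintype.split (rshift m1 i) = inr i.
Proof.
by have [k /eqP|k /rshift_inj ->] := split_ordP (rshift m1 i); rewrite ?eq_rlshift.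
Qed.

Lemma delta_lshift m1 m2 (j : 'I_m1) :
  delta_mx 0 (lshift m2 j) = row_mx (delta_mx 0 j) 0 :> 'rV[R]_(m1 + m2).
Proof.
apply/rowP => i; rewrite !mxE; case: splitP => k ik; rewrite !mxE.
  by rewrite (_ : i = lshift m2 k) ?(inj_eq (@lshift_inj _ _))//; exact: val_inj.
by rewrite (_ : i = rshift m1 k) ?eq_rlshift ?andbF//; exact: val_inj.
Qed.

Lemma delta_rshift m1 m2 (j : 'I_m2) :
  delta_mx 0 (rshift m1 j) = row_mx 0 (delta_mx 0 j) :> 'rV[R]_(m1 + m2).
Proof.
apply/rowP => i; rewrite !mxE; case: splitP => k ik; rewrite !mxE.
  by rewrite (_ : i = lshift m2 k) ?eq_lrshift ?andbF//; exact: val_inj.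
by rewrite (_ : i = rshift m1 k) ?(inj_eq (@rshift_inj _ _))//; exact: val_inj.
Qed.

Lemma split_derive m1 m2 (g1 : 'rV[R]_m1 -> R) (g2 : 'rV[R]_m2 -> R) (a : R) (x : 'rV[R]_(m1 + m2)) :
  (forall y j, derivable g1 y (delta_mx 0 j)) -> (forall y j, derivable g2 y (delta_mx 0 j)) ->
  (forall j, is_derive x (delta_mx 0 (lshift m2 j)) (fun x => g1 (lsubmx x) + a * g2 (rsubmx x))
     ('D_(delta_mx 0 j) g1 (lsubmx x))) /\
  (forall j, is_derive x (delta_mx 0 (rshift m1 j)) (fun x => g1 (lsubmx x) + a * g2 (rsubmx x))
     (a * 'D_(delta_mx 0 j) g2 (rsubmx x))).
Proof.
move=> d1 d2; split=> j; apply: is_derive_of_line.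
  have E : (fun s : R => g1 (lsubmx (x + s *: delta_mx 0 (lshift m2 j))) + a * g2 (rsubmx (x + s *: delta_mx 0 (lshift m2 j))))
    = (fun s => g1 (lsubmx x + s *: delta_mx 0 j) + a * g2 (rsubmx x)).
    by apply/funext => s; rewrite delta_lshift scale_row_mx linearD/= row_mxKl linearD/= row_mxKr scaler0 addr0.
  rewrite E; have h := line_is_derive (d1 (lsubmx x + (0 : R) *: delta_mx 0 j) j).
  have := is_deriveD h (is_derive_cst (a * g2 (rsubmx x)) (0 : R) 1).
  by rewrite scale0r !addr0.
have E : (fun s : R => g1 (lsubmx (x + s *: delta_mx 0 (rshift m1 j))) + a * g2 (rsubmx (x + s *: delta_mx 0 (rshift m1 j))))
  = (fun s => g1 (lsubmx x) + a * g2 (rsubmx x + s *: delta_mx 0 j)).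
  by apply/funext => s; rewrite delta_rshift scale_row_mx linearD/= row_mxKl linearD/= row_mxKr scaler0 addr0.
rewrite E; have h := line_is_derive (d2 (rsubmx x + (0 : R) *: delta_mx 0 j) j).
have := is_deriveD (is_derive_cst (g1 (lsubmx x)) (0 : R) 1) (is_deriveZ a h).
by rewrite scale0r addr0 add0r.
Qed.

(** The function psi1(x) + a psi2(y) on the product space lacks compact support. The coordinates of
    points of B stay in a cube by [cyl_range], so a cutoff beyond that cube restores it without
    changing the derivatives seen on B. *)
Lemma cyl_add (Psi1 Psi2 : cyl O) (a : R) : exists Psi : cyl O,
  forall u : H, BV u -> FC Psi u = FC Psi1 u + a * FC Psi2 u.
Proof.
case: (cyl_psiC1 Psi1) (cyl_psiC1 Psi2) => [d1 c1 _] [d2 c2 _].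
have k1 := C1_compact_continuous (cyl_psiC1 Psi1).
have k2 := C1_compact_continuous (cyl_psiC1 Psi2).
pose m1 := cyl_dim Psi1; pose m2 := cyl_dim Psi2.
pose g (x : 'rV[R]_(m1 + m2)) := cpsi Psi1 (lsubmx x) + a * cpsi Psi2 (rsubmx x).
have [C1 C10 hC1] := cyl_range Psi1; have [C2 C20 hC2] := cyl_range Psi2.
have C0 : 0 <= C1 + C2 by exact: addr_ge0.
have D x := split_derive a x d1 d2.
have gc : continuous g.
  move=> x; have FF := nbhs_filter (x : 'rV[R]_(m1 + m2)); apply: cvgD.
    by apply: (continuous_cvg _ (k1 _)); exact: lsubmx_continuous.
  apply: cvgM; first exact: cvg_cst.
  by apply: (continuous_cvg _ (k2 _)); exact: rsubmx_continuous.
have gd x j : derivable g x (delta_mx 0 j).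
  have [D1 D2] := D x; have [i ->|i ->] := split_ordP j; first by case: (D1 i).
  by case: (D2 i).
have gp j : continuous (fun x => 'D_(delta_mx 0 j) g x).
  have [i ->|i ->] := split_ordP j.
    have -> : (fun x => 'D_(delta_mx 0 (lshift m2 i)) g x) = (fun x => 'D_(delta_mx 0 i) (cpsi Psi1) (lsubmx x)).
      by apply/funext => x; have [D1 _] := D x; exact: (@derive_val _ _ _ _ _ _ _ (D1 i)).
    move=> x; have FF := nbhs_filter (x : 'rV[R]_(m1 + m2)).
    by apply: (continuous_cvg _ (c1 i _)); exact: lsubmx_continuous.
  have -> : (fun x => 'D_(delta_mx 0 (rshift m1 i)) g x) = (fun x => a * 'D_(delta_mx 0 i) (cpsi Psi2) (rsubmx x)).
    by apply/funext => x; have [_ D2] := D x; exact: (@derive_val _ _ _ _ _ _ _ (D2 i)).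
  move=> x; have FF := nbhs_filter (x : 'rV[R]_(m1 + m2)); apply: cvgM; first exact: cvg_cst.
  by apply: (continuous_cvg _ (c2 i _)); exact: rsubmx_continuous.
have [gC gE] := C1_compact_cutoff C0 gc gd gp.
pose w (j : 'I_(m1 + m2)) := match fintype.split j with inl i => cw Psi1 i | inr i => cw Psi2 i end.
have wV j : inV O (w j) by rewrite /w; case: (fintype.split j) => i; exact: cyl_wV.
exists (Cyl wV gC) => u [Bu Vu]; rewrite !(FcylE nu fV' _ Vu).
pose Psi := Cyl wV gC.
pose r := \row_i dotL2 O u (w i).
have rl : lsubmx r = \row_i dotL2 O u (cw Psi1 i).
  by apply/rowP => i; rewrite !mxE /w split_lshiftE.
have rr : rsubmx r = \row_i dotL2 O u (cw Psi2 i).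
  by apply/rowP => i; rewrite !mxE /w split_rshiftE.
have rC i : `|r 0 i| <= C1 + C2.
  rewrite mxE /w; case: (fintype.split i) => k.
    by apply: le_trans (hC1 u Bu k) _; rewrite lerDl.
  by apply: le_trans (hC2 u Bu k) _; rewrite lerDr.
have cE j : @cyl_coef R O Psi j u = 'D_(delta_mx 0 j) g r by exact: gE.
rewrite big_split_ord /= mulr_sumr; have [D1 D2] := D r; congr (_ + _); apply: eq_bigr => i _.
  rewrite cE (@derive_val _ _ _ _ _ _ _ (D1 i)) rl; congr (_ * Fns _ _ _ _ _).
  by rewrite /= /w split_lshiftE.
rewrite cE (@derive_val _ _ _ _ _ _ _ (D2 i)) rr mulrA; congr (_ * Fns _ _ _ _ _).
by rewrite /= /w split_rshiftE.
Qed.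

Lemma cyl_lincomb (s : seq (R * cyl O)) : exists Psi : cyl O,
  forall u : H, BV u -> FC Psi u = \sum_(p <- s) p.1 * FC p.2 u.
Proof.
elim: s => [|[a Psi2] s [Psi1 h1]].
  by have [Psi h] := cyl_zero; exists Psi => u Ku; rewrite big_nil h.
have [Psi h] := cyl_add Psi1 Psi2 a; exists Psi => u Ku.
by rewrite big_cons h// h1// addrC.
Qed.

End CylinderCombinations.

(** * Almost minimising mixtures of admissible pairs *)

Section DescentArithmetic.
Variable R : realType.

Lemma sqr_max0_le (x y : R) : x <= y -> 0 <= y -> Num.max x 0 ^+ 2 <= y ^+ 2.
Proof.
move=> xy y0; rewrite ler_pXn2r// ?nnegrE ?le_max ?lexx ?orbT//.
by rewrite ge_max xy y0.
Qed.

Lemma sum_sqr_mix (I : Type) (r : seq I) (b g : I -> R) (s : R) :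
  \sum_(i <- r) ((1 - s) * b i + s * g i) ^+ 2 = (1 - s) ^+ 2 * \sum_(i <- r) b i ^+ 2
    + 2 * s * (1 - s) * \sum_(i <- r) b i * g i + s ^+ 2 * \sum_(i <- r) g i ^+ 2.
Proof. by rewrite !mulr_sumr -!big_split/=; apply: eq_bigr => i _; ring. Qed.

(** One step towards the constraints: [a] and b are the current residuals, [d] and g those of the
    new pair, and the hypothesis on [(a + s) * d + Sbg] says that the two residual vectors form, up
    to s, an obtuse angle. The shift by s costs only O(s^2). *)
Lemma descent (a d y Sb Sbg Sg s K c : R) : 0 < s < 1 -> 0 <= a -> y <= a -> `|d| <= K -> Sg <= K ->
  (a + s) * d + Sbg <= 0 ->
  c = (1 - s) ^+ 2 * Sb + 2 * s * (1 - s) * Sbg + s ^+ 2 * Sg ->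
  Num.max ((1 - s) * y + s * d) 0 ^+ 2 + c <= (1 - s) ^+ 2 * (a ^+ 2 + Sb) + s ^+ 2 * (K ^+ 2 + 3 * K).
Proof.
move=> /andP[s0 s1] a0 ya /ler_normlP[dK1 dK2] SK h ->.
have K0 : 0 <= K by lra.
have s1' : 0 <= 1 - s by lra.
have s0' : 0 <= s by lra.
have dd : d ^+ 2 <= K ^+ 2.
  have -> : K ^+ 2 = d ^+ 2 + (K - d) * (K + d) by ring.
  by rewrite lerDl; apply: mulr_ge0; lra.
have m2 : Num.max ((1 - s) * y + s * d) 0 ^+ 2 <= ((1 - s) * a + s * d) ^+ 2.
  have [z0|z0] := leP 0 ((1 - s) * a + s * d).
    by apply: sqr_max0_le => //; rewrite lerD2r; exact: ler_wpM2l.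
  rewrite max_r ?expr0n ?sqr_ge0//; apply: ltW; apply: le_lt_trans z0.
  by rewrite lerD2r; exact: ler_wpM2l.
have t1 : 2 * s * (1 - s) * (a * d + Sbg) <= 2 * s ^+ 2 * K.
  have h1 : a * d + Sbg <= s * K.
    have : s * (- d) <= s * K by exact: ler_wpM2l.
    lra.
  have h2 : (1 - s) * (a * d + Sbg) <= s * K.
    apply: le_trans (ler_wpM2l s1' h1) _.
    have : 0 <= s * (s * K) by apply: mulr_ge0 => //; apply: mulr_ge0.
    lra.
  have : s * ((1 - s) * (a * d + Sbg)) <= s * (s * K) by exact: ler_wpM2l.
  lra.
have t2 : s ^+ 2 * (d ^+ 2 + Sg) <= s ^+ 2 * (K ^+ 2 + K).
  by apply: ler_wpM2l; [exact: sqr_ge0|lra].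
apply: le_trans (lerD m2 (lexx _)) _.
have -> : ((1 - s) * a + s * d) ^+ 2 + ((1 - s) ^+ 2 * Sb + 2 * s * (1 - s) * Sbg + s ^+ 2 * Sg)
   = (1 - s) ^+ 2 * (a ^+ 2 + Sb) + 2 * s * (1 - s) * (a * d + Sbg) + s ^+ 2 * (d ^+ 2 + Sg) by ring.
lra.
Qed.

(** As in the Frank-Wolfe method, a step gains an amount of order s and loses one of order s^2, so a
    positive infimum would be undercut. *)
Lemma inf_descent (S : set R) (K : R) : S !=set0 -> (forall q, S q -> 0 <= q) -> 0 <= K ->
  (forall s q, 0 < s < 1 -> S q -> exists2 q', S q' & q' <= (1 - s) ^+ 2 * q + s ^+ 2 * K) ->
  forall eta, 0 < eta -> exists2 q, S q & q < eta.
Proof.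
move=> S0 Sge K0 step eta eta0.
have lbS : has_lbound S by exists 0 => q; exact: Sge.
have hS : has_inf S by [].
set q0 := inf S.
have q00 : 0 <= q0 by apply: lb_le_inf => // q; exact: Sge.
have [q0p|q0z] := ltP 0 q0; last first.
  have [q Sq qlt] := inf_adherent eta0 hS; exists q => //.
  by apply: lt_le_trans qlt _; rewrite -/q0; lra.
(* With this step s (K + 1) = (1 - s) q0, against the inequality (2 - s) q0 <= s (K + 1) found at
   the infimum. *)
exfalso; pose s := q0 / (q0 + K + 1).
have den : 0 < q0 + K + 1 by lra.
have sE : s * (q0 + K + 1) = q0 by rewrite /s divfK// gt_eqF.
have s0 : 0 < s by exact: divr_gt0.
have s1 : s < 1 by rewrite /s ltr_pdivrMr//; lra.
have [q Sq qlt] := inf_adherent (exprn_gt0 2 s0) hS; rewrite -/q0 in qlt.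
have s01 : 0 < s < 1 by rewrite s0 s1.
have [q' Sq' q'le] := step s q s01 Sq.
have h : q0 <= q' by exact: ge_inf.
have h1 : (1 - s) ^+ 2 * q <= (1 - s) ^+ 2 * q0 + s ^+ 2.
  have a1 : (1 - s) ^+ 2 * q <= (1 - s) ^+ 2 * (q0 + s ^+ 2) by apply: ler_wpM2l; [exact: sqr_ge0|exact: ltW].
  apply: le_trans a1 _; rewrite mulrDr lerD2l ler_piMl ?sqr_ge0// expr_le1//; lra.
have h2 : q0 <= (1 - s) ^+ 2 * q0 + s ^+ 2 * (K + 1) by lra.
have h3 : s * ((2 - s) * q0) <= s * (s * (K + 1)) by move: h2; rewrite !expr2; lra.
rewrite ler_pM2l// in h3.
have h4 : s * (K + 1) = q0 - s * q0 by rewrite -[X in X - _]sE; ring.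
have h5 : s * q0 < 1 * q0 by rewrite ltr_pM2r.
by move: h3; rewrite h4 mulrBl; lra.
Qed.

End DescentArithmetic.

Section ConvexHull.
Variables (R : realType) (O : bounded_domain R).
Variables (lam : nat -> R) (e : nat -> Hspace O).
Hypothesis lam_e : stokes_eigenbasis lam e.
Variables (B : set (Hspace O)) (wB : weakly_compact B).
Variables (nu : R) (nu0 : 0 < nu) (f : vfield R -> R) (fV' : inVdual O f).
Local Notation H := (Hspace O).
Local Notation E u := (norm_grad O u ^+ 2).
Local Notation BV := (BV B).
Local Notation FC := (@Fcyl R O nu f).
Local Notation adm := (adm B nu f).

(* The laws of finitely many randomly chosen admissible pairs, as functionals. *)
Inductive conv : ((H -> R) -> R) -> Prop :=
| conv_wsum2 b : adm b -> conv (fun G => wsum2 G b)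
| conv_mix s L1 L2 : 0 <= s <= 1 -> conv L1 -> conv L2 -> conv (fun G => (1 - s) * L1 G + s * L2 G).

Lemma conv_lin L : conv L -> forall a G1 G2, L (fun u => a * G1 u + G2 u) = a * L G1 + L G2.
Proof.
elim=> [[[[t1 t2] u1] u2] _ a G1 G2|s L1 L2 _ _ h1 _ h2 a G1 G2]; last by rewrite h1 h2; ring.
by rewrite /wsum2; ring.
Qed.

Lemma conv_mono L : conv L -> forall G1 G2, (forall u, BV u -> G1 u <= G2 u) -> L G1 <= L G2.
Proof.
elim=> [[[[t1 t2] u1] u2] [[t10 t20 _] [K1 K2] _ _ _] G1 G2 h|s L1 L2 /andP[s0 s1] _ h1 _ h2 G1 G2 h].
  by apply: lerD; apply: ler_wpM2l => //; exact: h.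
by apply: lerD; apply: ler_wpM2l; rewrite ?subr_ge0//; [exact: h1|exact: h2].
Qed.

Lemma conv_cst L : conv L -> forall c, L (cst c) = c.
Proof.
elim=> [[[[t1 t2] u1] u2] [[_ _ t12] _ _ _ _] c|s L1 L2 _ _ h1 _ h2 c]; last by rewrite h1 h2; ring.
by rewrite /wsum2 /cst -mulrDl t12 mul1r.
Qed.

Lemma conv_energy : exists2 M0 : R, 0 <= M0 & forall L, conv L -> L (fun u => E u) <= M0.
Proof.
have [M0 M00 h] := adm_energy B nu0 fV'; exists M0 => // L; elim=> [[[[t1 t2] u1] u2] ab|s L1 L2 /andP[s0 s1] _ h1 _ h2].
  by have [] := h _ _ _ _ ab.
have -> : M0 = (1 - s) * M0 + s * M0 by ring.
by apply: lerD; apply: ler_wpM2l; rewrite ?subr_ge0.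
Qed.

(** Both points of a pair have the same norm, so the weight a(|u|^2) factors out of their mean. *)
Lemma conv_ell L (a : R -> R) : conv L -> (forall x, 0 <= x -> 0 <= a x) ->
  L (fun u => a (N O u) * ell O nu f u) <= 0.
Proof.
move=> cL a0; elim: cL => [[[[t1 t2] u1] u2] [_ _ n12 _ h]|s L1 L2 /andP[s0 s1] _ h1 _ h2].
  rewrite /wsum2 -n12.
  have -> : t1 * (a (N O u1) * ell O nu f u1) + t2 * (a (N O u1) * ell O nu f u2) =
    a (N O u1) * (t1 * ell O nu f u1 + t2 * ell O nu f u2) by ring.
  by apply: mulr_ge0_le0 => //; apply: a0; exact: N_ge0.
rewrite -[leRHS]addr0; apply: lerD; apply: mulr_ge0_le0 => //; by rewrite subr_ge0.
Qed.

Lemma wsum2_FC_bounded (Ps : seq (cyl O)) : exists K : R,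
  forall b, adm b -> \sum_(P <- Ps) wsum2 (fun u => FC P u) b ^+ 2 <= K.
Proof.
elim: Ps => [|P Ps [K hK]]; first by exists 0 => b _; rewrite big_nil.
have [C hC] := wsum2_bounded wB nu0 fV' (tame_Fcyl lam_e wB nu fV' P).
exists (C ^+ 2 + K) => b ab; rewrite big_cons; apply: lerD (hK b ab).
have C0 := le_trans (normr_ge0 _) (hC b ab).
by rewrite -real_normK ?num_real// ler_pXn2r ?nnegrE//; exact: hC.
Qed.

Lemma wsum2_lin (I : Type) (r : seq I) (c : I -> R) (G : I -> H -> R) b :
  wsum2 (fun u => \sum_(i <- r) c i * G i u) b = \sum_(i <- r) c i * wsum2 (G i) b.
Proof.
case: b => [[[t1 t2] u1] u2]; rewrite /wsum2 !mulr_sumr -big_split/=.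
by apply: eq_bigr => i _; ring.
Qed.

Lemma wsum2_eq G1 G2 b : adm b -> (forall u, BV u -> G1 u = G2 u) -> wsum2 G1 b = wsum2 G2 b.
Proof. by case: b => [[[t1 t2] u1] u2] [_ [K1 K2] _ _ _] h; rewrite /wsum2 !h. Qed.

Lemma wsum2D G1 G2 (b : R * R * H * H) : wsum2 (fun u => G1 u + G2 u) b = wsum2 G1 b + wsum2 G2 b.
Proof. by case: b => [[[t1 t2] u1] u2]; rewrite /wsum2; ring. Qed.

Lemma minimax k (m : R) (Ps : seq (cyl O)) (eta : R) : 0 < eta -> adm !=set0 ->
  (forall Psi : cyl O, exists2 b, adm b & m <= objective nu f e k Psi b) ->
  exists L, [/\ conv L, m - eta <= L (fun u => enk lam e k u)
    & List.Forall (fun P => `|L (fun u => FC P u)| <= eta) Ps].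
Proof.
move=> eta0 [b0 ab0] hm.
pose phi (L : (H -> R) -> R) := L (fun u => enk lam e k u).
pose G (L : (H -> R) -> R) P := L (fun u => FC P u).
pose Q L := Num.max (m - phi L) 0 ^+ 2 + \sum_(P <- Ps) G L P ^+ 2.
have [C hC] := wsum2_bounded wB nu0 fV' (tame_wcont B (wcont_enk lam_e (k:=k))).
have [K1 hK1] := wsum2_FC_bounded Ps.
pose K : R := `|m| + `|C| + `|K1|.
have KC b : adm b -> `|m - wsum2 (fun u => enk lam e k u) b| <= K.
  move=> ab; apply: le_trans (ler_normB _ _) _; rewrite /K.
  have h1 := le_trans (hC b ab) (ler_norm C); have := normr_ge0 K1; lra.
have KS b : adm b -> \sum_(P <- Ps) wsum2 (fun u => FC P u) b ^+ 2 <= K.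
  move=> ab; apply: le_trans (hK1 b ab) _; rewrite /K.
  by have := ler_norm K1; have := normr_ge0 m; have := normr_ge0 C; lra.
have K0 : 0 <= K by rewrite /K !addr_ge0.
have sumS0 L : 0 <= \sum_(P <- Ps) G L P ^+ 2 by apply: sumr_ge0 => P _; exact: sqr_ge0.
pose S := [set q | exists2 L, conv L & q = Q L].
have [||||q [L cL ->] qlt] := @inf_descent R S (K ^+ 2 + 3 * K) _ _ _ _ (eta ^+ 2) (exprn_gt0 _ eta0).
- by exists (Q (fun G => wsum2 G b0)); exists (fun G => wsum2 G b0) => //; exact: conv_wsum2.
- by move=> q [L _ ->]; apply: addr_ge0 (sumS0 L); exact: sqr_ge0.
- by rewrite addr_ge0 ?sqr_ge0// mulr_ge0.
- move=> s q s01 [L0 cL0 ->]; have /andP[s0 s1] := s01.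
  set a := Num.max (m - phi L0) 0.
  have a0 : 0 <= a by rewrite le_max lexx orbT.
  have as0 : 0 < a + s by apply: lt_le_trans s0 _; rewrite lerDr.
  (* The coefficients follow the gradient of [Q], normalised to give |grad P_k u|^2 the coefficient
     1; adding s keeps the denominator positive when a = 0. *)
  have [Psi hPsi] := cyl_lincomb wB nu fV' [seq (- (G L0 P / (a + s)), P) | P <- Ps].
  have [b ab mb] := hm Psi.
  pose L G := (1 - s) * L0 G + s * wsum2 G b.
  exists (Q L).
    by exists L => //; apply: conv_mix => //; [rewrite !ltW|exact: conv_wsum2].
  have cE := sum_sqr_mix Ps (G L0) (G (fun G => wsum2 G b)) s.
  have mE : m - phi L = (1 - s) * (m - phi L0) + s * (m - wsum2 (fun u => enk lam e k u) b).
    by rewrite /phi /L; ring.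
  rewrite /Q mE; apply: (descent s01 a0 _ (KC b ab) (KS b ab) _ cE); first by rewrite le_max lexx.
  move: mb; rewrite objectiveE (@wsum2_eq _ (fun u => enk lam e k u + \sum_(P <- Ps) - (G L0 P / (a + s)) * FC P u))//; last first.
    by move=> u Ku; rewrite (bracketE lam_e) hPsi// big_map.
  rewrite wsum2D (wsum2_lin Ps) => mb.
  have := ler_wpM2l (ltW as0) mb; rewrite mulrDr [X in _ <= _ + X -> _]mulr_sumr.
  have -> : \sum_(i <- Ps) (a + s) * (- (G L0 i / (a + s)) * wsum2 (fun u => FC i u) b) =
     - \sum_(P <- Ps) G L0 P * wsum2 (fun u => FC P u) b.
    rewrite -sumrN; apply: eq_bigr => P _.
    by rewrite !mulNr mulrN mulrA [(a + s) * _]mulrC divfK ?gt_eqF.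
  by move=> h; rewrite mulrBr; move: h; rewrite /G; lra.
exists L; split=> //.
  have h1 : Num.max (m - phi L) 0 ^+ 2 < eta ^+ 2.
    by apply: le_lt_trans qlt; rewrite /Q lerDl.
  have h2 : Num.max (m - phi L) 0 < eta.
    by rewrite -(ltr_pXn2r (n:=2))// ?nnegrE ?le_max ?lexx ?orbT// ltW.
  have h3 : m - phi L <= Num.max (m - phi L) 0 by rewrite le_max lexx.
  by move: h3 h2; rewrite /phi; lra.
have {}qlt : \sum_(P <- Ps) G L P ^+ 2 <= eta ^+ 2.
  by apply: ltW; apply: le_lt_trans qlt; rewrite /Q lerDr sqr_ge0.
elim: Ps qlt {hK1 KS sumS0 Q S} => [|P Ps IH]; first by constructor.
have ge0 : 0 <= \sum_(P <- Ps) G L P ^+ 2 by apply: sumr_ge0 => P' _; exact: sqr_ge0.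
rewrite big_cons => h; constructor.
  have h1 : `|G L P| ^+ 2 <= eta ^+ 2 by rewrite real_normK ?num_real//; apply: le_trans h; rewrite lerDl.
  by rewrite ler_pXn2r ?nnegrE// ltW in h1.
by apply: IH; apply: le_trans h; rewrite lerDr sqr_ge0.
Qed.

End ConvexHull.

(** * Measures representing positive functionals *)

Section BinaryPath.
Variables (R : realType) (p : seq bool -> R).
Hypothesis p_ge0 : forall s, 0 <= p s.
Hypothesis p_nil : p [::] = 1.
Hypothesis p_cons : forall s, p (false :: s) + p (true :: s) = p s.

(** Sends the points outside [0, 1[ to 0, so that every real t has a path through cells of positive
    mass. *)
Definition clip (t : R) : R := if (0 <= t) && (t < 1) then t else 0.

(* Words are written most recent bit first; the word s is sent to the interval [left s, left s + p s[. *)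
Fixpoint left (s : seq bool) : R :=
  if s is b :: s' then left s' + (if b then p (false :: s') else 0) else 0.

(** A binary search: the new bit says whether [clip t] lies in the right part of the current
    cell. *)
Fixpoint path (t : R) (n : nat) : seq bool :=
  if n is n'.+1 then (left (path t n') + p (false :: path t n') <= clip t) :: path t n' else [::].

Lemma clip_itv t : 0 <= clip t < 1.
Proof. by rewrite /clip; case: ifP => //; rewrite lexx ltr01. Qed.

Lemma size_path t n : size (path t n) = n.
Proof. by elim: n => //= n ->. Qed.

Lemma left_bounds s : 0 <= left s /\ left s + p s <= 1.
Proof.
elim: s => [|b s [h0 h1]] /=; first by rewrite p_nil; split; lra.
have := p_cons s; have := p_ge0 (false :: s); have := p_ge0 (true :: s).
by case: b; split; lra.
Qed.

Lemma path_cell t n : left (path t n) <= clip t < left (path t n) + p (path t n).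
Proof.
elim: n => [|n /andP[h0 h1]] /=; first by rewrite p_nil add0r clip_itv.
have := p_cons (path t n); set s := path t n in h0 h1 *.
have [h2 h3|h2 h3] := leP (left s + p (false :: s)) (clip t); apply/andP; split; lra.
Qed.

(** The half-open cell contains [clip t], so its length is positive. With [rep_mass], paths visit
    only words that some point of B realises. *)
Lemma path_pos t n : 0 < p (path t n).
Proof. by have /andP[h0 h1] := path_cell t n; lra. Qed.

Lemma cell_path t s : left s <= clip t < left s + p s -> path t (size s) = s.
Proof.
elim: s => [//|b s ih] /= /andP[h0 h1].
have p1 := p_cons s; have p2 := p_ge0 (false :: s); have p3 := p_ge0 (true :: s).
have E : path t (size s) = s.
  by apply: ih; apply/andP; case: b h0 h1; split; lra.
rewrite E; congr cons; case: b h0 h1 => h0 h1; first by rewrite h0.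
by apply/negbTE; rewrite -ltNge; lra.
Qed.

Lemma clip_meas : measurable_fun setT (clip : measurableTypeR R -> measurableTypeR R).
Proof.
apply: measurable_fun_ifT; [|exact: measurable_id|exact: measurable_cst].
apply: measurable_and.
  by apply: measurable_fun_ler; [exact: measurable_cst|exact: measurable_id].
by apply: measurable_fun_ltr; [exact: measurable_id|exact: measurable_cst].
Qed.

Lemma path_meas n (G : seq bool -> R) :
  measurable_fun setT (fun t : measurableTypeR R => G (path t n) : measurableTypeR R).
Proof.
elim: n G => [|n ih] G /=; first exact: measurable_cst.
have -> : (fun t => G ((left (path t n) + p (false :: path t n) <= clip t) :: path t n)) =
  (fun t => if left (path t n) + p (false :: path t n) <= clip t then G (true :: path t n) else G (false :: path t n)).
  by apply/funext => t; case: leP.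
apply: measurable_fun_ifT; [|exact: (ih (fun s => G (true :: s)))|exact: (ih (fun s => G (false :: s)))].
apply: measurable_fun_ler; last exact: clip_meas.
exact: (ih (fun s => left s + p (false :: s))).
Qed.

Definition leb01 := mrestr (@lebesgue_measure R) (measurable_itv `[(0 : R), 1[).

HB.instance Definition _ := Measure.on leb01.

Lemma leb01T : leb01 setT = 1%E.
Proof. by rewrite /leb01 /mrestr setTI lebesgue_measure_itv/= lte_fin ltr01 sube0. Qed.

HB.instance Definition _ := Measure_isProbability.Build _ _ _ leb01 leb01T.

(** The words of a given length cut [0, 1[ into intervals of lengths p s. *)
Lemma leb01_path (s : seq bool) : leb01 [set t | path t (size s) = s] = (p s)%:E.
Proof.
have [l0 l1] := left_bounds s; have p0 := p_ge0 s.
rewrite /leb01 /mrestr.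
have -> : [set t | path t (size s) = s] `&` [set` `[(0 : R), 1[] = [set` `[left s, left s + p s[].
  apply/seteqP; split=> t /=; rewrite !in_itv/=.
    move=> [ts t01]; have := path_cell t (size s); rewrite ts /clip.
    by rewrite t01.
  move=> ts; have t01 : 0 <= t < 1 by case/andP: ts => h1 h2; apply/andP; split; lra.
  by split=> //; apply: cell_path; rewrite /clip t01.
rewrite lebesgue_measure_itv/= lte_fin; case: ltP => h; first by rewrite -EFinB; congr EFin; lra.
by congr EFin; lra.
Qed.

Lemma path_set_meas (s : seq bool) : measurable ([set t | path t (size s) = s] : set (measurableTypeR R)).
Proof.
have := path_meas (size s) (fun s' => (s' == s)%:R) measurableT (measurable_set1 1).
rewrite setTI; congr measurable; apply/seteqP; split=> t /=.
  by case: eqP => // _ /eqP; rewrite eq_sym oner_eq0.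
by move=> ->; rewrite eqxx.
Qed.

Lemma integral_path n (G : seq bool -> R) :
  (\int[leb01]_t (G (path t n))%:E = (\sum_(s : n.-tuple bool) p s * G s)%:E)%E.
Proof.
have E t : (G (path t n))%:E = (\sum_(s : n.-tuple bool) (G s)%:E * (\1_[set t | path t (size s) = s] t)%:E)%E.
  have sz : size (path t n) == n by rewrite size_path.
  rewrite (bigD1 (Tuple sz))//= indicE mem_set/= ?size_path// mule1 big1 ?adde0// => s sn.
  rewrite indicE memNset ?mule0//= size_tuple => h.
  by move/eqP: sn; apply; apply: val_inj.
transitivity (\int[leb01]_t \sum_(s : n.-tuple bool) (G s)%:E * (\1_[set t | path t (size s) = s] t)%:E)%E.
  by apply: eq_integral => t _.
have I s : leb01.-integrable setT (fun t => (\1_[set t | path t (size s) = s] t)%:E).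
  by apply: integrable_indic; exact: path_set_meas.
rewrite integral_sum//; last by move=> s; apply: integrableZl => //; exact: I.
rewrite -sumEFin; apply: eq_bigr => s _.
rewrite integralZl//.
rewrite integral_indic// ?setIT; last exact: path_set_meas.
by rewrite [X in (_ * X)%E]leb01_path -EFinM mulrC.
Qed.

End BinaryPath.

(** * Countably many bits that separate the points of H *)

Section SeparatingBits.
Variables (R : realType) (O : bounded_domain R).
Variables (lam : nat -> R) (e : nat -> Hspace O).
Hypothesis lam_e : stokes_eigenbasis lam e.
Variables (B : set (Hspace O)) (wB : weakly_compact B).
Local Notation H := (Hspace O).

Lemma inHB u v : inH O u -> inH O v -> inH O (u - v).
Proof.
move=> Hu Hv; rewrite addrC -scaleN1r inHE.
have sL w : solenoidal_test O w -> L2field O w by move=> sw; exact: inV_L2 (solenoidal_V sw).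
exact: (fcl_lin (dotL2_form O) sL (@solenoidal_lin R O) (-1) Hv Hu).
Qed.

Lemma crd_inj (u v : H) : (forall n, crd e (hfun u) n = crd e (hfun v) n) -> u = v.
Proof.
move=> uv; have Lu := hfun_L2 u; have Lv := hfun_L2 v.
have Huv := inHB (hclass_inH u) (hclass_inH v).
have c0 n : crd e (hfun u - hfun v) n = 0.
  by rewrite /crd (formBl (dotL2_form O) Lu Lv (eL2 e n)) -!/(crd e _ n) uv subrr.
have := parseval lam_e Huv; have -> : (fun k => \sum_(n < k) crd e (hfun u - hfun v) n ^+ 2) = cst 0.
  by apply/funext => k; rewrite big1// => i _; rewrite c0 expr0n.
move=> /(cvgF_uniq (cvg_cst 0)) z; apply: distH_eq0.
by rewrite /distH normL2E /fnorm -z sqrtr0.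
Qed.

(* Two distinct points lie on different sides of some rational number in some coordinate, so these countably many bits separate points. *)
Definition bit (n : nat) (u : H) : bool :=
  if (unpickle n : option (nat * rat)) is Some iq then crd e (hfun u) iq.1 < ratr iq.2 else false.

Fixpoint word (n : nat) (u : H) : seq bool := if n is n'.+1 then bit n' u :: word n' u else [::].

Lemma size_word n u : size (word n u) = n.
Proof. by elim: n => //= n ->. Qed.

Lemma word_le m n u v : (m <= n)%N -> word n u = word n v -> word m u = word m v.
Proof.
elim: n => [|n ih]; first by rewrite leqn0 => /eqP ->.
by rewrite leq_eqVlt ltnS => /orP[/eqP -> //|mn] [_ h]; exact: ih.
Qed.

Lemma word_bit m n u v : (m < n)%N -> word n u = word n v -> bit m u = bit m v.
Proof. by move=> mn /(word_le mn) [->]. Qed.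

Definition osc_le (h : H -> R) n (eps : R) :=
  forall u v, B u -> B v -> word n u = word n v -> `|h u - h v| <= eps.

Lemma osc_le_mono h m n eps : (m <= n)%N -> osc_le h m eps -> osc_le h n eps.
Proof. by move=> mn hm u v Bu Bv /(word_le mn); exact: hm. Qed.

Lemma crd_limit_le (U : set_system nat) (uU : UltraFilter U) (u v : nat -> H) (u0 v0 : H) i :
  \oo `<=` U -> (forall n, word n (u n) = word n (v n)) ->
  wcvg (u @ U) u0 -> wcvg (v @ U) v0 -> crd e (hfun v0) i <= crd e (hfun u0) i.
Proof.
move=> oU uv cu cv; rewrite leNgt; apply/negP => lt.
(* A rational strictly between the two limits yields a bit on which u n and v n eventually
   differ. *)
have [q] := rat_in_itvoo lt; rewrite in_itv/= => /andP[q1 q2].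
have hu : \forall n \near U, crd e (hfun (u n)) i < ratr q.
  by have /cvgr_lt := cu (e i); exact.
have hv : \forall n \near U, ratr q < crd e (hfun (v n)) i.
  by have /cvgr_gt := cv (e i); exact.
have hn : \forall n \near U, (pickle (i, q) < n)%N by apply: oU; exists (pickle (i, q)).+1.
have [n [n1 [n2 n3]]] := filter_ex (filterI hu (filterI hv hn)).
have := word_bit n3 (uv n); rewrite /bit pickleK/= n1 => /esym.
by rewrite ltNge (ltW n2).
Qed.

(** Uniform continuity along words: pairs that share longer and longer words have, along an
    ultrafilter, weak limits with equal coordinates, hence one common limit. *)
Lemma osc_small h eps : wcont h -> 0 < eps -> exists n, osc_le h n eps.
Proof.
move=> ch eps0; apply: contrapT => /forallNP no.
have pick n : exists uv : H * H, [/\ B uv.1, B uv.2, word n uv.1 = word n uv.2 & eps < `|h uv.1 - h uv.2|].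
  apply: contrapT => /forallNP hn; apply: (no n) => u v Bu Bv uv.
  by rewrite leNgt; apply/negP => lt; apply: (hn (u, v)).
have [uv uvP] := choice pick; pose u n := (uv n).1; pose v n := (uv n).2.
have [U [uU oU]] := free_ultrafilter.
have Bu : (u @ U) B by apply: (@filterS _ U _ setT) => [n _|]; [case: (uvP n)|exact: filterT].
have Bv : (v @ U) B by apply: (@filterS _ U _ setT) => [n _|]; [case: (uvP n)|exact: filterT].
have [u0 _ cu] := B_ultra wB (ultra_fmap u uU) Bu.
have [v0 _ cv] := B_ultra wB (ultra_fmap v uU) Bv.
have ww n : word n (u n) = word n (v n) by case: (uvP n).
have E : u0 = v0.
  apply: crd_inj => i; apply/eqP; rewrite eq_le; apply/andP; split.
    exact: (crd_limit_le uU i oU (fun n => esym (ww n)) cv cu).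
  exact: (crd_limit_le uU i oU ww cu cv).
have hu : h (u n) @[n --> U] --> h u0 by exact: ch cu.
have hv : h (v n) @[n --> U] --> h v0 by exact: ch cv.
have c0 : (fun n => `|h (u n) - h (v n)|) @ U --> (0 : R).
  by have -> : 0 = `|h u0 - h v0| by [rewrite E subrr normr0]; apply: cvg_norm; exact: cvgB hu hv.
have : eps <= 0 by apply: (cvgF_ge c0); apply: (@filterS _ U _ setT) => [n _|]; [apply: ltW; case: (uvP n)|exact: filterT].
by rewrite leNgt eps0.
Qed.

End SeparatingBits.

Lemma sqrt_sum_small (R : realType) k (d : nat -> R) (r : R) : 0 < r ->
  (forall i, `|d i| < r / k.+1%:R) -> Num.sqrt (\sum_(n < k) 1 * d n ^+ 2) <= r.
Proof.
move=> r0 hd; rewrite -[leRHS](ger0_norm (ltW r0)) -sqrtr_sqr; apply: ler_wsqrtr.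
have k0 : 0 < k.+1%:R :> R by [].
have dr : 0 < r / k.+1%:R by exact: divr_gt0.
apply: (@le_trans _ _ (\sum_(n < k) (r / k.+1%:R) ^+ 2)).
  apply: ler_sum => n _; rewrite mul1r -real_normK ?num_real//.
  by rewrite ler_pXn2r ?nnegrE// ltW.
rewrite sumr_const card_ord -[X in X <= _]mulr_natl expr_div_n mulrA ler_pdivrMr ?exprn_gt0//.
rewrite mulrC; apply: ler_wpM2l; first exact: sqr_ge0.
by rewrite expr2 -natrM ler_nat mulSn -[X in (X <= _)%N]addn0 leq_add// ltnW.
Qed.

(** * Representation of a positive normalised functional by a measure on B *)

Section Representation.
Variables (R : realType) (O : bounded_domain R).
Variables (lam : nat -> R) (e : nat -> Hspace O).
Hypothesis lam_e : stokes_eigenbasis lam e.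
Variables (B : set (Hspace O)) (wB : weakly_compact B).
Local Notation H := (Hspace O).
Local Notation HB := (Hborel O).
Local Notation word := (word e).
Local Notation bit := (bit e).
Local Notation osc_le := (osc_le e B).

(** Indicators of words are bounded on B but need not be weakly continuous, so the functional has to
    act on more than [wcont]. *)
Definition bdd (G : H -> R) := exists C : R, forall u, B u -> `|G u| <= C.

Lemma bdd_lin a G1 G2 : bdd G1 -> bdd G2 -> bdd (fun u => a * G1 u + G2 u).
Proof.
move=> [C1 h1] [C2 h2]; exists (`|a| * C1 + C2) => u Bu.
apply: le_trans (ler_normD _ _) _; rewrite normrM; apply: lerD; last exact: h2.
by apply: ler_wpM2l => //; exact: h1.
Qed.

Lemma bdd_cst c : bdd (cst c).
Proof. by exists `|c|. Qed.

Lemma bdd_bool (b : H -> bool) : bdd (fun u => (b u)%:R).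
Proof. by exists 1 => u _; case: (b u); rewrite ?normr1 ?normr0. Qed.

Lemma bdd_sum (I : Type) (r : seq I) (c : I -> R) (F : I -> H -> R) :
  (forall i, bdd (F i)) -> bdd (fun u => \sum_(i <- r) c i * F i u).
Proof.
move=> hF; elim: r => [|i r ih].
  by have -> : (fun u => \sum_(i <- [::]) c i * F i u) = cst 0 by [apply/funext => u; rewrite big_nil]; exact: bdd_cst.
have -> : (fun u => \sum_(j <- i :: r) c j * F j u) = (fun u => c i * F i u + \sum_(j <- r) c j * F j u).
  by apply/funext => u; rewrite big_cons.
exact: bdd_lin.
Qed.

Variable Lam : (H -> R) -> R.
Hypothesis Lam_lin : forall a G1 G2, bdd G1 -> bdd G2 -> Lam (fun u => a * G1 u + G2 u) = a * Lam G1 + Lam G2.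
Hypothesis Lam_mono : forall G1 G2, bdd G1 -> bdd G2 -> (forall u, B u -> G1 u <= G2 u) -> Lam G1 <= Lam G2.
Hypothesis Lam1 : Lam (cst 1) = 1.

Lemma Lam0 : Lam (cst 0) = 0.
Proof.
have := Lam_lin 1 (bdd_cst 0) (bdd_cst 0).
have -> : (fun u : H => 1 * (cst 0 u : R) + (cst 0 u : R)) = (cst 0 : H -> R).
  by apply/funext => u; rewrite /cst mulr0 addr0.
by lra.
Qed.

Lemma Lam_sum (I : Type) (r : seq I) (c : I -> R) (F : I -> H -> R) :
  (forall i, bdd (F i)) -> Lam (fun u => \sum_(i <- r) c i * F i u) = \sum_(i <- r) c i * Lam (F i).
Proof.
move=> hF; elim: r => [|i r ih].
  rewrite big_nil; transitivity (Lam (cst 0)); last exact: Lam0.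
  by congr (Lam _); apply/funext => u; rewrite big_nil.
rewrite big_cons -ih -Lam_lin//; last exact: bdd_sum.
by congr (Lam _); apply/funext => u; rewrite big_cons.
Qed.

Definition mass (s : seq bool) : R := Lam (fun u => (word (size s) u == s)%:R).

Lemma mass_ge0 s : 0 <= mass s.
Proof.
rewrite -Lam0; apply: Lam_mono; [exact: bdd_cst|exact: bdd_bool|].
by move=> u _; rewrite ler0n.
Qed.

Lemma mass_nil : mass [::] = 1.
Proof. by rewrite -Lam1; congr (Lam _); apply/funext => u. Qed.

Lemma mass_cons s : mass (false :: s) + mass (true :: s) = mass s.
Proof.
have := Lam_lin 1 (bdd_bool (fun u => word (size s).+1 u == false :: s)) (bdd_bool (fun u => word (size s).+1 u == true :: s)).
rewrite mul1r => <-; congr (Lam _); apply/funext => u; rewrite /= !eqseq_cons.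
by case: (bit _ u); rewrite /= ?mul1r ?add0r ?addr0.
Qed.

(** When no point of B has the word, the value is junk; such words have mass 0, and no path visits
    them. *)
Definition rep (s : seq bool) : H := get [set u | B u /\ word (size s) u = s].

Lemma rep_ex s : (exists2 u, B u & word (size s) u = s) -> B (rep s) /\ word (size s) (rep s) = s.
Proof. by move=> [u Bu us]; apply: (@getPex _ [set u | B u /\ word (size s) u = s]); exists u. Qed.

Lemma rep_mass s : 0 < mass s -> B (rep s) /\ word (size s) (rep s) = s.
Proof.
move=> ms; apply: rep_ex; apply: contrapT => h.
suff : mass s <= 0 by rewrite leNgt ms.
rewrite -Lam0; apply: Lam_mono; [exact: bdd_bool|exact: bdd_cst|].
move=> u Bu; case: eqP => //= us; exfalso; apply: h; by exists u.
Qed.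

Local Notation pth := (path mass).

Lemma rep_path t n : B (rep (pth t n)) /\ word n (rep (pth t n)) = pth t n.
Proof.
have := rep_mass (path_pos mass_nil mass_cons t n).
by rewrite size_path.
Qed.

Lemma word_rep_path t m n : (n <= m)%N -> word n (rep (pth t m)) = pth t n.
Proof.
move=> nm; have [_ h] := rep_path t m.
suff E v : word m v = pth t m -> word n v = pth t n by exact: E.
elim: m nm {h} => [|m ih]; first by rewrite leqn0 => /eqP ->.
rewrite leq_eqVlt ltnS => /orP[/eqP -> //|nm] [_ hv]; exact: ih.
Qed.

(** Points chosen in nested cells accumulate weakly in B. One limit serves all h at once, since a
    single ultrafilter is used. *)
Lemma limit_point_ex t : exists2 x, B x & forall h n eps, wcont h -> osc_le h n eps ->
  `|h (rep (pth t n)) - h x| <= eps.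
Proof.
pose x n := rep (pth t n).
have [U [uU oU]] := free_ultrafilter.
have Bx : (x @ U) B by apply: (@filterS _ U _ setT) => [n _|]; [case: (rep_path t n)|exact: filterT].
have [x0 Bx0 cx] := B_ultra wB (ultra_fmap x uU) Bx.
exists x0 => // h n eps ch ho.
have hx : h (x m) @[m --> U] --> h x0 by exact: ch cx.
have c : (fun m => `|h (x n) - h (x m)|) @ U --> `|h (x n) - h x0|.
  by apply: cvg_norm; apply: cvgB => //; exact: cvg_cst.
apply: (cvgF_le c); apply: oU; exists n => // m /= nm.
have [B1 w1] := rep_path t n; have [B2 w2] := rep_path t m.
by apply: ho => //; rewrite w1 word_rep_path.
Qed.

Definition limit_point t : H := projT1 (cid2 (limit_point_ex t)).

Lemma limit_point_B t : B (limit_point t).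
Proof. by rewrite /limit_point; case: cid2. Qed.

Lemma limit_point_le t h n eps : wcont h -> osc_le h n eps ->
  `|h (rep (pth t n)) - h (limit_point t)| <= eps.
Proof. by move=> ch ho; rewrite /limit_point; case: cid2 => x _ hx /=; exact: hx. Qed.

Lemma wcont_limit_point_meas h : wcont h ->
  measurable_fun setT (fun t : measurableTypeR R => h (limit_point t) : measurableTypeR R).
Proof.
move=> ch; apply: (measurable_fun_cvg (h := fun n (t : measurableTypeR R) => h (rep (pth t n)))).
  by move=> n; exact: (path_meas mass n (fun s => h (rep s))).
move=> t _; apply/cvgrPdist_le => eps eps0; have [n hn] := osc_small lam_e wB ch eps0.
exists n => // m /= nm; rewrite distrC; apply: limit_point_le => //.
exact: osc_le_mono nm hn.
Qed.

(** Finite rational combinations of the basis: a countable dense set of centres for balls in H. *)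
Definition center (q : seq rat) : vfield R := osum (fun n => hfun (e n) : vfield R) (fun i => ratr q`_i) (size q).

Lemma center_L2 q : L2field O (center q).
Proof. exact: (osum_in (dotL2_form O) (eL2 e)). Qed.

Lemma dist_center_sqr q (u : vfield R) : L2field O u ->
  dotL2 O (u - center q) (u - center q) =
  N O u - 2 * (\sum_(i < size q) ratr q`_i * crd e u i) + \sum_(i < size q) 1 * ratr q`_i ^+ 2.
Proof.
move=> Lu; rewrite (form_sqB (dotL2_form O) Lu (center_L2 q)).
rewrite /center (form_osum (dotL2_form O) (eL2 e) (orthoL2 lam_e)).
by rewrite (form_osumr (dotL2_form O) (eL2 e)).
Qed.

Lemma N_limit_point_meas :
  measurable_fun setT (fun t : measurableTypeR R => N O (hfun (limit_point t)) : measurableTypeR R).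
Proof.
apply: (measurable_fun_cvg (h := fun k (t : measurableTypeR R) => Npart e k (hfun (limit_point t)))).
  by move=> k; exact: (wcont_limit_point_meas (wcont_Npart lam_e (k:=k))).
by move=> t _; apply: (parseval lam_e); exact: hclass_inH.
Qed.

Lemma center_limit_point_meas q (r : R) :
  measurable ([set t | normL2 O (hfun (limit_point t) - center q) < r] : set (measurableTypeR R)).
Proof.
have m2 : measurable_fun setT (fun t : measurableTypeR R =>
    dotL2 O (hfun (limit_point t) - center q) (hfun (limit_point t) - center q) : measurableTypeR R).
  have -> : (fun t : measurableTypeR R => dotL2 O (hfun (limit_point t) - center q) (hfun (limit_point t) - center q)) =
    (fun t => N O (hfun (limit_point t)) + ((- 2) * (\sum_(i < size q) ratr q`_i * crd e (hfun (limit_point t)) i)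
      + \sum_(i < size q) 1 * ratr q`_i ^+ 2)).
    by apply/funext => t; rewrite dist_center_sqr ?mulNr ?addrA//; exact: hfun_L2.
  apply: measurable_funD; first exact: N_limit_point_meas.
  have cg : wcont (fun u : H => (- 2) * (\sum_(i < size q) ratr q`_i * crd e (hfun u) i)
      + \sum_(i < size q) 1 * ratr q`_i ^+ 2).
    apply: wcontD; last exact: wcont_cst.
    by apply: wcontZ; apply: wcont_sum => i; apply: wcontZ; exact: (wcont_dot (hclass_inH (e i))).
  exact: (wcont_limit_point_meas cg).
have -> : [set t | normL2 O (hfun (limit_point t) - center q) < r] =
  (fun t => dotL2 O (hfun (limit_point t) - center q) (hfun (limit_point t) - center q)) @^-1` [set x | Num.sqrt x < r].
  by apply/seteqP; split=> t /=; rewrite normL2E /fnorm.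
rewrite -[X in measurable X]setTI; apply: m2 => //.
have ms : measurable_fun setT (fun x : measurableTypeR R => Num.sqrt x : measurableTypeR R).
  by apply: continuous_measurable_fun; exact: sqrt_continuous.
have := ms measurableT _ (measurable_itv `]-oo, r[).
by rewrite setTI; congr measurable; apply/seteqP; split=> x /=; rewrite in_itv.
Qed.

(** Measurability is first known only through weakly continuous functionals and their limits. A
    norm-open set is a countable union of balls around the centres, and the squared distance to a
    centre is N plus a weakly continuous functional. *)
Lemma limit_point_meas : measurable_fun setT (limit_point : measurableTypeR R -> HB).
Proof.
apply: (@measurability _ _ _ _ _ _ (@open H : set (set HB)) erefl) => _ [W oW <-]; rewrite setTI.
pose A (qr : seq rat * rat) : set H := [set u | normL2 O (hfun u - center qr.1) < ratr qr.2].
have -> : limit_point @^-1` W = \bigcup_(qr in [set qr | A qr `<=` W]) (limit_point @^-1` A qr).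
  apply/seteqP; split=> [t Wt|t [qr qrW]]; last exact: qrW.
  have /nbhs_ballP[eps /= eps0 hW] : nbhs (limit_point t) W by exact: open_nbhs_nbhs.
  set u := limit_point t in Wt hW *.
  have e20 : 0 < eps / 2 by rewrite divr_gt0.
  have [r] := rat_in_itvoo e20; rewrite in_itv/= => /andP[r0 re].
  have Lu := hfun_L2 u.
  have r20 : 0 < (ratr r : R) / 2 by rewrite divr_gt0.
  have tl : \forall k \near \oo, normL2 O (hfun u - Pk e k (hfun u)) < ratr r / 2.
    by have [_ _ /(_ u) h _] := lam_e; have /cvgr_lt := h; exact.
  have [k _ /(_ k (leqnn k)) /= tlk] := tl.
  have d0 : 0 < (ratr r : R) / 2 / k.+1%:R by rewrite divr_gt0.
  have pick i : exists q : rat, `|crd e (hfun u) i - ratr q| < ratr r / 2 / k.+1%:R.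
    have [q] := rat_in_itvoo (ltr_pwDr d0 (lexx (crd e (hfun u) i))).
    by rewrite in_itv/= => /andP[q1 q2]; exists q; rewrite distrC ger0_norm ?subr_ge0 ?ltW// ltrBlDl.
  have [q qP] := choice pick.
  have Au : A (mkseq q k, r) u.
    rewrite /A /= /center size_mkseq.
    have -> : osum (fun n => hfun (e n) : vfield R) (fun i => ratr (mkseq q k)`_i) k
       = osum (fun n => hfun (e n) : vfield R) (fun i => ratr (q i)) k.
      by apply: eq_bigr => i _; rewrite nth_mkseq.
    set c := osum _ _ k; have Lc : L2field O c by exact: (osum_in (dotL2_form O) (eL2 e)).
    have LP : L2field O (Pk e k (hfun u)) by rewrite Pk_osum; exact: (osum_in (dotL2_form O) (eL2 e)).
    rewrite normL2E; apply: le_lt_trans (fnorm_tri (dotL2_form O) Lu LP Lc) _.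
    rewrite [X in _ < X]splitr -!normL2E; apply: ltr_leD tlk _.
    have -> : Pk e k (hfun u) - c = osum (fun n => hfun (e n) : vfield R) (fun i => crd e (hfun u) i - ratr (q i)) k.
      by rewrite /Pk /c /osum -sumrB; apply: eq_bigr => i _; rewrite scalerBl.
    rewrite normL2E /fnorm (form_osum (dotL2_form O) (eL2 e) (orthoL2 lam_e)).
    exact: (sqrt_sum_small (d := fun n => crd e (hfun u) n - ratr (q n)) r20 qP).
  exists (mkseq q k, r) => // v Av; apply: hW.
  rewrite metric_structure.ballEmdist /= /mdist/= /distH.
  have Lv := hfun_L2 v; have Lc := center_L2 (mkseq q k).
  rewrite normL2E; apply: le_lt_trans (fnorm_tri (dotL2_form O) Lu Lc Lv) _.
  rewrite (fnormBC (dotL2_form O) Lc Lv) -!normL2E.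
  by apply: lt_trans (ltrD Au Av) _; rewrite /= [ltRHS]splitr; exact: ltrD.
rewrite bigcup_mkcond; apply: countable_bigcupT_measurable => // qr.
by case: ifPn => // _; exact: center_limit_point_meas.
Qed.

Lemma word_sum n (G : seq bool -> R) u :
  G (word n u) = \sum_(s : n.-tuple bool) G s * (word (size s) u == s)%:R.
Proof.
have sz : size (word n u) == n by rewrite size_word.
rewrite (bigD1 (Tuple sz))//= size_word eqxx mulr1 big1 ?addr0// => s sn.
rewrite size_tuple (_ : (_ == _) = false) ?mulr0//; apply/negbTE.
by apply: contra sn => /eqP h; apply/eqP/val_inj.
Qed.

Lemma bdd_word n (G : seq bool -> R) : bdd (fun u => G (word n u)).
Proof.
by under [X in bdd X]eq_fun do rewrite word_sum; apply: bdd_sum => s; exact: bdd_bool.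
Qed.

Lemma Lam_word n (G : seq bool -> R) : Lam (fun u => G (word n u)) = \sum_(s : n.-tuple bool) mass s * G s.
Proof.
under [X in Lam X]eq_fun do rewrite word_sum.
by rewrite Lam_sum => [|s]; [apply: eq_bigr => s _; rewrite mulrC|exact: bdd_bool].
Qed.

Lemma bddD G c : bdd G -> bdd (fun u => G u + c).
Proof.
move=> [C hC]; exists (C + `|c|) => u Bu.
by apply: le_trans (ler_normD _ _) _; rewrite lerD2r; exact: hC.
Qed.

Lemma LamD G c : bdd G -> Lam (fun u => G u + c) = Lam G + c.
Proof.
move=> bG; have E : Lam (cst c) = c.
  have := Lam_lin c (bdd_cst 1) (bdd_cst 0); rewrite Lam0 Lam1.
  have -> : (fun u : H => c * (cst 1 u : R) + (cst 0 u : R)) = (cst c : H -> R).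
    by apply/funext => u; rewrite /cst mulr1 addr0.
  by rewrite mulr1 addr0.
have := Lam_lin 1 bG (bdd_cst c); rewrite E mul1r => <-.
by congr (Lam _); apply/funext => u; rewrite mul1r.
Qed.

Lemma leb01_bounded_integrable (G : measurableTypeR R -> measurableTypeR R) (C : R) :
  measurable_fun setT G -> (forall t, `|G t| <= C) -> (@leb01 R).-integrable setT (EFin \o G).
Proof.
move=> mG hG; apply: measurable_bounded_integrable => //.
  by apply: le_lt_trans (probability_le1 _ _) _ => //; exact: ltry.
by exists C; split=> [|M CM t _]; [exact: num_real|exact: le_trans (hG t) (ltW CM)].
Qed.

(** Once words of length n make the oscillation of h at most eps, both sides are within eps of the
    sum of the mass s * h (rep s). *)
Lemma integral_limit_point h : wcont h -> (\int[@leb01 R]_t (h (limit_point t))%:E = (Lam h)%:E)%E.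
Proof.
move=> ch; have [C hC] := wcont_bounded wB ch; have bh : bdd h by exists C.
have ih : (@leb01 R).-integrable setT (fun t => (h (limit_point t))%:E).
  apply: (leb01_bounded_integrable (C := C)); first exact: wcont_limit_point_meas.
  by move=> t; exact: hC (limit_point_B t).
have ip n c : (@leb01 R).-integrable setT (fun t => (h (rep (pth t n)) + c)%:E).
  apply: (leb01_bounded_integrable (C := C + `|c|)); first exact: (path_meas mass n (fun s => h (rep s) + c)).
  move=> t; apply: le_trans (ler_normD _ _) _; rewrite lerD2r; apply: hC.
  by case: (rep_path t n).
have iE n c := integral_path mass_ge0 mass_nil mass_cons n (fun s => h (rep s) + c).
have repw n u : B u -> B (rep (word n u)) /\ word n (rep (word n u)) = word n u.
  by move=> Bu; have := @rep_ex (word n u); rewrite size_word; apply; exists u.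
have step (eps : R) : 0 < eps -> (\int[@leb01 R]_t (h (limit_point t))%:E <= (Lam h + 2 * eps)%:E)%E /\
   ((Lam h - 2 * eps)%:E <= \int[@leb01 R]_t (h (limit_point t))%:E)%E.
  move=> eps0; have [n hn] := osc_small lam_e wB ch eps0.
  have near t : h (rep (pth t n)) + - eps <= h (limit_point t) <= h (rep (pth t n)) + eps.
    by have := limit_point_le t ch hn; rewrite ler_norml => /andP[h1 h2]; apply/andP; split; lra.
  have nearw u : B u -> h u - eps <= h (rep (word n u)) <= h u + eps.
    move=> Bu; have [Br wr] := repw n u Bu; have := hn _ _ Br Bu wr.
    by rewrite ler_norml => /andP[h1 h2]; apply/andP; split; lra.
  split.
    have : (\int[@leb01 R]_t (h (limit_point t))%:E <= \int[@leb01 R]_t (h (rep (pth t n)) + eps)%:E)%E.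
      by apply: le_integral => // t _; rewrite lee_fin; case/andP: (near t).
    move=> /le_trans; apply; rewrite iE -(Lam_word n (fun s => h (rep s) + eps)) lee_fin -LamD//.
    apply: Lam_mono; [exact: (bdd_word n (fun s => h (rep s) + eps))|exact: bddD|].
    by move=> u Bu; case/andP: (nearw u Bu) => _ h2; lra.
  have : (\int[@leb01 R]_t (h (rep (pth t n)) + - eps)%:E <= \int[@leb01 R]_t (h (limit_point t))%:E)%E.
    by apply: le_integral => // t _; rewrite lee_fin; case/andP: (near t).
  apply: le_trans; rewrite iE -(Lam_word n (fun s => h (rep s) + - eps)) lee_fin -LamD//.
  apply: Lam_mono; [exact: bddD|exact: (bdd_word n (fun s => h (rep s) + - eps))|].
  by move=> u Bu; case/andP: (nearw u Bu) => h1 _; lra.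
have fI := integrable_fin_num measurableT ih.
move: step; rewrite -(fineK fI); set I := fine _ => step; congr EFin; apply/eqP; rewrite eq_le.
apply/andP; split; apply/ler_addgt0Pr => eps eps0; have e2 : 0 < eps / 2 by rewrite divr_gt0.
  by have [] := step _ e2; rewrite !lee_fin; lra.
by have [] := step _ e2; rewrite !lee_fin; lra.
Qed.

Theorem functional_measure : exists2 mu : probability HB R, mu (~` B) = 0%E &
  forall h, wcont h -> (\int[mu]_u (h u)%:E = (Lam h)%:E)%E.
Proof.
pose X : {mfun measurableTypeR R >-> HB} := HB.pack_for {mfun measurableTypeR R >-> HB}
  (limit_point : measurableTypeR R -> HB) (isMeasurableFun.Build _ _ _ _ (limit_point : measurableTypeR R -> HB) limit_point_meas).
exists (distribution (@leb01 R) X) => [|h ch].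
  have E : limit_point @^-1` (~` B) = set0.
    by apply/seteqP; split=> t //= h; apply: h; exact: limit_point_B.
  by change (@leb01 R (limit_point @^-1` (~` B)) = 0%E); rewrite E measure0.
have [C hC] := wcont_bounded wB ch.
rewrite -(integral_limit_point ch) integral_distribution//.
  by apply/measurable_EFinP; exact: wcont_meas.
apply: (leb01_bounded_integrable (C := C)); first exact: wcont_limit_point_meas.
by move=> t; exact: hC (limit_point_B t).
Qed.

End Representation.

(** * Limits of mixtures are stationary statistical solutions *)

(** Right difference quotients of a nondecreasing function are nonnegative; the right side is
    available even at 0. *)
Lemma energy_weight_ge0 (R : realType) (psi dpsi : R -> R) x : energy_weight psi dpsi -> 0 <= x -> 0 <= dpsi x.
Proof.
move=> [_ nd der _ _] x0; have h := der x x0.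
have c : h^-1 * (psi (x + h) - psi x) @[h --> 0^'+] --> dpsi x.
  apply: cvg_trans h; apply: cvg_app => P hP.
  have hP' : \forall y \near (0 : R), y != 0 -> 0 <= x + y -> P y by exact: hP.
  have : \forall y \near (0 : R), 0 < y -> P y.
    by apply: filterS hP' => y hy y0; apply: hy; rewrite ?gt_eqF// addr_ge0// ltW.
  exact.
apply: (cvgF_ge c); near=> y.
have y0 : 0 < y by near: y; exact: nbhs_right_gt.
by rewrite mulr_ge0 ?invr_ge0 ?subr_ge0 ?(ltW y0)//; apply: nd => //; rewrite lerDl ltW.
Unshelve. all: by end_near.
Qed.

Lemma continuous_max0 (R : realType) (a : R -> R) : {within `[0, +oo[, continuous a} ->
  continuous (fun x : R => a (Num.max 0 x)).
Proof.
move=> /subspace_continuousP ca x.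
have m0 (y : R) : 0 <= Num.max 0 y by rewrite le_max lexx.
have A0 : [set` `[(0 : R), +oo[] (Num.max 0 x) by rewrite /= in_itv/= m0.
have cm : continuous (fun x : R => Num.max 0 x).
  by move=> y; apply: (@continuous_max _ _ (cst 0) id); [exact: cst_continuous|exact: cvg_id].
move=> P hP; have h1 : \forall y \near Num.max 0 x, [set` `[(0 : R), +oo[] y -> P (a y) := ca _ A0 P hP.
have h2 : \forall y \near x, [set` `[(0 : R), +oo[] (Num.max 0 y) -> P (a (Num.max 0 y)) := cm x _ h1.
have : \forall y \near x, P (a (Num.max 0 y)).
  by apply: filterS h2 => y; apply; rewrite /= in_itv/= m0.
exact.
Qed.

Section ConvUltrafilter.
Variables (R : realType) (O : bounded_domain R).
Variables (lam : nat -> R) (e : nat -> Hspace O).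
Hypothesis lam_e : stokes_eigenbasis lam e.
Variables (B : set (Hspace O)) (wB : weakly_compact B).
Variables (nu : R) (nu0 : 0 < nu) (f : vfield R -> R) (fV' : inVdual O f).
Local Notation H := (Hspace O).
Local Notation E u := (norm_grad O u ^+ 2).
Local Notation BV := (BV B).
Local Notation FC := (@Fcyl R O nu f).
Local Notation conv := (conv B nu f).

(** The sets of mixtures that meet finitely many constraints up to eta are nonempty by [minimax],
    and they form a filter base because lists can be concatenated and tolerances shrunk. *)
Lemma conv_ultrafilter k (m : R) : adm B nu f !=set0 ->
  (forall Psi : cyl O, exists2 b, adm B nu f b & m <= objective nu f e k Psi b) ->
  exists U : set_system ((H -> R) -> R), [/\ UltraFilter U, U [set L | conv L],
    forall eta, 0 < eta -> \forall L \near U, m - eta <= L (fun u : H => enk lam e k u)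
    & forall Psi eta, 0 < eta -> \forall L \near U, `|L (fun u : H => FC Psi u)| <= eta].
Proof.
move=> adm0 hm.
pose good (PE : seq (cyl O) * R) := [set L : (H -> R) -> R | [/\ conv L, m - PE.2 <= L (fun u : H => enk lam e k u)
    & List.Forall (fun P => `|L (fun u : H => FC P u)| <= PE.2) PE.1]].
pose D := [set PE : seq (cyl O) * R | 0 < PE.2].
have FF : Filter (filter_from D good).
  apply: filter_from_filter; first by exists ([::], 1); exact: ltr01.
  move=> [P1 e1] [P2 e2] /= e10 e20; exists (P1 ++ P2, Num.min e1 e2); first by rewrite /D/= lt_min e10 e20.
  have m1 : Num.min e1 e2 <= e1 by rewrite ge_min lexx.
  have m2 : Num.min e1 e2 <= e2 by rewrite ge_min lexx orbT.
  move=> L [/= cL h1 /List.Forall_app[h2 h3]]; split; split=> //=.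
  - by apply: le_trans h1; rewrite lerD2l lerN2.
  - by apply: List.Forall_impl h2 => P /le_trans; exact.
  - by apply: le_trans h1; rewrite lerD2l lerN2.
  - by apply: List.Forall_impl h3 => P /le_trans; exact.
have PF : ProperFilter (filter_from D good).
  apply: filter_from_proper => -[Ps eta] /= eta0.
  by have [L hL] := minimax lam_e wB nu0 fV' Ps eta0 adm0 hm; exists L.
have [U [uU hU]] := ultraFilterLemma PF.
have gU Ps eta : 0 < eta -> U (good (Ps, eta)) by move=> eta0; apply: hU; exists (Ps, eta).
exists U; split=> //.
- by apply: filterS (gU [::] 1 ltr01) => L [].
- by move=> eta eta0; apply: filterS (gU [::] eta eta0) => L [].
- by move=> Psi eta eta0; apply: filterS (gU [:: Psi] eta eta0) => L [_ _ hF]; exact: (List.Forall_inv hF).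
Qed.

Variables (U : set_system ((H -> R) -> R)) (uU : UltraFilter U) (cU : U [set L | conv L]).

Definition Lam (G : H -> R) : R := lim (L G @[L --> U]).

(** The mean enstrophy of the mixtures is uniformly bounded, hence so are the means of such
    functionals, and their limits along [U] exist. *)
Definition grow (G : H -> R) := exists C : R, forall u, BV u -> `|G u| <= C * (1 + E u).

Lemma bdd_grow G : bdd B G -> grow G.
Proof.
move=> [C hC]; exists `|C| => u [Bu _]; apply: le_trans (hC u Bu) _; apply: le_trans (ler_norm _) _.
by rewrite ler_peMr// lerDl E_ge0.
Qed.

Lemma tame_grow G : tame B G -> grow G.
Proof. by move=> /(tame_bound wB)[C _ hC]; exists C. Qed.

Lemma conv_bound G (C : R) : (forall u, BV u -> `|G u| <= C * (1 + E u)) ->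
  exists K : R, forall L, conv L -> `|L G| <= K.
Proof.
move=> hG; have [M0 M00 hM] := conv_energy B nu0 fV'; exists (`|C| * M0 + `|C|) => L cL.
have hG' u : BV u -> `|G u| <= `|C| * E u + cst `|C| u.
  move=> Ku; apply: le_trans (hG u Ku) _; rewrite /cst -[X in _ <= _ + X]mulr1 -mulrDr addrC.
  by apply: ler_wpM2r; [apply: addr_ge0 => //; exact: E_ge0|exact: ler_norm].
have h0 : L (fun u => `|C| * E u + cst `|C| u) <= `|C| * M0 + `|C|.
  by rewrite (conv_lin cL) (conv_cst cL) lerD2r; apply: ler_wpM2l => //; exact: hM.
rewrite ler_norml; apply/andP; split; last first.
  apply: le_trans h0; apply: (conv_mono cL) => u Ku.
  exact: le_trans (ler_norm _) (hG' u Ku).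
rewrite lerNl; apply: le_trans h0.
have -> : - L G = L (fun u => (-1) * G u + cst 0 u) by rewrite (conv_lin cL) (conv_cst cL) addr0 mulN1r.
apply: (conv_mono cL) => u Ku; rewrite /cst mulN1r addr0.
by apply: le_trans (hG' u Ku); rewrite -normrN; exact: ler_norm.
Qed.

Lemma Lam_cvg G : grow G -> (fun L => L G) @ U --> Lam G.
Proof.
move=> [C hC]; have [K hK] := conv_bound hC.
have [|l hl] := @ultra_lim _ _ _ uU (fun L => L G) K; first by apply: filterS cU => L; exact: hK.
by rewrite /Lam; apply/cvg_ex; exists l.
Qed.

Lemma Lam_near G c : grow G -> (\forall L \near U, L G <= c) -> Lam G <= c.
Proof. by move=> gG; apply: cvgF_le; exact: Lam_cvg. Qed.

Lemma Lam_near_ge G c : grow G -> (\forall L \near U, c <= L G) -> c <= Lam G.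
Proof. by move=> gG; apply: cvgF_ge; exact: Lam_cvg. Qed.

Lemma grow_lin a G1 G2 : grow G1 -> grow G2 -> grow (fun u => a * G1 u + G2 u).
Proof.
move=> [C1 h1] [C2 h2]; exists (`|a| * C1 + C2) => u Ku.
apply: le_trans (ler_normD _ _) _; rewrite normrM mulrDl -mulrA; apply: lerD; last exact: h2.
by apply: ler_wpM2l => //; exact: h1.
Qed.

Lemma Lam_lin a G1 G2 : grow G1 -> grow G2 -> Lam (fun u => a * G1 u + G2 u) = a * Lam G1 + Lam G2.
Proof.
move=> g1 g2; have c1 : (fun L => a * L G1 + L G2) @ U --> a * Lam G1 + Lam G2.
  by apply: cvgD; [apply: cvgM; [exact: cvg_cst|exact: Lam_cvg]|exact: Lam_cvg].
apply: (cvgF_uniq (Lam_cvg (grow_lin a g1 g2))); apply: cvg_trans c1.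
by apply: near_eq_cvg; apply: filterS cU => L cL; rewrite (conv_lin cL).
Qed.

Lemma Lam_mono G1 G2 : grow G1 -> grow G2 -> (forall u, BV u -> G1 u <= G2 u) -> Lam G1 <= Lam G2.
Proof.
move=> g1 g2 h; apply: (cvgF_ler (Lam_cvg g1) (Lam_cvg g2)).
by apply: filterS cU => L cL; exact: (conv_mono cL).
Qed.

Lemma Lam1 : Lam (cst 1) = 1.
Proof.
have g : grow (cst 1) by apply: bdd_grow; exact: bdd_cst.
have c1 : (fun L : (H -> R) -> R => 1 : R) @ U --> (1 : R) by exact: cvg_cst.
apply: (cvgF_uniq (Lam_cvg g)); apply: cvg_trans c1.
by apply: near_eq_cvg; apply: filterS cU => L cL; rewrite (conv_cst cL).
Qed.

Lemma Lam_measure : exists2 mu : probability (Hborel O) R, mu (~` B) = 0%E &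
  forall h, wcont h -> (\int[mu]_u (h u)%:E = (Lam h)%:E)%E.
Proof.
apply: (functional_measure lam_e wB) => [a G1 G2 b1 b2|G1 G2 b1 b2 h|]; last exact: Lam1.
  by apply: Lam_lin; exact: bdd_grow.
by apply: Lam_mono => [||u [Bu _]]; [exact: bdd_grow|exact: bdd_grow|exact: h].
Qed.

End ConvUltrafilter.

Lemma integral_enk_cvg (R : realType) (O : bounded_domain R) (lam : nat -> R) (e : nat -> Hspace O)
    (mu : probability (Hborel O) R) : stokes_eigenbasis lam e ->
  (\int[mu]_u (enk lam e n (hfun u))%:E @[n --> \oo] --> \int[mu]_u enstrophy O (hfun u))%E.
Proof.
move=> lam_e; pose g n (u : Hborel O) := (enk lam e n (hfun u))%:E.
have mg n : measurable_fun setT (g n) by apply/measurable_EFinP; exact: (enk_meas lam_e).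
have g0 n u : setT u -> (0 <= g n u)%E by move=> _; rewrite lee_fin (enk_ge0 lam_e).
have gnd u : setT u -> {homo g^~ u : n m / (n <= m)%N >-> (n <= m)%E}.
  by move=> _ n m nm; rewrite lee_fin; exact: (enk_nd lam_e).
have := @cvg_monotone_convergence _ _ _ mu setT measurableT g mg g0 gnd.
have -> : (\int[mu]_x limn (g^~ x) = \int[mu]_u enstrophy O (hfun u))%E.
  by apply: eq_integral => u _; apply: cvg_lim => //; exact: (enstrophy_cvg lam_e).
exact.
Qed.

(** * The represented measure is a stationary statistical solution *)

Section LimitMeasure.
Variables (R : realType) (O : bounded_domain R).
Variables (lam : nat -> R) (e : nat -> Hspace O).
Hypothesis lam_e : stokes_eigenbasis lam e.
Variables (B : set (Hspace O)) (wB : weakly_compact B).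
Variables (nu : R) (nu0 : 0 < nu) (f : vfield R -> R) (fV' : inVdual O f).
Local Notation H := (Hspace O).
Local Notation HB := (Hborel O).
Local Notation E u := (norm_grad O u ^+ 2).
Local Notation BV := (BV B).
Local Notation V := (@Vset R O).
Local Notation FC := (@Fcyl R O nu f).
Local Notation conv := (conv B nu f).
Local Notation tame := (tame B).
Variables (U : set_system ((H -> R) -> R)) (uU : UltraFilter U) (cU : U [set L | conv L]).
Local Notation Lam := (Lam U).
Variable mu : probability HB R.
Hypothesis muB : mu (~` B) = 0%E.
Hypothesis muh : forall h, wcont h -> (\int[mu]_u (h u)%:E = (Lam h)%:E)%E.

Let mV : measurable V := measurable_V lam_e.
Let mBV : measurable (BV : set HB) := measurable_BV lam_e wB.

Lemma Lam_energy : exists2 M0 : R, 0 <= M0 & forall L, conv L -> L (fun u => E u) <= M0.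
Proof. exact: (conv_energy B nu0 fV'). Qed.

(** The enstrophy is not weakly continuous, so [muh] does not apply to it; the bound is shown for
    each [enk] and carried over by monotone convergence. *)
Lemma enstrophy_bound (M0 : R) : (forall L, conv L -> L (fun u => E u) <= M0) ->
  (\int[mu]_u enstrophy O (hfun u) <= M0%:E)%E.
Proof.
move=> hM; have c := @integral_enk_cvg _ _ _ _ mu lam_e.
rewrite -(cvg_lim _ c)//; apply: lime_le; first by apply/cvg_ex; eexists; exact: c.
apply: nearW => n; rewrite (muh (wcont_enk lam_e (k := n))) lee_fin.
apply: (Lam_near nu0 fV' uU cU); first by apply: tame_grow => //; apply: tame_wcont; exact: (wcont_enk lam_e).
apply: filterS cU => L cL; apply: le_trans (hM L cL).
by apply: (conv_mono cL) => u Ku; exact: (BV_enk_le lam_e n Ku).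
Qed.

Lemma enstrophy_fin : (\int[mu]_u enstrophy O (hfun u) < +oo)%E.
Proof. by have [M0 _ hM] := Lam_energy; apply: le_lt_trans (enstrophy_bound hM) _; exact: ltry. Qed.

Lemma mu_BVC : mu (~` (BV : set HB)) = 0%E.
Proof. by rewrite probability_setC// (mu_BV lam_e wB muB enstrophy_fin) subee. Qed.

Lemma integral_BV_wcont h : wcont h -> (\int[mu]_(u in (BV : set HB)) (h u)%:E = (Lam h)%:E)%E.
Proof.
move=> ch; rewrite -(muh ch); have [C hC] := wcont_bounded wB ch.
have mN : measurable (~` (BV : set HB)) by exact: measurableC.
have mh : measurable_fun setT (EFin \o (h : HB -> R)) by apply/measurable_EFinP; exact: wcont_meas.
have ih : mu.-integrable setT (EFin \o (h : HB -> R)).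
  apply/(negligible_integrable mN measurableT mh mu_BVC); rewrite setTD setCK.
  have mhV : measurable_fun V (h : HB -> R) by apply: measurable_funTS; exact: wcont_meas.
  apply: (integrableS mV mBV); first by move=> u [].
  have [C' hC'] := tame_grow wB (tame_wcont B ch).
  exact: (integrable_V lam_e wB muB enstrophy_fin mhV hC').
by rewrite [RHS](negligible_integral mN measurableT ih mu_BVC) setTD setCK.
Qed.

(** [mu] represents [Lam] on weakly continuous functionals only. A tame G differs from one by at
    most eta (1 + E), and the mean of E is at most M0 both under [mu] and under the mixtures. *)
Lemma tame_integral_le G : tame G -> measurable_fun V (G : HB -> R) ->
  (\int[mu]_(u in V) (G u)%:E <= (Lam G)%:E)%E.
Proof.
move=> tG mG; have [M0 M00 hM] := Lam_energy; have [C hC] := tame_grow wB tG.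
have muE := enstrophy_fin.
rewrite (integral_BV lam_e wB muB muE mG hC); apply/lee_addgt0Pr => eps eps0.
have M1 : 0 < 2 * (1 + M0) by rewrite mulr_gt0// ltr_pwDl.
pose eta := eps / (2 * (1 + M0)); have eta0 : 0 < eta by exact: divr_gt0.
have etaE : eta * (1 + M0) + eta * (1 + M0) = eps.
  rewrite -mulrDr (_ : 1 + M0 + (1 + M0) = 2 * (1 + M0)); last by ring.
  by rewrite /eta divfK ?gt_eqF.
have [h ch hh] := tG eta eta0.
have BVV : (BV : set HB) `<=` V by move=> u [].
have iG := integrableS mV mBV BVV (integrable_V lam_e wB muB muE mG hC).
have mE : measurable_fun V (fun u : HB => 1 + E (hfun u)).
  by apply: measurable_funD; [exact: measurable_cst|exact: (E_meas lam_e)].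
have E1 (u : H) : BV u -> `|1 + E (hfun u)| <= 1 * (1 + E (hfun u)).
  by move=> _; rewrite mul1r ger0_norm// addr_ge0// E_ge0.
have iE := integrableS mV mBV BVV (integrable_V lam_e wB muB muE mE E1).
have mh : measurable_fun V (h : HB -> R) by apply: measurable_funTS; exact: wcont_meas.
have [Ch hCh] := tame_grow wB (tame_wcont B ch).
have ih := integrableS mV mBV BVV (integrable_V lam_e wB muB muE mh hCh).
have IE : (\int[mu]_(u in (BV : set HB)) (1 + E (hfun u))%:E <= (1 + M0)%:E)%E.
  apply: (@le_trans _ _ (\int[mu]_u (1 + enstrophy O (hfun u)))%E).
    have -> : (\int[mu]_(u in (BV : set HB)) (1 + E (hfun u))%:E = \int[mu]_(u in (BV : set HB)) (1 + enstrophy O (hfun u)))%E.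
      by apply: eq_integral => u; rewrite inE => -[_ Vu]; rewrite enstrophy_V.
    apply: ge0_subset_integral => //.
      by apply: emeasurable_funD; [exact: measurable_cst|exact: (enstrophy_meas lam_e)].
    by move=> u _; apply: adde_ge0 => //; exact: enstrophy_ge0.
  rewrite ge0_integralD//; last 2 first.
    by move=> u _; exact: enstrophy_ge0.
    exact: (enstrophy_meas lam_e).
  have := integral_cst mu measurableT 1%E; rewrite mul1e => ->.
  rewrite EFinD; apply: leeD; last exact: enstrophy_bound.
  exact: (probability_le1 mu measurableT).
have s1 : (\int[mu]_(u in (BV : set HB)) (G u)%:E <= \int[mu]_(u in (BV : set HB)) ((h u)%:E + eta%:E * (1 + E (hfun u))%:E))%E.
  apply: le_integral => //; first by apply: integrableD => //; exact: integrableZl.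
  move=> u; rewrite inE => Ku; rewrite -EFinM -EFinD lee_fin.
  by have := hh u Ku; rewrite ler_norml => /andP[_]; lra.
apply: le_trans s1 _; rewrite integralD//; last exact: integrableZl.
rewrite integralZl// integral_BV_wcont//.
have s2 : Lam h <= eta * (1 + M0) + Lam G.
  apply: (@le_trans _ _ (Lam (fun u => eta * (1 + E (hfun u)) + G u))).
    apply: (Lam_mono nu0 fV' uU cU); [by exists Ch| |].
      by apply: grow_lin; [exists 1 => u Ku; exact: E1|exists C].
    by move=> u Ku; have := hh u Ku; rewrite ler_norml => /andP[]; lra.
  rewrite (Lam_lin nu0 fV' uU cU); [|by exists 1 => u Ku; exact: E1|by exists C].
  rewrite lerD2r; apply: ler_wpM2l; first exact: ltW.
  apply: (Lam_near nu0 fV' uU cU); first by exists 1 => u Ku; exact: E1.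
  apply: filterS cU => L cL.
  have -> : L (fun u => 1 + E (hfun u)) = L (fun u => 1 * E (hfun u) + cst 1 u).
    by congr (L _); apply/funext => u; rewrite mul1r addrC.
  by rewrite (conv_lin cL) (conv_cst cL) mul1r addrC lerD2l; exact: hM.
apply: (@le_trans _ _ ((Lam h)%:E + eta%:E * (1 + M0)%:E)%E).
  by apply: leeD2l; apply: lee_wpmul2l => //; rewrite lee_fin ltW.
by rewrite -EFinM -!EFinD lee_fin; move: s2 etaE; lra.
Qed.

Lemma tame_integral G : tame G -> measurable_fun V (G : HB -> R) ->
  (\int[mu]_(u in V) (G u)%:E = (Lam G)%:E)%E.
Proof.
move=> tG mG; apply/eqP; rewrite eq_le tame_integral_le//=.
have mGN : measurable_fun V (fun u : HB => - G u) by exact: measurable_funN.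
have := tame_integral_le (tameN tG) mGN.
have [C hC] := tame_grow wB tG; have iG := integrable_V lam_e wB muB enstrophy_fin mG hC.
have -> : Lam (fun u => - G u) = - Lam G.
  have g0 : grow B (cst 0) by apply: bdd_grow; exact: bdd_cst.
  have gG : grow B G by exists C.
  have := Lam_lin nu0 fV' uU cU (-1) gG g0.
  have g1 : grow B (cst 1) by apply: bdd_grow; exact: bdd_cst.
  have := Lam_lin nu0 fV' uU cU (-1) g1 g1.
  have -> : (fun u : H => -1 * (cst 1 u : R) + (cst 1 u : R)) = (cst 0 : H -> R).
    by apply/funext => u; rewrite /cst mulN1r addNr.
  have -> : (fun u : H => -1 * G u + (cst 0 u : R)) = (fun u => - G u).
    by apply/funext => u; rewrite /cst mulN1r addr0.
  by lra.
have -> : (\int[mu]_(u in V) (- G u)%:E = - \int[mu]_(u in V) (G u)%:E)%E.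
  by rewrite -integralN ?integrable_add_def//; apply: eq_integral => u _; rewrite EFinN.
by rewrite EFinN leeN2.
Qed.

Lemma aN_ell_meas (a : R -> R) (g : H -> R) : continuous a -> measurable_fun V (g : HB -> R) ->
  measurable_fun V (fun u : HB => a (N O (hfun u)) * g u).
Proof.
move=> ca mg; apply: measurable_funM => //; apply: measurable_funTS.
by apply: (measurableT_comp _ (N_meas lam_e)); exact: continuous_measurable_fun.
Qed.

Lemma ellk_meas j : measurable_fun V (fun u : HB => ellk lam e nu f j (hfun u)).
Proof.
apply: measurable_funB; last exact: (f_meas lam_e fV').
by apply: measurable_funM; [exact: measurable_cst|apply: measurable_funTS; exact: (enk_meas lam_e)].
Qed.

(** For each [ellk] the inequality comes from the mixtures by [conv_ell], as ellk <= ell on V;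
    dominated convergence under a multiple of 1 + E then reaches [ell]. *)
Lemma limit_energy (a : R -> R) (A : R) : continuous a -> (forall x, 0 <= x -> 0 <= a x <= A) ->
  (\int[mu]_(u in V) (a (N O (hfun u)) * ell O nu f (hfun u))%:E <= 0)%E.
Proof.
move=> ca aA; have a0 x : 0 <= x -> 0 <= a x by move=> /aA/andP[].
have aA' x : 0 <= x -> `|a x| <= A by move=> /aA/andP[h1 h2]; rewrite ger0_norm.
have [Cl Cl0 hl] := ell_bound nu0 fV'.
have tG j : tame (fun u => a (N O (hfun u)) * ellk lam e nu f j (hfun u)).
  apply: (tameM wB (A := A)); [by move=> u _; apply: aA'; exact: N_ge0| |exact: (tame_ellk lam_e B nu fV')].
  exact: (tame_aN lam_e B ca aA').
have mG j := aN_ell_meas ca (ellk_meas j).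
have le0 j : (\int[mu]_(u in V) (a (N O (hfun u)) * ellk lam e nu f j (hfun u))%:E <= 0)%E.
  rewrite (tame_integral (tG j) (mG j)) lee_fin.
  apply: (Lam_near nu0 fV' uU cU); first exact: tame_grow.
  apply: filterS cU => L cL; apply: le_trans (conv_ell cL a0).
  apply: (conv_mono cL) => u [_ Vu]; apply: ler_wpM2l; first by apply: a0; exact: N_ge0.
  exact: (ellk_le lam_e nu0 f j Vu).
have muE := enstrophy_fin.
have m1E : measurable_fun V (fun u : HB => A * (Cl + nu) * (1 + E (hfun u))).
  apply: measurable_funM; first exact: measurable_cst.
  by apply: measurable_funD; [exact: measurable_cst|exact: (E_meas lam_e)].
have A0 : 0 <= A by exact: le_trans (normr_ge0 _) (aA' 0 (lexx 0)).
have b1E (u : H) : BV u -> `|A * (Cl + nu) * (1 + E (hfun u))| <= (A * (Cl + nu)) * (1 + E (hfun u)).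
  by move=> _; rewrite ger0_norm// mulr_ge0 ?mulr_ge0 ?addr_ge0 ?E_ge0// ltW.
have i1E := integrable_V lam_e wB muB muE m1E b1E.
have ml : measurable_fun V (fun u : HB => a (N O (hfun u)) * ell O nu f (hfun u)) by exact: aN_ell_meas (ell_meas lam_e nu fV').
have cl : \forall u \ae mu, V u -> (a (N O (hfun u)) * ellk lam e nu f j (hfun u))%:E @[j --> \oo]
    --> (a (N O (hfun u)) * ell O nu f (hfun u))%:E.
  apply: aeW => u Vu; apply: cvg_EFin; first exact: nearW.
  have c0 : (fun j => a (N O (hfun u)) * ellk lam e nu f j (hfun u)) @ \oo --> a (N O (hfun u)) * ell O nu f (hfun u).
    by apply: cvgM; [exact: cvg_cst|exact: (ellk_cvg lam_e Vu)].
  exact: c0.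
have dom : \forall u \ae mu, forall j, V u -> (`|(a (N O (hfun u)) * ellk lam e nu f j (hfun u))%:E|
    <= (EFin \o (fun u : HB => A * (Cl + nu) * (1 + E (hfun u)))%R) u)%E.
  apply: aeW => u j Vu; rewrite /comp abse_EFin lee_fin normrM -mulrA; apply: ler_pM => //.
    by apply: aA'; exact: N_ge0.
  have e1 := enk_le_grad lam_e j Vu; have e0 := enk_ge0 lam_e j (hfun u); have l1 := hl _ Vu.
  have -> : ellk lam e nu f j (hfun u) = ell O nu f (hfun u) - nu * (E (hfun u) - enk lam e j (hfun u)).
    by rewrite /ellk /ell; ring.
  apply: le_trans (ler_normB _ _) _; rewrite [X in _ <= X]mulrDl; apply: lerD => //.
  rewrite normrM (gtr0_norm nu0) ler_pM2l// ger0_norm ?subr_ge0//.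
  by apply: ler_wpDl => //; rewrite lerBlDr lerDl.
have [_ _ c] := dominated_convergence mV (fun j => proj2 (measurable_EFinP _ _) (mG j)) (proj2 (measurable_EFinP _ _) ml) cl i1E dom.
rewrite -(cvg_lim _ c)//; apply: lime_le; first by apply/cvg_ex; eexists; exact: c.
exact: nearW.
Qed.

Lemma limit_fpsss : (forall Psi eta, 0 < eta -> \forall L \near U, `|L (fun u : H => FC Psi u)| <= eta) ->
  fpsss_on nu f B mu.
Proof.
move=> hF; split; last exact: muB; split.
- exact: enstrophy_fin.
- move=> psi dpsi w; have [_ _ _ cd [C hC]] := w.
  (* [dpsi] is controlled only on [0, +oo[, so it is extended to the left by its value at 0. *)
  have ca := continuous_max0 cd.
  have m0 (x : R) : 0 <= x -> Num.max 0 x = x by move=> x0; rewrite max_r.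
  have aC (x : R) : 0 <= x -> 0 <= dpsi (Num.max 0 x) <= C.
    move=> x0; rewrite m0//; apply/andP; split; first exact: (energy_weight_ge0 w).
    by apply: le_trans (ler_norm _) _; exact: hC.
  have := limit_energy ca aC; congr (_ <= _)%E; apply: eq_integral => u _.
  by rewrite m0 ?N_ge0// normL2_sqr//; exact: hfun_L2.
move=> Psi; have tF := tame_Fcyl lam_e wB nu fV' Psi.
have mF : measurable_fun V (fun u : HB => FC Psi (hfun u)) := Fcyl_meas lam_e nu fV' Psi.
have E0 : (\int[mu]_(u in V) (Fns O nu f (hfun u) (cyl_diff Psi (dotL2 O (hfun u))))%:E =
  \int[mu]_(u in V) (FC Psi (hfun u))%:E)%E by [].
rewrite E0 (tame_integral tF mF); congr EFin.
have gF := tame_grow wB tF.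
apply/eqP; rewrite eq_le; apply/andP; split.
  apply/ler_addgt0Pr => eps eps0; rewrite add0r; apply: (Lam_near nu0 fV' uU cU gF).
  by apply: filterS (hF Psi eps eps0) => L; exact: le_trans (ler_norm _).
apply/ler_addgt0Pr => eps eps0; rewrite -lerBlDr sub0r; apply: (Lam_near_ge nu0 fV' uU cU gF).
by apply: filterS (hF Psi eps eps0) => L; rewrite ler_norml => /andP[].
Qed.

Lemma limit_enk k (m : R) : (forall eta, 0 < eta -> \forall L \near U, m - eta <= L (fun u : H => enk lam e k u)) ->
  (m%:E <= \int[mu]_u (enk lam e k (hfun u))%:E)%E.
Proof.
move=> hm; rewrite (muh (wcont_enk lam_e (k := k))) lee_fin; apply/ler_addgt0Pr => eps eps0.
rewrite -lerBlDr; apply: (Lam_near_ge nu0 fV' uU cU); last exact: hm.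
by apply: tame_grow => //; apply: tame_wcont; exact: (wcont_enk lam_e).
Qed.

End LimitMeasure.

Lemma solution_above (R : realType) (O : bounded_domain R) (lam : nat -> R) (e : nat -> Hspace O)
    (B : set (Hspace O)) (nu : R) (f : vfield R -> R) k (m : R) :
  stokes_eigenbasis lam e -> weakly_compact B -> 0 < nu -> inVdual O f -> adm B nu f !=set0 ->
  (forall Psi : cyl O, exists2 b, adm B nu f b & m <= objective nu f e k Psi b) ->
  exists2 mu, fpsss_on nu f B mu & (m%:E <= \int[mu]_u (enk lam e k (hfun u))%:E)%E.
Proof.
move=> lam_e wB nu0 fV' adm0 hm.
have [U [uU cU hU hF]] := conv_ultrafilter lam_e wB nu0 fV' adm0 hm.
have [mu muB muh] := Lam_measure lam_e wB nu0 fV' uU cU.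
exists mu; first exact: (limit_fpsss lam_e wB nu0 fV' uU cU muB muh hF).
exact: (limit_enk lam_e wB nu0 fV' uU cU muh hU).
Qed.

(** * Strong duality *)

Section Duality.
Variables (R : realType) (O : bounded_domain R).
Variables (lam : nat -> R) (e : nat -> Hspace O).
Hypothesis lam_e : stokes_eigenbasis lam e.
Variables (B : set (Hspace O)) (wB : weakly_compact B).
Variables (nu : R) (nu0 : 0 < nu) (f : vfield R -> R) (fV' : inVdual O f).

Lemma enk_le_enstrophy k (u : Hborel O) : ((enk lam e k (hfun u))%:E <= enstrophy O (hfun u))%E.
Proof.
rewrite /enstrophy; case: ifPn => [/asboolP Vu|_]; last exact: leey.
by rewrite lee_fin; exact: (enk_le_grad lam_e k Vu).
Qed.

Lemma integral_enk_ge0 (mu : probability (Hborel O) R) k : (0 <= \int[mu]_u (enk lam e k (hfun u))%:E)%E.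
Proof. by apply: integral_ge0 => u _; rewrite lee_fin (enk_ge0 lam_e). Qed.

(** Over an empty [Bf] every bound holds vacuously, -1 included, whereas the integral of [enk] is
    nonnegative. *)
Lemma Bf_nonempty : fpsss_on nu f B !=set0 -> Bf nu f B !=set0.
Proof.
move=> [mu hmu]; apply/set0P/eqP => Bf0; have [Psi _] := cyl_zero B nu fV'.
have hM b : Bf nu f B b -> objective nu f e 0 Psi b <= -1 by rewrite Bf0.
have := le_trans (integral_enk_ge0 mu 0) (dual_upper_bound lam_e wB nu0 fV' hmu hM).
by rewrite lee_fin lerNr oppr0 ler10.
Qed.

Lemma objective_nd k k' (Psi : cyl O) b : (k <= k')%N -> adm B nu f b ->
  objective nu f e k Psi b <= objective nu f e k' Psi b.
Proof.
move=> kk; rewrite !objectiveE; case: b => [[[t1 t2] u1] u2] [[t10 t20 _] _ _ _ _].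
have h u : bracket nu f e k Psi u <= bracket nu f e k' Psi u.
  by rewrite !(bracketE lam_e) lerD2r; exact: (enk_nd lam_e).
by apply: lerD; apply: ler_wpM2l.
Qed.

Lemma inf_max_cvg (M : nat -> cyl O -> R) : fpsss_on nu f B !=set0 ->
  (forall k Psi, is_max [set objective nu f e k Psi b | b in Bf nu f B] (M k Psi)) ->
  ereal_inf [set (M k Psi)%:E | Psi in [set: cyl O]] @[k --> \oo] -->
    ereal_sup [set (\int[mu]_u enstrophy O (hfun u))%E | mu in fpsss_on nu f B].
Proof.
move=> [mu0 hmu0] hM; set I := fun k => ereal_inf _; set S := ereal_sup _.
have ub k Psi b : Bf nu f B b -> objective nu f e k Psi b <= M k Psi.
  by move=> Bb; have [_ h] := hM k Psi; apply: h; exists b.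
have dual mu k : fpsss_on nu f B mu -> (\int[mu]_u (enk lam e k (hfun u))%:E <= I k)%E.
  move=> hmu; apply: le_ereal_inf_tmp => _ [Psi _ <-].
  by apply: (dual_upper_bound lam_e wB nu0 fV' hmu) => b; exact: ub.
have Ind : nondecreasing_seq I.
  move=> k k' kk; apply: le_ereal_inf_tmp => _ [Psi _ <-].
  apply: (@le_trans _ _ (M k Psi)%:E); first by apply: ereal_inf_lbound; exists Psi.
  have [[b Bb <-] _] := hM k Psi; rewrite lee_fin; apply: le_trans (ub k' Psi b Bb).
  by apply: objective_nd => //; exact: Bf_adm.
have IS k : (I k <= S)%E.
  have [Psi0 _] := cyl_zero B nu fV'.
  (* Finiteness allows I k to serve as the real bound m of [solution_above]; the given solution
     bounds it from below. *)
  have If : I k \is a fin_num.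
    rewrite ge0_fin_numE; last exact: le_trans (integral_enk_ge0 mu0 k) (dual mu0 k hmu0).
    apply: (@le_lt_trans _ _ (M k Psi0)%:E); last exact: ltry.
    by apply: ereal_inf_lbound; exists Psi0.
  have [b0 Bb0] := Bf_nonempty (ex_intro _ mu0 hmu0).
  have adm0 : adm B nu f !=set0 by exists b0; exact: Bf_adm.
  have hm (Psi : cyl O) : exists2 b, adm B nu f b & fine (I k) <= objective nu f e k Psi b.
    have [[b Bb bE] _] := hM k Psi; exists b; first exact: Bf_adm.
    by rewrite bE -lee_fin fineK//; apply: ereal_inf_lbound; exists Psi.
  have [mu hmu] := solution_above lam_e wB nu0 fV' adm0 hm; rewrite fineK// => h.
  apply: le_trans h _; apply: (@le_trans _ _ (\int[mu]_u enstrophy O (hfun u))%E).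
    apply: ge0_le_integral => //.
    - by move=> u _; rewrite lee_fin (enk_ge0 lam_e).
    - by apply/measurable_EFinP; exact: (enk_meas lam_e).
    - exact: (enstrophy_meas lam_e).
    - by move=> u _; exact: enk_le_enstrophy.
  by apply: ereal_sup_ubound; exists mu.
(* A nondecreasing sequence tends to its supremum; this is S by [IS] and, conversely, by monotone
   convergence in the weak duality [dual]. *)
have := ereal_nondecreasing_cvgn Ind; suff -> : ereal_sup (range I) = S by [].
apply/eqP; rewrite eq_le; apply/andP; split; first by apply: ge_ereal_sup => _ [k _ <-].
apply: ge_ereal_sup => _ [mu hmu <-].
have c := @integral_enk_cvg _ _ _ _ mu lam_e.
rewrite -(cvg_lim _ c)//; apply: lime_le; first by apply/cvg_ex; eexists; exact: c.
apply: nearW => k; apply: le_trans (dual mu k hmu) _.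
by apply: ereal_sup_ubound; exists k.
Qed.

End Duality.

Theorem mainTheorem3 (R : realType) (Omega : bounded_domain R) (nu : R)
    (nu_gt0 : 0 < nu) (f : vfield R -> R) (fV' : inVdual Omega f)
    (lam : nat -> R) (e : nat -> Hspace Omega)
    (lam_e : stokes_eigenbasis lam e) (B : set (Hspace Omega))
    (B_weakly_compact : weakly_compact B)
    (B_nonempty : fpsss_on nu f B !=set0) :
  exists M : nat -> cyl Omega -> R,
    (forall k Psi, is_max [set objective nu f e k Psi b | b in Bf nu f B] (M k Psi)) /\
    ereal_inf [set (M k Psi)%:E | Psi in [set: cyl Omega]] @[k --> \oo] -->
      ereal_sup [set (\int[mu]_u enstrophy Omega (hfun u))%E | mu in fpsss_on nu f B].
Proof.
have Bf0 := Bf_nonempty lam_e B_weakly_compact nu_gt0 fV' B_nonempty.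
pose M k Psi := projT1 (cid (Bf_max lam_e B_weakly_compact nu_gt0 fV' k Psi Bf0)).
have hM k Psi : is_max [set objective nu f e k Psi b | b in Bf nu f B] (M k Psi).
  exact: projT2 (cid _).
by exists M; split; [exact: hM|exact: (inf_max_cvg lam_e B_weakly_compact nu_gt0 fV' B_nonempty hM)].
Qed.
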